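(* Let $c>0$ be sufficiently large, let $N_0\subset\mathbb{CP}^4$ be the quintic hypersurface $z_1z_4(z_0^3-z_1^3-z_4^3)-z_2z_3(cz_0^3-z_2^3-z_3^3)=0$ (which is nodal with exactly $49$ nodes), let $D_0\subset N_0$ be the divisor $z_3=z_4=0$, and let $N_1\to N_0$ be the blow-up of $D_0$ in $N_0$. Then $N_1$ is smoothable.
   Context: $N_1$ is a projective nodal complex 3-fold, i.e. its germ at each singular point is biholomorphic to that of $\{x_1x_4-x_2x_3=0\}\subset\mathbb C^4$ at $0$. A compact complex space is smoothable if it is the central fibre of a proper flat family over a neighbourhood of $0$ in $\mathbb C$ whose other fibres are nonsingular. *)

(* Defs.v *)
From HB Require Import structures.
From mathcomp Require Import all_boot all_order all_algebra.
From mathcomp Require Import generic_quotient ring_quotient complex.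
From mathcomp Require Import all_classical all_reals all_analysis.

Set Implicit Arguments.
Unset Strict Implicit.
Unset Printing Implicit Defensive.

Import Order.TTheory GRing.Theory Num.Theory.
Import numFieldNormedType.Exports.

Local Open Scope classical_set_scope.
Local Open Scope quotient_scope.
Local Open Scope ring_scope.

(* R[i] packaged as a numClosedFieldType: for a bare R[i] the normed-module
   structures of MathComp-Analysis are not inferred. *)
Definition CC (R : realType) : numClosedFieldType := R[i]%C.

Section Commutative_algebra.

Definition ideal_of (A : comNzRingType) (S : set A) : set A :=
  [set a | exists k (r g : 'I_k -> A),
      (forall i, S (g i)) /\ a = \sum_(i < k) r i * g i].

Variables (A B : comNzRingType) (h : {rmorphism A -> B}).

Definition balanced (N P : lmodType A) (beta : B -> N -> P) : Prop :=
  [/\ forall b b' n, beta (b + b') n = beta b n + beta b' n,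
      forall b n n', beta b (n + n') = beta b n + beta b n' &
      forall a b n, beta (h a * b) n = a *: beta b n /\
                    beta b (a *: n) = a *: beta b n].

(* \sum_i b_i (x) n_i = 0 in the tensor product of B and N over A: by the
   universal property, every A-bilinear map kills the element. *)
Definition tensor_zero (N : lmodType A) k (b : 'I_k -> B) (n : 'I_k -> N) :=
  forall (P : lmodType A) (beta : B -> N -> P),
    balanced beta -> \sum_(i < k) beta (b i) (n i) = 0.

(* B (x)_A - preserves injectivity *)
Definition flat_hom : Prop :=
  forall (M N : lmodType A) (f : {linear M -> N}), injective f ->
  forall k (b : 'I_k -> B) (m : 'I_k -> M),
    tensor_zero b (fun i => f (m i)) -> tensor_zero b m.

End Commutative_algebra.

Lemma near_eq_differentiable (K : numFieldType) (V W : normedModType K)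
    (f g : V -> W) (x : V) :
  (\forall y \near x, f y = g y) -> differentiable f x -> differentiable g x.
Proof.
move=> fg df; have /diff_locallyP[cd ef] := df.
have eg : g \o shift x = cst (g x) + 'd f x +o_0 id.
  apply/eqaddoP => e e0.
  move/eqaddoP : ef => /(_ e e0).
  have : \forall y \near 0, f (y + x) = g (y + x).
    have -> : (\forall y \near 0, f (y + x) = g (y + x)) = (\forall y \near x, f y = g y).
      rewrite (near_shift 0 x) /=; congr (nbhs _ _).
      by apply/funext => z /=; rewrite subr0.
    by [].
  apply: filterS2 => y e1.
  by rewrite /= /GRing.add /GRing.opp /= e1 (nbhs_singleton fg).
have dgE := diff_unique cd eg.
by apply/diff_locallyP; rewrite dgE.
Qed.

Lemma near_val (T : topologicalType) (W : set T) (x : W) (P : set T) :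
  (\forall y \near \val x, P y) -> \forall y \near x, P (\val y).
Proof. exact: (@initial_continuous W T set_val x P). Qed.

Section Complex_spaces.
Variable R : realType.
Local Notation C := (CC R).

(* A C-ringed space, its structure sheaf being presented as an etale space:
   sec x s says that the family s of germs is a section of the sheaf on some
   neighbourhood of x.  Thus the sections over an open set U are the families
   s such that sec x s for all x in U (the values of s outside U are
   irrelevant), and the gluing condition holds by construction. *)
Record ringed_space := RingedSpace {
  rs_pt :> topologicalType ;
  stalk : rs_pt -> comNzRingType ;
  scal : forall x, {rmorphism C -> stalk x} ;
  sec : rs_pt -> (forall y, stalk y) -> Prop ;
  sec_scal : forall x a, sec x (fun y => scal y a) ;
  sec_sub : forall x s t, sec x s -> sec x t -> sec x (fun y => s y - t y) ;
  sec_mul : forall x s t, sec x s -> sec x t -> sec x (fun y => s y * t y) ;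
  sec_near : forall x s, sec x s -> \forall y \near x, sec y s ;
  sec_ext : forall x s t,
    (\forall y \near x, s y = t y) -> sec x s -> sec x t ;
  sec_germ : forall x (a : stalk x), exists2 s, sec x s & s x = a ;
  sec_sep : forall x s, sec x s -> s x = 0 -> \forall y \near x, s y = 0 }.

Arguments scal : clear implicits.
Arguments sec : clear implicits.

Record morphism (X Y : ringed_space) := Morphism {
  mor :> X -> Y ;
  pull : forall x, {rmorphism stalk (mor x) -> stalk x} ;
  mor_cont : continuous mor ;
  pull_scal : forall x a, pull x (scal Y (mor x) a) = scal X x a ;
  pull_sec : forall x s,
    sec Y (mor x) s -> sec X x (fun y => pull y (s (mor y))) }.

(* phi induces an isomorphism of X with the ringed space carried by the subset
   V of Y with sheaf O_Y / I; by the first isomorphism theorem this is read off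
   on stalks. *)
Definition iso_onto (X Y : ringed_space) (phi : morphism X Y)
    (V : set Y) (I : forall y : Y, set (stalk y)) : Prop :=
  [/\ injective phi, range phi = V,
      forall x N, nbhs x N -> exists2 M, nbhs (phi x) M & phi @^-1` M `<=` N,
      forall x (b : stalk x), exists a, pull phi x a = b &
      forall x a, pull phi x a = 0 <-> I (phi x) a].

Section Open_subspace.
Variables (X : ringed_space) (W : set X).

Definition open_sec (x : W) (s : forall y : W, stalk (\val y)) : Prop :=
  exists2 t, sec X (\val x) t & \forall y \near x, s y = t (\val y).

(* X restricted to W, meant for W open *)
Program Definition open_subspace : ringed_space :=
  @RingedSpace (set_type W) (fun x => stalk (\val x)) (fun x => scal X (\val x))
    open_sec _ _ _ _ _ _ _.
Next Obligation.
move=> x a; exists (fun y => scal X y a); first exact: sec_scal.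
exact: filterE.
Qed.
Next Obligation.
move=> x s t [s' hs es] [t' ht et]; exists (fun y => s' y - t' y).
  exact: sec_sub.
by move: es et; apply: filterS2 => y -> ->.
Qed.
Next Obligation.
move=> x s t [s' hs es] [t' ht et]; exists (fun y => s' y * t' y).
  exact: sec_mul.
by move: es et; apply: filterS2 => y -> ->.
Qed.
Next Obligation.
move=> x s [t ht et]; have := near_val (sec_near ht); have := near_join et.
by apply: filterS2 => y ety hty; exists t.
Qed.
Next Obligation.
move=> x s t est [u hu eu]; exists u => //.
by move: est eu; apply: filterS2 => y -> ->.
Qed.
Next Obligation.
move=> x a; have [s hs sx] := sec_germ a.
exists (fun y => s (\val y)) => //; exists s => //; exact: filterE.
Qed.
Next Obligation.
move=> x s [t ht et] s0; have t0 : t (\val x) = 0.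
  by rewrite -s0; apply/esym; exact: (nbhs_singleton et).
by move: (near_val (sec_sep ht t0)) et; apply: filterS2 => y ty0 ->.
Qed.

End Open_subspace.

(* Spaces whose structure sheaf consists of C-valued functions: reg x f says
   that f is a section of the sheaf near x. *)
Record funspace := Funspace {
  fs_pt :> topologicalType ;
  reg : fs_pt -> (fs_pt -> C) -> Prop ;
  reg_cst : forall x a, reg x (cst a) ;
  reg_sub : forall x f g, reg x f -> reg x g -> reg x (f \- g) ;
  reg_mul : forall x f g, reg x f -> reg x g -> reg x (f \* g) ;
  reg_near : forall x f, reg x f -> \forall y \near x, reg y f ;
  reg_ext : forall x f g,
    (\forall y \near x, f y = g y) -> reg x f -> reg x g }.

Arguments reg : clear implicits.

Section Germs.
Variables (F : funspace) (x : F).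

Definition reg_pred : {pred F -> C} := fun f => `[< reg F x f >].

Lemma reg_predP f : reflect (reg F x f) (f \in reg_pred).
Proof. exact: asboolP. Qed.

Lemma reg_subring : subring_closed reg_pred.
Proof.
split=> [|f g /reg_predP hf /reg_predP hg|f g /reg_predP hf /reg_predP hg].
- by apply/reg_predP; exact: (reg_cst x (1 : C)).
- by apply/reg_predP; exact: reg_sub.
- by apply/reg_predP; exact: reg_mul.
Qed.

Record regfun := RegFun { regfun_val :> F -> C ; _ : regfun_val \in reg_pred }.
HB.instance Definition _ := [isSub for regfun_val].
HB.instance Definition _ := [Choice of regfun by <:].
HB.instance Definition _ :=
  GRing.SubChoice_isSubComPzRing.Build (F -> C) reg_pred regfun reg_subring.

Lemma regfun_oner_neq0 : (1 : regfun) != 0.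
Proof.
apply/eqP => e.
have /eqP : (1 : C) = 0 := congr1 (fun f : regfun => regfun_val f x) e.
by rewrite oner_eq0.
Qed.
HB.instance Definition _ :=
  GRing.PzSemiRing_isNonZero.Build regfun regfun_oner_neq0.

Definition null_pred : {pred regfun} :=
  fun f => `[< \forall y \near x, \val f y = 0 >].

Lemma null_ideal : idealr_closed null_pred.
Proof.
split=> [||a f g].
- by apply/asboolP; exact: filterE.
- by apply/asboolP => /nbhs_singleton /eqP; rewrite oner_eq0.
- move=> /asboolP f0 /asboolP g0; apply/asboolP.
  move: f0 g0; apply: filterS2 => y fy gy.
  have -> : \val (a * f + g) y = \val a y * \val f y + \val g y by [].
  by rewrite fy gy mulr0 addr0.
Qed.
HB.instance Definition _ := isIdealr.Build regfun null_pred null_ideal.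

Definition germ : comNzRingType := {ideal_quot null_pred}.

(* the germ of f at x if f is regular near x, a junk value otherwise *)
Definition germ_of (f : F -> C) : germ := \pi_germ (insubd (0 : regfun) f).

Lemma insubd_reg f : reg F x f -> \val (insubd (0 : regfun) f) = f.
Proof. by move=> hf; rewrite insubdK //; apply/reg_predP. Qed.

Lemma germ_eqP f g : reg F x f -> reg F x g ->
  germ_of f = germ_of g <-> \forall y \near x, f y = g y.
Proof.
move=> hf hg; rewrite /germ_of; set f' := insubd _ f; set g' := insubd _ g.
have vE y : \val (f' - g') y = f y - g y.
  have -> : \val (f' - g') y = \val f' y - \val g' y by [].
  by rewrite /f' /g' !insubd_reg.
split=> [/eqP|fg].
  rewrite -Quotient.idealrBE => /asboolP.
  by apply: filterS => y /eqP; rewrite vE subr_eq0 => /eqP.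
apply/eqP; rewrite -Quotient.idealrBE; apply/asboolP.
by move: fg; apply: filterS => y fgy; rewrite vE fgy subrr.
Qed.

Lemma germ_of_surj (a : germ) : exists2 f, reg F x f & germ_of f = a.
Proof.
exists (\val (repr a)); first by apply/reg_predP; exact: valP.
by rewrite /germ_of valKd reprK.
Qed.

Lemma germ_sub f g : reg F x f -> reg F x g ->
  germ_of (f \- g) = germ_of f - germ_of g.
Proof.
move=> hf hg; rewrite /germ_of -raddfB; congr (\pi_germ _).
apply: val_inj; rewrite insubd_reg; last exact: reg_sub.
by rewrite -[in LHS](insubd_reg hf) -[in LHS](insubd_reg hg).
Qed.

Lemma germ_mul f g : reg F x f -> reg F x g ->
  germ_of (f \* g) = germ_of f * germ_of g.
Proof.
move=> hf hg; rewrite /germ_of -rmorphM; congr (\pi_germ _).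
apply: val_inj; rewrite insubd_reg; last exact: reg_mul.
by rewrite -[in LHS](insubd_reg hf) -[in LHS](insubd_reg hg).
Qed.

Definition germ_cst (a : C) : germ := germ_of (cst a).

Lemma germ_cst_zmod : zmod_morphism germ_cst.
Proof. by move=> a b; rewrite /germ_cst -germ_sub //; exact: reg_cst. Qed.

Lemma germ_cst_monoid : monoid_morphism germ_cst.
Proof.
split=> [|a b]; last by rewrite /germ_cst -germ_mul //; exact: reg_cst.
rewrite /germ_cst /germ_of -[RHS](rmorph1 (\pi_germ : regfun -> germ)).
by congr (\pi_germ _); apply: val_inj; rewrite insubd_reg //; exact: reg_cst.
Qed.

HB.instance Definition _ :=
  GRing.isZmodMorphism.Build C germ germ_cst germ_cst_zmod.
HB.instance Definition _ :=
  GRing.isMonoidMorphism.Build C germ germ_cst germ_cst_monoid.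
End Germs.

Section Space_of_functions.
Variable F : funspace.

Definition germ_sec (x : F) (s : forall y : F, germ y) : Prop :=
  exists2 f, reg F x f & \forall y \near x, s y = germ_of y f.

Program Definition rs_of_funspace : ringed_space :=
  @RingedSpace F (@germ F) (fun x => @germ_cst F x) germ_sec _ _ _ _ _ _ _.
Next Obligation.
by move=> x a; exists (cst a); [exact: reg_cst|exact: filterE].
Qed.
Next Obligation.
move=> x s t [f hf ef] [g hg eg]; exists (f \- g); first exact: reg_sub.
have hfg : \forall y \near x, reg F y f /\ reg F y g.
  by apply: filterI; exact: reg_near.
by move: ef eg hfg; apply: filterS3 => y -> -> [? ?]; rewrite germ_sub.
Qed.
Next Obligation.
move=> x s t [f hf ef] [g hg eg]; exists (f \* g); first exact: reg_mul.
have hfg : \forall y \near x, reg F y f /\ reg F y g.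
  by apply: filterI; exact: reg_near.
by move: ef eg hfg; apply: filterS3 => y -> -> [? ?]; rewrite germ_mul.
Qed.
Next Obligation.
move=> x s [f hf ef]; have := near_join ef; have := reg_near hf.
by apply: filterS2 => y hfy efy; exists f.
Qed.
Next Obligation.
move=> x s t est [f hf ef]; exists f => //.
by move: est ef; apply: filterS2 => y ->.
Qed.
Next Obligation.
move=> x a; have [f hf <-] := germ_of_surj a.
by exists (fun y => germ_of y f) => //; exists f => //; exact: filterE.
Qed.
Next Obligation.
move=> x s [f hf ef] s0; have fx : germ_of x f = germ_of x (cst 0).
  rewrite -(nbhs_singleton ef) s0; apply/esym.
  exact: (rmorph0 (@germ_cst F x)).
have /near_join f0 := (germ_eqP hf (reg_cst x 0)).1 fx.
move: ef f0 (reg_near hf).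
apply: filterS3 => y -> f0y hfy; rewrite -[RHS](rmorph0 (@germ_cst F y)).
by apply/germ_eqP => //; exact: reg_cst.
Qed.
End Space_of_functions.

(* V with its sheaf of holomorphic functions *)
Section Affine.
Variable V : normedModType C.

Program Definition affine_fun : funspace :=
  @Funspace V (fun x f => \forall y \near x, differentiable f y) _ _ _ _ _.
Next Obligation.
by move=> x a; apply: filterE => y; exact: differentiable_cst.
Qed.
Next Obligation.
by move=> x f g; apply: filterS2 => y; exact: differentiableB.
Qed.
Next Obligation.
by move=> x f g; apply: filterS2 => y; exact: differentiableM.
Qed.
Next Obligation. by move=> x f /near_join. Qed.
Next Obligation.
move=> x f g /near_join; apply: filterS2 => y; exact: near_eq_differentiable.
Qed.

Definition affine : ringed_space := rs_of_funspace affine_fun.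
End Affine.

(* The subset A of F with the functions that extend locally to sections of the
   sheaf of F.  For A an analytic subset of a complex manifold this is the
   reduced complex structure of A. *)
Section Induced.
Variables (F : funspace) (A : set F).

Definition induced_reg (x : A) (f : A -> C) : Prop :=
  exists2 g, reg F (\val x) g & \forall y \near x, f y = g (\val y).

Program Definition induced : funspace :=
  @Funspace (set_type A) induced_reg _ _ _ _ _.
Next Obligation.
by move=> x a; exists (cst a); [exact: reg_cst|exact: filterE].
Qed.
Next Obligation.
move=> x f g [f' hf ef] [g' hg eg]; exists (f' \- g'); first exact: reg_sub.
by move: ef eg; apply: filterS2 => y /= -> ->.
Qed.
Next Obligation.
move=> x f g [f' hf ef] [g' hg eg]; exists (f' \* g'); first exact: reg_mul.
by move: ef eg; apply: filterS2 => y /= -> ->.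
Qed.
Next Obligation.
move=> x f [g hg eg]; move: (near_val (reg_near hg)) (near_join eg).
by apply: filterS2 => y hgy egy; exists g.
Qed.
Next Obligation.
move=> x f g efg [h hh eh]; exists h => //.
by move: efg eh; apply: filterS2 => y ->.
Qed.
End Induced.

(* The sheaf on T whose sections are detected on F: a function is a section over
   an open set U iff its composite with p is one over p @^-1` U. *)
Section Coinduced.
Variables (F : funspace) (T : topologicalType) (p : F -> T).
Hypothesis p_cont : continuous p.

Program Definition coinduced : funspace :=
  @Funspace T
    (fun x f => \forall y \near x, forall v, p v = y -> reg F v (f \o p))
    _ _ _ _ _.
Next Obligation.
by move=> x a; apply: filterE => y v _; exact: reg_cst.
Qed.
Next Obligation.
move=> x f g; apply: filterS2 => y hf hg v pv.
by apply: reg_sub; [exact: hf|exact: hg].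
Qed.
Next Obligation.
move=> x f g; apply: filterS2 => y hf hg v pv.
by apply: reg_mul; [exact: hf|exact: hg].
Qed.
Next Obligation. by move=> x f /near_join. Qed.
Next Obligation.
move=> x f g /near_join; apply: filterS2 => y efg hf v pv.
apply: reg_ext (hf v pv); move: efg; rewrite -pv; exact: p_cont.
Qed.
End Coinduced.

Section Projective_space.
Variable n : nat.

Definition cone : set 'rV[C]_n.+1 := [set v | v != 0].

Definition proportional (v w : cone) : bool :=
  `[< exists2 a : C, a != 0 & \val w = a *: \val v >].

Lemma proportional_equiv : equiv_class_of proportional.
Proof.
split=> [v|v w|v u w].
- by apply/asboolP; exists 1; rewrite ?oner_eq0 ?scale1r.
- apply/asboolP/asboolP => -[a a0 ->]; exists a^-1; rewrite ?invr_eq0 //.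
    by rewrite scalerA mulVf ?scale1r.
  by rewrite scalerA mulVf ?scale1r.
- move=> /asboolP[a a0 va] /asboolP[b b0 ub]; apply/asboolP.
  by exists (b * a); rewrite ?mulf_neq0 // ub va scalerA.
Qed.

Canonical proportional_equivRel := EquivRelPack proportional_equiv.

Definition CP : topologicalType := quotient_topology {eq_quot proportional}.

Definition line (v : cone) : CP := \pi_CP v.

Lemma line_continuous : continuous line.
Proof. exact: pi_continuous. Qed.

(* A function on an open subset U of CP is holomorphic iff it is so in
   homogeneous coordinates, i.e. on the preimage of U in C^(n+1) \ {0}. *)
Definition CP_fun : funspace :=
  @coinduced (induced (F := affine_fun 'rV[C]_n.+1) cone) CP line
    line_continuous.
End Projective_space.

Arguments cone : clear implicits.

Section Biprojective_space.
Variables m n : nat.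

Definition bicone : set ('rV[C]_m.+1 * 'rV[C]_n.+1) :=
  [set p | p.1 != 0 /\ p.2 != 0].

Definition bifst (p : bicone) : cone m :=
  exist _ (\val p).1 (mem_set (set_mem (valP p)).1).
Definition bisnd (p : bicone) : cone n :=
  exist _ (\val p).2 (mem_set (set_mem (valP p)).2).

Definition biline (p : bicone) : CP m * CP n :=
  (line (bifst p), line (bisnd p)).

Lemma biline_continuous : continuous biline.
Proof.
have c1 : continuous bifst.
  apply: continuous_comp_initial => p.
  apply: (@continuous_comp _ _ _ (\val : bicone -> _) fst); last exact: cvg_fst.
  exact: initial_continuous.
have c2 : continuous bisnd.
  apply: continuous_comp_initial => p.
  apply: (@continuous_comp _ _ _ (\val : bicone -> _) snd); last exact: cvg_snd.
  exact: initial_continuous.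
have c1' : continuous (@line m \o bifst).
  by move=> p; apply: continuous_comp; [exact: c1|exact: line_continuous].
have c2' : continuous (@line n \o bisnd).
  by move=> p; apply: continuous_comp; [exact: c2|exact: line_continuous].
by move=> p; exact: (cvg_pair (c1' p) (c2' p)).
Qed.

Definition CPxCP_fun : funspace :=
  @coinduced (induced (F := affine_fun ('rV[C]_m.+1 * 'rV[C]_n.+1)%type) bicone)
    (CP m * CP n)%type biline biline_continuous.
End Biprojective_space.

(* The germ of X at x is isomorphic to the germ at p of the complex subspace
   f_1 = ... = f_k = 0 of C^n, with structure sheaf O / (f_1, ..., f_k). *)
Definition local_model (X : ringed_space) (x : X) n k
    (f : 'I_k -> 'rV[C]_n -> C) (p : 'rV[C]_n) : Prop :=
  exists (W : set X) (U : set 'rV[C]_n)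
         (phi : morphism (open_subspace W) (affine 'rV[C]_n)),
    [/\ open W, W x, open U & U p] /\
    [/\ forall i q, U q -> differentiable (f i) q,
        forall w : open_subspace W, \val w = x -> phi w = p &
        iso_onto phi [set q | U q /\ forall i, f i q = 0]
          (fun q => ideal_of (range (fun i => germ_of q (f i))))].

Definition complex_space (X : ringed_space) : Prop :=
  hausdorff_space X /\
  forall x : X, exists n k (f : 'I_k -> 'rV[C]_n -> C) p, local_model x f p.

Definition nonsingular_at (X : ringed_space) (x : X) : Prop :=
  exists n (f : 'I_0 -> 'rV[C]_n -> C) p, local_model x f p.

Definition nonsingular (X : ringed_space) : Prop :=
  forall x : X, nonsingular_at x.

Definition hcoord n (v : 'rV[C]_n.+1) (k : nat) : C := v 0 (inord k).

Definition node_at (X : ringed_space) (x : X) : Prop :=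
  @local_model X x 4 1
    (fun _ v => hcoord v 0 * hcoord v 3 - hcoord v 1 * hcoord v 2)
    0.

Definition singular_points (X : ringed_space) : set X :=
  [set x | ~ nonsingular_at x].
Arguments singular_points : clear implicits.

Definition nodal (X : ringed_space) : Prop :=
  complex_space X /\ forall x : X, singular_points X x -> node_at x.

(* F is the fibre over b of pi : X -> C: the subspace pi @^-1` [set b] of X,
   with the ideal sheaf generated by the maximal ideal of O_{C,b}. *)
Definition is_fibre (X : ringed_space) (pi : morphism X (affine C)) (b : C)
    (F : ringed_space) : Prop :=
  exists i : morphism F X,
    iso_onto i (pi @^-1` [set b])
      (fun x => ideal_of
         [set pull pi x (germ_of (pi x) h) |
            h in [set h | reg (affine_fun C) (pi x) h /\ h (pi x) = 0]]).

Definition proper_over (X Y : topologicalType) (f : X -> Y) (D : set Y) :=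
  forall K : set Y, compact K -> K `<=` D -> compact (f @^-1` K).

(* X -> D is a family over an open neighbourhood D of 0 in C; a morphism to D
   is a morphism to C with image in D. *)
Definition smoothable (N : ringed_space) : Prop :=
  exists (X : ringed_space) (D : set C) (pi : morphism X (affine C)),
    [/\ complex_space X, open D, D 0 & range pi `<=` D] /\
    [/\ proper_over pi D,
        forall x, flat_hom (pull pi x),
        is_fibre pi 0 N &
        forall b, D b -> b != 0 -> exists2 F, is_fibre pi b F & nonsingular F].

(* For l : C^(n+1) -> C^(m+1) with homogeneous components of the same degree,
   the blow-up of A along the ideal generated by the components of l: the
   closure of the graph of [l] : A \ {l = 0} -> CP^m (l v is nonzero below as
   w : cone is).  The blow-up of a reduced space is reduced, so it carries the
   induced structure. *)
Definition blowup_set n m (A : set (CP n)) (l : 'rV[C]_n.+1 -> 'rV[C]_m.+1) :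
    set (CP n * CP m) :=
  closure [set x | exists (v : cone n) (w : cone m),
             [/\ A (line v), \val w = l (\val v) & x = (line v, line w)]].

Definition blowup n m (A : set (CP n)) (l : 'rV[C]_n.+1 -> 'rV[C]_m.+1) :
    ringed_space :=
  rs_of_funspace (induced (F := CPxCP_fun n m) (blowup_set A l)).

Section Example.
Variable c : R.

Definition quintic (v : 'rV[C]_5) : C :=
  let z := hcoord v in
  z 1%N * z 4%N * (z 0%N ^+ 3 - z 1%N ^+ 3 - z 4%N ^+ 3)
  - z 2%N * z 3%N * ((c%:C)%C * z 0%N ^+ 3 - z 2%N ^+ 3 - z 3%N ^+ 3).

Definition N0_set : set (CP 4) :=
  [set line v | v in [set v | quintic (\val v) = 0]].

(* The quintic has no multiple factors, so the hypersurface it defines is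
   reduced. *)
Definition N0 : ringed_space := rs_of_funspace (induced (F := CP_fun 4) N0_set).

(* z_3, z_4 generate the ideal of D_0 *)
Definition N1 : ringed_space :=
  blowup N0_set (fun v => \row_(j < 2) hcoord v (j + 3)).
End Example.
End Complex_spaces.

Arguments scal {R} X x : rename.
Arguments sec {R} X x s : rename.
Arguments reg {R} F x f : rename.
Arguments cone {R} n : rename.
Arguments bicone {R} m n : rename.
Arguments affine {R} V.
Arguments singular_points {R} X.

(* Main.v *)
Require Import Defs.
From HB Require Import structures.
From mathcomp Require Import all_boot all_order all_algebra.
From mathcomp Require Import generic_quotient ring_quotient complex.
From mathcomp Require Import all_classical all_reals all_analysis.
From mathcomp Require Import ring lra.
Set Implicit Arguments.
Unset Strict Implicit.
Unset Printing Implicit Defensive.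
Import Order.TTheory GRing.Theory Num.Theory.
Import numFieldNormedType.Exports.
Local Open Scope classical_set_scope.
Local Open Scope card_scope.
Local Open Scope ring_scope.

(* N1 is the complete intersection
     z3 w1 = z4 w0,  Q := w1 z1 (z0^3 - z1^3 - z4^3) - w0 z2 (c z0^3 - z2^3 - z3^3) = 0
   in CP^4 x CP^1, and it is smoothed by the family
     z3 w1 = z4 w0,  Q + t z0^4 (w0 + w1) = 0  in CP^4 x CP^1 x C,  |t| small.
   An explicit study of the critical equations for c > 10 shows that at every
   point of the family either t is part of a coordinate system of the total
   space, or t = 0 and the total space has coordinates in which t = x0 x3 - x1 x2.
   Hence the total space is a manifold, all fibres with t <> 0 are nonsingular, t
   is a nonzerodivisor (which gives flatness, O_(C,b) being a discrete valuation
   ring), and t generates the ideal of functions vanishing on t = 0, so that the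
   central fibre is the reduced space N1.

   The same computation at t = 0 shows that the gradient of the quintic vanishes
   only where z0 <> 0, z1 z4 = z2 z3 = 0, z1^4 = z1 z0^3, z4^4 = z4 z0^3 and
   z2^4 = c z2 z0^3, z3^4 = c z3 z0^3, which are 7 * 7 points.  There N0 is a
   quadric cone; it is singular, since the tangent vectors of this cone span C^4,
   so that a smooth germ would fill an open set, on which the quadric does not
   vanish.

   Local rings of holomorphic functions are accessible through division by a
   coordinate and by a quadric, obtained from Cauchy integrals with parameters. *)

(** * Cauchy integrals *)

(** Off D_0 the first equation gives (w0 : w1) = (z3 : z4), and the family becomes quintic + t z0^4
    (z3 + z4) = 0: every member still contains the plane z3 = z4 = 0, as a deformation that is to be
    followed by the blow-up must. Of the 49 nodes, 16 lie on D_0, and there the complete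
    intersection is already smooth. At the other 33 one has z0 <> 0 and z3 + z4 <> 0, since z3 = -
    z4 <> 0 would give c = -1; so t is the quintic divided by a unit. This is what the choice of
    z0^4 (w0 + w1) achieves.

    The disc is not found by compactness: its radius [small c ^+ 2] is explicit, and one computation
    with Lagrange multipliers treats t = 0 and t <> 0 together. Large c separates the two halves of
    the quintic: a critical point with t <> 0 would make two quantities equal that differ by a power
    of c.

    Flatness is defined by testing tensors against all modules, so torsion-freeness is turned into
    flatness by constructing one module that detects the vanishing of a tensor. *)

Lemma near_dist (K : numFieldType) (V : pseudoMetricNormedZmodType K) (x : V) (e : K) :
  0 < e -> \forall y \near x, `|x - y| < e.
Proof. by move=> e0; apply: (@cvgr_dist_lt _ _ _ (nbhs x) _ id x). Qed.

Section ComplexNumbers.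
Variable R : realType.
Local Notation C := (CC R).
Implicit Types (z w : C) (x y : R).

Definition mkC x y : C := (x +i* y)%C.
Definition re z : R := complex.Re z.
Definition im z : R := complex.Im z.
(** Norms of C-modules take their values in C itself; estimates are carried out on this real number,
    where [lra] applies. *)
Definition nrm z : R := re `|z|.

Lemma mkCK z : mkC (re z) (im z) = z. Proof. by case: z. Qed.

Lemma nrmE z : `|z| = mkC (nrm z) 0. Proof. by case: z. Qed.

Lemma realCE (e : C) : 0 <= e -> e = mkC (re e) 0.
Proof. by case: e => a b; rewrite lecE /= => /andP[/eqP -> _]. Qed.

Lemma leC x y : (mkC x 0 <= mkC y 0) = (x <= y).
Proof. exact: lecR. Qed.

Lemma ltC x y : (mkC x 0 < mkC y 0) = (x < y).
Proof. exact: ltcR. Qed.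

Lemma mkC0 : mkC 0 0 = 0. Proof. by []. Qed.

Lemma mkCD x y x' y' : mkC x y + mkC x' y' = mkC (x + x') (y + y').
Proof. by []. Qed.

Lemma mkC0D x y : mkC (x + y) 0 = mkC x 0 + mkC y 0.
Proof. by rewrite mkCD addr0. Qed.

Lemma mkC_split x y : mkC x y = mkC x 0 + mkC 0 y.
Proof. by rewrite mkCD addr0 add0r. Qed.

Lemma mkCN x y : - mkC x y = mkC (- x) (- y). Proof. by []. Qed.

Lemma mkCM x y : mkC x 0 * mkC y 0 = mkC (x * y) 0.
Proof. by rewrite /mkC; simpc. Qed.

Lemma ler_re z : `|re z| <= nrm z.
Proof.
have := @normc_ge_Re _ z; rewrite -[X in _ <= X]/(`|(z : C)|) nrmE.
by rewrite -leC.
Qed.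

Lemma ler_im z : `|im z| <= nrm z.
Proof.
have := ler_re (z * mkC 0 1).
have -> : re (z * mkC 0 1) = - im z by case: z => a b; rewrite /re /=; simpc.
have -> : nrm (z * mkC 0 1) = nrm z.
  rewrite /nrm normrM; suff -> : `|mkC 0 1| = 1 by rewrite mulr1.
  rewrite /mkC normc_def /= expr0n expr1n add0r sqrtr1 //.
by rewrite normrN.
Qed.

Lemma ler_mkC x y : `|mkC x y| <= mkC (`|x| + `|y|) 0.
Proof.
have -> : mkC x y = mkC x 0 + mkC 0 1 * mkC y 0 by rewrite /mkC; simpc.
have nx t : `|mkC t 0| = mkC `|t| 0.
  by rewrite /mkC normc_def /= expr0n addr0 sqrtr_sqr.
rewrite (le_trans (ler_normD _ _)) // normrM !nx.
have -> : `|mkC 0 1| = 1.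
  by rewrite /mkC normc_def /= expr0n expr1n add0r sqrtr1.
by rewrite mul1r mkCD addr0.
Qed.

Lemma ler_nrm z : nrm z <= `|re z| + `|im z|.
Proof. by have := ler_mkC (re z) (im z); rewrite mkCK nrmE leC. Qed.

Lemma ltr_nrm z (e : C) : 0 < e -> (`|z| < e) = (nrm z < re e).
Proof. by move=> e0; rewrite (realCE (ltW e0)) nrmE ltC. Qed.

Lemma re_gt0 (e : C) : 0 < e -> 0 < re e.
Proof. by move=> e0; rewrite -ltC -realCE // ltW. Qed.

Lemma re_continuous : continuous (re : C -> R).
Proof.
move=> z; apply/(@cvgrPdist_lt _ _ _ (nbhs z)) => e e0.
have e0' : 0 < mkC e 0 by rewrite -mkC0 ltC.
apply: filterS (near_dist (z : C) e0') => w.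
rewrite nrmE ltC; apply: le_lt_trans.
have -> : re z - re w = re (z - w) by case: (z); case: (w).
exact: ler_re.
Qed.

Lemma im_continuous : continuous (im : C -> R).
Proof.
move=> z; apply/(@cvgrPdist_lt _ _ _ (nbhs z)) => e e0.
have e0' : 0 < mkC e 0 by rewrite -mkC0 ltC.
apply: filterS (near_dist (z : C) e0') => w.
rewrite nrmE ltC; apply: le_lt_trans.
have -> : im z - im w = im (z - w) by case: (z); case: (w).
exact: ler_im.
Qed.

Lemma mkC_continuous : continuous (fun p : R * R => mkC p.1 p.2).
Proof.
move=> p; apply/(@cvgrPdist_lt _ _ _ (nbhs p)) => e e0; have e2 : 0 < re e / 2.
  by rewrite divr_gt0 // re_gt0.
apply: filterS (near_dist (p : (R * R)%type) e2) => q; rewrite ltr_nrm //.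
rewrite prod_normE /= gt_max => /andP[h1 h2].
rewrite mkCN mkCD.
rewrite (le_lt_trans (ler_nrm _)) // /re /im /=.
by rewrite [ltRHS]splitr ltrD.
Qed.

Lemma cvg_mkC (T : Type) (F : set_system T) {FF : Filter F} (f g : T -> R) x y :
  f @ F --> x -> g @ F --> y -> (fun t => mkC (f t) (g t)) @ F --> mkC x y.
Proof.
move=> fx gy.
apply: (@cvg_comp _ _ _ (fun t => (f t, g t)) (fun p => mkC p.1 p.2) _
  (nbhs (x, y))); first exact: cvg_pair fx gy.
exact: (mkC_continuous (x := (x, y))).
Qed.

Lemma continuousC (T : topologicalType) (f : T -> C) (t : T) :
  {for t, continuous f} <->
  {for t, continuous (re \o f)} /\ {for t, continuous (im \o f)}.
Proof.
split=> [cf|[cr ci]].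
  split; apply: continuous_comp => //; [exact: re_continuous|exact: im_continuous].
rewrite /prop_for /continuous_at -[f t]mkCK.
have -> : f = fun t => mkC (re (f t)) (im (f t)) by apply/funext => u; rewrite mkCK.
exact: cvg_mkC cr ci.
Qed.

End ComplexNumbers.

(** * Integrals of complex functions over a segment *)

Section Integral.
Variable R : realType.
Local Notation C := (CC R).
Local Notation mu := (@lebesgue_measure R).

(** Continuity is two-sided even at the end points: the integrands below are restrictions of
    functions that are continuous on a neighbourhood of the contour, and no subspace topology has to
    be carried along. *)
Definition continuous_on (T : topologicalType) (a b : R) (f : R -> T) :=
  forall x, a <= x <= b -> {for x, continuous f}.

Lemma continuous_on_integrable a b (f : R -> R) : continuous_on a b f ->
  mu.-integrable `[a, b] (EFin \o f).
Proof.
move=> cf; apply: continuous_compact_integrable; first exact: segment_compact.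
apply: continuous_in_subspaceT => x; rewrite inE /= in_itv /=; exact: cf.
Qed.

Definition cint a b (f : R -> C) : C :=
  mkC (\int[mu]_(x in `[a, b]) re (f x)) (\int[mu]_(x in `[a, b]) im (f x)).

Lemma continuous_on_re a b (f : R -> C) : continuous_on a b f ->
  continuous_on a b (@re R \o f) /\ continuous_on a b (@im R \o f).
Proof. by move=> cf; split=> x /cf /continuousC[]. Qed.

Lemma cintD a b (f g : R -> C) : continuous_on a b f -> continuous_on a b g ->
  cint a b (fun x => f x + g x) = cint a b f + cint a b g.
Proof.
move=> /continuous_on_re[/continuous_on_integrable fr /continuous_on_integrable fi].
move=> /continuous_on_re[/continuous_on_integrable gr /continuous_on_integrable gi].
rewrite /cint mkCD -!RintegralD //.
by congr mkC; apply: eq_Rintegral => x _; case: (f x); case: (g x).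
Qed.

Lemma cintZ a b (k : C) (f : R -> C) : continuous_on a b f ->
  cint a b (fun x => k * f x) = k * cint a b f.
Proof.
move=> /continuous_on_re[cr ci].
have fr := continuous_on_integrable cr; have fi := continuous_on_integrable ci.
have sc (c : R) (u : R -> R) : continuous_on a b u -> continuous_on a b (fun x => c * u x).
  by move=> cu x /cu; apply: continuousM; exact: cst_continuous.
have -> : k * cint a b f = mkC
    (re k * \int[mu]_(x in `[a, b]) re (f x) - im k * \int[mu]_(x in `[a, b]) im (f x))
    (re k * \int[mu]_(x in `[a, b]) im (f x) + im k * \int[mu]_(x in `[a, b]) re (f x)).
  by rewrite /cint /mkC; case: (k) => p q; simpc.
rewrite -!RintegralZl // -RintegralD // -?RintegralB //.
1: by congr mkC; apply: eq_Rintegral => x _; case: (f x) => ? ?; case: (k) => ? ?;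
   rewrite /re /im /=; simpc.
all: exact: continuous_on_integrable (sc _ _ _).
Qed.

Lemma cintB a b (f g : R -> C) : continuous_on a b f -> continuous_on a b g ->
  cint a b (fun x => f x - g x) = cint a b f - cint a b g.
Proof.
move=> cf cg; have cg' : continuous_on a b (fun x => -1 * g x).
  by move=> x /cg; apply: continuousM; exact: cst_continuous.
rewrite -[- cint a b g]mulN1r -cintZ // -cintD //.
by congr cint; apply/funext => x; rewrite mulN1r.
Qed.

Lemma eq_cint a b (f g : R -> C) : (forall x, a <= x <= b -> f x = g x) ->
  cint a b f = cint a b g.
Proof.
move=> fg; rewrite /cint; congr mkC; apply: eq_Rintegral => x;
by rewrite inE /= in_itv /= => /fg ->.
Qed.

Lemma lebesgue_measure_segment (a b : R) : a <= b ->
  fine (mu `[a, b]%classic) = b - a.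
Proof.
move=> ab; rewrite lebesgue_measure_itv /= lte_fin.
by move: ab; rewrite le_eqVlt => /predU1P[->|->] //; rewrite ltxx subrr.
Qed.

Lemma Rintegral_le_cst (a b M : R) (f : R -> R) : a <= b -> continuous_on a b f ->
  (forall x, a <= x <= b -> `|f x| <= M) ->
  `|\int[mu]_(x in `[a, b]) f x| <= M * (b - a).
Proof.
move=> ab cf fM; have fi := continuous_on_integrable cf.
rewrite (le_trans (le_normr_Rintegral _ fi)) //.
rewrite -lebesgue_measure_segment // -Rintegral_cst //; apply: le_Rintegral => //.
- apply: (@continuous_on_integrable _ _ (fun x => `|f x|)) => x /cf.
  by move=> ?; apply: continuous_comp => //; exact: norm_continuous.
- by apply: (@continuous_on_integrable _ _ (fun=> M)) => x _; exact: cst_continuous.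
Qed.

(* the factor 2 comes from estimating real and imaginary parts separately *)
Lemma le_cint a b (M : R) (f : R -> C) : a <= b -> continuous_on a b f ->
  (forall x, a <= x <= b -> `|f x| <= mkC M 0) ->
  `|cint a b f| <= mkC (2 * M * (b - a)) 0.
Proof.
move=> ab /continuous_on_re[cr ci] fM; rewrite (le_trans (ler_mkC _ _)) // leC.
rewrite -mulrA mulr2n mulrDl mul1r lerD //; apply: Rintegral_le_cst => //.
  by move=> x /fM; rewrite nrmE leC; apply: le_trans; exact: ler_re.
by move=> x /fM; rewrite nrmE leC; apply: le_trans; exact: ler_im.
Qed.

Lemma cint_split a m b (f : R -> C) : a <= m -> m <= b -> continuous_on a b f ->
  cint a b f = cint a m f + cint m b f.
Proof.
move=> am mb /continuous_on_re[cr ci].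
have key (g : R -> R) : continuous_on a b g -> \int[mu]_(x in `[a, b]) g x =
    \int[mu]_(x in `[a, m]) g x + \int[mu]_(x in `[m, b]) g x.
  move=> cg; have gi := continuous_on_integrable cg.
  apply/eqP; rewrite addrC -subr_eq; apply/eqP.
  rewrite Rintegral_itvB //= ?bnd_simp //.
  rewrite Rintegral_itv_obnd_cbnd //.
  have : continuous_on m b g by move=> x /andP[mx xb]; apply: cg; rewrite xb (le_trans am mx).
  move/continuous_on_integrable; apply: integrableS => //.
  by move=> x /=; rewrite !in_itv /= => /andP[/ltW -> ->].
by rewrite /cint mkCD -!key.
Qed.

End Integral.

Lemma diff_remainder (K : numFieldType) (V W : normedModType K) (f : V -> W) x :
  differentiable f x -> forall e : K, 0 < e ->
  \forall y \near x, `|f y - f x - 'd f x (y - x)| <= e * `|y - x|.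
Proof.
move=> /diff_locallyP[_ fE] e e0; move/eqaddoP : fE => /(_ e e0) fE.
have -> : (\forall y \near x, `|f y - f x - 'd f x (y - x)| <= e * `|y - x|) =
          (\forall y \near 0, `|f (y + x) - f x - 'd f x y| <= e * `|y|).
  rewrite (near_shift 0 x) /=; congr (nbhs _ _); apply/funext => y /=.
  by rewrite subr0 addrK.
move: fE; apply: filterS => y.
by rewrite -[in X in _ -> X]addrA -[in X in _ -> X]opprD.
Qed.

(** * Contour integrals over rectangles and the theorem of Goursat *)

Section Contour.
Variable R : realType.
Local Notation C := (CC R).
Implicit Types (f g : C -> C) (x y : R).

Definition iC : C := mkC 0 1.

Definition rect x0 x1 y0 y1 : set C :=
  [set z | x0 <= re z <= x1 /\ y0 <= im z <= y1].

(** The integral of f(z) dz along the boundary, counterclockwise: bottom minus top, then right minus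
    left with dz = i dy. *)
Definition bd f x0 x1 y0 y1 : C :=
  cint x0 x1 (fun t => f (mkC t y0)) - cint x0 x1 (fun t => f (mkC t y1)) +
  iC * (cint y0 y1 (fun t => f (mkC x1 t)) - cint y0 y1 (fun t => f (mkC x0 t))).

Lemma continuous_on_hline f a b y :
  (forall x, a <= x <= b -> {for mkC x y, continuous f}) ->
  continuous_on a b (fun t => f (mkC t y)).
Proof.
move=> cf x /cf; apply: (@continuous_comp _ _ _ (fun t => mkC t y)).
by apply: cvg_mkC; [exact: cvg_id|exact: cvg_cst].
Qed.

Lemma continuous_on_vline f a b x :
  (forall y, a <= y <= b -> {for mkC x y, continuous f}) ->
  continuous_on a b (fun t => f (mkC x t)).
Proof.
move=> cf y /cf; apply: (@continuous_comp _ _ _ (fun t => mkC x t)).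
by apply: cvg_mkC; [exact: cvg_cst|exact: cvg_id].
Qed.

Lemma bd_splitx f x0 m x1 y0 y1 : x0 <= m -> m <= x1 ->
  continuous_on x0 x1 (fun t => f (mkC t y0)) ->
  continuous_on x0 x1 (fun t => f (mkC t y1)) ->
  bd f x0 x1 y0 y1 = bd f x0 m y0 y1 + bd f m x1 y0 y1.
Proof.
move=> h1 h2 c0 c1; rewrite /bd (cint_split h1 h2 c0) (cint_split h1 h2 c1).
ring.
Qed.

Lemma bd_splity f x0 x1 y0 m y1 : y0 <= m -> m <= y1 ->
  continuous_on y0 y1 (fun t => f (mkC x0 t)) ->
  continuous_on y0 y1 (fun t => f (mkC x1 t)) ->
  bd f x0 x1 y0 y1 = bd f x0 x1 y0 m + bd f x0 x1 m y1.
Proof.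
move=> h1 h2 c0 c1; rewrite /bd (cint_split h1 h2 c0) (cint_split h1 h2 c1).
ring.
Qed.

Definition frame x0 x1 y0 y1 : set C :=
  [set z | rect x0 x1 y0 y1 z /\
     [\/ re z = x0, re z = x1, im z = y0 | im z = y1]].

Definition frame_continuous f x0 x1 y0 y1 :=
  forall z, frame x0 x1 y0 y1 z -> {for z, continuous f}.

Section Frame.
Variables (x0 x1 y0 y1 : R) (x01 : x0 <= x1) (y01 : y0 <= y1).

Lemma frame_lines f : frame_continuous f x0 x1 y0 y1 ->
  [/\ continuous_on x0 x1 (fun t => f (mkC t y0)),
      continuous_on x0 x1 (fun t => f (mkC t y1)),
      continuous_on y0 y1 (fun t => f (mkC x0 t)) &
      continuous_on y0 y1 (fun t => f (mkC x1 t))].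
Proof.
move=> cf; split; (apply: continuous_on_hline || apply: continuous_on_vline) => t tab;
apply: cf; (split; first by split=> //=; rewrite ?lexx ?x01 ?y01).
- exact: Or43.
- exact: Or44.
- exact: Or41.
- exact: Or42.
Qed.

Lemma bdD f g : frame_continuous f x0 x1 y0 y1 -> frame_continuous g x0 x1 y0 y1 ->
  bd (fun z => f z + g z) x0 x1 y0 y1 = bd f x0 x1 y0 y1 + bd g x0 x1 y0 y1.
Proof.
move=> /frame_lines[? ? ? ?] /frame_lines[? ? ? ?]; rewrite /bd !cintD //; ring.
Qed.

Lemma bdZ k f : frame_continuous f x0 x1 y0 y1 ->
  bd (fun z => k * f z) x0 x1 y0 y1 = k * bd f x0 x1 y0 y1.
Proof. by move=> /frame_lines[? ? ? ?]; rewrite /bd !cintZ //; ring. Qed.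

Lemma bdB f g : frame_continuous f x0 x1 y0 y1 -> frame_continuous g x0 x1 y0 y1 ->
  bd (fun z => f z - g z) x0 x1 y0 y1 = bd f x0 x1 y0 y1 - bd g x0 x1 y0 y1.
Proof.
by move=> /frame_lines[? ? ? ?] /frame_lines[? ? ? ?]; rewrite /bd !cintB //; ring.
Qed.

Lemma eq_bd f g : (forall z, frame x0 x1 y0 y1 z -> f z = g z) ->
  bd f x0 x1 y0 y1 = bd g x0 x1 y0 y1.
Proof.
move=> fg; rewrite /bd; congr (_ - _ + _ * (_ - _)); apply: eq_cint => t tab;
apply: fg; (split; first by split=> //=; rewrite ?lexx ?x01 ?y01).
- exact: Or43.
- exact: Or44.
- exact: Or42.
- exact: Or41.
Qed.

Lemma normiC : `|iC| = 1.
Proof. by rewrite /iC /mkC normc_def /= expr0n expr1n add0r sqrtr1. Qed.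

Lemma le_bd f M : frame_continuous f x0 x1 y0 y1 ->
  (forall z, frame x0 x1 y0 y1 z -> `|f z| <= mkC M 0) ->
  `|bd f x0 x1 y0 y1| <= mkC (4 * M * ((x1 - x0) + (y1 - y0))) 0.
Proof.
move=> /frame_lines[c1 c2 c3 c4] fM.
have e : 4 * M * ((x1 - x0) + (y1 - y0)) = (2 * M * (x1 - x0) + 2 * M * (x1 - x0))
  + (2 * M * (y1 - y0) + 2 * M * (y1 - y0)) by ring.
rewrite {}e !mkC0D.
rewrite (le_trans (ler_normD _ _)) // lerD //.
  rewrite (le_trans (ler_normB _ _)) // lerD //; apply: le_cint => // t tab;
  apply: fM; (split; first by split=> //=; rewrite ?lexx ?x01 ?y01).
    exact: Or43.
  exact: Or44.
rewrite normrM normiC mul1r.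
rewrite (le_trans (ler_normB _ _)) // lerD //; apply: le_cint => // t tab;
apply: fM; (split; first by split=> //=; rewrite ?lexx ?x01 ?y01).
  exact: Or42.
exact: Or41.
Qed.

Lemma cint_cst a b k : a <= b -> cint a b (fun=> k) = mkC (b - a) 0 * k :> C.
Proof.
move=> ab; rewrite /cint !Rintegral_cst // !lebesgue_measure_segment //.
by rewrite -[in RHS](mkCK k) /mkC; simpc; congr mkC; rewrite mulrC.
Qed.

(** The differences of the integrand between opposite sides are constants, so the integral is
    computed by hand. *)
Lemma bd_affine a b : bd (fun z => a + b * z) x0 x1 y0 y1 = 0.
Proof.
have ca z : {for z, continuous (fun z : C => a + b * z)}.
  by apply: continuousD; [exact: cst_continuous|
    apply: continuousM; [exact: cst_continuous|exact: cvg_id]].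
have [c1 c2 c3 c4] := frame_lines (fun z _ => ca z).
rewrite /bd -!cintB //.
rewrite (@eq_cint _ _ _ _ (fun=> b * (mkC 0 y0 - mkC 0 y1))); last first.
  move=> t _; rewrite [mkC t y0]mkC_split [mkC t y1]mkC_split.
  by move: (mkC t 0) (mkC 0 y0) (mkC 0 y1) => u v w; ring.
rewrite (@eq_cint _ y0 y1 _ (fun=> b * (mkC x1 0 - mkC x0 0))); last first.
  move=> t _; rewrite [mkC x1 t]mkC_split [mkC x0 t]mkC_split.
  by move: (mkC x1 0) (mkC x0 0) (mkC 0 t) => u v w; ring.
rewrite !cint_cst //.
have iy t : mkC 0 t = iC * mkC t 0 by rewrite /iC /mkC; simpc.
have dm s t : mkC (s - t) 0 = mkC s 0 - mkC t 0 by rewrite mkCN mkCD oppr0 addr0.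
rewrite !iy !dm.
by move: iC (mkC x0 0) (mkC x1 0) (mkC y0 0) (mkC y1 0) => ? ? ? ? ?; ring.
Qed.

End Frame.
End Contour.

Section Goursat.
Variable R : realType.
Local Notation C := (CC R).
Implicit Types (f g : C -> C) (x y : R).

Lemma differentiable_frame f x0 x1 y0 y1 :
  (forall z, rect x0 x1 y0 y1 z -> differentiable f z) ->
  frame_continuous f x0 x1 y0 y1.
Proof. by move=> df z [/df d _]; exact: differentiable_continuous. Qed.

Lemma diff_scalar f (z h : C) : differentiable f z -> 'd f z h = 'd f z 1 * h.
Proof. by move=> df; rewrite -{1}[h]mulr1 -[h * 1]/(h *: 1) linearZ /= mulrC. Qed.

(** The first order Taylor polynomial at z integrates to 0 and may be subtracted. What remains is at
    most e/4 times the sum of the sides, and 4 is the constant of [le_bd]. *)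
Lemma bd_local f (z : C) (e : R) : 0 < e -> differentiable f z ->
  exists2 d : R, 0 < d & forall x0 x1 y0 y1,
    [/\ x0 <= x1, y0 <= y1, rect x0 x1 y0 y1 z & (x1 - x0) + (y1 - y0) < d] ->
    (forall w, rect x0 x1 y0 y1 w -> differentiable f w) ->
    nrm (bd f x0 x1 y0 y1) <= e * ((x1 - x0) + (y1 - y0)) ^+ 2.
Proof.
move=> e0 df.
have e4 : 0 < mkC (e / 4) 0 by rewrite -mkC0 ltC divr_gt0.
have /nbhs_ballP[d /= d0 dP] := diff_remainder df e4.
exists (re d); first exact: re_gt0.
move=> x0 x1 y0 y1 [x01 y01 [zx zy] small] dfr.
set a := f z - 'd f z 1 * z.
have fr := differentiable_frame dfr.
have af : frame_continuous (fun w => a + 'd f z 1 * w) x0 x1 y0 y1.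
  move=> w _; apply: continuousD; first exact: cst_continuous.
  by apply: continuousM; [exact: cst_continuous|exact: cvg_id].
have <- : bd (fun w => f w - (a + 'd f z 1 * w)) x0 x1 y0 y1 = bd f x0 x1 y0 y1.
  by rewrite bdB // bd_affine // subr0.
rewrite -leC -nrmE.
have -> : e * (x1 - x0 + (y1 - y0)) ^+ 2 =
  4 * (e / 4 * (x1 - x0 + (y1 - y0))) * ((x1 - x0) + (y1 - y0)) by field.
apply: le_bd; [exact: x01|exact: y01|move=> w hw|move=> w [[wx wy] _]].
  by apply: continuousB; [exact: fr|exact: af].
have wz : nrm (w - z) <= x1 - x0 + (y1 - y0).
  apply: le_trans (ler_nrm _) _.
  have -> : re (w - z) = re w - re z by case: (w); case: (z).
  have -> : im (w - z) = im w - im z by case: (w); case: (z).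
  apply: lerD; rewrite ler_norml; move: wx wy zx zy => /andP[? ?] /andP[? ?] /andP[? ?] /andP[? ?].
    by apply/andP; split; lra.
  by apply/andP; split; lra.
have : `|f w - f z - 'd f z (w - z)| <= mkC (e / 4) 0 * `|w - z|.
  apply: dP; rewrite -ball_normE /= distrC.
  by rewrite ltr_nrm // (le_lt_trans wz).
rewrite diff_scalar //.
have -> : f w - f z - 'd f z 1 * (w - z) = f w - (a + 'd f z 1 * w).
  by rewrite /a; ring.
move/le_trans; apply; rewrite nrmE mkCM leC ler_wpM2l // ltW //.
by rewrite divr_gt0.
Qed.

Section Bisection.
Variables (f : C -> C) (x0 y0 w h : R).
Hypotheses (w0 : 0 <= w) (h0 : 0 <= h).
Hypothesis df : forall z, rect x0 (x0 + w) y0 (y0 + h) z -> differentiable f z.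
Variable e : R.
Hypothesis e0 : 0 < e.

Let q (n : nat) : R := (2 ^+ n)^-1.
Let cell (n : nat) (p : R * R) := bd f p.1 (p.1 + w * q n) p.2 (p.2 + h * q n).
Let bad n p := [/\ x0 <= p.1, p.1 + w * q n <= x0 + w, y0 <= p.2,
   p.2 + h * q n <= y0 + h &
   e * ((w + h) * q n) ^+ 2 < nrm (cell n p)].

Let q_gt0 n : 0 < q n. Proof. by rewrite invr_gt0 exprn_gt0. Qed.
Let qS n : q n = q n.+1 + q n.+1.
Proof. by rewrite /q exprS invfM; field. Qed.

(** The boundary integral is the sum over the four quarters while the bound is divided by four, so
    some quarter violates it as well. *)
Let bad_step n p : bad n p -> exists p' : R * R,
  [/\ bad n.+1 p', p.1 <= p'.1, p'.1 + w * q n.+1 <= p.1 + w * q n,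
     p.2 <= p'.2 & p'.2 + h * q n.+1 <= p.2 + h * q n].
Proof.
move=> [b1 b2 b3 b4 b5].
have wq := mulr_ge0 w0 (ltW (q_gt0 n.+1)); have hq := mulr_ge0 h0 (ltW (q_gt0 n.+1)).
have ew : w * q n = w * q n.+1 + w * q n.+1 by rewrite -mulrDr -qS.
have eh : h * q n = h * q n.+1 + h * q n.+1 by rewrite -mulrDr -qS.
move: (b2) (b4); rewrite ew eh => b2' b4'.
set u := w * q n.+1 in ew wq b2' *; set v := h * q n.+1 in eh hq b4' *.
have cf x y : x0 <= x -> x <= x0 + w -> y0 <= y -> y <= y0 + h ->
    {for mkC x y, continuous f}.
  move=> *; apply: differentiable_continuous; apply: df.
  by split; apply/andP; split.
have hl a b y : x0 <= a -> b <= x0 + w -> y0 <= y -> y <= y0 + h ->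
    continuous_on a b (fun t => f (mkC t y)).
  move=> *; apply: continuous_on_hline => t /andP[? ?]; apply: cf => //; lra.
have vl a b x : y0 <= a -> b <= y0 + h -> x0 <= x -> x <= x0 + w ->
    continuous_on a b (fun t => f (mkC x t)).
  move=> *; apply: continuous_on_vline => t /andP[? ?]; apply: cf => //; lra.
have sum4 : cell n p = cell n.+1 p + cell n.+1 (p.1, p.2 + v) +
    (cell n.+1 (p.1 + u, p.2) + cell n.+1 (p.1 + u, p.2 + v)).
  rewrite /cell ew eh -/u -/v /=.
  have -> : bd f p.1 (p.1 + (u + u)) p.2 (p.2 + (v + v)) =
      bd f p.1 (p.1 + u) p.2 (p.2 + (v + v)) + bd f (p.1 + u) (p.1 + (u + u)) p.2 (p.2 + (v + v)).
    by apply: bd_splitx; [lra|lra|apply: hl; lra|apply: hl; lra].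
  have -> : bd f p.1 (p.1 + u) p.2 (p.2 + (v + v)) =
      bd f p.1 (p.1 + u) p.2 (p.2 + v) + bd f p.1 (p.1 + u) (p.2 + v) (p.2 + (v + v)).
    by apply: bd_splity; [lra|lra|apply: vl; lra|apply: vl; lra].
  have -> : bd f (p.1 + u) (p.1 + (u + u)) p.2 (p.2 + (v + v)) =
      bd f (p.1 + u) (p.1 + (u + u)) p.2 (p.2 + v) +
      bd f (p.1 + u) (p.1 + (u + u)) (p.2 + v) (p.2 + (v + v)).
    by apply: bd_splity; [lra|lra|apply: vl; lra|apply: vl; lra].
  by rewrite (addrA p.1 u u) (addrA p.2 v v).
have nD (s t : C) : nrm (s + t) <= nrm s + nrm t.
  by rewrite -leC mkC0D -!nrmE ler_normD.
have e4 : e * ((w + h) * q n) ^+ 2 = 4 * (e * ((w + h) * q n.+1) ^+ 2).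
  by rewrite (qS n); ring.
set E := e * ((w + h) * q n.+1) ^+ 2 in e4.
have [g1|g1] := ltP E (nrm (cell n.+1 p)).
  by exists p; split; [split=> //; rewrite -/u -/v|..]; rewrite -/u -/v; clear -b1 b2' b3 b4' wq hq; lra.
have [g2|g2] := ltP E (nrm (cell n.+1 (p.1, p.2 + v))).
  by exists (p.1, p.2 + v); split=> /=; [split=> //=; rewrite -/u -/v|..]; rewrite -/u -/v; clear -b1 b2' b3 b4' wq hq; lra.
have [g3|g3] := ltP E (nrm (cell n.+1 (p.1 + u, p.2))).
  by exists (p.1 + u, p.2); split=> /=; [split=> //=; rewrite -/u -/v|..]; rewrite -/u -/v; clear -b1 b2' b3 b4' wq hq; lra.
have [g4|g4] := ltP E (nrm (cell n.+1 (p.1 + u, p.2 + v))).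
  by exists (p.1 + u, p.2 + v); split=> /=; [split=> //=; rewrite -/u -/v|..]; rewrite -/u -/v; clear -b1 b2' b3 b4' wq hq; lra.
exfalso; move: b5; rewrite e4 sum4.
have := nD (cell n.+1 p + cell n.+1 (p.1, p.2 + v))
  (cell n.+1 (p.1 + u, p.2) + cell n.+1 (p.1 + u, p.2 + v)).
have := nD (cell n.+1 p) (cell n.+1 (p.1, p.2 + v)).
have := nD (cell n.+1 (p.1 + u, p.2)) (cell n.+1 (p.1 + u, p.2 + v)).
lra.
Qed.

(** A violation would propagate to nested rectangles shrinking to a point, where f is differentiable
    and [bd_local] gives the bound. *)
Lemma le_bd_area : nrm (bd f x0 (x0 + w) y0 (y0 + h)) <= e * (w + h) ^+ 2.
Proof.
rewrite leNgt; apply/negP => big.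
have bad0 : bad 0 (x0, y0).
  by rewrite /bad /cell /q /= expr0 invr1 !mulr1; split.
have /choice[nx nxP] : forall np : nat * (R * R), exists p' : R * R,
    bad np.1 np.2 -> [/\ bad np.1.+1 p', np.2.1 <= p'.1,
     p'.1 + w * q np.1.+1 <= np.2.1 + w * q np.1,
     np.2.2 <= p'.2 & p'.2 + h * q np.1.+1 <= np.2.2 + h * q np.1].
  move=> [n p] /=; have [/bad_step[p' ?]|nb] := pselect (bad n p).
    by exists p'.
  by exists p.
pose s := fix s n := if n is m.+1 then nx (m, s m) else (x0, y0).
have bs n : bad n (s n) by elim: n => //= n /(nxP (n, _))[].
have st n := nxP (n, s n) (bs n).
have mono n m : [/\ (s n).1 <= (s (n + m)%N).1, (s (n + m)%N).1 + w * q (n + m) <= (s n).1 + w * q n,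
   (s n).2 <= (s (n + m)%N).2 & (s (n + m)%N).2 + h * q (n + m) <= (s n).2 + h * q n].
  elim: m => [|m [i1 i2 i3 i4]]; first by rewrite addn0.
  rewrite addnS; have [_ /= j1 j2 j3 j4] := st (n + m)%N; split; lra.
have wq n := mulr_ge0 w0 (ltW (q_gt0 n)); have hq n := mulr_ge0 h0 (ltW (q_gt0 n)).
have bnd n m : [/\ (s n).1 <= (s m).1 + w * q m & (s n).2 <= (s m).2 + h * q m].
  have [nm|mn] := leqP n m.
    have [i1 i2 i3 i4] := mono n (m - n)%N; rewrite subnKC // in i1 i2 i3 i4.
    have := wq m; have := hq m; split; lra.
  have [i1 i2 i3 i4] := mono m (n - m)%N; rewrite subnKC 1?ltnW // in i1 i2 i3 i4.
  have := wq n; have := hq n; split; lra.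
(* By [bnd] every lower left corner is below every upper right corner, so these suprema are the
   coordinates of a point common to all the rectangles. *)
pose X := sup (range (fun n => (s n).1)); pose Y := sup (range (fun n => (s n).2)).
have hX n : (s n).1 <= X <= (s n).1 + w * q n.
  apply/andP; split.
    apply: ub_le_sup; last by exists n.
    by exists ((s 0%N).1 + w * q 0) => _ [m _ <-]; have [] := bnd m 0%N.
  apply: ge_sup; first by exists (s 0%N).1, 0%N.
  by move=> _ [m _ <-]; have [] := bnd m n.
have hY n : (s n).2 <= Y <= (s n).2 + h * q n.
  apply/andP; split.
    apply: ub_le_sup; last by exists n.
    by exists ((s 0%N).2 + h * q 0) => _ [m _ <-]; have [] := bnd m 0%N.
  apply: ge_sup; first by exists (s 0%N).2, 0%N.
  by move=> _ [m _ <-]; have [] := bnd m n.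
have dz : differentiable f (mkC X Y).
  apply: df; have := hX 0%N; have := hY 0%N; rewrite /q expr0 invr1 !mulr1 /=.
  by split.
have [d d0 dP] := bd_local e0 dz.
have [n nd] : exists n, (w + h) * q n < d.
  have [wh|wh] := leP (w + h) 0.
    by exists 0%N; rewrite (le_lt_trans _ d0) // mulr_le0_ge0 // ltW.
  have : (fun n => (w + h) * (2^-1 : R) ^+ n) @ \oo --> (0 : R).
    by apply: (@cvg_geometric R (w + h) 2^-1); rewrite ger0_norm; lra.
  move/cvgrPdist_lt/(_ d d0) => [N _ /(_ N)] /= NP; exists N.
  have := NP (leqnn N); rewrite sub0r normrN /q exprVn => /(le_lt_trans _); apply.
  exact: ler_norm.
have [b1 b2 b3 b4] := bs n.
rewrite ltNge => /negP; apply.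
have ww := wq n; have hh := hq n.
have := dP (s n).1 ((s n).1 + w * q n) (s n).2 ((s n).2 + h * q n).
have -> : ((s n).1 + w * q n - (s n).1) + ((s n).2 + h * q n - (s n).2) = (w + h) * q n.
  by ring.
apply; first by split=> //; try lra; split.
by move=> z [/andP[? ?] /andP[? ?]]; apply: df; split; apply/andP; split; lra.
Qed.

End Bisection.

Lemma goursat f x0 x1 y0 y1 : x0 <= x1 -> y0 <= y1 ->
  (forall z, rect x0 x1 y0 y1 z -> differentiable f z) -> bd f x0 x1 y0 y1 = 0.
Proof.
move=> x01 y01 df; set w := x1 - x0; set h := y1 - y0.
have w0 : 0 <= w by rewrite subr_ge0.
have h0 : 0 <= h by rewrite subr_ge0.
have e1 : x1 = x0 + w by rewrite /w; ring.
have e2 : y1 = y0 + h by rewrite /h; ring.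
rewrite e1 e2 in df *.
apply/eqP; rewrite -normr_eq0 nrmE -mkC0; apply/eqP; congr mkC.
apply/eqP; rewrite eq_le; apply/andP; split; last first.
  by rewrite -leC -nrmE mkC0.
apply/ler_addgt0Pr => e e0; rewrite add0r.
have K0 : 0 < (w + h) ^+ 2 + 1 by rewrite ltr_wpDl // sqr_ge0.
apply: le_trans (le_bd_area w0 h0 df (divr_gt0 e0 K0)) _.
by rewrite mulrAC ler_pdivrMr // ler_pM2l // lerDl.
Qed.

End Goursat.

(** A differential has to be continuous, which in an arbitrary normed module is not automatic; here
    an operator bound provides it. *)
Lemma bounded_linear_differentiable (K : numFieldType) (V W : normedModType K)
    (f : V -> W) (x : V) (L : {linear V -> W}) (B : K) :
  0 <= B ->
  (forall v, `|L v| <= B * `|v|) ->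
  (forall e : K, 0 < e -> \forall y \near x, `|f y - f x - L (y - x)| <= e * `|y - x|) ->
  differentiable f x /\ 'd f x = L :> (V -> W).
Proof.
move=> B0 LB fL; have B1 : 0 < B + 1 by rewrite ltr_wpDl.
have cL : continuous L.
  move=> v; apply/(@cvgrPdist_lt _ _ _ (nbhs v)) => e e0.
  apply: filterS (near_dist v (divr_gt0 e0 B1)) => w.
  rewrite ltr_pdivlMr // -linearB; apply: le_lt_trans.
  by rewrite (le_trans (LB _)) // mulrC ler_wpM2l // lerDl.
have fE : f \o shift x = cst (f x) + L +o_0 id.
  apply/eqaddoP => e /fL {}fL.
  move: fL; rewrite (near_shift 0 x) /=; apply: filterS => y /=.
  by rewrite subr0 addrK -[in X in X -> _]addrA -[in X in X -> _]opprD.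
have dE := diff_unique cL fE; split=> //.
by apply/diff_locallyP; rewrite dE.
Qed.

Section RealNorm.
Variable R : realType.
Local Notation C := (CC R).
Variable V : normedModType C.
Implicit Types (v w : V).

Definition nv v : R := re `|v|.

Lemma nvE v : `|v| = mkC (nv v) 0.
Proof. exact: realCE. Qed.

Lemma nv_ge0 v : 0 <= nv v.
Proof. by rewrite -leC -nvE mkC0. Qed.

Lemma nvD v w : nv (v + w) <= nv v + nv w.
Proof. by rewrite -leC mkC0D -!nvE ler_normD. Qed.

Lemma nvN v : nv (- v) = nv v.
Proof. by rewrite /nv normrN. Qed.

Lemma nvB v w : nv (v - w) <= nv v + nv w.
Proof. by rewrite -[nv w]nvN nvD. Qed.

Lemma nv_sub v w : nv (v - w) = nv (w - v).
Proof. by rewrite -nvN opprB. Qed.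

Lemma nvZ k v : nv (k *: v) = nrm k * nv v.
Proof.
suff : mkC (nv (k *: v)) 0 = mkC (nrm k * nv v) 0 by case.
by rewrite -mkCM -!nvE normrZ nrmE.
Qed.

Lemma nv0 : nv 0 = 0. Proof. by rewrite /nv normr0. Qed.

Lemma nv_eq0 v : (nv v == 0) = (v == 0).
Proof.
rewrite -[in RHS](normr_eq0 v) nvE; apply/eqP/eqP => [->|]; first by rewrite mkC0.
by case.
Qed.

Lemma nv_gt0 v : (0 < nv v) = (v != 0).
Proof. by rewrite lt_neqAle nv_ge0 andbT eq_sym nv_eq0. Qed.

Lemma near_nv v (d : R) : 0 < d -> \forall w \near v, nv (w - v) < d.
Proof.
move=> d0; have d0' : 0 < mkC d 0 by rewrite -mkC0 ltC.
apply: filterS (near_dist v d0') => w.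
by rewrite nvE ltC nv_sub.
Qed.

Lemma near_nvP v (P : set V) : (\forall w \near v, P w) <->
  exists2 d : R, 0 < d & forall w, nv (w - v) < d -> P w.
Proof.
split=> [/nbhs_ballP[d /= d0 dP]|[d d0 dP]]; last exact: filterS (near_nv v d0).
exists (re d); first exact: re_gt0.
move=> w wd; apply: dP; rewrite -ball_normE /= distrC.
by rewrite (realCE (ltW d0)) nvE ltC.
Qed.

Lemma differentiable_near_nv (W : normedModType C) (f : V -> W) v : differentiable f v ->
  forall e : R, 0 < e -> exists2 d : R, 0 < d &
    forall w, nv (w - v) < d -> re `|f w - f v - 'd f v (w - v)| <= e * nv (w - v).
Proof.
move=> df e e0; have e0' : 0 < mkC e 0 by rewrite -mkC0 ltC.
have /near_nvP[d d0 dP] := diff_remainder df e0'.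
exists d => // w /dP; rewrite [X in _ <= _ * X]nvE mkCM [X in X <= _]realCE //.
by rewrite leC.
Qed.

End RealNorm.

Section NormC.
Variable R : realType.
Local Notation C := (CC R).
Implicit Types (z w : C).
Lemma nrmM z w : nrm (z * w) = nrm z * nrm w.
Proof. exact: (@nvZ R C z w). Qed.
Lemma nrmV z : nrm z^-1 = (nrm z)^-1.
Proof.
have [->|z0] := eqVneq z 0; first by rewrite invr0 -[nrm _]/(@nv R C 0) nv0 invr0.
have n0 : nrm z != 0 by rewrite (@nv_eq0 R C).
by apply: (mulfI n0); rewrite -nrmM !divff // /nrm normr1.
Qed.
Lemma nrm1 : nrm (1 : C) = 1. Proof. by rewrite /nrm normr1. Qed.
Lemma nrmX z n : nrm (z ^+ n) = nrm z ^+ n.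
Proof. by elim: n => [|n ih]; rewrite ?expr0 ?nrm1 // !exprS nrmM ih. Qed.
Lemma nrm_mkC (x : R) : nrm (mkC x 0) = `|x|.
Proof. by rewrite /nrm /mkC normc_def /= expr0n addr0 sqrtr_sqr. Qed.
Lemma nrm_ge0 z : 0 <= nrm z. Proof. exact: (@nv_ge0 R C). Qed.
Lemma nrmD z w : nrm (z + w) <= nrm z + nrm w. Proof. exact: (@nvD R C). Qed.
Lemma nrmB z w : nrm (z - w) <= nrm z + nrm w. Proof. exact: (@nvB R C). Qed.
Lemma nrm_gt0 z : (0 < nrm z) = (z != 0). Proof. exact: (@nv_gt0 R C). Qed.
Lemma nrm_eq0 z : (nrm z == 0) = (z == 0). Proof. exact: (@nv_eq0 R C). Qed.
End NormC.

(** * Cauchy's formula and the Taylor remainder in one variable *)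

Section Cauchy.
Variable R : realType.
Local Notation C := (CC R).
Implicit Types (f g : C -> C) (x y r : R).

(** Two strips of full height beside the hole and two pieces below and above it are cut off;
    [goursat] applies to each of the four. *)
Lemma bd_hole f x0 l r x1 y0 d u y1 :
  x0 <= l -> l <= r -> r <= x1 -> y0 <= d -> d <= u -> u <= y1 ->
  (forall z, rect x0 x1 y0 y1 z -> ~ (l < re z < r /\ d < im z < u) ->
     differentiable f z) ->
  bd f x0 x1 y0 y1 = bd f l r d u.
Proof.
move=> h1 h2 h3 h4 h5 h6 df.
have cf x y : x0 <= x <= x1 -> y0 <= y <= y1 -> ~ (l < x < r /\ d < y < u) ->
    {for mkC x y, continuous f}.
  by move=> ? ? ?; apply: differentiable_continuous; apply: df.
have hl a b y : x0 <= a -> b <= x1 -> y0 <= y <= d \/ u <= y <= y1 ->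
    continuous_on a b (fun t => f (mkC t y)).
  move=> ? ? hy; apply: continuous_on_hline => t /andP[? ?]; apply: cf.
  - by apply/andP; split; lra.
  - by apply/andP; case: hy => /andP[? ?]; split; lra.
  - by case=> _ /andP[? ?]; case: hy => /andP[? ?]; lra.
have vl a b x : y0 <= a -> b <= y1 -> x0 <= x <= l \/ r <= x <= x1 ->
    continuous_on a b (fun t => f (mkC x t)).
  move=> ? ? hy; apply: continuous_on_vline => t /andP[? ?]; apply: cf.
  - by apply/andP; case: hy => /andP[? ?]; split; lra.
  - by apply/andP; split; lra.
  - by case=> /andP[? ?] _; case: hy => /andP[? ?]; lra.
have z0 a b a' b' : x0 <= a -> a <= b -> b <= x1 -> y0 <= a' -> a' <= b' -> b' <= y1 ->
    [\/ b <= l, r <= a, b' <= d | u <= a'] -> bd f a b a' b' = 0.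
  move=> ? ? ? ? ? ? hh; apply: goursat => // z [/andP[? ?] /andP[? ?]].
  apply: df; first by split; apply/andP; split; lra.
  by case=> /andP[? ?] /andP[? ?]; case: hh => ?; lra.
rewrite (@bd_splitx _ f x0 l x1); [|lra|lra|apply: hl; lra|apply: hl; lra].
have -> : bd f x0 l y0 y1 = 0 by apply: z0; [lra|lra|lra|lra|lra|lra|apply: Or41; lra].
rewrite add0r.
rewrite (@bd_splitx _ f l r x1); [|lra|lra|apply: hl; lra|apply: hl; lra].
have -> : bd f r x1 y0 y1 = 0 by apply: z0; [lra|lra|lra|lra|lra|lra|apply: Or42; lra].
rewrite addr0.
rewrite (@bd_splity _ f l r y0 d y1); [|lra|lra|apply: vl; lra|apply: vl; lra].
have -> : bd f l r y0 d = 0 by apply: z0; [lra|lra|lra|lra|lra|lra|apply: Or43; lra].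
rewrite add0r.
rewrite (@bd_splity _ f l r d u y1); [|lra|lra|apply: vl; lra|apply: vl; lra].
have -> : bd f l r u y1 = 0 by apply: z0; [lra|lra|lra|lra|lra|lra|apply: Or44; lra].
by rewrite addr0.
Qed.

Lemma contC_mul f g (z : C) : {for z, continuous f} -> {for z, continuous g} ->
  {for z, continuous (fun w : C => f w * g w)}.
Proof. exact: continuousM. Qed.

Lemma contC_sub f g (z : C) : {for z, continuous f} -> {for z, continuous g} ->
  {for z, continuous (fun w : C => f w - g w)}.
Proof. exact: continuousB. Qed.

Lemma contC_cst (k z : C) : {for z, continuous (fun w : C => k)}.
Proof. exact: cst_continuous. Qed.

Lemma diffC_mul f g (z : C) : differentiable f z -> differentiable g z ->
  differentiable (fun w : C => f w * g w) z.
Proof. exact: differentiableM. Qed.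

Lemma diffC_sub f g (z : C) : differentiable f z -> differentiable g z ->
  differentiable (fun w : C => f w - g w) z.
Proof. exact: differentiableB. Qed.

Lemma diffC_cst (k z : C) : differentiable (fun w : C => k) z.
Proof. exact: differentiable_cst. Qed.

Lemma diffC_cont f (z : C) : differentiable f z -> {for z, continuous f}.
Proof. exact: differentiable_continuous. Qed.

Lemma diffC_inv (a z : C) : z != a -> differentiable (fun w : C => (w - a)^-1) z.
Proof.
move=> za; apply: (@differentiableV C C (fun w => w - a)); last by rewrite subr_eq0.
exact: (@diffC_sub id (fun=> a)).
Qed.

Lemma differentiable_div f (a z : C) : differentiable f z -> z != a ->
  differentiable (fun w : C => f w / (w - a)) z.
Proof. by move=> df za; exact: diffC_mul df (diffC_inv za). Qed.

Lemma continuous_div f (a z : C) : {for z, continuous f} -> z != a ->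
  {for z, continuous (fun w : C => f w / (w - a))}.
Proof. by move=> cf za; exact: contC_mul cf (diffC_cont (diffC_inv za)). Qed.

(** The quotient (f z - f a) / (z - a) is bounded near a and holomorphic elsewhere, so by [bd_hole]
    its integral equals that over an arbitrarily small square around a. *)
Lemma cauchy_rect f x0 x1 y0 y1 a :
  (forall z, rect x0 x1 y0 y1 z -> differentiable f z) ->
  x0 < re a < x1 -> y0 < im a < y1 ->
  bd (fun z => f z / (z - a)) x0 x1 y0 y1 =
  f a * bd (fun z => 1 / (z - a)) x0 x1 y0 y1.
Proof.
move=> df /andP[ax0 ax1] /andP[ay0 ay1].
have ra : rect x0 x1 y0 y1 a by split; apply/andP; split; exact: ltW.
have x01 : x0 <= x1 by lra. have y01 : y0 <= y1 by lra.
have na z : frame x0 x1 y0 y1 z -> z != a.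
  by move=> [_ h]; apply/eqP => e; rewrite e in h; case: h => h; lra.
have c1 : frame_continuous (fun z => f z / (z - a)) x0 x1 y0 y1.
  by move=> z hz; apply: continuous_div (na _ hz); apply: diffC_cont; apply: df; case: hz.
have c3 : frame_continuous (fun z => 1 / (z - a)) x0 x1 y0 y1.
  by move=> z hz; apply: continuous_div (na _ hz); exact: contC_cst.
have c4 : frame_continuous (fun z => f a * (1 / (z - a))) x0 x1 y0 y1.
  by move=> z hz; apply: contC_mul; [exact: contC_cst|exact: c3].
rewrite -(bdZ x01 y01 (f a) c3); apply/eqP; rewrite -subr_eq0 -(bdB x01 y01 c1 c4).
set g := fun z => f z / (z - a) - f a * (1 / (z - a)).
have dg z : rect x0 x1 y0 y1 z -> z != a -> differentiable g z.
  move=> rz za; apply: diffC_sub; first exact: differentiable_div (df _ rz) za.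
  by apply: diffC_mul; [exact: diffC_cst|apply: differentiable_div za; exact: diffC_cst].
have [d d0 dP] := differentiable_near_nv (df _ ra) ltr01.
set M := nrm ('d f a 1) + 1.
have gM z : nrm (z - a) < d -> z != a -> nrm (g z) <= M.
  move=> /dP + za; rewrite -/(nrm _) -/(nrm (z - a)) mul1r => h.
  have za' : z - a != 0 by rewrite subr_eq0.
  have -> : g z = (f z - f a) / (z - a) by rewrite /g; field.
  rewrite nrmM nrmV ler_pdivrMr ?nrm_gt0 // /M mulrDl mul1r -nrmM -diff_scalar; last exact: df.
  have -> : f z - f a = 'd f a (z - a) + (f z - f a - 'd f a (z - a)).
    by rewrite addrCA subrr addr0.
  by rewrite (le_trans (nrmD _ _)) // lerD2l.
rewrite -nrm_eq0; apply/eqP/le_anti; rewrite nrm_ge0 andbT.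
apply/ler_addgt0Pr => e e0; rewrite add0r.
have M0 : 0 < M by rewrite ltr_wpDl // nrm_ge0.
(* d / 4 keeps the small square where [g] is bounded by M, e / (16 M) brings its integral below e,
   and the other bounds keep it inside the rectangle. *)
set s := Num.min (Num.min (d / 4) (e / (16 * M))) (Num.min (Num.min (re a - x0) (x1 - re a))
   (Num.min (im a - y0) (y1 - im a))).
have [s0 [s1 s2 s3 s4] [s5 s6]] : [/\ 0 < s, [/\ s <= d / 4, s <= e / (16 * M), s <= re a - x0 & s <= x1 - re a] &
   s <= im a - y0 /\ s <= y1 - im a].
  rewrite /s; split; first by rewrite !lt_min !subr_gt0 ax0 ax1 ay0 ay1 !divr_gt0 // mulr_gt0.
    by rewrite !ge_min !lexx ?orbT.
  by rewrite !ge_min !lexx ?orbT.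
clearbody s.
rewrite (@bd_hole g x0 (re a - s) (re a + s) x1 y0 (im a - s) (im a + s) y1); try lra; last first.
  move=> z rz hz; apply: dg => //; apply/eqP => e1; apply: hz; rewrite e1.
  by split; apply/andP; split; lra.
have sub z : frame (re a - s) (re a + s) (im a - s) (im a + s) z ->
    rect x0 x1 y0 y1 z /\ z != a.
  move=> [[/andP[? ?] /andP[? ?]] h]; split; first by split; apply/andP; split; lra.
  by apply/eqP => e1; rewrite e1 in h; case: h => h; lra.
have xs : re a - s <= re a + s by lra. have ys : im a - s <= im a + s by lra.
have := le_bd xs ys (f := g) (M := M).
rewrite nrmE leC => hb.
apply: le_trans (hb _ _) _.
- by move=> z /sub[rz za]; apply: differentiable_continuous; exact: dg.
- move=> z hz; have [rz za] := sub _ hz; rewrite nrmE leC; apply: gM => //.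
  apply: le_lt_trans (ler_nrm _) _.
  have -> : re (z - a) = re z - re a by case: (z); case: (a).
  have -> : im (z - a) = im z - im a by case: (z); case: (a).
  case: hz => -[/andP[q1 q2] /andP[q3 q4]] _.
  have : `|re z - re a| <= s by clear -q1 q2; rewrite ler_norml; apply/andP; split; lra.
  have : `|im z - im a| <= s by clear -q3 q4; rewrite ler_norml; apply/andP; split; lra.
  clear -s1 s0 d0; move: `|_| `|_| => ? ?; lra.
- have -> : 4 * M * (re a + s - (re a - s) + (im a + s - (im a - s))) = s * (16 * M) by ring.
  by rewrite -ler_pdivlMr // mulr_gt0.
Qed.

End Cauchy.

Section Kernel.
Variable R : realType.
Local Notation C := (CC R).
Implicit Types (f g : C -> C) (x y r : R).

Definition sq f r : C := bd f (- r) r (- r) r.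

Definition sqf r : set C := frame (- r) r (- r) r.

(* This is 2 pi i, but only ksq r <> 0 is needed. *)
Definition ksq r : C := sq (fun z => 1 / z) r.

Lemma sqfP r (z : C) : sqf r z -> r <= nrm z.
Proof.
have h1 := ler_re z; have h2 := ler_im z.
have h3 := ler_norm (re z); have h4 := ler_norm (im z).
have h5 := ler_normr (re z) (- re z); have h6 := ler_norm (- re z).
have h7 := ler_norm (- im z); rewrite !normrN in h6 h7.
by move=> [_ [] e]; lra.
Qed.

Lemma sqf_neq r (z a : C) : sqf r z -> - r < re a < r -> - r < im a < r -> z != a.
Proof.
by move=> [_ h] /andP[? ?] /andP[? ?]; apply/eqP => e; rewrite e in h; case: h; lra.
Qed.

Lemma inv_mkC x y : (mkC x y)^-1 = mkC (x / (x ^+ 2 + y ^+ 2)) (- (y / (x ^+ 2 + y ^+ 2))).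
Proof. by []. Qed.

(** Each side has length 2 r and contributes to the imaginary part the integral of r / (t^2 + r^2)
    >= 1 / (2 r), hence at least 1. *)
Lemma ksq_ge r : 0 < r -> 4 <= nrm (ksq r).
Proof.
move=> r0; apply: le_trans (ler_im _); apply: le_trans (ler_norm _).
have rr : - r <= r by lra.
have z0 (a : C) : sqf r a -> a != 0.
  by move=> ha; apply: sqf_neq ha _ _; apply/andP; rewrite /re /im /=; split; lra.
have fc : frame_continuous (fun z : C => 1 / z) (- r) r (- r) r.
  move=> z /z0 z1; have := continuous_div (@contC_cst R 1 z) z1.
  by have -> : (fun w : C => 1 / (w - 0)) = (fun w => 1 / w) by apply/funext => w; rewrite subr0.
have [c1 c2 c3 c4] := frame_lines rr rr fc.
have key (h : R -> R) : continuous_on (- r) r h ->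
    (forall t, - r <= t <= r -> h t = r / (t ^+ 2 + r ^+ 2)) ->
    1 <= \int[@lebesgue_measure R]_(x in `[- r, r]) h x.
  move=> ch hE; have -> : 1 = (2 * r)^-1 * fine (@lebesgue_measure R `[- r, r]%classic).
    by rewrite lebesgue_measure_segment //; field; rewrite gt_eqF.
  rewrite -Rintegral_cst //; apply: le_Rintegral => //.
  - by apply: (@continuous_on_integrable _ _ _ (fun=> _)) => x _; exact: cst_continuous.
  - exact: continuous_on_integrable.
  move=> t; rewrite /= in_itv /= => tr; rewrite hE // invfM mulrC.
  move/andP: tr => [ta tb].
  rewrite ler_pdivrMr // mulrAC ler_pdivlMr; last by rewrite ltr_wpDl ?sqr_ge0 ?exprn_gt0.
  rewrite mulrC ler_pdivrMr //; clear -r0 ta tb; move: (t : R) ta tb => {}t ? ?; nra.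
have [r1 i1] := continuous_on_re c1; have [r2 i2] := continuous_on_re c2.
have [r3 i3] := continuous_on_re c3; have [r4 i4] := continuous_on_re c4.
have neg (h : R -> R) : continuous_on (- r) r h ->
    \int[@lebesgue_measure R]_(x in `[- r, r]) h x =
    - \int[@lebesgue_measure R]_(x in `[- r, r]) (- h x).
  move=> ch; rewrite -[RHS]mulN1r -RintegralZl //.
    by apply: eq_Rintegral => x _; rewrite mulN1r opprK.
  by apply: (@continuous_on_integrable _ _ _ (fun x => - h x)) => x /ch; exact: continuousN.
have -> : im (ksq r) = \int[@lebesgue_measure R]_(x in `[- r, r]) im (1 / mkC x (- r)) -
   \int[@lebesgue_measure R]_(x in `[- r, r]) im (1 / mkC x r) +
   (\int[@lebesgue_measure R]_(x in `[- r, r]) re (1 / mkC r x) -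
    \int[@lebesgue_measure R]_(x in `[- r, r]) re (1 / mkC (- r) x)).
  by rewrite /ksq /sq /bd /cint /iC /mkC /im /re /=; simpc.
rewrite (neg _ i2) (neg _ r3) !opprK.
have := key _ i1; have := key _ r4.
have nr4 := key (fun x => - re (1 / mkC (- r) x)).
have ni2 := key (fun x => - im (1 / mkC x r)).
move=> k3 k1.
have := k1 _; have := k3 _; have := nr4 _ _; have := ni2 _ _.
have e t : t ^+ 2 + r ^+ 2 != 0 by rewrite gt_eqF // ltr_wpDl ?sqr_ge0 ?exprn_gt0.
move=> /(_ _ _)/wrap[||K1]; [by move=> x /i2; exact: continuousN|move=> t _|].
  by rewrite mul1r inv_mkC /im /= opprK.
move=> /(_ _ _)/wrap[||K2]; [by move=> x /r3; exact: continuousN|move=> t _|].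
  by rewrite mul1r inv_mkC /re /= sqrrN addrC mulNr opprK.
move=> /(_ _)/wrap[|K3]; first by move=> t _; rewrite -[LHS]/(re (1 / mkC r t)) mul1r inv_mkC /re /= addrC.
move=> /(_ _)/wrap[|K4]; first by move=> t _; rewrite -[LHS]/(im (1 / mkC t (- r))) mul1r inv_mkC /im /= sqrrN mulNr opprK.
have -> : 4 = (1 + 1) + (1 + 1) :> R by ring.
by rewrite !lerD.
Qed.

Lemma ksq_neq0 r : 0 < r -> ksq r != 0.
Proof. by move=> /ksq_ge h; rewrite -nrm_gt0; lra. Qed.

End Kernel.

Section CauchySquare.
Variable R : realType.
Local Notation C := (CC R).
Implicit Types (f g : C -> C) (x y r : R).

Lemma re_sub (z w : C) : re (z - w) = re z - re w.
Proof. by case: z; case: w. Qed.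

Lemma im_sub (z w : C) : im (z - w) = im z - im w.
Proof. by case: z; case: w. Qed.

Lemma re_nrm (z : C) : - nrm z <= re z <= nrm z.
Proof. by rewrite -ler_norml ler_re. Qed.

Lemma im_nrm (z : C) : - nrm z <= im z <= nrm z.
Proof. by rewrite -ler_norml ler_im. Qed.

Lemma sqf_dist r (z a : C) s : sqf r z -> - s <= re a <= s -> - s <= im a <= s ->
  r - s <= nrm (z - a).
Proof.
have := re_nrm (z - a); have := im_nrm (z - a); rewrite re_sub im_sub.
by move=> /andP[? ?] /andP[? ?] [_ h] /andP[? ?] /andP[? ?]; case: h => h; lra.
Qed.

Lemma le_sq f r M : 0 < r -> frame_continuous f (- r) r (- r) r ->
  (forall z, sqf r z -> nrm (f z) <= M) -> nrm (sq f r) <= 16 * M * r.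
Proof.
move=> r0 cf fM; have rr : - r <= r by lra.
rewrite -leC -nrmE.
have -> : 16 * M * r = 4 * M * ((r - - r) + (r - - r)) by ring.
by apply: le_bd => // z /fM; rewrite nrmE leC.
Qed.

Lemma re0_in r : 0 < r -> - r < re (0 : C) < r.
Proof. by move=> r0; rewrite /re /=; apply/andP; split; lra. Qed.

Lemma im0_in r : 0 < r -> - r < im (0 : C) < r.
Proof. by move=> r0; rewrite /im /=; apply/andP; split; lra. Qed.

Lemma sqf_r r : 0 < r -> sqf r (mkC r 0).
Proof.
move=> r0; split; last exact: Or42.
by rewrite /rect /re /im /=; split; apply/andP; split; lra.
Qed.

(** Both poles lie inside the square, so the difference of the two kernels may be integrated over a
    square of any larger size L. There it is of order |a| / L^2 on a contour of length 8 L, which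
    tends to 0. *)
Lemma ksq_const r (a : C) : 0 < r -> - r < re a < r -> - r < im a < r ->
  sq (fun z => 1 / (z - a)) r = ksq r.
Proof.
move=> r0 ra ia; have rr : - r <= r by lra.
have ca (L : R) (b z : C) : sqf L z -> - L < re b < L -> - L < im b < L ->
    {for z, continuous (fun z => 1 / (z - b))}.
  by move=> h1 h2 h3; apply: continuous_div (sqf_neq h1 h2 h3); exact: contC_cst.
have -> : ksq r = sq (fun z : C => 1 / (z - 0)) r.
  by congr sq; apply/funext => z; rewrite subr0.
apply/eqP; rewrite -subr_eq0 /sq -(bdB rr rr); last 2 first.
- by move=> z hz; exact: (ca r).
- by move=> z hz; exact: (ca r _ _ hz (re0_in r0) (im0_in r0)).
set g := fun z => _ - _.
rewrite -nrm_eq0; apply/eqP/le_anti; rewrite nrm_ge0 andbT.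
apply/ler_addgt0Pr => e e0; rewrite add0r.
have na0 := nrm_ge0 a.
have na1 : 0 <= nrm a / e by rewrite divr_ge0 // ltW.
(* The first term keeps the contour at distance at least L / 2 from a, the second makes the final
   bound 32 |a| / L at most e. *)
pose L := 2 * r + 32 * (nrm a / e).
have L0 : 0 < L by rewrite /L; lra.
have L2 : 2 * r <= L by rewrite /L; lra.
have Le : 32 * nrm a <= e * L.
  have : e * (32 * (nrm a / e)) = 32 * nrm a by field; rewrite gt_eqF.
  by have := mulr_gt0 e0 r0; rewrite /L mulrDr => ? ->; lra.
clearbody L.
have dg (z b : C) : (re z = re b /\ im z = im b -> False) -> differentiable (fun z => 1 / (z - b)) z.
  move=> h; apply: differentiable_div; first exact: diffC_cst.
  by apply/eqP => e1; apply: h; rewrite e1.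
have -> : bd g (- r) r (- r) r = sq g L.
  symmetry; rewrite /sq; apply: bd_hole; try lra.
  move=> z _ hz; apply: diffC_sub; apply: dg => -[e1 e2]; apply: hz; rewrite e1 e2;
    split; by [|exact: re0_in r0|exact: im0_in r0].
have aL : - r <= re a <= r /\ - r <= im a <= r.
  by move: ra ia => /andP[? ?] /andP[? ?]; split; apply/andP; split; lra.
have LL : - L < re a < L /\ - L < im a < L.
  by move: ra ia => /andP[? ?] /andP[? ?]; split; apply/andP; split; lra.
have := @le_sq g L (2 * nrm a / L ^+ 2) L0 => hb.
apply: le_trans (hb _ _) _.
- move=> z hz; apply: contC_sub; first by exact: (ca L _ _ hz (proj1 LL) (proj2 LL)).
  exact: (ca L _ _ hz (re0_in L0) (im0_in L0)).
- move=> z hz.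
  have n1 : L / 2 <= nrm (z - a).
    have := sqf_dist hz (proj1 aL) (proj2 aL); apply: le_trans.
    by clear -L2; lra.
  have n2 := sqfP hz.
  have za : z - a != 0 by rewrite -nrm_gt0 (lt_le_trans _ n1) // divr_gt0.
  have z0 : z != 0 by rewrite -nrm_gt0 (lt_le_trans _ n2).
  have -> : g z = a / (z * (z - a)) by rewrite /g subr0; field; rewrite za z0.
  rewrite nrmM nrmV nrmM ler_pdivrMr; last by rewrite mulr_gt0 ?nrm_gt0.
  have : L * (L / 2) <= nrm z * nrm (z - a) by apply: ler_pM => //; rewrite ?divr_ge0 // ltW.
  have -> : 2 * nrm a / L ^+ 2 = nrm a / (L * (L / 2)) by field; rewrite gt_eqF.
  move=> h; rewrite mulrAC ler_pdivlMr; last by rewrite !mulr_gt0 // divr_gt0.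
  by rewrite ler_wpM2l.
- have -> : 16 * (2 * nrm a / L ^+ 2) * L = 32 * nrm a / L by field; rewrite gt_eqF.
  by rewrite ler_pdivrMr.
Qed.

Lemma cauchy_sq f r (a : C) : 0 < r ->
  (forall z, rect (- r) r (- r) r z -> differentiable f z) ->
  - r < re a < r -> - r < im a < r ->
  sq (fun z => f z / (z - a)) r = f a * ksq r.
Proof.
by move=> r0 df ra ia; rewrite /sq cauchy_rect // -(ksq_const r0 ra ia).
Qed.

Lemma sqf_nz r (z : C) : 0 < r -> sqf r z -> z != 0.
Proof. by move=> r0 /sqfP h; rewrite -nrm_gt0; lra. Qed.

(** Insert 1 / (z - a) - 1 / z - a / z^2 = a^2 / (z^2 (z - a)) into Cauchy's formula. This gives the
    estimate with [A], the normalized integral of f / z^2, in the place of the derivative. *)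
Lemma cauchy_remainder f r M (a : C) : 0 < r ->
  (forall z, rect (- r) r (- r) r z -> differentiable f z) ->
  (forall z, sqf r z -> nrm (f z) <= M) -> nrm a <= r / 2 ->
  nrm (f a - f 0 - 'd f 0 a) <= 8 * M / r ^+ 2 * nrm a ^+ 2.
Proof.
move=> r0 df fM ar; have rr : - r <= r by lra.
have fc : frame_continuous f (- r) r (- r) r by exact: differentiable_frame.
have zinv (z : C) n : z != 0 -> {for z, continuous (fun w : C => (w ^+ n)^-1)}.
  move=> z0; apply: (@continuousV C C (fun w => w ^+ n)); first by rewrite expf_neq0.
  elim: n => [|n ih]; first exact: contC_cst.
  rewrite (_ : (GRing.exp (R:=C))^~ n.+1 = fun w : C => w * w ^+ n); last first.
    by apply/funext => w; rewrite exprS.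
  exact: (@contC_mul R id (fun w => w ^+ n) z (@cvg_id C (nbhs z)) ih).
set K := ksq r; have K0 : K != 0 by exact: ksq_neq0.
set A := sq (fun z => f z / z ^+ 2) r / K.
have key (b : C) : nrm b <= r / 2 -> nrm (f b - f 0 - b * A) <= 8 * M / r ^+ 2 * nrm b ^+ 2.
  move=> br; have := re_nrm b; have := im_nrm b => /andP[b1 b2] /andP[b3 b4].
  have inb : - r < re b < r by clear -br b3 b4 r0; apply/andP; split; lra.
  have inb' : - r < im b < r by clear -br b1 b2 r0; apply/andP; split; lra.
  have c1 : frame_continuous (fun z => f z / (z - b)) (- r) r (- r) r.
    by move=> z hz; apply: continuous_div (sqf_neq hz inb inb'); exact: fc.
  have c2 : frame_continuous (fun z => f z / (z - 0)) (- r) r (- r) r.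
    by move=> z hz; apply: continuous_div (sqf_neq hz (re0_in r0) (im0_in r0)); exact: fc.
  have c3 : frame_continuous (fun z => f z / z ^+ 2) (- r) r (- r) r.
    by move=> z hz; apply: contC_mul; [exact: fc|exact: zinv (sqf_nz r0 hz)].
  have c3b : frame_continuous (fun z => b * (f z / z ^+ 2)) (- r) r (- r) r.
    by move=> z hz; apply: contC_mul; [exact: contC_cst|exact: c3].
  have c12 : frame_continuous (fun z => f z / (z - b) - f z / (z - 0)) (- r) r (- r) r.
    by move=> z hz; apply: contC_sub; [exact: c1|exact: c2].
  have E : (f b - f 0 - b * A) * K =
      sq (fun z => f z / (z - b) - f z / (z - 0) - b * (f z / z ^+ 2)) r.
    rewrite /sq (bdB rr rr c12 c3b) (bdB rr rr c1 c2) (bdZ rr rr b c3).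
    rewrite -!/(sq _ r) !cauchy_sq ?re0_in ?im0_in // /A -/K mulrBl mulrBl.
    by congr (_ - _); rewrite -mulrA divfK.
  have -> : f b - f 0 - b * A = ((f b - f 0 - b * A) * K) / K by rewrite mulfK.
  rewrite E nrmM nrmV ler_pdivrMr ?nrm_gt0 //.
  have c4 : frame_continuous (fun z => f z / (z - b) - f z / (z - 0) - b * (f z / z ^+ 2)) (- r) r (- r) r.
    by move=> z hz; apply: contC_sub; [exact: c12|exact: c3b].
  have := le_sq (M := 2 * M / r ^+ 3 * nrm b ^+ 2) r0 c4.
  move/(_ _)/le_trans; apply; last first.
    have := ksq_ge r0; rewrite -/K => K4.
    have -> : 16 * (2 * M / r ^+ 3 * nrm b ^+ 2) * r = (8 * M / r ^+ 2 * nrm b ^+ 2) * 4.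
      by field; rewrite gt_eqF.
    rewrite ler_wpM2l // mulr_ge0 ?sqr_ge0 // divr_ge0 ?sqr_ge0 // mulr_ge0 //.
    by apply: le_trans (nrm_ge0 _) (fM _ (sqf_r r0)).
  move=> z hz.
  have n1 : r / 2 <= nrm (z - b).
    have h : r - r / 2 <= nrm (z - b) by apply: (sqf_dist hz); clear -br b1 b2 b3 b4; apply/andP; split; lra.
    by apply: le_trans h; clear; lra.
  have n2 := sqfP hz; have z0 := sqf_nz r0 hz.
  have zb : z - b != 0 by rewrite -nrm_gt0 (lt_le_trans _ n1) // divr_gt0.
  have -> : f z / (z - b) - f z / (z - 0) - b * (f z / z ^+ 2) =
      f z * (b ^+ 2 / (z ^+ 2 * (z - b))) by rewrite subr0; field; rewrite zb z0.
  rewrite nrmM nrmM nrmV nrmM !nrmX mulrCA.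
  have -> : 2 * M / r ^+ 3 * nrm b ^+ 2 = nrm b ^+ 2 * (M / (r ^+ 2 * (r / 2))).
    by field; rewrite gt_eqF.
  rewrite ler_wpM2l ?sqr_ge0 //; apply: ler_pM => //; rewrite ?nrm_ge0 ?fM //.
    by rewrite invr_ge0 mulr_ge0 ?nrm_ge0 // sqr_ge0.
  have rp : 0 < r ^+ 2 * (r / 2) by rewrite mulr_gt0 ?exprn_gt0 // divr_gt0.
  rewrite lef_pV2 ?posrE //; last by rewrite mulr_gt0 ?exprn_gt0 ?nrm_gt0.
  by apply: ler_pM; rewrite ?sqr_ge0 ?divr_ge0 ?lerXn2r ?nnegrE ?nrm_ge0 // ltW.
have d0 : differentiable f 0.
  have /andP[? ?] := re0_in r0; have /andP[? ?] := im0_in r0.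
  by apply: df; split; apply/andP; split; exact: ltW.
(* [A] is the derivative at 0: along small real t both f t - f 0 - t A and f t - f 0 - t f'(0) are
   o(t). *)
suff -> : 'd f 0 a = a * A by exact: key.
rewrite diff_scalar // mulrC; congr (_ * _).
apply/eqP; rewrite -subr_eq0 -nrm_eq0; apply/eqP/le_anti; rewrite nrm_ge0 andbT.
apply/ler_addgt0Pr => e e0; rewrite add0r.
have e2 : 0 < e / 2 by rewrite divr_gt0.
have [d dp dP] := differentiable_near_nv d0 e2.
set Q := 8 * M / r ^+ 2 in key.
pose t := Num.min (Num.min (d / 2) (r / 2)) (e / 2 / (`|Q| + 1)).
have Q1 : 0 < `|Q| + 1 by rewrite ltr_wpDl.
have [t0 t1 t2 t3] : [/\ 0 < t, t <= d / 2, t <= r / 2 & t <= e / 2 / (`|Q| + 1)].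
  rewrite /t; split; last by rewrite ge_min lexx orbT.
  - by rewrite !lt_min !divr_gt0.
  - by rewrite !ge_min lexx.
  - by rewrite !ge_min lexx orbT.
clearbody t.
have nt : nrm (mkC t 0) = t by rewrite nrm_mkC gtr0_norm.
have := dP (mkC t 0); rewrite subr0 -/(nrm _) -[nv _]/(nrm (mkC t 0)) nt (@diff_scalar _ f 0 (mkC t 0)) // => h1.
have {}h1 := h1 (_ : t < d).
have h2 := key (mkC t 0); rewrite nt in h2.
have : t * nrm ('d f 0 1 - A) <= t * e.
  have -> : t * nrm ('d f 0 1 - A) =
     nrm ((f (mkC t 0) - f 0 - mkC t 0 * A) - (f (mkC t 0) - f 0 - 'd f 0 1 * mkC t 0)).
    by rewrite -{1}nt -nrmM; congr nrm; ring.
  apply: le_trans (nrmB _ _) _.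
  have td : t < d by clear -t1 dp; lra.
  have g1 := h1 td; have g2 := h2 t2.
  apply: le_trans (lerD g2 g1) _.
  have : Q * t <= e / 2.
    have tQ : t * (`|Q| + 1) <= e / 2 by rewrite -ler_pdivlMr.
    by have := ler_norm Q; clear -tQ t0; move: `|Q| tQ => q; nra.
  by clear -t0; rewrite expr2; nra.
by rewrite ler_pM2l.
Qed.

End CauchySquare.

(** * Cauchy estimates in normed modules and integrals with parameters *)

Section HolRemainder.
Variable R : realType.
Local Notation C := (CC R).

Lemma nrm0 : nrm (0 : C) = 0. Proof. exact: (@nv0 R C). Qed.

Lemma continuous_nvP (V W : normedModType C) (f : V -> W) (z : V) :
  {for z, continuous f} <->
  forall e : R, 0 < e -> exists2 d : R, 0 < d &
    forall w, nv (w - z) < d -> nv (f w - f z) < e.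
Proof.
split=> [cf e e0|h]; last first.
  apply/(@cvgrPdist_lt _ _ _ (nbhs z)) => e e0.
  have [d d0 dP] := h _ (re_gt0 e0).
  apply/near_nvP; exists d => // w /dP; rewrite nv_sub => h1.
  by rewrite (realCE (ltW e0)) nvE ltC.
apply/(near_nvP z (fun w => nv (f w - f z) < e)).
exact: (cf _ (near_nv (f z) e0)).
Qed.

Section OneFunction.
Variable V : normedModType C.
Variables (H : V -> C) (x : V) (rho M : R).
Hypothesis rho0 : 0 < rho.
Hypothesis dH : forall y, nv (y - x) < rho -> differentiable H y.
Hypothesis HM : forall y, nv (y - x) < rho -> nrm (H y) <= M.

Lemma is_diff_line (v : V) (s : C) :
  is_diff s (fun s : C => x + s *: v) (fun s : C => s *: v).
Proof.
have h := is_diffD (is_diff_cst x s) (is_diff_scalel s v).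
by apply: is_diff_eq h _; apply/funext => t /=; rewrite /GRing.add /= add0r.
Qed.

Lemma hol_bound_ge0 : 0 <= M.
Proof.
by apply: le_trans (nrm_ge0 _) (HM (y := x) _); rewrite subrr nv0.
Qed.

(** Restrict H to the complex line s -> x + s v and apply [cauchy_remainder] at s = 1. The square
    has half-side r = rho / (4 |v|), which keeps its points within rho / 2 of x. *)
Lemma hol_remainder (v : V) : nv v <= rho / 8 ->
  nrm (H (x + v) - H x - 'd H x v) <= 128 * M / rho ^+ 2 * nv v ^+ 2.
Proof.
have dHx : differentiable H x by apply: dH; rewrite subrr nv0.
have [->|v0] := eqVneq v 0.
  by rewrite addr0 subrr linear0 subr0 nrm0 nv0 expr0n /= mulr0.
have v1 : 0 < nv v by rewrite nv_gt0.
move=> hv; pose f (s : C) := H (x + s *: v).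
pose r := rho / (4 * nv v).
have r0 : 0 < r by rewrite divr_gt0 // mulr_gt0.
have rv : r * nv v = rho / 4 by rewrite /r; field; rewrite gt_eqF.
have near s : nrm s <= 2 * r -> nv (x + s *: v - x) < rho.
  move=> hs; rewrite addrC addKr nvZ.
  have : nrm s * nv v <= 2 * r * nv v by rewrite ler_pM2r.
  by rewrite -mulrA rv => /le_lt_trans; apply; move: rho0; lra.
have ns z : rect (- r) r (- r) r z -> nrm z <= 2 * r.
  move=> [h1 h2]; apply: le_trans (ler_nrm _) _.
  by rewrite mulr2n mulrDl mul1r lerD // ler_norml.
have df s : nrm s <= 2 * r -> is_diff s f ('d H (x + s *: v) \o (fun s : C => s *: v)).
  move=> hs; have lin := is_diff_line v s.
  have dd : is_diff (x + s *: v) H ('d H (x + s *: v)).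
    by apply: DiffDef => //; apply: dH; exact: near.
  exact: (is_diff_comp (f := fun s : C => x + s *: v)).
have d0 : 'd f 0 = 'd H x \o (fun s : C => s *: v) :> (C -> C).
  have [|_ ->] := df 0; first by rewrite nrm0 mulr_ge0 // ltW.
  by rewrite scale0r addr0.
have := @cauchy_remainder R f r M 1 r0.
rewrite d0 /= nrm1 /f scale0r addr0 !scale1r expr1n mulr1 => hc.
have -> : 128 * M / rho ^+ 2 * nv v ^+ 2 = 8 * M / r ^+ 2.
  by rewrite /r; field; rewrite !gt_eqF.
apply: hc.
- by move=> z /ns /df[].
- by move=> z [/ns hz _]; apply: HM; exact: near.
- by rewrite ler_pdivlMr // mul1r /r ler_pdivlMr ?mulr_gt0 //; move: hv; lra.
Qed.

(** At the multiple of v of norm rho / 8 the differential is a difference of two values of H up to a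
    remainder of size 2 M. *)
Lemma hol_diff_bound (v : V) : nrm ('d H x v) <= 32 * M / rho * nv v.
Proof.
have dHx : differentiable H x by apply: dH; rewrite subrr nv0.
have M0 := hol_bound_ge0.
have [->|v0] := eqVneq v 0; first by rewrite linear0 nrm0 nv0 mulr0.
have v1 : 0 < nv v by rewrite nv_gt0.
pose t := rho / (8 * nv v); have t0 : 0 < t by rewrite divr_gt0 // mulr_gt0.
have tv : nv (mkC t 0 *: v) = rho / 8.
  by rewrite nvZ nrm_mkC gtr0_norm // /t; field; rewrite gt_eqF.
have := hol_remainder (v := mkC t 0 *: v); rewrite tv lexx => /(_ isT).
have -> : 128 * M / rho ^+ 2 * (rho / 8) ^+ 2 = 2 * M by field; rewrite gt_eqF.
rewrite linearZ /= => h.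
have h1 : nrm (H x) <= M by apply: HM; rewrite subrr nv0.
have h2 : nrm (H (x + mkC t 0 *: v)) <= M.
  by apply: HM; rewrite addrC addKr tv; move: rho0; lra.
have h3 : t * nrm ('d H x v) <= 4 * M.
  have -> : t * nrm ('d H x v) = nrm (mkC t 0 * 'd H x v).
    by rewrite nrmM nrm_mkC gtr0_norm.
  have -> : mkC t 0 * 'd H x v = H (x + mkC t 0 *: v) - H x -
      (H (x + mkC t 0 *: v) - H x - mkC t 0 * 'd H x v) by rewrite opprB addrCA subrr addr0.
  apply: le_trans (nrmB _ _) _.
  have h4 := le_trans (nrmB (H (x + mkC t 0 *: v)) (H x)) (lerD h2 h1).
  by apply: le_trans (lerD h4 h) _; rewrite [4 * M](_ : _ = M + M + 2 * M) //; ring.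
rewrite -(ler_pM2l t0); apply: le_trans h3 _.
by rewrite le_eqVlt; apply/orP; left; apply/eqP; rewrite /t; field; rewrite !gt_eqF.
Qed.

End OneFunction.

Section ParameterIntegral.
Variable V : normedModType C.
Variables (K : C -> V -> C) (A : set C) (x : V) (r rho M : R).
Hypotheses (r0 : 0 < r) (rho0 : 0 < rho).
Hypothesis oA : open A.
Hypothesis sA : forall z, sqf r z -> A z.
Hypothesis dK : forall z y, A z -> nv (y - x) < rho -> differentiable (K z) y.
Hypothesis KM : forall z y, A z -> nv (y - x) < rho -> nrm (K z y) <= M.
Hypothesis cK : forall z y, A z -> nv (y - x) < rho -> {for z, continuous (K^~ y)}.

Let rr : - r <= r. Proof. by move: r0; lra. Qed.

Section AtPoint.
Variable y : V.
Hypothesis hy : nv (y - x) < rho / 2.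
Let s := rho / 2.
Let s0 : 0 < s. Proof. by rewrite divr_gt0. Qed.
Let near z : nv (z - y) < s -> nv (z - x) < rho.
Proof.
move=> h; have -> : z - x = (z - y) + (y - x) by rewrite addrA subrK.
apply: le_lt_trans (nvD _ _) _; rewrite [ltRHS](_ : _ = s + s); last by rewrite -splitr.
by rewrite ltrD.
Qed.
Let dKy z : A z -> forall w, nv (w - y) < s -> differentiable (K z) w.
Proof. by move=> Az w /near; exact: dK. Qed.
Let KMy z : A z -> forall w, nv (w - y) < s -> nrm (K z w) <= M.
Proof. by move=> Az w /near; exact: KM. Qed.
Let Q := 128 * M / s ^+ 2.
Let rem z v : A z -> nv v <= s / 8 ->
  nrm (K z (y + v) - K z y - 'd (K z) y v) <= Q * nv v ^+ 2.
Proof. by move=> Az; exact: hol_remainder s0 (dKy Az) (KMy Az) v. Qed.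
Let yy : nv (y - y) < s. Proof. by rewrite subrr nv0. Qed.

(** The derivative along v is a limit, uniform in z, of the difference quotients of [K z], and these
    are continuous in z. *)
Let cdK v z : A z -> {for z, continuous (fun z => 'd (K z) y v)}.
Proof.
move=> Az; have M0 : 0 <= M := hol_bound_ge0 s0 (KMy Az).
have Q0 : 0 <= Q by rewrite divr_ge0 ?sqr_ge0 // mulr_ge0.
apply/continuous_nvP => e e0.
pose B := nv v; have B0 : 0 <= B := nv_ge0 v.
(* The first bound allows [rem] to be applied to t v, the second makes its error Q (t |v|)^2 at most
   t e / 4. *)
pose t := Num.min (s / 8 / (B + 1)) (e / 4 / (Q * B ^+ 2 + 1)).
have B1 : 0 < B + 1 by rewrite ltr_wpDl.
have QB : 0 <= Q * B ^+ 2 by rewrite mulr_ge0 ?sqr_ge0.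
have QB1 : 0 < Q * B ^+ 2 + 1 by rewrite ltr_wpDl.
have [t0 t1 t2] : [/\ 0 < t, t * (B + 1) <= s / 8 & t * (Q * B ^+ 2 + 1) <= e / 4].
  rewrite /t; split; first by rewrite lt_min !divr_gt0.
    by rewrite -ler_pdivlMr // ge_min lexx.
  by rewrite -ler_pdivlMr // ge_min lexx orbT.
clearbody t.
have tB : t * B <= s / 8 by apply: le_trans t1; rewrite ler_pM2l // lerDl.
have tQ : t * (Q * B ^+ 2) <= e / 4 by apply: le_trans t2; rewrite ler_pM2l // lerDl.
have nt : nrm (mkC t 0) = t by rewrite nrm_mkC gtr0_norm.
have ntv : nv (mkC t 0 *: v) = t * B by rewrite nvZ nt.
have hyt : nv (y + mkC t 0 *: v - x) < rho.
  by apply: near; rewrite addrC addKr ntv; apply: le_lt_trans tB _; move: s0; lra.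
have hyx : nv (y - x) < rho by exact: near yy.
have e8 : 0 < t * (e / 8) by rewrite mulr_gt0 // divr_gt0.
have /continuous_nvP/(_ _ e8)[d1 d10 D1] := cK Az hyt.
have /continuous_nvP/(_ _ e8)[d2 d20 D2] := cK Az hyx.
have /near_nvP[d3 d30 D3] : \forall w \near z, A w by apply: open_nbhs_nbhs; split.
exists (Num.min (Num.min d1 d2) d3); first by rewrite !lt_min d10 d20.
move=> w; rewrite !lt_min => /andP[/andP[/D1 h1 /D2 h2] /D3 Aw].
pose D u := 'd (K u) y v; pose N u := K u (y + mkC t 0 *: v) - K u y.
have apx u : A u -> nrm (N u - mkC t 0 * D u) <= t * (e / 4).
  move=> Au; have := rem Au (v := mkC t 0 *: v); rewrite ntv => /(_ tB).
  rewrite linearZ /= => /le_trans; apply.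
  have -> : Q * (t * B) ^+ 2 = t * (t * (Q * B ^+ 2)) by ring.
  by rewrite ler_pM2l.
have hN : nrm (N w - N z) < t * (e / 8) + t * (e / 8).
  have -> : N w - N z = (K w (y + mkC t 0 *: v) - K z (y + mkC t 0 *: v)) -
      (K w y - K z y).
    by rewrite /N; move: (K w _) (K z _) (K w y) (K z y) => a b c d; ring.
  by apply: le_lt_trans (nrmB _ _) _; apply: ltrD.
have : t * nrm (D w - D z) < t * e.
  have -> : t * nrm (D w - D z) =
      nrm ((N w - N z) - ((N w - mkC t 0 * D w) - (N z - mkC t 0 * D z))).
    rewrite -{1}nt -nrmM; congr nrm.
    by move: (N w) (N z) (D w) (D z) (mkC t 0) => a b c d f; ring.
  apply: le_lt_trans (nrmB _ _) _.
  have h3 := le_trans (nrmB (N w - mkC t 0 * D w) (N z - mkC t 0 * D z))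
    (lerD (apx _ Aw) (apx _ Az)).
  apply: lt_le_trans (ltr_leD hN h3) _.
  have -> : t * (e / 8) + t * (e / 8) + (t * (e / 4) + t * (e / 4)) = t * (e * (3 / 4)) by field.
  by rewrite ler_pM2l // ler_piMr ?ltW // ltr_pdivrMr // mul1r ltr_nat.
by rewrite ltr_pM2l.
Qed.

Let fK w : nv (w - y) < s -> frame_continuous (K^~ w) (- r) r (- r) r.
Proof. by move=> hw z hz; apply: cK; [exact: sA|exact: near]. Qed.

Let fdK v : frame_continuous (fun z => 'd (K z) y v) (- r) r (- r) r.
Proof. by move=> z hz; apply: cdK; exact: sA. Qed.

Let L (v : V) : C := sq (fun z => 'd (K z) y v) r.

Let L_linear : linear L.
Proof.
move=> a u v; rewrite /L /sq.
have fa : frame_continuous (fun z => a * 'd (K z) y u) (- r) r (- r) r.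
  by move=> z hz; apply: contC_mul; [exact: contC_cst|exact: fdK].
change (bd (fun z => 'd (K z) y (a *: u + v)) (- r) r (- r) r =
  a * bd (fun z => 'd (K z) y u) (- r) r (- r) r + bd (fun z => 'd (K z) y v) (- r) r (- r) r).
rewrite -(bdZ rr rr a (@fdK u)) -(bdD rr rr fa (@fdK v)).
have -> // : (fun z => 'd (K z) y (a *: u + v)) = (fun z => a * 'd (K z) y u + 'd (K z) y v).
by apply/funext => z; rewrite linearD linearZ.
Qed.

HB.instance Definition _ := GRing.isLinear.Build C V C *:%R L L_linear.

(** Differentiation under the integral sign: the quadratic remainder of [hol_remainder] is uniform
    in z on the contour and can be integrated. *)
Lemma integral_differentiable_at :
  differentiable (fun w => sq (K^~ w) r) y.
Proof.
have As : A (mkC r 0) by apply/sA/sqf_r.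
have M0 : 0 <= M := hol_bound_ge0 s0 (KMy As).
have Q0 : 0 <= Q by rewrite divr_ge0 ?sqr_ge0 // mulr_ge0.
have B0 : 0 <= 16 * (32 * M / s) * r by rewrite !mulr_ge0 ?invr_ge0 // ltW.
have [|v|e e0|//] := @bounded_linear_differentiable C V C
  (fun w => sq (K^~ w) r) y L (mkC (16 * (32 * M / s) * r) 0).
- by rewrite -mkC0 leC.
- rewrite [X in _ <= _ * X]nvE mkCM [X in X <= _]nvE leC.
  have -> : 16 * (32 * M / s) * r * nv v = 16 * (32 * M / s * nv v) * r by ring.
  change (nrm (sq (fun z => 'd (K z) y v) r) <= 16 * (32 * M / s * nv v) * r).
  apply: le_sq => // z hz; exact: hol_diff_bound s0 (dKy (sA hz)) (KMy (sA hz)) v.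
- have q0 : 0 <= 16 * Q * r by apply: mulr_ge0 (ltW r0); exact: mulr_ge0.
  have q1 : 0 < 16 * Q * r + 1 by rewrite ltr_wpDl.
  apply/near_nvP.
  exists (Num.min (s / 8) (re e / (16 * Q * r + 1))).
    by rewrite lt_min !divr_gt0 ?re_gt0.
  move=> w; rewrite lt_min => /andP[h1 h2].
  rewrite [X in _ <= _ * X]nvE (realCE (ltW e0)) mkCM [X in X <= _]nvE leC.
  have hw : nv (w - y) < s by apply: lt_trans h1 _; move: s0; lra.
  have fb : frame_continuous (fun z => K z w - K z y) (- r) r (- r) r.
    by move=> z hz; apply: contC_sub; [exact: fK|exact: fK].
  rewrite /L /sq -(bdB rr rr (fK hw) (fK yy)) -(bdB rr rr fb (@fdK _)).
  apply: (@le_trans _ _ (16 * (Q * nv (w - y) ^+ 2) * r)).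
    change (nrm (sq (fun z => K z w - K z y - 'd (K z) y (w - y)) r) <= 16 * (Q * nv (w - y) ^+ 2) * r).
    apply: le_sq; [exact: r0| |move=> z hz].
      by move=> z hz; apply: contC_sub; [exact: fb|exact: fdK].
     have := rem (sA hz) (ltW h1).
    by rewrite (addrC y) subrK.
  have -> : 16 * (Q * nv (w - y) ^+ 2) * r = (16 * Q * r * nv (w - y)) * nv (w - y) by ring.
  rewrite ler_wpM2r ?nv_ge0 //.
  move: h2; rewrite ltr_pdivlMr // => h2; apply: le_trans (ltW h2).
  by rewrite mulrC ler_wpM2l ?nv_ge0 // lerDl.
Qed.

End AtPoint.

Lemma integral_holomorphic : \forall y \near x, differentiable (fun w => sq (K^~ w) r) y.
Proof.
apply: filterS (near_nv x (_ : 0 < rho / 2)); last by rewrite divr_gt0.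
by move=> y; exact: integral_differentiable_at.
Qed.

End ParameterIntegral.
End HolRemainder.

(** * Division and coordinates *)

Section Holomorphic.
Variable R : realType.
Local Notation C := (CC R).

Definition holo (V W : normedModType C) (f : V -> W) (p : V) :=
  \forall y \near p, differentiable f y.

Section Division.
Variable V : normedModType C.
Variables (p e : V) (lam : V -> C).
Hypothesis lam_shift : forall y (t : C), lam (y + t *: e) = lam y + t.
Hypothesis lam_p : lam p = 0.
Hypothesis lam_holo : holo lam p.

(** By [lam_shift], [lam] is an affine coordinate on each line y + C e; this is the point of that
    line where it takes the value z. *)
Definition on_line (z : C) (y : V) : V := y + (z - lam y) *: e.

Lemma on_line_lam y : on_line (lam y) y = y.
Proof. by rewrite /on_line subrr scale0r addr0. Qed.

Lemma lam_on_line z y : lam (on_line z y) = z.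
Proof. by rewrite lam_shift addrC subrK. Qed.

Lemma on_line_shift z y (t : C) : on_line z (y + t *: e) = on_line z y.
Proof.
by rewrite /on_line lam_shift opprD addrA scalerDl scaleNr addrACA subrr addr0.
Qed.

Lemma differentiable_on_line_arg z y : differentiable (on_line^~ y) z.
Proof.
rewrite (_ : on_line^~ y = fun z : C => (y - lam y *: e) + z *: e); last first.
  by apply/funext => t; rewrite /on_line scalerBl [_ - _ *: e]addrC addrA.
by have [] := is_diff_line (y - lam y *: e) e z.
Qed.

Lemma differentiable_on_line z y : differentiable lam y -> differentiable (on_line z) y.
Proof.
move=> dl; apply: (@differentiableD C V V id (fun y => (z - lam y) *: e)).
  by [].
apply: (@differentiableZl C V V (fun y => z - lam y) e).
by apply: (@differentiableB C V C (fun=> z) lam).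
Qed.

(** The radii for Cauchy integrals along the lines y + C e: the square of half-side r has its points
    of modulus less than 3 r, and |lam y| < r / 4 keeps the pole [lam y] well inside it. *)
Lemma division_radius (h : V -> C) : holo h p ->
  exists M, exists2 r : R, 0 < r & exists2 rho : R, 0 < rho &
  forall y, nv (y - p) < rho -> [/\ nrm (lam y) < r / 4, differentiable lam y &
    forall z, nrm z < 3 * r -> differentiable h (on_line z y) /\ nrm (h (on_line z y)) <= M].
Proof.
move=> hh; pose M := nrm (h p) + 1; pose N := nv e.
have N0 : 0 <= N := nv_ge0 e.
have hp : differentiable h p by exact: nbhs_singleton hh.
have /near_nvP[d d0 dP] : \forall y \near p, differentiable h y /\ nrm (h y) <= M.
  apply: filterI hh _.
  have /continuous_nvP/(_ 1 ltr01)[d d0 D] := differentiable_continuous hp.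
  apply/near_nvP; exists d => // w /D; rewrite -[nv _]/(nrm (h w - h p)) => h1.
  have -> : h w = h p + (h w - h p) by rewrite addrC subrK.
  by apply: le_trans (nrmD _ _) _; rewrite lerD2l ltW.
pose r := d / (8 * (N + 1)).
have N1 : 0 < N + 1 by rewrite ltr_wpDl.
have r0 : 0 < r by rewrite divr_gt0 // mulr_gt0.
have rN : r * (N + 1) = d / 8 by rewrite /r; field; rewrite gt_eqF.
have r4 : 0 < r / 4 by rewrite divr_gt0.
have lp : differentiable lam p by exact: nbhs_singleton lam_holo.
exists M, r => //.
have /continuous_nvP/(_ _ r4)[d1 d10 D1] := differentiable_continuous lp.
have /near_nvP[d2 d20 D2] := lam_holo.
exists (Num.min (Num.min d1 d2) (d / 2)); first by rewrite !lt_min d10 d20 divr_gt0.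
move=> y; rewrite !lt_min => /andP[/andP[/D1 h1 /D2 h2] h3].
rewrite lam_p subr0 -[nv _]/(nrm (lam y)) in h1; split=> // z hz; apply: dP.
rewrite /on_line addrAC; apply: le_lt_trans (nvD _ _) _; rewrite nvZ.
have h4 : nrm (z - lam y) <= 3 * r + r / 4.
  by apply: le_trans (nrmB _ _) _; rewrite lerD // ltW.
have h5 : nrm (z - lam y) * N <= (3 * r + r / 4) * (N + 1).
  by apply: ler_pM => //; rewrite ?nrm_ge0 // lerDl.
have -> : d = d / 2 + d / 2 by exact: splitr.
apply: ltr_leD h3 (le_trans h5 _).
have -> : (3 * r + r / 4) * (N + 1) = 13 / 4 * (r * (N + 1)) by field.
by rewrite rN; move: d0; lra.
Qed.

(** The quotient of both divisions, up to the factor [ksq r]; D is z for a coordinate and z^2 - s y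
    for a quadric. On the ring r / 2 < |z| < 3 r one has |z - lam y| >= r / 4, so the integrand is
    bounded and [integral_holomorphic] applies. *)
Lemma division_holo (h : V -> C) (D : C -> V -> C) (M r rho c1 : R) :
  0 < r -> 0 < rho -> 0 < c1 ->
  (forall y, nv (y - p) < rho -> [/\ nrm (lam y) < r / 4, differentiable lam y &
    forall z, nrm z < 3 * r -> differentiable h (on_line z y) /\ nrm (h (on_line z y)) <= M]) ->
  (forall z y, r / 2 < nrm z -> nv (y - p) < rho ->
    [/\ differentiable (D z) y, c1 <= nrm (D z y) & differentiable (D^~ y) z]) ->
  holo (fun y => sq (fun z => h (on_line z y) / (D z y * (z - lam y))) r) p.
Proof.
move=> r0 rho0 c10 hh hD.
pose A : set C := [set z | r / 2 < nrm z < 3 * r].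
have h4 z y : A z -> nv (y - p) < rho -> r / 4 <= nrm (z - lam y).
  move=> /andP[z1 _] /hh[l1 _ _].
  have : nrm z <= nrm (z - lam y) + nrm (lam y).
    by rewrite -{1}(subrK (lam y) z) nrmD.
  move: (nrm _) (nrm _) (nrm _) z1 l1 => a b c; lra.
have nz z y : A z -> nv (y - p) < rho -> D z y * (z - lam y) != 0.
  move=> Az hy; have [z1 _] := andP Az; have [_ c2 _] := hD _ _ z1 hy.
  rewrite -nrm_gt0 nrmM; apply: mulr_gt0; first exact: lt_le_trans c10 c2.
  by apply: lt_le_trans (h4 _ _ Az hy); exact: divr_gt0.
apply: (@integral_holomorphic R V (fun z y => h (on_line z y) / (D z y * (z - lam y))) A
  p r rho (M / (c1 * (r / 4)))) => //.
- rewrite openE => z /andP[z1 z2]; apply/(near_nvP z A).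
  exists (Num.min (nrm z - r / 2) (3 * r - nrm z)); first by rewrite lt_min !subr_gt0 z1.
  move=> w; rewrite lt_min -[nv _]/(nrm (w - z)) => /andP[w1 w2].
  have h1 : nrm w <= nrm (w - z) + nrm z by rewrite -{1}(subrK z w) nrmD.
  have h2 : nrm z <= nrm (w - z) + nrm w.
    by rewrite -[nrm (w - z)](@nvN R C) opprB -{1}(subrK w z) nrmD.
  rewrite /A /=; move: (nrm (w - z)) (nrm z) (nrm w) h1 h2 w1 w2 => u v t h1 h2 w1 w2.
  by apply/andP; split; lra.
- move=> z hz; rewrite /A /=; have z1 := sqfP hz; case: hz => -[h1 h2] _.
  have := ler_nrm z; rewrite -!ler_norml in h1 h2.
  move: (nrm z) `|re z| `|im z| z1 h1 h2 => a b c => ? ? ? ?.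
  by apply/andP; split; lra.
- move=> z y Az hy; have [z1 z2] := andP Az; have [_ dl /(_ z z2)[dh _]] := hh _ hy.
  have [d1 _ _] := hD _ _ z1 hy.
  apply: differentiableM; first exact: differentiable_comp (differentiable_on_line _ dl) dh.
  apply: differentiableV; last exact: nz.
  apply: differentiableM => //; exact: differentiableB.
- move=> z y Az hy; have [z1 z2] := andP Az; have [_ dl /(_ z z2)[_ hM]] := hh _ hy.
  have [_ c2 _] := hD _ _ z1 hy; have c4 := h4 _ _ Az hy.
  have p0 : 0 < c1 * (r / 4) by rewrite mulr_gt0 // divr_gt0.
  rewrite nrmM nrmV; apply: ler_pM; rewrite ?invr_ge0 ?nrm_ge0 //.
  rewrite lef_pV2 ?posrE ?nrm_gt0 ?nz // nrmM.
  by apply: ler_pM => //; rewrite ltW // divr_gt0.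
- move=> z y Az hy; have [z1 z2] := andP Az; have [_ dl /(_ z z2)[dh _]] := hh _ hy.
  have [_ _ d1] := hD _ _ z1 hy.
  apply: diffC_cont; apply: diffC_mul.
    exact: differentiable_comp (differentiable_on_line_arg z y) dh.
  apply: (@differentiableV C C (fun z => D z y * (z - lam y))); last exact: nz.
  by apply: diffC_mul => //; apply: (@diffC_sub R id (fun=> lam y)).
Qed.

Lemma rect_nrm (r : R) (z : C) : 0 < r -> rect (- r) r (- r) r z -> nrm z < 3 * r.
Proof.
move=> r0 [h1 h2]; apply: le_lt_trans (ler_nrm z) _.
rewrite -!ler_norml in h1 h2; move: `|re z| `|im z| h1 h2 => a b.
by move: r0; lra.
Qed.

Lemma nrm_lt_in (r : R) (z : C) : nrm z < r -> - r < re z < r /\ - r < im z < r.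
Proof.
move=> zr; rewrite -!ltr_norml.
by split; apply: le_lt_trans zr; [exact: ler_re|exact: ler_im].
Qed.

Lemma continuous_on_line0 : {for p, continuous (on_line 0)}.
Proof.
apply: differentiable_continuous; apply: differentiable_on_line.
exact: nbhs_singleton lam_holo.
Qed.

Lemma on_line0p : on_line 0 p = p.
Proof. by rewrite /on_line lam_p subrr scale0r addr0. Qed.

(** With 1 / (z - lam) - 1 / z = lam / (z (z - lam)), Cauchy's formula on the line through y yields
    h y - h (on_line 0 y) as a multiple of lam y, and the second value vanishes by hypothesis. *)
Lemma divisible_by_coordinate (h : V -> C) : holo h p ->
  (\forall y \near p, lam y = 0 -> h y = 0) ->
  exists2 g : V -> C, holo g p & \forall y \near p, h y = lam y * g y.
Proof.
move=> hh van; have [M [r r0 [rho rho0 hr]]] := division_radius hh.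
have r2 : 0 < r / 2 by rewrite divr_gt0.
have := @division_holo h (fun z _ => z) M r rho (r / 2) r0 rho0 r2 hr.
set G := (fun y : V => sq _ r) => /(_ _)/wrap[].
  move=> z y zr _; split; [exact: differentiable_cst|exact: ltW|by []].
move=> hG; exists (fun y => G y / ksq r).
  apply: filterS hG => y dG; apply: (@differentiableM C V G (fun=> (ksq r)^-1)) => //.
have K0 : ksq r != 0 by exact: ksq_neq0.
have van0 : \forall y \near p, h (on_line 0 y) = 0.
  have : \forall y \near on_line 0 p, lam y = 0 -> h y = 0 by rewrite on_line0p.
  move=> h1; have := continuous_on_line0 h1; apply: (@filterS _ (nbhs p)) => y h2.
  by apply: h2; exact: lam_on_line.
have := near_nv p rho0; move: van0; apply: filterS2 => y van0 hy.
have [l4 dl hz] := hr _ hy.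
have ly : nrm (lam y) < r by apply: lt_trans l4 _; move: r0; lra.
have [in1 in2] := nrm_lt_in ly.
set f := fun z => h (on_line z y).
have df z : rect (- r) r (- r) r z -> differentiable f z.
  move=> /(rect_nrm r0)/hz[dh _].
  exact: differentiable_comp (differentiable_on_line_arg z y) dh.
have ff := differentiable_frame df.
have rr : - r <= r by move: r0; lra.
have E1 := cauchy_sq r0 df in1 in2.
have E0 := cauchy_sq r0 df (re0_in r0) (im0_in r0).
have f0 : f 0 = 0 by [].
rewrite f0 mul0r in E0.
have c1 : frame_continuous (fun z => f z / (z - lam y)) (- r) r (- r) r.
  by move=> z hz'; apply: continuous_div (sqf_neq hz' in1 in2); exact: ff.
have c0 : frame_continuous (fun z => f z / (z - 0)) (- r) r (- r) r.
  by move=> z hz'; apply: continuous_div (sqf_neq hz' (re0_in r0) (im0_in r0)); exact: ff.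
have c2 : frame_continuous (fun z => f z / (z * (z - lam y))) (- r) r (- r) r.
  move=> z hz'; apply: contC_mul; first exact: ff.
  apply: (@continuousV C C (fun z => z * (z - lam y))).
    by rewrite mulf_neq0 ?subr_eq0 ?(sqf_neq hz' in1 in2) // (sqf_nz r0 hz').
  apply: (@contC_mul R id (fun z => z - lam y)); first exact: cvg_id.
  by apply: (@contC_sub R id (fun=> lam y)); [exact: cvg_id|exact: contC_cst].
have c3 : frame_continuous (fun z => lam y * (f z / (z * (z - lam y)))) (- r) r (- r) r.
  by move=> z hz'; apply: contC_mul; [exact: contC_cst|exact: c2].
have EG : lam y * G y = sq (fun z => f z / (z - lam y)) r - sq (fun z => f z / (z - 0)) r.
  rewrite /G /sq -(bdZ rr rr (lam y) c2) -(bdB rr rr c1 c0); apply: eq_bd => // z hz'.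
  rewrite subr0; field.
  by rewrite (sqf_nz r0 hz') subr_eq0 (sqf_neq hz' in1 in2).
by rewrite mulrA EG E1 E0 subr0 /f on_line_lam mulfK.
Qed.

(** Weierstrass division by the polynomial lam^2 - s with an explicit quotient. The remainder is
    affine in lam and vanishes at the two square roots of s; where s <> 0 these are distinct and the
    remainder is 0, and by density and continuity it is 0 everywhere. *)
Lemma divisible_by_quadric (s h : V -> C) : holo s p -> s p = 0 ->
  (forall y t, s (y + t *: e) = s y) ->
  (\forall y \near p, forall d : R, 0 < d -> exists2 y', nv (y' - y) < d & s y' != 0) ->
  holo h p ->
  (\forall y \near p, lam y ^+ 2 - s y = 0 -> h y = 0) ->
  exists2 g : V -> C, holo g p & \forall y \near p, h y = (lam y ^+ 2 - s y) * g y.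
Proof.
move=> hs sp s_shift dense hh van.
have [M [r r0 [rho1 rho10 hr1]]] := division_radius hh.
have r8 : 0 < r ^+ 2 / 8 by rewrite divr_gt0 // exprn_gt0.
have dsp : differentiable s p by exact: nbhs_singleton hs.
have [rho rho0 hr] : exists2 rho : R, 0 < rho & forall y, nv (y - p) < rho ->
    [/\ nv (y - p) < rho1, differentiable s y & nrm (s y) < r ^+ 2 / 8].
  have /continuous_nvP/(_ _ r8)[d1 d10 D1] := differentiable_continuous dsp.
  have /near_nvP[d2 d20 D2] := hs.
  exists (Num.min (Num.min d1 d2) rho1); first by rewrite !lt_min d10 d20.
  move=> y; rewrite !lt_min => /andP[/andP[/D1 h1 /D2 h2] h3].
  by rewrite sp subr0 in h1.
pose D (z : C) y := z ^+ 2 - s y.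
have hD z y : r / 2 < nrm z -> nv (y - p) < rho ->
    [/\ differentiable (D z) y, r ^+ 2 / 8 <= nrm (D z y) & differentiable (D^~ y) z].
  move=> zr /hr[_ ds s8]; split.
  - by apply: (@differentiableB C V C (fun=> z ^+ 2) s).
  - have : nrm (z ^+ 2) <= nrm (D z y) + nrm (s y).
      by rewrite -{1}(subrK (s y) (z ^+ 2)) nrmD.
    rewrite nrmX; have : r ^+ 2 / 4 <= nrm z ^+ 2.
      have -> : r ^+ 2 / 4 = (r / 2) ^+ 2 by field.
      by rewrite lerXn2r ?nnegrE ?nrm_ge0 ?ltW // divr_gt0.
    by move: (nrm (s y)) (nrm (D z y)) s8 => a b ? ? ?; lra.
  - apply: diffC_sub; last exact: diffC_cst.
    by apply: (@diffC_mul R id id).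
have hr2 y : nv (y - p) < rho -> _ := fun h => let: And3 h1 _ _ := hr y h in hr1 y h1.
have := @division_holo h D M r rho (r ^+ 2 / 8) r0 rho0 r8 hr2 hD.
set G := (fun y : V => sq _ r) => hG.
exists (fun y => G y / ksq r).
  by apply: filterS hG => y dG; apply: (@differentiableM C V G (fun=> (ksq r)^-1)).
have K0 : ksq r != 0 by exact: ksq_neq0.
have rr : - r <= r by move: r0; lra.
(* The remainder is lam y * r1 y + r2 y, because (z^2 - s) - (lam^2 - s) = (z - lam) (z + lam). Both
   coefficients are constant along e. *)
pose r1 y := sq (fun z => h (on_line z y) / D z y) r.
pose r2 y := sq (fun z => z * (h (on_line z y) / D z y)) r.
have claim1 y : nv (y - p) < rho ->
    h y * ksq r - (lam y ^+ 2 - s y) * G y = lam y * r1 y + r2 y.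
  move=> hy; have [l4 dl hz] := hr2 _ hy.
  have ly : nrm (lam y) < r by apply: lt_trans l4 _; move: r0; lra.
  have [in1 in2] := nrm_lt_in ly.
  set f := fun z => h (on_line z y).
  have df z : rect (- r) r (- r) r z -> differentiable f z.
    move=> /(rect_nrm r0)/hz[dh _].
    exact: differentiable_comp (differentiable_on_line_arg z y) dh.
  have ff := differentiable_frame df.
  have z2 z : sqf r z -> r / 2 < nrm z.
    by move=> /sqfP; move: (nrm z) => a ?; move: r0; lra.
  have Dn z : sqf r z -> D z y != 0.
    by move=> /z2 h2; have [_ h3 _] := hD _ _ h2 hy; rewrite -nrm_gt0 (lt_le_trans r8).
  have Dc z : sqf r z -> {for z, continuous (D^~ y)}.
    by move=> /z2 h2; have [_ _ h3] := hD _ _ h2 hy; exact: diffC_cont.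
  have Di z : sqf r z -> {for z, continuous (fun z => (D z y)^-1)}.
    by move=> hz'; apply: (@continuousV C C (D^~ y)); [exact: Dn|exact: Dc].
  have c1 : frame_continuous (fun z => f z / (z - lam y)) (- r) r (- r) r.
    by move=> z hz'; apply: continuous_div (sqf_neq hz' in1 in2); exact: ff.
  have c2 : frame_continuous (fun z => f z / (D z y * (z - lam y))) (- r) r (- r) r.
    move=> z hz'; apply: contC_mul; first exact: ff.
    apply: (@continuousV C C (fun z => D z y * (z - lam y))).
      by apply: mulf_neq0; [exact: Dn|rewrite subr_eq0; exact: sqf_neq hz' in1 in2].
    apply: contC_mul; first exact: Dc.
    by apply: (@contC_sub R id (fun=> lam y)); [exact: cvg_id|exact: contC_cst].
  set q := lam y ^+ 2 - s y.
  have c3 : frame_continuous (fun z => q * (f z / (D z y * (z - lam y)))) (- r) r (- r) r.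
    by move=> z hz'; apply: contC_mul; [exact: contC_cst|exact: c2].
  have c4 : frame_continuous (fun z => f z / D z y) (- r) r (- r) r.
    by move=> z hz'; apply: contC_mul; [exact: ff|exact: Di].
  have c5 : frame_continuous (fun z => z * (f z / D z y)) (- r) r (- r) r.
    by move=> z hz'; apply: (@contC_mul R id (fun z => f z / D z y)); [exact: cvg_id|exact: c4].
  have c6 : frame_continuous (fun z => lam y * (f z / D z y)) (- r) r (- r) r.
    by move=> z hz'; apply: contC_mul; [exact: contC_cst|exact: c4].
  have <- : f (lam y) = h y by rewrite /f on_line_lam.
  rewrite -(cauchy_sq r0 df in1 in2) /r1 /r2 /G /sq -(bdZ rr rr q c2) -(bdB rr rr c1 c3).
  rewrite -(bdZ rr rr (lam y) c4) -(bdD rr rr c6 c5); apply: eq_bd => // z hz'.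
  have := Dn z hz'; have := sqf_neq hz' in1 in2; rewrite -subr_eq0 /D /q => n1 n2.
  by rewrite -/(f z); field; rewrite n1 n2.
have r1s y t : r1 (y + t *: e) = r1 y.
  have E : (fun z => (h (on_line z (y + t *: e)) / D z (y + t *: e))) =
           (fun z => (h (on_line z y) / D z y)).
    by apply/funext => z; rewrite on_line_shift /D s_shift.
  by rewrite /r1 E.
have r2s y t : r2 (y + t *: e) = r2 y.
  have E : (fun z => z * (h (on_line z (y + t *: e)) / D z (y + t *: e))) =
           (fun z => z * (h (on_line z y) / D z y)).
    by apply/funext => z; rewrite on_line_shift /D s_shift.
  by rewrite /r2 E.
pose N := nv e; have N0 : 0 <= N := nv_ge0 e.
have N1 : 0 < N + 1 by rewrite ltr_wpDl.
have [d d0 dP] : exists2 d : R, 0 < d & forall y, nv (y - p) < d ->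
    nv (y - p) < rho /\ (lam y ^+ 2 - s y = 0 -> h y = 0).
  have /near_nvP[d d0 D1] := van; exists (Num.min d rho); first by rewrite lt_min d0.
  by move=> y; rewrite lt_min => /andP[/D1 ? ?].
have d4 : 0 < d / 4 / (N + 1) by rewrite !divr_gt0.
have [d' d'0 d'P] : exists2 d' : R, 0 < d' & forall y, nv (y - p) < d' ->
    [/\ nv (y - p) < d / 4, nrm (lam y) < d / 4 / (N + 1), nrm (s y) < (d / 4 / (N + 1)) ^+ 2 &
     [/\ differentiable G y, differentiable h y, differentiable lam y &
      forall d : R, 0 < d -> exists2 y', nv (y' - y) < d & s y' != 0]].
  have lp : differentiable lam p by exact: nbhs_singleton lam_holo.
  have /continuous_nvP/(_ _ d4)[d1 d10 D1] := differentiable_continuous lp.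
  have d42 : 0 < (d / 4 / (N + 1)) ^+ 2 by rewrite exprn_gt0.
  have /continuous_nvP/(_ _ d42)[d2 d20 D2] := differentiable_continuous dsp.
  have [d3 d30 D3] := (near_nvP p _).1 (filterI (filterI hG dense) (filterI hh lam_holo)).
  exists (Num.min (Num.min d1 d2) (Num.min d3 (d / 4))).
    by rewrite !lt_min d10 d20 d30 divr_gt0.
  move=> y; rewrite !lt_min => /andP[/andP[/D1 h1 /D2 h2] /andP[/D3[[? ?] [? ?]] h4]].
  by rewrite lam_p subr0 in h1; rewrite sp subr0 in h2.
have claim2 y : nv (y - p) < d' -> s y != 0 -> h y * ksq r - (lam y ^+ 2 - s y) * G y = 0.
  move=> /d'P[y4 l4 s4 _] sy.
  (* The points of the line with lam = t and lam = - t lie on the quadric, where h vanishes; so t r1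
     + r2 = - t r1 + r2 = 0. *)
  pose t := sqrtC (s y); have t2 : t ^+ 2 = s y := sqrtCK _.
  have t0 : t != 0 by apply: contraNneq sy => t0; rewrite -t2 t0 expr0n.
  have nt : nrm t < d / 4 / (N + 1).
    rewrite -t2 nrmX in s4.
    by rewrite -(ltr_pXn2r (n := 2)) // ?nnegrE ?nrm_ge0 // ltW.
  have inb z : nrm z = nrm t -> nv (on_line z y - p) < d.
    move=> zt; rewrite /on_line addrAC; apply: le_lt_trans (nvD _ _) _; rewrite nvZ.
    have h1 : nrm (z - lam y) * N <= (d / 4 / (N + 1) + d / 4 / (N + 1)) * (N + 1).
      apply: ler_pM => //; rewrite ?nrm_ge0 ?lerDl //.
      by apply: le_trans (nrmB _ _) _; rewrite zt lerD // ltW.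
    apply: lt_le_trans (ltr_leD y4 h1) _.
    have -> : (d / 4 / (N + 1) + d / 4 / (N + 1)) * (N + 1) = d / 2.
      by field; rewrite gt_eqF.
    by move: d0; lra.
  have zero z : nrm z = nrm t -> z ^+ 2 = s y -> z * r1 y + r2 y = 0.
    move=> zt z2; have [hz1 hz2] := dP _ (inb _ zt).
    have := claim1 _ hz1; rewrite lam_on_line {1 2 3}/on_line s_shift r1s r2s z2 subrr mul0r subr0.
    by rewrite -[y + _]/(on_line z y) hz2 ?mul0r // lam_on_line {1}/on_line s_shift z2 subrr.
  have e1 := zero t erefl t2.
  have e2 : - t * r1 y + r2 y = 0 by apply: zero; [exact: (@nvN R C t)|rewrite sqrrN].
  have hy : nv (y - p) < rho.
    have -> : y = on_line (lam y) y by rewrite on_line_lam.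
    rewrite on_line_lam; have [//|] := dP y; first by apply: lt_trans y4 _; move: d0; lra.
    done.
  rewrite claim1 //.
  have r20 : r2 y = 0.
    have h1 : r2 y * 2 = (t * r1 y + r2 y) + (- t * r1 y + r2 y) by ring.
    by move/eqP: h1; rewrite e1 e2 addr0 mulf_eq0 pnatr_eq0 orbF => /eqP.
  have r10 : r1 y = 0.
    by move/eqP: e1; rewrite r20 addr0 mulf_eq0 (negPf t0) => /eqP.
  by rewrite r10 r20 mulr0 addr0.
have claim3 y : nv (y - p) < d' / 2 -> h y * ksq r - (lam y ^+ 2 - s y) * G y = 0.
  move=> hy; set F := fun y => h y * ksq r - (lam y ^+ 2 - s y) * G y.
  have hy' : nv (y - p) < d' by apply: lt_trans hy _; move: d'0; lra.
  have [y4 _ _ [dG dh dl dns]] := d'P _ hy'.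
  have [|hyr _] := dP y; first by apply: lt_trans y4 _; move: d0; lra.
  have [_ ds _] := hr _ hyr.
  have cF : {for y, continuous F}.
    apply: differentiable_continuous; apply: differentiableB.
      by apply: (@differentiableM C V h (fun=> ksq r)).
    apply: (@differentiableM C V (fun y => lam y ^+ 2 - s y) G) => //.
    apply: (@differentiableB C V C (fun y => lam y ^+ 2) s) => //.
    by apply: (@differentiableM C V lam lam).
  apply/eqP; rewrite -nrm_eq0; apply/eqP/le_anti; rewrite nrm_ge0 andbT.
  apply/ler_addgt0Pr => eps eps0; rewrite add0r.
  have /continuous_nvP/(_ _ eps0)[d1 d10 D1] := cF.
  have [|y' y1 sy'] := dns (Num.min d1 (d' / 2)); first by rewrite lt_min d10 divr_gt0.
  move: y1; rewrite lt_min => /andP[/D1 y1 y2].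
  have y'd : nv (y' - p) < d'.
    have -> : y' - p = (y' - y) + (y - p) by rewrite addrA subrK.
    by apply: le_lt_trans (nvD _ _) _; rewrite [ltRHS]splitr ltrD.
  have F0 : F y' = 0 by exact: claim2.
  by move: y1; rewrite F0 sub0r nvN => /ltW.
apply/near_nvP; exists (d' / 2); first by rewrite divr_gt0.
move=> y /claim3/eqP; rewrite subr_eq0 => /eqP hy.
by rewrite mulrA -hy mulfK.
Qed.

End Division.
End Holomorphic.

(** * Strict differentiability and the inverse function theorem *)

Section StrictDifferentiability.
Variable R : realType.
Local Notation C := (CC R).

(** Subtracting the first order Taylor polynomial at p leaves a function F of order |y - p|^2. It is
    bounded by Q rho^2 on the ball of radius rho, so the Cauchy estimates make it Lipschitz with a
    constant of order Q rho. *)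
Lemma holo_strict (V : normedModType C) (H : V -> C) (p : V) : holo H p ->
  forall e : R, 0 < e -> exists2 d : R, 0 < d & forall x y,
    nv (x - p) < d -> nv (y - p) < d ->
    nrm (H x - H y - 'd H p (x - y)) <= e * nv (x - y).
Proof.
move=> hH e e0; have dHp : differentiable H p by exact: nbhs_singleton hH.
pose L v : C := 'd H p v.
pose F y := H y - L (y - p) - H p.
have dL y : differentiable (fun y => L (y - p)) y.
  apply: (@differentiable_comp C V V C (fun y => y - p) L).
    by apply: differentiableB => //; exact: differentiable_cst.
  exact: (@linear_differentiable C V C ('d H p) (y - p) (diff_continuous dHp)).
have [d1 d10 D1] : exists2 d1 : R, 0 < d1 & forall y, nv (y - p) < d1 ->
    differentiable H y /\ nrm (H y) <= nrm (H p) + 1.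
  have /continuous_nvP/(_ 1 ltr01)[d2 d20 D2] := differentiable_continuous dHp.
  have /near_nvP[d3 d30 D3] := hH; exists (Num.min d2 d3); first by rewrite lt_min d20.
  move=> y; rewrite lt_min => /andP[/D2 h /D3 ?]; split=> //.
  rewrite -[nv _]/(nrm (H y - H p)) in h.
  have -> : H y = H p + (H y - H p) by rewrite addrC subrK.
  by apply: le_trans (nrmD _ _) _; rewrite lerD2l ltW.
pose M := nrm (H p) + 1; have M0 : 0 <= M by rewrite addr_ge0 ?nrm_ge0.
pose Q := 128 * M / d1 ^+ 2.
have Q0 : 0 <= Q by apply: divr_ge0 (sqr_ge0 _); exact: mulr_ge0.
have rem v : nv v <= d1 / 8 -> nrm (F (p + v)) <= Q * nv v ^+ 2.
  move=> hv; have := hol_remainder d10 (fun y h => proj1 (D1 y h)) (fun y h => proj2 (D1 y h)) hv.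
  by rewrite /F /L [p + v - p]addrC addKr addrAC.
have {rem}rem y : nv (y - p) <= d1 / 8 -> nrm (F y) <= Q * nv (y - p) ^+ 2.
  by move=> /rem; rewrite addrC subrK.
(* 80 = 16 + 64: the remainder contributes 512 Q |x - y| <= 16 Q rho and the differential of F
   contributes 64 Q rho. *)
pose rho := Num.min (d1 / 8) (e / (80 * Q + 1)).
have Q1 : 0 < 80 * Q + 1 by rewrite ltr_wpDl // mulr_ge0.
have rho0 : 0 < rho by rewrite lt_min !divr_gt0.
have rhod : rho <= d1 / 8 by rewrite ge_min lexx.
have rhoe : rho * (80 * Q) <= e.
  have : rho * (80 * Q + 1) <= e by rewrite -ler_pdivlMr // ge_min lexx orbT.
  by apply: le_trans; rewrite ler_pM2l // lerDl.
clearbody rho.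
exists (rho / 64); first by rewrite divr_gt0.
move=> x y hx hy.
have near w : nv (w - y) < rho / 2 -> nv (w - p) < rho.
  move=> hw; have -> : w - p = (w - y) + (y - p) by rewrite addrA subrK.
  apply: le_lt_trans (nvD _ _) _; rewrite [ltRHS]splitr; apply: ltr_leD => //.
  by apply: le_trans (ltW hy) _; clear -rho0; lra.
have FM w : nv (w - y) < rho / 2 -> nrm (F w) <= Q * rho ^+ 2.
  move=> /near h; apply: le_trans (rem _ _) _; first by apply: le_trans (ltW h) rhod.
  by rewrite ler_wpM2l // lerXn2r ?nnegrE ?nv_ge0 // ltW.
have dF w : nv (w - y) < rho / 2 -> differentiable F w.
  move=> /near h; have [|dHw _] := D1 w.
    by apply: lt_le_trans h _; apply: le_trans rhod _; clear -d10; lra.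
  apply: (@differentiableB C V C (fun y => H y - L (y - p)) (fun=> H p)).
    exact: (differentiableB dHw (dL w)).
  exact: differentiable_cst.
have r2 : 0 < rho / 2 by rewrite divr_gt0.
have xy' : nv (x - y) <= rho / 32.
  have -> : x - y = (x - p) - (y - p) by rewrite opprB addrA subrK.
  by apply: le_trans (nvB _ _) (le_trans (ltW (ltrD hx hy)) _); clear -rho0; lra.
have xy : nv (x - y) <= rho / 2 / 8 by apply: le_trans xy' _; clear -rho0; lra.
have h1 := hol_remainder r2 dF FM xy.
have h2 := hol_diff_bound r2 dF FM (x - y).
have -> : H x - H y - 'd H p (x - y) =
    (F (y + (x - y)) - F y - 'd F y (x - y)) + 'd F y (x - y).
  rewrite subrK (addrC y) subrK /F /L.
  have -> : x - y = (x - p) - (y - p) by rewrite opprB addrA subrK.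
  by rewrite linearB /=; move: ('d H p (x - p)) ('d H p (y - p)) (H x) (H y) (H p) => a b u v w; ring.
apply: le_trans (nrmD _ _) (le_trans (lerD h1 h2) _).
have E1 : 128 * (Q * rho ^+ 2) / (rho / 2) ^+ 2 * nv (x - y) ^+ 2 = 512 * Q * nv (x - y) * nv (x - y).
  by field; rewrite gt_eqF.
have E2 : 32 * (Q * rho ^+ 2) / (rho / 2) * nv (x - y) = 64 * Q * rho * nv (x - y).
  by field; rewrite gt_eqF.
rewrite E1 E2 -mulrDl ler_wpM2r ?nv_ge0 //; apply: le_trans rhoe.
have : Q * nv (x - y) <= Q * (rho / 32) by rewrite ler_wpM2l.
by move: (nv _) => a; clear; lra.
Qed.

End StrictDifferentiability.

Section RowVectors.
Variable R : realType.
Local Notation C := (CC R).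

Lemma nv_rV_lt n (w : 'rV[C]_n) (M : R) : 0 < M ->
  nv w < M <-> forall i, nrm (w 0 i) < M.
Proof.
move=> M0; have M0' : 0 < mkC M 0 by rewrite -mkC0 ltC.
have E : nv w < M <-> ball 0 (mkC M 0) w.
  by rewrite -ball_normE /= sub0r normrN nvE ltC.
rewrite E; split=> [[_ h] i|h].
  by have := h 0 i; rewrite -ball_normE /= mxE sub0r normrN nrmE ltC.
by split=> // i j; rewrite ord1 -ball_normE /= mxE sub0r normrN nrmE ltC.
Qed.

Lemma nrm_coord n (w : 'rV[C]_n) i : nrm (w 0 i) <= nv w.
Proof.
apply/ler_addgt0Pr => e e0; apply: ltW.
have h : nv w < nv w + e by rewrite ltrDl.
have M0 : 0 < nv w + e by rewrite ltr_wpDl ?nv_ge0.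
exact: ((nv_rV_lt w M0).1 h).
Qed.

Lemma nv_rV_le n (w : 'rV[C]_n) (M : R) : 0 <= M ->
  (forall i, nrm (w 0 i) <= M) -> nv w <= M.
Proof.
move=> M0 h; apply/ler_addgt0Pr => e e0; apply: ltW.
apply/(nv_rV_lt w); first by rewrite ltr_wpDl.
by move=> i; apply: le_lt_trans (h i) _; rewrite ltrDl.
Qed.

Lemma differentiable_rV (V : normedModType C) n (F : V -> 'rV[C]_n) (p : V) :
  (forall i, differentiable (fun y => F y 0 i) p) -> differentiable F p.
Proof.
move=> dF; have -> : F = \sum_(i < n) (fun y => F y 0 i *: (delta_mx 0 i : 'rV[C]_n)).
  apply/funext => y; rewrite {1}(row_sum_delta (F y)).
  by elim/big_ind2 : _ => // ? f ? g -> ->.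
apply: differentiable_sum => i.
exact: (@differentiableZl C V 'rV[C]_n (fun y => F y 0 i)).
Qed.

Lemma diff_coord_fun (V : normedModType C) n (F : V -> 'rV[C]_n) (p : V) i :
  differentiable F p ->
  differentiable (fun y => F y 0 i) p /\
  forall v, 'd (fun y => F y 0 i) p v = ('d F p v) 0 i.
Proof.
move=> dF; pose c (w : 'rV[C]_n) : C := w 0 i.
have lc : linear c by move=> a u v; rewrite /c !mxE.
pose c' : {linear 'rV[C]_n -> C} := HB.pack c (GRing.isLinear.Build C _ _ _ c lc).
have cc : continuous c' by exact: coord_continuous.
have dc w : differentiable c' w by exact: linear_differentiable.
split; first exact: (differentiable_comp dF (dc (F p))).
move=> v; have -> : (fun y => F y 0 i) = c' \o F by [].
have e1 := diff_comp dF (dc (F p)); have e2 := diff_lin (F p) cc.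
by rewrite e1 /= e2.
Qed.

Lemma differentiable_mulmxr n m (A : 'M[C]_(n, m)) (p : 'rV[C]_n) :
  differentiable (fun v : 'rV[C]_n => v *m A) p /\
  'd (fun v : 'rV[C]_n => v *m A) p = mulmxr A :> ('rV[C]_n -> 'rV[C]_m).
Proof.
have d q : differentiable (mulmxr A : 'rV[C]_n -> 'rV[C]_m) q.
  apply: differentiable_rV => j.
  have -> : (fun y : 'rV[C]_n => mulmxr A y 0 j) = \sum_(k < n) (fun y : 'rV[C]_n => y 0 k * A k j).
    apply/funext => y; rewrite /mulmxr mxE.
    by elim/big_ind2 : _ => // ? f ? g -> ->.
  apply: differentiable_sum => k.
  apply: (@differentiableM C _ (fun y : 'rV[C]_n => y 0 k) (fun=> A k j)) => //.
  exact: differentiable_coord.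
split; first exact: d.
have c q : {for q, continuous (mulmxr A : 'rV[C]_n -> 'rV[C]_m)}.
  exact: differentiable_continuous.
exact: (@diff_lin C _ _ (mulmxr A) p c).
Qed.

(** The intervals around u n of radius 2 K / 2^n are nested. The limit is the supremum of their left
    ends, and the rate of convergence comes with it. *)
Lemma geometric_limit (u : nat -> R) (K : R) :
  (forall n, `|u n.+1 - u n| <= K / 2 ^+ n) ->
  exists l, forall n, `|u n - l| <= 2 * K / 2 ^+ n.
Proof.
move=> hu; pose b n := 2 * K / 2 ^+ n.
have bS n : b n - b n.+1 = K / 2 ^+ n by rewrite /b exprS; field.
have K0 : 0 <= K by have := hu 0%N; rewrite expr0 divr1; apply: le_trans.
have b0 n : 0 <= b n by rewrite divr_ge0 ?mulr_ge0 // exprn_ge0.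
have st n : u n - b n <= u n.+1 - b n.+1 /\ u n.+1 + b n.+1 <= u n + b n.
  have := hu n; rewrite ler_norml -bS => /andP[? ?]; split; lra.
have mono n m : u n - b n <= u (n + m)%N - b (n + m)%N /\ u (n + m)%N + b (n + m)%N <= u n + b n.
  elim: m => [|m [h1 h2]]; first by rewrite addn0.
  by rewrite addnS; have [h3 h4] := st (n + m)%N; split; [exact: le_trans h1 h3|exact: le_trans h4 h2].
have bnd n m : u n - b n <= u m + b m.
  have [nm|mn] := leqP n m.
    have [h1 _] := mono n (m - n)%N; rewrite subnKC // in h1.
    by have := b0 m; move: h1; lra.
  have [_ h1] := mono m (n - m)%N; rewrite subnKC 1?ltnW // in h1.
  by have := b0 n; move: h1; lra.
exists (sup (range (fun n => u n - b n))) => n.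
have h1 : u n - b n <= sup (range (fun n => u n - b n)).
  apply: ub_le_sup; last by exists n.
  by exists (u 0%N + b 0%N) => _ [m _ <-]; exact: bnd.
have h2 : sup (range (fun n => u n - b n)) <= u n + b n.
  apply: ge_sup; first by exists (u 0%N - b 0%N), 0%N.
  by move=> _ [m _ <-]; exact: bnd.
by rewrite ler_norml -/(b n); apply/andP; split; lra.
Qed.

Lemma div_pow2_lt (K e : R) : 0 <= K -> 0 < e -> exists n, K / 2 ^+ n < e.
Proof.
move=> K0 e0.
have : (fun n => K * (2^-1 : R) ^+ n) @ \oo --> (0 : R).
  by apply: (@cvg_geometric R K 2^-1); rewrite ger0_norm // invf_lt1 // ltr1n.
move/cvgrPdist_lt/(_ e e0) => [N _ /(_ N)] /= NP; exists N.
have := NP (leqnn N); rewrite sub0r normrN exprVn => /(le_lt_trans _); apply.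
exact: ler_norm.
Qed.

Lemma geometric_limit_rV m (u : nat -> 'rV[C]_m) (K : R) :
  (forall n, nv (u n.+1 - u n) <= K / 2 ^+ n) ->
  exists l, forall n, nv (u n - l) <= 4 * K / 2 ^+ n.
Proof.
move=> hu.
have hi i n : nrm (u n.+1 0 i - u n 0 i) <= K / 2 ^+ n.
  by have := le_trans (nrm_coord _ i) (hu n); rewrite !mxE.
have /choice[a aP] : forall i, exists l, forall n, `|re (u n 0 i) - l| <= 2 * K / 2 ^+ n.
  by move=> i; apply: geometric_limit => n; rewrite -re_sub (le_trans (ler_re _)).
have /choice[b bP] : forall i, exists l, forall n, `|im (u n 0 i) - l| <= 2 * K / 2 ^+ n.
  by move=> i; apply: geometric_limit => n; rewrite -im_sub (le_trans (ler_im _)).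
have K0 : 0 <= K by have := le_trans (nv_ge0 _) (hu 0%N); rewrite expr0 divr1.
exists (\row_i mkC (a i) (b i)) => n; apply: nv_rV_le.
  by rewrite divr_ge0 ?mulr_ge0 // exprn_ge0.
move=> i; rewrite !mxE; apply: le_trans (ler_nrm _) _.
rewrite re_sub im_sub; have := lerD (aP i n) (bP i n).
by have -> : 4 * K / 2 ^+ n = 2 * K / 2 ^+ n + 2 * K / 2 ^+ n by rewrite -!mulrA -mulrDl -natrD.
Qed.

End RowVectors.

Section InverseFunction.
Variable R : realType.
Local Notation C := (CC R).

Definition biholo (V W : normedModType C) (f : V -> W) (g : W -> V)
    (U : set V) (U' : set W) : Prop :=
  [/\ open U, open U',
     forall x, U x -> [/\ U' (f x), g (f x) = x & differentiable f x] &
     forall y, U' y -> [/\ U (g y), f (g y) = y & differentiable g y]].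

(** The lower bound on the differential makes its matrix invertible. With L the inverse, g y - x - L
    (y - f x) is L applied to the first order error of f at g y, and |g y - x| is controlled by |y -
    f x|. *)
Lemma differentiable_left_inverse n (f : 'rV[C]_n -> 'rV[C]_n) (g : 'rV[C]_n -> 'rV[C]_n)
    (x : 'rV[C]_n) (c : R) :
  0 < c -> differentiable f x ->
  (\forall y \near f x, f (g y) = y) -> g (f x) = x ->
  (\forall y \near f x, c * nv (g y - x) <= nv (y - f x)) ->
  (forall v, c * nv v <= nv ('d f x v)) ->
  differentiable g (f x).
Proof.
move=> c0 df fg gf gl dfl.
pose A : 'M[C]_n := lin1_mx ('d f x).
have AE v : 'd f x v = v *m A by rewrite mul_rV_lin1.
have Au : A \in unitmx.
  rewrite -row_free_unit -kermx_eq0; apply/eqP/row_matrixP => i; rewrite row0.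
  have : row i (kermx A) *m A = 0 by rewrite -row_mul mulmx_ker row0.
  rewrite -AE => h; have := dfl (row i (kermx A)); rewrite h nv0 pmulr_rle0 // => h1.
  by apply/eqP; rewrite -nv_eq0; apply/eqP/le_anti; rewrite h1 nv_ge0.
pose L : {linear 'rV[C]_n -> 'rV[C]_n} := mulmxr (invmx A).
have LE w : L w = w *m invmx A by [].
have Ll w : c * nv (L w) <= nv w.
  by have := dfl (L w); rewrite AE /L /= mulmxKV.
have [||e e0|//] := @bounded_linear_differentiable C _ _ g (f x) L (mkC c^-1 0).
- by rewrite -mkC0 leC invr_ge0 ltW.
- by move=> w; rewrite !nvE mkCM leC mulrC ler_pdivlMr // mulrC.
pose r := re e; have r0 : 0 < r := re_gt0 e0.
have cr : 0 < r * c * c by rewrite !mulr_gt0.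
have [d d0 D] := differentiable_near_nv df cr.
have gx : \forall y \near f x, nv (g y - x) < d.
  have cd : 0 < c * d by rewrite mulr_gt0.
  have := near_nv (f x) cd; move: gl; apply: filterS2 => y h1 h2.
  by have := le_lt_trans h1 h2; rewrite ltr_pM2l.
move: fg gl gx; apply: filterS3 => y fg gl gx.
rewrite gf (realCE (ltW e0)) !nvE mkCM leC -/r.
have -> : g y - x - L (y - f x) = L ('d f x (g y - x) - (y - f x)).
  by rewrite !LE [in RHS]mulmxBl AE mulmxK.
rewrite -(ler_pM2l c0); apply: le_trans (Ll _) _.
have h := D _ gx; rewrite fg in h; rewrite nv_sub; apply: le_trans h _.
have -> : r * c * c * nv (g y - x) = r * c * (c * nv (g y - x)) by ring.
have -> : c * (r * nv (y - f x)) = r * c * nv (y - f x) by ring.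
by rewrite ler_pM2l // mulr_gt0.
Qed.

(** By strict differentiability f - id is Lipschitz with constant 1/2 near p. Hence f is injective
    there, and y = f x is solved by the iteration u -> u + (y - f u), whose steps are halved each
    time. *)
Lemma inverse_function_id n (f : 'rV[C]_n -> 'rV[C]_n) (p : 'rV[C]_n) :
  holo f p -> (forall v, 'd f p v = v) ->
  exists U U' g, U p /\ biholo f g U U'.
Proof.
move=> hf dfp; have dp : differentiable f p by exact: nbhs_singleton hf.
have half : 0 < 2^-1 :> R by [].
have comp i : holo (fun y => f y 0 i) p.
  by apply: filterS hf => y dy; have [] := diff_coord_fun i dy.
have /choice[dl dlP] : forall i : 'I_n, exists d : R, 0 < d /\ forall x y,
    nv (x - p) < d -> nv (y - p) < d ->
    nrm (f x 0 i - f y 0 i - 'd (fun y => f y 0 i) p (x - y)) <= 2^-1 * nv (x - y).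
  by move=> i; have [d d0 D] := holo_strict (comp i) half; exists d.
have [d1 d10 D1] := (near_nvP p _).1 hf.
pose d := \big[Num.min/d1]_(i < n) dl i.
have d0 : 0 < d.
  by rewrite /d; elim/big_ind : _ => // [a b a0 b0|i _]; [rewrite lt_min a0|exact: (dlP i).1].
have dd1 : d <= d1 by exact: bigmin_le_id.
have ddl i : d <= dl i by exact: bigmin_le_cond.
clearbody d.
have strict x y : nv (x - p) < d -> nv (y - p) < d ->
    nv (f x - f y - (x - y)) <= 2^-1 * nv (x - y).
  move=> hx hy; apply: nv_rV_le; first by rewrite mulr_ge0 ?nv_ge0.
  move=> i; have := (dlP i).2 _ _ (lt_le_trans hx (ddl i)) (lt_le_trans hy (ddl i)).
  by rewrite (diff_coord_fun i dp).2 dfp !mxE.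
have dfb x : nv (x - p) < d -> differentiable f x.
  by move=> h; apply: D1; exact: lt_le_trans h dd1.
have lower x y : nv (x - p) < d -> nv (y - p) < d -> 2^-1 * nv (x - y) <= nv (f x - f y).
  move=> hx hy; have h := strict _ _ hx hy.
  have : nv (x - y) <= nv (f x - f y) + nv (f x - f y - (x - y)).
    have {1}-> : x - y = (f x - f y) - (f x - f y - (x - y)) by rewrite subKr.
    exact: nvB.
  by move: (nv (x - y)) (nv (f x - f y)) h => a b h; lra.
have solve y : nv (y - f p) < d / 8 -> exists2 x, nv (x - p) < d & f x = y.
  move=> hy; pose u := fix u k := if k is k'.+1 then u k' + (y - f (u k')) else p.
  pose K := nv (y - f p).
  have K0 : 0 <= K := nv_ge0 _.
  have Kd : 8 * K < d by move: hy; rewrite -/K; lra.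
  have pow k : 0 < (2 : R) ^+ k by rewrite exprn_gt0.
  have uS k : u k.+1 - u k = y - f (u k) by rewrite /= addrC addKr.
  have inb k : nv (u k - p) <= 2 * K * (1 - 1 / 2 ^+ k) -> nv (u k - p) < d.
    move=> h2; apply: le_lt_trans h2 _; apply: (@le_lt_trans _ _ (2 * K)).
      by rewrite ler_piMr ?mulr_ge0 // lerBlDr lerDl divr_ge0 // ltW.
    by move: Kd K0; lra.
  have stA k : nv (u k - p) <= 2 * K * (1 - 1 / 2 ^+ k) ->
      nv (u k.+1 - u k) <= K / 2 ^+ k -> nv (u k.+1 - p) <= 2 * K * (1 - 1 / 2 ^+ k.+1).
    move=> h1 h2.
    have -> : u k.+1 - p = (u k.+1 - u k) + (u k - p) by rewrite addrA subrK.
    apply: le_trans (nvD _ _) (le_trans (lerD h2 h1) _).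
    rewrite le_eqVlt; apply/orP; left; apply/eqP.
    by rewrite exprS; field; rewrite gt_eqF.
  have st k : nv (u k - p) <= 2 * K * (1 - 1 / 2 ^+ k) /\ nv (u k.+1 - u k) <= K / 2 ^+ k.
    elim: k => [|k [h1 h2]].
      by rewrite uS subrr nv0 expr0 !divr1 subrr mulr0.
    have h3 := stA _ h1 h2; split=> //.
    have -> : u k.+2 - u k.+1 = - (f (u k.+1) - f (u k) - (u k.+1 - u k)).
      by rewrite uS [in RHS]uS opprB opprB addrA subrK.
    rewrite nvN; apply: le_trans (strict _ _ (inb _ h3) (inb _ h1)) _.
    by rewrite exprS invfM mulrCA ler_pM2l.
  have [l hl] := geometric_limit_rV (fun k => (st k).2).
  have lp : nv (l - p) < d.
    have := hl 0%N; rewrite expr0 divr1 nv_sub => h; apply: le_lt_trans h _.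
    by move: Kd K0; lra.
  exists l => //; apply/eqP; rewrite -subr_eq0 -nv_eq0; apply/eqP/le_anti; rewrite nv_ge0 andbT.
  apply/ler_addgt0Pr => e e0; rewrite add0r.
  have [k hk] := div_pow2_lt (mulr_ge0 (ler0n R 7) K0) e0.
  apply: le_trans (ltW hk).
  have upk := inb _ (st k).1.
  have -> : f l - y = (f l - f (u k) - (l - u k)) + (l - u k) - (u k.+1 - u k).
    by rewrite subrK uS opprB addrA subrK.
  have h1 := strict _ _ lp upk; have h2 := hl k; have h3 := (st k).2.
  rewrite nv_sub in h2.
  apply: le_trans (nvB _ _) _.
  apply: le_trans (lerD (nvD _ _) (lexx _)) _.
  have -> : 7 * K / 2 ^+ k = 2^-1 * (4 * K / 2 ^+ k) + (4 * K / 2 ^+ k) + (K / 2 ^+ k) by field; rewrite gt_eqF.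
  by rewrite !lerD // (le_trans h1) // ler_pM2l.
pose U' : set 'rV[C]_n := [set y | nv (y - f p) < d / 8].
pose U : set 'rV[C]_n := [set x | nv (x - p) < d /\ U' (f x)].
have /choice[g gP] : forall y, exists x, U' y -> nv (x - p) < d /\ f x = y.
  move=> y; have [/solve[x ? ?]|nU] := pselect (U' y); first by exists x.
  by exists 0.
have oU' : open U'.
  rewrite openE => y hy; apply/(near_nvP y U'); exists (d / 8 - nv (y - f p)).
    by rewrite subr_gt0.
  move=> w; rewrite ltrBrDr => h; rewrite /U' /=.
  have -> : w - f p = (w - y) + (y - f p) by rewrite addrA subrK.
  exact: le_lt_trans (nvD _ _) h.
have oU : open U.
  rewrite openE => x [hx hfx]; apply: filterI.
    apply/(near_nvP x (fun w => nv (w - p) < d)); exists (d - nv (x - p)); first by rewrite subr_gt0.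
    move=> w; rewrite ltrBrDr => h.
    have -> : w - p = (w - x) + (x - p) by rewrite addrA subrK.
    exact: le_lt_trans (nvD _ _) h.
  apply: (differentiable_continuous (dfb _ hx)).
  by apply: open_nbhs_nbhs; split.
have inj x x' : nv (x - p) < d -> nv (x' - p) < d -> f x = f x' -> x = x'.
  move=> hx hx' e; have := lower _ _ hx hx'; rewrite e subrr nv0 pmulr_rle0 // => h.
  by apply/eqP; rewrite -subr_eq0 -nv_eq0; apply/eqP/le_anti; rewrite h nv_ge0.
exists U, U', g; split.
  by split; rewrite /U' /= subrr nv0 // divr_gt0.
split; [exact: oU|exact: oU'|move=> x [hx hfx]|move=> y hy].
  by split; [exact: hfx|have [h1 h2] := gP _ hfx; exact: inj|exact: dfb].
have [hx fx] := gP _ hy; split; [by split; rewrite ?fx|exact: fx|].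
have c0 : 0 < 4^-1 :> R by [].
have := @differentiable_left_inverse n f g (g y) 4^-1 c0 (dfb _ hx); rewrite fx; apply.
- apply: filterS (open_nbhs_nbhs (conj oU' hy)) => w hw.
  by have [] := gP _ hw.
- by [].
- apply: filterS (open_nbhs_nbhs (conj oU' hy)) => w hw.
  have [hw1 hw2] := gP _ hw; have := lower _ _ hw1 hx; rewrite hw2 fx.
  by apply: le_trans; rewrite ler_wpM2r ?nv_ge0 // lef_pV2 ?posrE // ler_nat.
(* Along a short multiple of v, f stretches by at least 1/2 and differs from its differential by at
   most 1/4; this leaves 1/4 for the differential. *)
move=> v; have [e e0 eP] := differentiable_near_nv (dfb _ hx) c0.
have [->|v0] := eqVneq v 0; first by rewrite nv0 mulr0 nv_ge0.
have v1 : 0 < nv v by rewrite nv_gt0.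
pose t := Num.min e (d - nv (g y - p)) / 2 / nv v.
have m0 : 0 < Num.min e (d - nv (g y - p)) by rewrite lt_min e0 subr_gt0.
have t0 : 0 < t by rewrite !divr_gt0.
have tv : nv (mkC t 0 *: v) < Num.min e (d - nv (g y - p)).
  rewrite nvZ nrm_mkC gtr0_norm // /t divfK ?gt_eqF // ltr_pdivrMr // mulr_natr mulr2n.
  by rewrite ltrDl.
rewrite lt_min ltrBrDr in tv; have [tv1 tv2] := andP tv.
have h1 := eP (g y + mkC t 0 *: v); rewrite [_ + _ - _]addrC addKr in h1.
have {}h1 := h1 tv1.
have h2 : nv (g y + mkC t 0 *: v - p) < d.
  rewrite addrAC [_ + _ *: _]addrC; exact: le_lt_trans (nvD _ _) tv2.
have := lower _ _ h2 hx; rewrite [g y + _ - g y]addrC addKr => h3.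
have h4 : nv (f (g y + mkC t 0 *: v) - f (g y)) <=
    nv ('d f (g y) (mkC t 0 *: v)) + nv (f (g y + mkC t 0 *: v) - f (g y) - 'd f (g y) (mkC t 0 *: v)).
  by rewrite -{1}(subrK ('d f (g y) (mkC t 0 *: v)) (f (g y + mkC t 0 *: v) - f (g y))) addrC nvD.
rewrite -/(nv _) in h1.
have ntv : nv (mkC t 0 *: v) = t * nv v by rewrite nvZ nrm_mkC gtr0_norm.
have nd : nv ('d f (g y) (mkC t 0 *: v)) = t * nv ('d f (g y) v).
  by rewrite linearZ /= nvZ nrm_mkC gtr0_norm.
rewrite ntv in h1 h3; rewrite nd in h4.
rewrite -(ler_pM2l t0).
move: (nv (f _ - f _)) (nv (f _ - f _ - _)) h1 h3 h4 => a b h1 h3 h4.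
by rewrite mulrCA; move: (t * nv v) (t * nv _) h1 h3 h4 => ? ? *; lra.
Qed.

End InverseFunction.

Section Coordinates.
Variable R : realType.
Local Notation C := (CC R).

(** The missing columns come from Gaussian elimination of the transpose: they are the last n rows of
    the invertible factor [row_ebase]. *)
Lemma complete_unitmx (F : fieldType) k n (D : 'M[F]_(k + n, k)) :
  (forall c : 'cV_k, D *m c = 0 -> c = 0) ->
  exists K : 'M[F]_(k + n, n), row_mx D K \in unitmx.
Proof.
move=> inj; pose A := D^T.
have fA : row_free A.
  rewrite -kermx_eq0; apply/eqP/row_matrixP => i; rewrite row0.
  apply: trmx_inj; rewrite trmx0; apply: inj.
  by apply: trmx_inj; rewrite trmx_mul trmxK trmx0 -row_mul mulmx_ker row0.
exists (dsubmx (row_ebase A))^T.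
have -> : row_mx D (dsubmx (row_ebase A))^T = (col_mx A (dsubmx (row_ebase A)))^T.
  by rewrite tr_col_mx trmxK.
rewrite unitmx_tr.
have -> : col_mx A (dsubmx (row_ebase A)) =
    block_mx (col_ebase A) 0 0 1%:M *m row_ebase A.
  rewrite -[X in _ = _ *m X](vsubmxK (row_ebase A)) mul_block_col !mul0mx mul1mx add0r addr0.
  congr col_mx; rewrite -{1}(mulmx_ebase A) (eqP fA).
  rewrite -mulmxA; congr (_ *m _).
  rewrite -{1}(vsubmxK (row_ebase A)) [pid_mx k](_ : _ = row_mx 1%:M 0).
    by rewrite mul_row_col mul1mx mul0mx addr0.
  apply/matrixP => i j; rewrite [LHS]mxE [RHS]mxE; case: splitP => l jl.
    by rewrite mxE jl ltn_ord andbT.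
  rewrite mxE jl; case: eqP => // ij; have := ltn_ord i.
  by rewrite [X in (X < _)%N]ij ltnNge leq_addr.
by rewrite unitmx_mul row_ebase_unit andbT unitmxE det_ublock det1 mulr1 -unitmxE col_ebase_unit.
Qed.

Lemma diff_comp_linear (K : numFieldType) (V W X : normedModType K) (f : V -> W)
    (g : {linear W -> X}) p v : differentiable f p -> continuous g ->
  'd (g \o f) p v = g ('d f p v).
Proof.
move=> df cg; have dg := linear_differentiable (f p) cg.
by rewrite (diff_comp df dg) /= (diff_lin (f p) cg).
Qed.

Lemma diff_comp_mulmx (V : normedModType C) n m (f : V -> 'rV[C]_n) (A : 'M[C]_(n, m)) p v :
  differentiable f p -> 'd (fun u => f u *m A) p v = 'd f p v *m A.
Proof.
move=> df; apply: (@diff_comp_linear C V _ _ f (mulmxr A)) => // q.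
by apply: differentiable_continuous; have [] := differentiable_mulmxr A q.
Qed.

Lemma biholo_comp_linear n (f g : 'rV[C]_n -> 'rV[C]_n) U U' (J : 'M[C]_n) : J \in unitmx ->
  biholo (fun u => f u *m invmx J) g U U' ->
  (forall x, U x -> differentiable f x) ->
  biholo f (fun y => g (y *m invmx J)) U [set y | U' (y *m invmx J)].
Proof.
move=> Ju [oU oU' h1 h2] df.
have c q : {for q, continuous (fun v : 'rV[C]_n => v *m invmx J)}.
  by apply: differentiable_continuous; have [] := differentiable_mulmxr (invmx J) q.
split; [exact: oU| |move=> x Ux|move=> y Uy].
- by apply: open_comp => // q _; exact: c.
- by have [a1 a2 _] := h1 _ Ux; split; [exact: a1|exact: a2|exact: df].
have [u1 u2 u3] := h2 _ Uy; split; first exact: u1.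
  by rewrite -[LHS](mulmxKV Ju) u2 mulmxKV.
exact: (differentiable_comp (differentiable_mulmxr (invmx J) y).1 u3).
Qed.

Lemma inverse_function n (f : 'rV[C]_n -> 'rV[C]_n) (p : 'rV[C]_n) (J : 'M[C]_n) :
  holo f p -> J \in unitmx -> (forall v, 'd f p v = v *m J) ->
  exists U U' g, U p /\ biholo f g U U'.
Proof.
move=> hf Ju dfp; pose L (v : 'rV[C]_n) := v *m invmx J.
have dL q := differentiable_mulmxr (invmx J) q.
have dp : differentiable f p by exact: nbhs_singleton hf.
have [|v|U [U' [g [Up bi]]]] := @inverse_function_id R n (L \o f) p.
- by apply: filterS hf => y dy; exact: differentiable_comp dy (dL (f y)).1.
- by rewrite diff_comp_mulmx // dfp mulmxK.
have df x : U x -> differentiable f x.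
  case: bi => _ _ h _ /h[_ _ d].
  have -> : f = (fun v : 'rV[C]_n => v *m J) \o (L \o f).
    by apply/funext => y; rewrite /= /L mulmxKV.
  exact: differentiable_comp d (differentiable_mulmxr J ((L \o f) x)).1.
exists U, [set y | U' (y *m invmx J)], (fun y => g (y *m invmx J)).
by split; [exact: Up|exact: (@biholo_comp_linear n f g U U' J Ju bi df)].
Qed.

Lemma differentiable_row_mx (V : normedModType C) m n (F : V -> 'rV[C]_m) (G : V -> 'rV[C]_n) p :
  differentiable F p -> differentiable G p ->
  differentiable (fun y => row_mx (F y) (G y)) p /\
  forall v, 'd (fun y => row_mx (F y) (G y)) p v = row_mx ('d F p v) ('d G p v).
Proof.
move=> dF dG.
have E i : (fun y => row_mx (F y) (G y) 0 i) =
    match fintype.split i with inl j => (fun y => F y 0 j) | inr j => (fun y => G y 0 j) end.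
  apply/funext => y; case: splitP => j ij.
    by rewrite (_ : i = lshift n j) ?row_mxEl //; exact: val_inj.
  by rewrite (_ : i = rshift m j) ?row_mxEr //; exact: val_inj.
have d : differentiable (fun y => row_mx (F y) (G y)) p.
  apply: differentiable_rV => i; rewrite E; case: splitP => j _.
    by have [] := diff_coord_fun j dF.
  by have [] := diff_coord_fun j dG.
split=> // v; apply/rowP => i; rewrite -(diff_coord_fun i d).2 E.
case: splitP => j ij.
  have -> : i = lshift n j by exact: val_inj.
  by rewrite row_mxEl (diff_coord_fun j dF).2.
have -> : i = rshift m j by exact: val_inj.
by rewrite row_mxEr (diff_coord_fun j dG).2.
Qed.

(** Functions with independent differentials become the first k coordinates; the others can be taken
    linear. *)
Lemma complete_coordinates k n (F : 'rV[C]_(k + n) -> 'rV[C]_k) p (D : 'M[C]_(k + n, k)) :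
  holo F p -> (forall v, 'd F p v = v *m D) ->
  (forall c : 'cV_k, D *m c = 0 -> c = 0) ->
  exists (K : 'M[C]_(k + n, n)) U U' g, U p /\
    biholo (fun u => row_mx (F u) (u *m K)) g U U'.
Proof.
move=> hF dF inj; have [K Ku] := complete_unitmx inj; exists K.
have dp : differentiable F p by exact: nbhs_singleton hF.
apply: (inverse_function _ Ku) => [|v].
  apply: filterS hF => y dy; exact: (differentiable_row_mx dy (differentiable_mulmxr K y).1).1.
have [_ ->] := differentiable_row_mx dp (differentiable_mulmxr K p).1.
by rewrite dF (differentiable_mulmxr K p).2 /= mul_mx_row.
Qed.

End Coordinates.

(** * Order of vanishing in one variable *)

Section Order.
Variable R : realType.
Local Notation C := (CC R).
Implicit Types (f g : C -> C) (b : C).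

Definition divisible_power f b k :=
  exists2 g, holo g b & \forall z \near b, f z = (z - b) ^+ k * g z.

Lemma diffC_id (z : C) : differentiable (id : C -> C) z.
Proof. by have [] := is_diff_id z. Qed.

Lemma diffC_exp k (z : C) : differentiable (fun w : C => w ^+ k) z.
Proof.
elim: k => [|k ih]; first exact: diffC_cst.
have -> : (fun w : C => w ^+ k.+1) = (fun w => w * w ^+ k) by apply/funext => w; rewrite exprS.
exact: (@diffC_mul R id) (diffC_id z) ih.
Qed.

Lemma holo_div f b : holo f b -> f b = 0 ->
  exists2 g, holo g b & \forall z \near b, f z = (z - b) * g z.
Proof.
move=> hf fb; apply: (@divisible_by_coordinate R C b 1 (fun z => z - b)) => //.
- by move=> y t; rewrite -[t *: 1]/(t * 1) mulr1 addrAC.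
- by rewrite subrr.
- by apply: filterE => z; apply: (@diffC_sub R id (fun=> b)) => //; exact: diffC_cst.
- by apply: filterE => z /eqP; rewrite subr_eq0 => /eqP ->.
Qed.

(** If f = (z - b)^k G with |f| <= M, Cauchy's formula on a square of half-side r bounds G by 8 M /
    r^k for |w - b| < r / 2. So |f w| <= 8 M / 2^k for every k. *)
Lemma flat_holo_eq0 f b : holo f b -> (forall k, divisible_power f b k) ->
  \forall z \near b, f z = 0.
Proof.
move=> hf hk; have df : differentiable f b by exact: nbhs_singleton hf.
pose M := nrm (f b) + 1; have M0 : 0 <= M by rewrite addr_ge0 ?nrm_ge0.
have [d d0 dP] : exists2 d : R, 0 < d & forall z, nrm (z - b) < d -> differentiable f z /\ nrm (f z) <= M.
  have /continuous_nvP/(_ 1 ltr01)[d2 d20 D2] := differentiable_continuous df.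
  have [d3 d30 D3] := (near_nvP b _).1 hf; exists (Num.min d2 d3); first by rewrite lt_min d20.
  move=> y; rewrite lt_min => /andP[/D2 h /D3 ?]; split=> //.
  rewrite -[nv _]/(nrm (f y - f b)) in h.
  have -> : f y = f b + (f y - f b) by rewrite addrC subrK.
  by apply: le_trans (nrmD _ _) _; rewrite lerD2l ltW.
pose r := d / 3; have r0 : 0 < r by rewrite divr_gt0.
have r3 : 3 * r = d by rewrite /r; field.
apply/(near_nvP b (fun z => f z = 0)); exists (r / 2); first by rewrite divr_gt0.
move=> w; rewrite -[nv _]/(nrm (w - b)) => hw.
apply/eqP; rewrite -nrm_eq0; apply/eqP/le_anti; rewrite nrm_ge0 andbT.
apply/ler_addgt0Pr => e e0; rewrite add0r.
have [k hk2] := div_pow2_lt (mulr_ge0 (ler0n R 8) M0) e0; apply: le_trans (ltW hk2).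
have [g hg gE] := hk k.
(* The germ g supplies the value at the removable singularity, while the quotient makes sense on the
   whole square, whose size does not depend on k. *)
pose G (s : C) := if s == 0 then g b else f (b + s) / s ^+ k.
have fG s : f (b + s) = s ^+ k * G s.
  rewrite /G; case: eqP => [->|/eqP s0]; last by rewrite mulrC divfK // expf_neq0.
  by rewrite addr0 (nbhs_singleton gE) subrr.
have dshift (s : C) : differentiable (fun s => b + s) s.
  exact: (@differentiableD C C C (fun=> b) id s (diffC_cst _ _) (diffC_id s)).
have nearG s : (\forall t \near s, t != 0) -> differentiable f (b + s) -> s != 0 -> differentiable G s.
  move=> ht dfs s0.
  apply: (@near_eq_differentiable C C C (fun s => f (b + s) / s ^+ k)).
    by apply: filterS ht => t t0; rewrite /G (negPf t0).
  apply: diffC_mul.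
    exact: (@differentiable_comp C C C C (fun s => b + s) f _ (dshift s) dfs).
  apply: (@differentiableV C C (fun s => s ^+ k)); last by rewrite expf_neq0.
  exact: diffC_exp.
have dG s : rect (- r) r (- r) r s -> differentiable G s.
  move=> /(rect_nrm r0); rewrite r3 => hs.
  have [s0|s0] := eqVneq s 0; last first.
    apply: (nearG _ _ _ s0); last by apply: (dP (b + s) _).1; rewrite addrC addKr.
    apply/(near_nvP s (fun t : C => t != 0)); exists (nrm s); first by rewrite nrm_gt0.
    by move=> t ht; apply: contraTneq ht => ->; rewrite sub0r nvN -leNgt.
  rewrite s0; apply: (@near_eq_differentiable C C C (fun s => g (b + s))).
    have : \forall s \near (0 : C), f (b + s) = s ^+ k * g (b + s).
      have [d1 d10 D1] := (near_nvP b _).1 gE.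
      apply/(near_nvP 0 (fun s => f (b + s) = s ^+ k * g (b + s))); exists d1 => // t.
      by rewrite subr0 => ht; rewrite D1 // addrC addKr.
    apply: filterS => t ft; rewrite /G; case: eqP => [->|/eqP t0]; first by rewrite addr0.
    by rewrite ft mulrC mulKf ?expf_neq0.
  apply: (@differentiable_comp C C C C (fun s => b + s) g _ (dshift 0)).
  by rewrite addr0; exact: nbhs_singleton hg.
have hwr : nrm (w - b) < r by apply: lt_trans hw _; move: r0; lra.
have [in1 in2] := nrm_lt_in hwr.
have cG := cauchy_sq r0 dG in1 in2.
have K0 := ksq_neq0 r0; have K4 := ksq_ge r0.
have pr : 0 < r ^+ k by rewrite exprn_gt0.
have bound : nrm (G (w - b)) <= 8 * M / r ^+ k.
  have -> : G (w - b) = G (w - b) * ksq r / ksq r by rewrite mulfK.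
  rewrite -cG nrmM nrmV ler_pdivrMr ?nrm_gt0 //.
  apply: (@le_trans _ _ (8 * M / r ^+ k * 4)); last first.
    by rewrite ler_wpM2l // divr_ge0 ?mulr_ge0 // ltW.
  have -> : 8 * M / r ^+ k * 4 = 16 * (M / r ^+ k * (2 / r)) * r by field; rewrite !gt_eqF.
  apply: le_sq => // [z hz|z hz].
    by apply: continuous_div (sqf_neq hz in1 in2); apply: diffC_cont; apply: dG; case: hz.
  have zr := sqfP hz; have z0 := sqf_nz r0 hz.
  have h1 : r / 2 <= nrm (z - (w - b)).
    have : nrm z <= nrm (z - (w - b)) + nrm (w - b) by rewrite -{1}(subrK (w - b) z) nrmD.
    by move: (nrm z) (nrm (z - _)) (nrm (w - b)) zr hw => u v t; lra.
  rewrite nrmM nrmV; apply: ler_pM; rewrite ?invr_ge0 ?nrm_ge0 //.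
    rewrite /G (negPf z0) nrmM nrmV nrmX; apply: ler_pM; rewrite ?invr_ge0 ?exprn_ge0 ?nrm_ge0 //.
      have [] // := dP (b + z) _; rewrite addrC addKr -r3; apply: rect_nrm => //; by case: hz.
    by rewrite lef_pV2 ?posrE ?exprn_gt0 ?nrm_gt0 // lerXn2r ?nnegrE ?nrm_ge0 // ltW.
  have -> : 2 / r = (r / 2)^-1 by field; rewrite gt_eqF.
  by rewrite lef_pV2 ?posrE ?divr_gt0 // (lt_le_trans _ h1) // divr_gt0.
have -> : w = b + (w - b) by rewrite addrC subrK.
rewrite fG nrmM nrmX; apply: le_trans (ler_pM (exprn_ge0 _ (nrm_ge0 _)) (nrm_ge0 _)
  (_ : nrm (w - b) ^+ k <= (r / 2) ^+ k) bound) _.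
  by rewrite lerXn2r ?nnegrE ?nrm_ge0 ?divr_ge0 ?ltW.
rewrite le_eqVlt; apply/orP; left; apply/eqP.
by rewrite expr_div_n; field; rewrite !gt_eqF ?exprn_gt0.
Qed.

Lemma holo_order f b : holo f b ->
  (\forall z \near b, f z = 0) \/
  exists k g, [/\ holo g b, g b != 0 & \forall z \near b, f z = (z - b) ^+ k * g z].
Proof.
move=> hf; have [all|/existsNP[k0 nk0]] := pselect (forall k, divisible_power f b k).
  by left; exact: flat_holo_eq0.
right; have d0 : divisible_power f b 0.
  by exists f => //; apply: filterE => z; rewrite expr0 mul1r.
have [k [hk nk]] : exists k, divisible_power f b k /\ ~ divisible_power f b k.+1.
  elim: k0 nk0 => [//|k ih nk]; have [hk|/ih//] := pselect (divisible_power f b k).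
  by exists k.
have [g hg gE] := hk; exists k, g; split=> //; apply/eqP => g0.
have [h hh hE] := holo_div hg g0; apply: nk; exists h => //.
by move: gE hE; apply: filterS2 => z -> ->; rewrite exprSr mulrA.
Qed.

End Order.

(** * Flatness over a discrete valuation ring *)

Section QuotientModule.
Local Open Scope quotient_scope.
Variables (A : comNzRingType) (V : lmodType A) (K : {pred V}).
Hypothesis K_zmod : zmod_closed K.
Hypothesis K_scale : forall a v, v \in K -> a *: v \in K.

(** The closure proof is a phantom argument, so that the subgroup structure can be attached to this
    copy of K. The copy [quotl] of the quotient carries the stability under scalars in the same
    way. *)
Definition subm_pred & zmod_closed K : {pred V} := K.
HB.instance Definition _ := GRing.isZmodClosed.Build V (subm_pred K_zmod) K_zmod.
Definition quotm : zmodType := Quotient.quot (subm_pred K_zmod).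
Definition quotm_pi (v : V) : quotm := \pi_(Quotient.quot (subm_pred K_zmod)) v.

Lemma quotm_piP v w : quotm_pi v = quotm_pi w <-> v - w \in K.
Proof.
rewrite -[_ \in K]/(v - w \in subm_pred K_zmod) Quotient.idealrBE.
by split=> [/eqP|/eqP].
Qed.

Lemma quotm_piB v w : quotm_pi (v - w) = quotm_pi v - quotm_pi w.
Proof. exact: (raddfB \pi_(Quotient.quot (subm_pred K_zmod))). Qed.

Lemma quotm_piD v w : quotm_pi (v + w) = quotm_pi v + quotm_pi w.
Proof. exact: (raddfD \pi_(Quotient.quot (subm_pred K_zmod))). Qed.

Definition quotm_scale (_ : forall a v, v \in K -> a *: v \in K) (a : A) (x : quotm) : quotm :=
  quotm_pi (a *: repr (x : Quotient.quot (subm_pred K_zmod))).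

Lemma quotm_scaleE a v : quotm_scale K_scale a (quotm_pi v) = quotm_pi (a *: v).
Proof.
apply/quotm_piP; rewrite -scalerBr; apply: K_scale; apply/quotm_piP.
exact: reprK.
Qed.

Lemma quotm_pi_surj (x : quotm) : exists v, x = quotm_pi v.
Proof. by exists (repr (x : Quotient.quot (subm_pred K_zmod))); rewrite /quotm_pi reprK. Qed.

Definition quotl (_ : forall a v, v \in K -> a *: v \in K) : Type := quotm.
HB.instance Definition _ := GRing.Zmodule.on (quotl K_scale).

Program Definition quotl_lmod := @GRing.Zmodule_isLmodule.Build A (quotl K_scale)
  (quotm_scale K_scale) _ _ _ _.
Next Obligation.
by move=> a b x; have [v ->] := quotm_pi_surj x; rewrite !quotm_scaleE scalerA.
Qed.
Next Obligation.
by move=> x; have [v ->] := quotm_pi_surj x; rewrite !quotm_scaleE scale1r.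
Qed.
Next Obligation.
move=> a x y; have [v ->] := quotm_pi_surj x; have [w ->] := quotm_pi_surj y.
by rewrite -quotm_piD !quotm_scaleE scalerDr quotm_piD.
Qed.
Next Obligation.
move=> x a b; have [v ->] := quotm_pi_surj x.
by rewrite !quotm_scaleE scalerDl quotm_piD.
Qed.
HB.instance Definition _ := quotl_lmod.

Lemma quotient_module : exists (P : lmodType A) (f : {linear V -> P}),
  forall v, f v = 0 <-> v \in K.
Proof.
exists (quotl K_scale).
have lin : linear (quotm_pi : V -> quotl K_scale).
  by move=> a v w; rewrite quotm_piD -quotm_scaleE.
pose l := GRing.isLinear.Build _ _ _ _ (quotm_pi : V -> quotl K_scale) lin.
pose f : {linear V -> quotl K_scale} := HB.pack (quotm_pi : V -> quotl K_scale) l.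
exists f => v; have -> : 0 = quotm_pi 0 :> quotm.
  by rewrite -[in RHS](subrr 0) quotm_piB subrr.
by have := quotm_piP v 0; rewrite subr0.
Qed.
End QuotientModule.

Section Flatness.
Variables (A B : comNzRingType) (h : {rmorphism A -> B}) (w : A).

Definition indep m (b : 'I_m -> B) : Prop :=
  forall a : 'I_m -> A, \sum_j h (a j) * b j = 0 -> forall j, a j = 0.

Hypothesis valuation :
  forall a, a = 0 \/ exists k u v, u * v = 1 /\ a = u * w ^+ k.
Hypothesis torsion_free : forall b, h w * b = 0 -> b = 0.

(** As long as all coefficients are divisible by w, the relation can be divided by w, B having no
    w-torsion. This stops because the exponent of w in a j decreases; a coefficient not divisible by
    w is a unit. *)
Lemma unit_relation m (b : 'I_m -> B) (a : 'I_m -> A) j :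
  \sum_j h (a j) * b j = 0 -> a j != 0 ->
  exists a' i v, \sum_j h (a' j) * b j = 0 /\ a' i * v = 1.
Proof.
move=> + aj; case: (valuation (a j)) => [/eqP|]; first by rewrite (negPf aj).
case=> k [u [v [uv]]]; elim: k a {aj} => [|k IH] a aj rel.
  by exists a, j, v; rewrite aj mulr1.
have [[i /asboolP ni]|di] := pselect (exists i, ~~ `[< exists c, a i = w * c >]).
  exists a, i; case: (valuation (a i)) => [ai0|[[|l] [u' [v' [uv' ai]]]]].
  - by case: ni; exists 0; rewrite mulr0.
  - by exists v'; rewrite ai mulr1.
  - by case: ni; exists (u' * w ^+ l); rewrite ai exprS mulrCA.
(* Quotients by w are not known to be unique in A, so the one at j is prescribed in order to lower
   the exponent. *)
have /choice[a' ha'] : forall i, exists c, a i = w * c /\ (i = j -> c = u * w ^+ k).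
  move=> i; have [->|/eqP ij] := eqVneq i j.
    by exists (u * w ^+ k); rewrite aj exprS mulrCA.
  have /asboolP[c hc] : `[< exists c, a i = w * c >].
    by apply: contrapT => /negP ni; apply: di; exists i.
  by exists c; split.
apply: (IH a'); first exact: (ha' j).2.
apply: torsion_free; rewrite -[RHS]rel mulr_sumr; apply: eq_bigr => i _.
by rewrite (ha' i).1 rmorphM mulrA.
Qed.

(** A finitely generated torsion-free module over a valuation ring is free: a relation with a unit
    coefficient expresses one generator by the others. *)
Lemma exists_indep m (b : 'I_m -> B) : exists m' (b' : 'I_m' -> B),
  indep b' /\ forall i, exists a, b i = \sum_j h (a j) * b' j.
Proof.
elim: m b => [|m IH] b; first by exists 0%N, b; split=> [a _|] [].
have [ib|nib] := pselect (indep b).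
  exists m.+1, b; split=> // i; exists (fun j => (j == i)%:R).
  rewrite (bigD1 i) //= eqxx rmorph1 mul1r big1 ?addr0 // => j /negPf->.
  by rewrite rmorph0 mul0r.
have [a [rel [j aj]]] : exists a, \sum_j h (a j) * b j = 0 /\ exists j, a j != 0.
  apply: contrapT => na; apply: nib => a rel j; apply: contrapT => /eqP aj.
  by apply: na; exists a; split=> //; exists j.
have {rel aj}[c [i [v [rel civ]]]] := unit_relation rel aj.
have [m' [b' [ib' sp]]] := IH (fun j => b (lift i j)).
exists m', b'; split=> // l; have [li|[l' ->]] : l = i \/ exists l', l = lift i l'.
- by case: (unliftP i l) => [l' ->|->]; [right; exists l'|left].
- have /choice[d hd] := sp.
  exists (fun j => - v * \sum_l' c (lift i l') * d l' j).
  have bl : b l = - h v * \sum_l' h (c (lift i l')) * b (lift i l').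
    move: rel; rewrite (bigD1_ord i) //= => /(congr1 (fun x => h v * x)).
    rewrite mulr0 mulrDr mulrA -rmorphM mulrC mulrC [v * _]mulrC civ rmorph1 mul1r li.
    by move/eqP; rewrite addr_eq0 => /eqP->; rewrite mulNr.
  rewrite bl; under eq_bigr => l' _ do rewrite hd mulr_sumr.
  rewrite exchange_big mulr_sumr; apply: eq_bigr => j' _ /=.
  rewrite rmorphM rmorphN -mulrA; congr (_ * _).
  rewrite rmorph_sum mulr_suml; apply: eq_bigr => l' _.
  by rewrite rmorphM mulrA.
- exact: sp.
Qed.

Section Bilinear.
Variable N : lmodType A.

(** c s is the coordinate vector of s in the independent family b, for s in the finite set S. *)
Definition frame_rel (S : seq B) m (b : 'I_m -> B) (c : B -> 'I_m -> A) : Prop :=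
  [/\ uniq S, indep b & forall s, s \in S -> s = \sum_j h (c s j) * b j].

(* phi stands for the element \sum_s s (x) phi s of B (x) N. *)
Definition null_tensor (phi : B -> N) : Prop :=
  exists S0 : seq B, forall S m b c, {subset S0 <= S} -> @frame_rel S m b c ->
    forall j, \sum_(s <- S) c s j *: phi s = 0.

Definition pure (b : B) (n : N) : B -> N := fun s => if s == b then n else 0.

Lemma sum_pure S b n m (c : B -> 'I_m -> A) j : uniq S -> b \in S ->
  \sum_(s <- S) c s j *: pure b n s = c b j *: n.
Proof.
move=> uS bS; rewrite (bigD1_seq b) //= /pure eqxx big1_seq ?addr0 // => s /andP[/negPf-> _].
by rewrite scaler0.
Qed.

Definition null_tensor_pred : {pred B -> N} := fun phi => `[< null_tensor phi >].

Lemma null_tensor_zmod : zmod_closed null_tensor_pred.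
Proof.
split=> [|phi psi /asboolP[S1 h1] /asboolP[S2 h2]]; apply/asboolP.
  exists [::] => S m b c _ _ j; rewrite big1_seq // => s _; exact: scaler0.
exists (S1 ++ S2) => S m b c sub fr j.
have sub1 : {subset S1 <= S} by move=> s sS; apply: sub; rewrite mem_cat sS.
have sub2 : {subset S2 <= S} by move=> s sS; apply: sub; rewrite mem_cat sS orbT.
under eq_bigr => s _ do rewrite scalerBr.
by rewrite sumrB (h1 _ _ _ _ sub1 fr) (h2 _ _ _ _ sub2 fr) subrr.
Qed.

Lemma null_tensor_scale a phi : phi \in null_tensor_pred -> a *: phi \in null_tensor_pred.
Proof.
move=> /asboolP[S1 h1]; apply/asboolP; exists S1 => S m b c sub fr j.
have -> : \sum_(s <- S) c s j *: (a *: phi) s = a *: \sum_(s <- S) c s j *: phi s.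
  rewrite scaler_sumr; apply: eq_bigr => s _.
  by rewrite -[(a *: phi) s]/(a *: phi s) !scalerA mulrC.
by rewrite (h1 _ _ _ _ sub fr) scaler0.
Qed.

Lemma frame_rel_lin S m b c a s s' s'' : @frame_rel S m b c ->
  s \in S -> s' \in S -> s'' \in S -> s'' = h a * s + s' ->
  forall j, c s'' j = a * c s j + c s' j.
Proof.
move=> [uS ib sp] sS sS' sS'' e j; apply/eqP; rewrite -subr_eq0; apply/eqP.
apply: (ib (fun j => c s'' j - (a * c s j + c s' j))).
under eq_bigr => i _ do rewrite rmorphB rmorphD rmorphM mulrBl mulrDl -mulrA.
by rewrite sumrB big_split /= -mulr_sumr -!sp // e subrr.
Qed.

(** The hypothesis is applied to one well chosen module: the functions B -> N modulo those whose
    coordinate sums vanish in every frame of every large enough finite set. [pure] becomes bilinear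
    there because coordinates in a frame are unique ([frame_rel_lin]), and a frame for the b i
    exists by [exists_indep]. *)
Lemma tensor_zero_frame k (b : 'I_k -> B) (n : 'I_k -> N) : tensor_zero h b n ->
  exists m (b' : 'I_m -> B) (c : 'I_k -> 'I_m -> A),
    (forall i, b i = \sum_j h (c i j) * b' j) /\
    forall j, \sum_i c i j *: n i = 0.
Proof.
move=> tz; have [P [f f0]] := quotient_module null_tensor_zmod null_tensor_scale.
pose beta s x : P := f (pure s x).
have fE phi psi : phi - psi \in null_tensor_pred -> f phi = f psi.
  by move=> /f0/eqP; rewrite linearB subr_eq0 => /eqP.
have lin a s s' x : beta (h a * s + s') x = a *: beta s x + beta s' x.
  rewrite /beta -linearZ -linearD; apply: fE; apply/asboolP.
  exists [:: s; s'; h a * s + s'] => S m b' c sub fr j.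
  have sS : s \in S by apply: sub; rewrite !inE eqxx.
  have sS' : s' \in S by apply: sub; rewrite !inE eqxx orbT.
  have sS'' : h a * s + s' \in S by apply: sub; rewrite !inE eqxx !orbT.
  have uS : uniq S by case: fr.
  pose p1 := pure s x; pose p2 := pure s' x; pose p3 := pure (h a * s + s') x.
  rewrite -[LHS]/(\sum_(i <- S) c i j *: (p3 i - (a *: p1 i + p2 i))).
  under eq_bigr => i _ do rewrite scalerBr scalerDr scalerA mulrC -scalerA.
  rewrite sumrB big_split /= -scaler_sumr !sum_pure //.
  by rewrite (frame_rel_lin fr sS sS' sS'' erefl) scalerDl scalerA subrr.
have lin2 a s x y : beta s (a *: x + y) = a *: beta s x + beta s y.
  rewrite /beta -linearZ -linearD; congr (f _); apply/funext => i.
  rewrite -[RHS]/(a *: pure s x i + pure s y i) /pure; case: ifP => // _.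
  by rewrite scaler0 addr0.
have b0 x : beta 0 x = 0.
  by have /eqP := lin 1 0 0 x; rewrite mulr0 addr0 scale1r addrC -subr_eq subrr => /eqP.
have b0' x : beta x 0 = 0.
  by have /eqP := lin2 1 x 0 0; rewrite scaler0 addr0 scale1r addrC -subr_eq subrr => /eqP.
have bal : balanced h beta.
  split=> [s s' x|s x y|a s x].
  - by rewrite -[s + s']/(s + s') -[in LHS](mul1r s) -(rmorph1 h) lin scale1r.
  - by rewrite -[in LHS](scale1r x) lin2 scale1r.
  - split; first by rewrite -[in LHS](addr0 (h a * s)) lin b0 addr0.
    by rewrite -[in LHS](addr0 (a *: x)) lin2 b0' addr0.
have := tz P beta bal; rewrite /beta -linear_sum => /f0/asboolP[S0 hS0].
pose S := undup (S0 ++ codom b); have uS : uniq S by exact: undup_uniq.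
have [m [b' [ib' sp]]] := exists_indep (fun i : 'I_(size S) => nth 0 S i).
have /choice[c hc] : forall s, exists c : 'I_m -> A, s \in S -> s = \sum_j h (c j) * b' j.
  move=> s; have [sS|] := boolP (s \in S); last by exists (fun=> 0).
  have si : (index s S < size S)%N by rewrite index_mem.
  have [a ha] := sp (Ordinal si); exists a => _; rewrite -ha /= nth_index //.
have bS i : b i \in S by rewrite mem_undup mem_cat codom_f orbT.
exists m, b', (fun i => c (b i)); split=> [i|j]; first by apply: hc.
rewrite -[RHS](hS0 S m b' c _ _ j) //; last first.
  by move=> s sS; rewrite mem_undup mem_cat sS.
under [RHS]eq_bigr => s _ do rewrite fct_sumE scaler_sumr.
by rewrite exchange_big; apply: eq_bigr => i _; rewrite sum_pure.
Qed.
End Bilinear.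

(** In a frame b' the tensor is the sum over j of b' j (x) (sum over i of c i j m i). The second
    factors vanish after applying f, hence before. *)
Lemma torsion_free_flat : flat_hom h.
Proof.
move=> M N f finj k b m /tensor_zero_frame[l [b' [c [bE cz]]]].
have {}cz j : \sum_i c i j *: m i = 0.
  apply: finj; rewrite linear_sum raddf0 -[RHS](cz j); apply: eq_bigr => i _.
  exact: linearZ.
move=> P beta [bD bD' bZ].
have b0 x : beta 0 x = 0 by have := (bZ 0 0 x).1; rewrite mulr0 scale0r.
have b0' x : beta x 0 = 0 by have := (bZ 0 x 0).2; rewrite !scale0r.
have sumr I (r : seq I) (F : I -> M) x : beta x (\sum_(i <- r) F i) = \sum_(i <- r) beta x (F i).
  by elim/big_rec2: _ => // i y1 y2 _ <-; rewrite bD'.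
have suml I (r : seq I) (F : I -> B) x : beta (\sum_(i <- r) F i) x = \sum_(i <- r) beta (F i) x.
  by elim/big_rec2: _ => // i y1 y2 _ <-; rewrite bD.
under eq_bigr => i _ do rewrite bE suml.
rewrite exchange_big big1 // => j _ /=.
under eq_bigr => i _ do rewrite (bZ _ _ _).1 -(bZ _ _ _).2.
by rewrite -sumr cz b0'.
Qed.
End Flatness.

(** * Morphisms and charts *)

Section Morphisms.
Variable R : realType.
Local Notation C := (CC R).

Definition regular_at (F G : funspace R) (phi : F -> G) (x : F) : Prop :=
  {for x, continuous phi} /\ forall h, reg G (phi x) h -> reg F x (h \o phi).

Section Germ_pull.
Variables (F G : funspace R) (phi : F -> G) (x : F).

Definition germ_pull (a : germ (phi x)) : germ x :=
  germ_of x (\val (repr a) \o phi).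

Hypothesis rphi : regular_at phi x.

Lemma germ_pullE h : reg G (phi x) h ->
  germ_pull (germ_of (phi x) h) = germ_of x (h \o phi).
Proof.
move=> hh; rewrite /germ_pull; set k := \val (repr _).
have hk : reg G (phi x) k by apply/reg_predP; exact: valP.
apply/germ_eqP; [exact: rphi.2|exact: rphi.2|].
apply: (rphi.1 [set y | k y = h y]); apply/(germ_eqP hk hh).
by rewrite /k /germ_of valKd reprK.
Qed.

Lemma germ_pull_zmod : zmod_morphism germ_pull.
Proof.
move=> a b; have [f hf <-] := germ_of_surj a; have [g hg <-] := germ_of_surj b.
rewrite -germ_sub // !germ_pullE //; last exact: reg_sub.
by rewrite -germ_sub //; exact: rphi.2.
Qed.

Lemma germ_pull_monoid : monoid_morphism germ_pull.
Proof.
split=> [|a b].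
  rewrite -(rmorph1 (@germ_cst R G (phi x))) germ_pullE; last exact: reg_cst.
  exact: (rmorph1 (@germ_cst R F x)).
have [f hf <-] := germ_of_surj a; have [g hg <-] := germ_of_surj b.
rewrite -germ_mul // !germ_pullE //; last exact: reg_mul.
by rewrite -germ_mul //; exact: rphi.2.
Qed.

Definition germ_pull_rmorphism : {rmorphism germ (phi x) -> germ x} :=
  HB.pack germ_pull
    (GRing.isZmodMorphism.Build _ _ germ_pull germ_pull_zmod)
    (GRing.isMonoidMorphism.Build _ _ germ_pull germ_pull_monoid).
End Germ_pull.

Section Morphism_of.
Variables (F G : funspace R) (phi : F -> G).

Program Definition morphism_of (rphi : forall x, regular_at phi x) :
    morphism (rs_of_funspace F) (rs_of_funspace G) :=
  @Morphism R (rs_of_funspace F) (rs_of_funspace G) phi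
    (fun x => germ_pull_rmorphism (rphi x)) _ _ _.
Next Obligation. by move=> rphi x; exact: (rphi x).1. Qed.
Next Obligation.
by move=> rphi x a; rewrite /= germ_pullE //; exact: reg_cst.
Qed.
Next Obligation.
move=> rphi x s [f hf ef]; exists (f \o phi); first exact: (rphi x).2.
have h1 : \forall y \near x, s (phi y) = germ_of (phi y) f := (rphi x).1 _ ef.
have h2 : \forall y \near x, reg G (phi y) f := (rphi x).1 _ (reg_near hf).
apply: filterS2 h1 h2 => y -> hfy; exact: (germ_pullE (rphi y) hfy).
Qed.

Variable W : set F.

(** [phi] is defined on the whole of F and regular only on W: coordinate maps have arbitrary values
    outside their domain. *)
Program Definition open_morphism_of (rphi : forall x, W x -> regular_at phi x) :
    morphism (@open_subspace R (rs_of_funspace F) W) (rs_of_funspace G) :=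
  @Morphism R (@open_subspace R (rs_of_funspace F) W) (rs_of_funspace G)
    (fun w => phi (\val w))
    (fun w => germ_pull_rmorphism (rphi (\val w) (set_mem (valP w)))) _ _ _.
Next Obligation.
move=> rphi w; apply: (@continuous_comp _ _ _ (\val : W -> F) phi).
  exact: initial_continuous.
exact: (rphi _ (set_mem (valP w))).1.
Qed.
Next Obligation.
by move=> rphi w a; exact: (germ_pullE (rphi _ (set_mem (valP w))) (reg_cst _ a)).
Qed.
Next Obligation.
move=> rphi w s [f hf ef]; have [cw rw] := rphi _ (set_mem (valP w)).
exists (fun y => germ_of y (f \o phi)).
  by exists (f \o phi); [exact: rw|exact: filterE].
have h1 : \forall y \near w, s (phi (\val y)) = germ_of (phi (\val y)) f.
  exact: (near_val (cw _ ef)).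
have h2 : \forall y \near w, reg G (phi (\val y)) f.
  exact: (near_val (cw _ (reg_near hf))).
apply: filterS2 h1 h2 => y e hfy; by rewrite -(germ_pullE (rphi _ (set_mem (valP y))) hfy) -e.
Qed.
End Morphism_of.

Lemma germ_eq0 (F : funspace R) x f : reg F x f ->
  germ_of x f = 0 <-> \forall y \near x, f y = 0.
Proof.
move=> hf; rewrite -(rmorph0 (@germ_cst R F x)).
exact: germ_eqP hf (reg_cst x 0).
Qed.

Lemma reg_sum (F : funspace R) x k (g : 'I_k -> F -> C) :
  (forall i, reg F x (g i)) -> reg F x (\sum_i g i) /\
  germ_of x (\sum_i g i) = \sum_i germ_of x (g i).
Proof.
elim: k g => [|k IH] g hg.
  rewrite !big_ord0; split; first exact: reg_cst.
  exact: (rmorph0 (@germ_cst R F x)).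
rewrite !big_ord_recr /=; have [h1 h2] := IH _ (fun i => hg (widen_ord (leqnSn k) i)).
set f := \sum_i _ in h1 h2 *.
have hN : reg F x (cst 0 \- g ord_max) by apply: reg_sub => //; exact: reg_cst.
have fE : f + g ord_max = f \- (cst 0 \- g ord_max).
  by apply/funext => y; rewrite /= sub0r opprK.
rewrite fE; split; first exact: reg_sub.
rewrite germ_sub // germ_sub //; last exact: reg_cst.
by rewrite h2 -/(germ_cst x 0) (rmorph0 (@germ_cst R F x)) sub0r opprK.
Qed.

(** [ideal_of] allows any finite list of generators with repetitions; the terms with the same
    generator are collected into one coefficient. *)
Lemma ideal_of_germs (F : funspace R) x k (f : 'I_k -> F -> C) h :
  (forall i, reg F x (f i)) -> reg F x h ->
  ideal_of (range (fun i => germ_of x (f i))) (germ_of x h) <->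
  exists g : 'I_k -> F -> C, (forall i, reg F x (g i)) /\
    \forall y \near x, h y = \sum_i g i y * f i y.
Proof.
move=> hf hh; split=> [[l [r [a [aS aE]]]]|[g [hg gE]]].
  have /choice[j hj] : forall i, exists j, germ_of x (f j) = a i.
    by move=> i; have [j _ <-] := aS i; exists j.
  have /choice[r' hr'] : forall i, exists g, reg F x g /\ germ_of x g = r i.
    by move=> i; have [g ? ?] := germ_of_surj (r i); exists g.
  pose g i : F -> C := \sum_(m < l) (if j m == i then r' m else cst 0).
  have hgm i m : reg F x (if j m == i then r' m else cst 0).
    by case: ifP => _; [exact: (hr' m).1|exact: reg_cst].
  have hg i : reg F x (g i) by exact: (reg_sum (hgm i)).1.
  exists g; split=> //.
  have hp i : reg F x (g i \* f i) by apply: reg_mul.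
  suff : \forall y \near x, h y = (\sum_i (g i \* f i)) y.
    by apply: filterS => y ->; rewrite fct_sumE.
  apply/germ_eqP => //; first exact: (reg_sum hp).1.
  rewrite (reg_sum hp).2 aE.
  under [RHS]eq_bigr => i _ do rewrite germ_mul // (reg_sum (hgm i)).2 mulr_suml.
  rewrite exchange_big; apply: eq_bigr => m _ /=.
  rewrite (bigD1 (j m)) //= eqxx (hr' m).2 hj big1 ?addr0 // => i /negPf ji.
  rewrite eq_sym ji -/(germ_cst x 0) (rmorph0 (@germ_cst R F x)); exact: mul0r.
exists k, (fun i => germ_of x (g i)), (fun i => germ_of x (f i)).
split=> [i|]; first by exists i.
have hp i : reg F x (g i \* f i) by apply: reg_mul.
under eq_bigr => i _ do rewrite -germ_mul //.
rewrite -(reg_sum hp).2; apply/germ_eqP => //; first exact: (reg_sum hp).1.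
by move: gE; apply: filterS => y ->; rewrite fct_sumE.
Qed.

(** The last two hypotheses are the surjectivity of the map of stalks and the statement that its
    kernel is generated by the f i. The inverse [psi] is prescribed only on the zero set. *)
Lemma local_model_intro (F : funspace R) n k (f : 'I_k -> 'rV[C]_n -> C)
    (W : set F) (U : set 'rV[C]_n) (phi : F -> 'rV[C]_n) (psi : 'rV[C]_n -> F) :
  open W -> open U -> (forall i q, U q -> differentiable (f i) q) ->
  (forall x, W x -> [/\ U (phi x), forall i, f i (phi x) = 0 & psi (phi x) = x]) ->
  (forall q, U q -> (forall i, f i q = 0) -> W (psi q) /\ phi (psi q) = q) ->
  (forall x, W x -> @regular_at F (affine_fun 'rV[C]_n) phi x) ->
  (forall x N, W x -> nbhs x N ->
     \forall q \near phi x, (forall i, f i q = 0) -> N (psi q)) ->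
  (forall x h, W x -> reg F x h -> exists2 g, reg (affine_fun 'rV[C]_n) (phi x) g &
     \forall y \near x, h y = g (phi y)) ->
  (forall x h, W x -> reg (affine_fun 'rV[C]_n) (phi x) h ->
     (\forall y \near x, h (phi y) = 0) ->
     exists g : 'I_k -> 'rV[C]_n -> C, (forall i, reg (affine_fun 'rV[C]_n) (phi x) (g i)) /\
       \forall q \near phi x, h q = \sum_i g i q * f i q) ->
  forall x, W x -> @local_model R (rs_of_funspace F) x n k f (phi x).
Proof.
move=> oW oU df hphi hpsi rphi nphi ext ker x Wx.
exists W, U, (open_morphism_of rphi); split; first by split=> //; case: (hphi x Wx).
have rf i y : W y -> reg (affine_fun 'rV[C]_n) (phi y) (f i).
  move=> Wy; have [Uy _ _] := hphi y Wy.
  have := open_nbhs_nbhs (conj oU Uy : open_nbhs (phi y) U).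
  by apply: filterS => q; exact: df.
split=> //; first by move=> w <-.
split.
- move=> w w' e; apply: val_inj.
  have [_ _ <-] := hphi _ (set_mem (valP w)); have [_ _ <-] := hphi _ (set_mem (valP w')).
  by congr psi.
- apply/seteqP; split=> [_ [w _ <-]|q [Uq fq]].
    by have [] := hphi _ (set_mem (valP w)).
  have [Wq pq] := hpsi q Uq fq.
  by exists (exist _ (psi q) (mem_set Wq)).
- move=> w N [N' [[V oV VE] N'w] sub]; have Ww := set_mem (valP w).
  have Vw : nbhs (\val w) V.
    by apply: open_nbhs_nbhs; split=> //; move: N'w; rewrite -VE.
  have hM := nphi _ _ Ww Vw; exists [set q | (forall i, f i q = 0) -> V (psi q)] => //.
  move=> w' /= hw'; apply: sub; rewrite -VE /=.
  have [_ fw' pw'] := hphi _ (set_mem (valP w')).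
  by rewrite -[X in V X]pw'; exact: hw'.
- move=> w b; have Ww := set_mem (valP w).
  have [h hh <-] := germ_of_surj b; have [g hg gE] := ext _ _ Ww hh.
  exists (germ_of (phi (\val w) : affine_fun 'rV[C]_n) g).
  rewrite [LHS](germ_pullE (rphi _ Ww) hg).
  apply/germ_eqP => //; first exact: (rphi _ Ww).2.
  by move: gE; apply: filterS => y ->.
- move=> w a; have Ww := set_mem (valP w).
  have [h hh <-] := germ_of_surj a.
  rewrite [X in X = 0](germ_pullE (rphi _ Ww) hh).
  rewrite germ_eq0; last exact: (rphi _ Ww).2.
  rewrite ideal_of_germs //; last by move=> i; exact: rf.
  split=> [h0|[g [hg gE]]]; first exact: ker.
  have := (rphi _ Ww).1 _ gE.
  have nW : \forall y \near \val w, W y by exact: open_nbhs_nbhs.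
  apply: filterS2 nW => y Wy /= -> ; have [_ fy _] := hphi _ Wy.
  by rewrite big1 // => i _; rewrite fy mulr0.
Qed.
End Morphisms.

(** * Charts of induced and coinduced spaces *)

Section Charts.
Variable R : realType.
Local Notation C := (CC R).

(** Both maps are total and matter only on W and U. The last condition determines the structure
    sheaf of F on W. *)
Definition chart (F : funspace R) n (W : set F) (U : set 'rV[C]_n)
    (phi : F -> 'rV[C]_n) (psi : 'rV[C]_n -> F) : Prop :=
  [/\ open W /\ open U,
      forall x, W x -> U (phi x) /\ psi (phi x) = x,
      forall q, U q -> W (psi q) /\ phi (psi q) = q,
      (forall x, W x -> {for x, continuous phi}) /\
      (forall q, U q -> {for q, continuous psi}) &
      forall x f, W x -> reg F x f <-> holo (f \o psi) (phi x)].

Lemma holo_comp (V V' V'' : normedModType C) (h : V -> V') (f : V' -> V'') p :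
  (\forall y \near p, differentiable h y) -> holo f (h p) -> holo (f \o h) p.
Proof.
move=> dh df; have ch : {for p, continuous h}.
  exact: (differentiable_continuous (nbhs_singleton dh)).
have df' : \forall y \near p, differentiable f (h y) by exact: (ch _ df).
by apply: filterS2 dh df' => y d1 d2; exact: (differentiable_comp d1 d2).
Qed.

Lemma holo_ext (V : normedModType C) (f g : V -> C) p :
  (\forall y \near p, f y = g y) -> holo f p -> holo g p.
Proof. exact: (@reg_ext R (affine_fun V) p f g). Qed.

Lemma chart_reg (F : funspace R) n W U phi psi : @chart F n W U phi psi ->
  forall x h, W x -> holo h (phi x) -> reg F x (h \o phi).
Proof.
move=> [[oW oU] h1 h2 [c1 c2] hr] x h Wx hh; apply/hr => //.
apply: holo_ext hh; have Ux := (h1 x Wx).1.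
have nU : \forall q \near phi x, U q by exact: open_nbhs_nbhs.
by apply: filterS nU => q /h2[_ /= ->].
Qed.

Lemma chart_local_model (F : funspace R) n W U phi psi : @chart F n W U phi psi ->
  forall x (f : 'I_0 -> 'rV[C]_n -> C), W x ->
  @local_model R (rs_of_funspace F) x n 0 f (phi x).
Proof.
move=> ch x f Wx; have [[oW oU] h1 h2 [c1 c2] hr] := ch.
apply: (@local_model_intro R F n 0 f W U phi psi) => //.
- by move=> [].
- by move=> y Wy; have [? ?] := h1 y Wy; split=> // -[].
- by move=> q Uq _; exact: h2.
- move=> y Wy; split; first exact: c1.
  by move=> h; exact: (chart_reg ch).
- move=> y N Wy Ny; have [Uy py] := h1 y Wy.
  have : \forall q \near phi y, N (psi q) by apply: (c2 _ Uy); rewrite py.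
  by apply: filterS => q ? _.
- move=> y h Wy /hr => /(_ Wy) hh; exists (h \o psi) => //.
  have nW : \forall z \near y, W z by exact: open_nbhs_nbhs.
  by apply: filterS nW => z /h1[_ /= ->].
- move=> y h Wy hh h0; exists (fun=> cst 0); split=> [[]//|].
  have [Uy py] := h1 y Wy.
  have nU : \forall q \near phi y, U q by exact: open_nbhs_nbhs.
  have h0' : \forall q \near phi y, h (phi (psi q)) = 0.
    by apply: (c2 _ Uy [set z | h (phi z) = 0]); rewrite py.
  by apply: filterS2 nU h0' => q /h2[_ ->] ->; rewrite big_ord0.
Qed.

Lemma chart_nonsingular (F : funspace R) n W U phi psi : @chart F n W U phi psi ->
  forall x, W x -> @nonsingular_at R (rs_of_funspace F) x.
Proof.
move=> ch x Wx; exists n, (fun=> cst 0), (phi x); exact: chart_local_model ch _ _ Wx.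
Qed.

Lemma continuous_at_val (T S : topologicalType) (Z : set S) (f : T -> Z) x :
  {for x, continuous (\val \o f : T -> S)} -> {for x, continuous f}.
Proof.
move=> cf N [N' [[V oV VE] N'x] sub].
have : \forall y \near x, V (\val (f y)).
  by apply: cf; apply: open_nbhs_nbhs; split=> //; move: N'x; rewrite -VE.
by apply: filterS => y Vy; apply: sub; rewrite -VE.
Qed.

Lemma differentiable_idfun (V : normedModType C) (u : V) : differentiable (id : V -> V) u.
Proof. have [h _] := is_diff_id u; exact: h. Qed.

Lemma differentiable_row0 n k (u : 'rV[C]_n) :
  differentiable (fun v : 'rV[C]_n => row_mx (0 : 'rV[C]_k) v) u.
Proof.
exact: (differentiable_row_mx (differentiable_cst _ _) (differentiable_idfun u)).1.
Qed.

Lemma open_preimage_on (T S : topologicalType) (W : set T) (f : T -> S) (V : set S) :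
  open W -> (forall x, W x -> {for x, continuous f}) -> open V ->
  open [set x | W x /\ V (f x)].
Proof.
move=> oW cf oV; rewrite openE => x [Wx Vx].
have nW : \forall y \near x, W y by exact: open_nbhs_nbhs.
have nV : \forall y \near x, V (f y) by apply: (cf x Wx); exact: open_nbhs_nbhs.
by apply: filterS2 nW nV => y ? ?; split.
Qed.

Lemma open_preimage (T S : topologicalType) (f : T -> S) (V : set S) :
  (forall x, {for x, continuous f}) -> open V -> open [set x | V (f x)].
Proof.
move=> cf oV; have := @open_preimage_on T S setT f V openT (fun x _ => cf x) oV.
by congr open; apply/seteqP; split=> x //= [].
Qed.

(** The coordinates b straighten Z: their first k components are equations of Z, the last n are
    coordinates on it. The point z0 is the value of the inverse outside its domain. *)
Lemma induced_chart (E : funspace R) k n W U phi psi (b g : 'rV[C]_(k + n) -> 'rV[C]_(k + n))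
    U1 U1' (Z : set E) (z0 : Z) :
  @chart E (k + n) W U phi psi -> biholo b g U1 U1' ->
  (forall y, W y -> U1 (phi y) -> Z y <-> lsubmx (b (phi y)) = 0) ->
  @chart (Defs.induced Z) n [set y | W (\val y) /\ U1 (phi (\val y))]
    [set u | U1' (row_mx 0 u) /\ U (g (row_mx 0 u))]
    (fun y => rsubmx (b (phi (\val y))))
    (fun u => insubd z0 (psi (g (row_mx 0 u)))).
Proof.
move=> [[oW oU] h1 h2 [c1 c2] hr] [oU1 oU1' b1 b2] hZ.
have cval y : {for y, continuous (\val : Z -> E)} by exact: initial_continuous.
have crow (u : 'rV[C]_n) : {for u, continuous (fun v : 'rV[C]_n => row_mx (0 : 'rV[C]_k) v)}.
  exact: (differentiable_continuous (@differentiable_row0 n k u)).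
have oW' : open [set y : Z | W (\val y) /\ U1 (phi (\val y))].
  have oWU : open [set y | W y /\ U1 (phi y)] by exact: open_preimage_on.
  exact: (open_preimage cval oWU).
set U' : set 'rV[C]_n := [set u | U1' (row_mx 0 u) /\ U (g (row_mx 0 u))]; have oU' : open U'.
  have oV : open [set q | U1' q /\ U (g q)].
    by apply: open_preimage_on => // q /b2[_ _ /differentiable_continuous].
  exact: (open_preimage crow oV).
have valZ u : U' u -> Z (psi (g (row_mx 0 u))) /\
    [/\ W (psi (g (row_mx 0 u))), phi (psi (g (row_mx 0 u))) = g (row_mx 0 u) &
      U1 (g (row_mx 0 u)) /\ b (g (row_mx 0 u)) = row_mx 0 u].
  move=> [u1 u2]; have [Wu pu] := h2 _ u2; have [gu1 bg _] := b2 _ u1.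
  by split=> //; apply/hZ => //; rewrite pu // bg row_mxKl.
have insE u : U' u -> \val (insubd z0 (psi (g (row_mx 0 u)))) = psi (g (row_mx 0 u)).
  by move=> /valZ[Zu _]; rewrite insubdK //; exact: mem_set.
have rowE (y : Z) : W (\val y) -> U1 (phi (\val y)) ->
    row_mx 0 (rsubmx (b (phi (\val y)))) = b (phi (\val y)).
  move=> Wy Uy; rewrite -[RHS]hsubmxK; congr row_mx; apply/esym.
  by apply/(hZ _ Wy Uy); exact: set_mem (valP y).
have phiU (y : Z) : W (\val y) /\ U1 (phi (\val y)) -> U' (rsubmx (b (phi (\val y)))).
  move=> [Wy Uy]; rewrite /U' /= rowE //; have [Uby -> _] := b1 _ Uy.
  by split=> //; case: (h1 _ Wy).
split.
- by split.
- move=> y [Wy Uy]; split; first by apply: phiU.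
  apply: val_inj; rewrite insE; last exact: phiU.
  by rewrite rowE //; have [_ -> _] := b1 _ Uy; case: (h1 _ Wy).
- move=> u Uu; have [Zu [Wu pu [U1u bg]]] := valZ u Uu.
  by rewrite /= insE // pu bg row_mxKr.
- split.
  + move=> y [Wy Uy]; have [_ _ db] := b1 _ Uy.
    apply: (@continuous_comp _ _ _ (phi \o \val : Z -> _) (rsubmx \o b) y).
      exact: (@continuous_comp _ _ _ (\val : Z -> _) phi y (cval y) (c1 _ Wy)).
    apply: (@continuous_comp _ _ _ b rsubmx) (differentiable_continuous db) _.
    exact: differentiable_continuous (differentiable_rsubmx _).
  + move=> u Uu; apply: continuous_at_val.
    have [Zu [Wu pu [U1u bg]]] := valZ u Uu; have [u1 u2] := Uu.
    have [_ _ dg] := b2 _ u1.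
    have cc : {for u, continuous (fun v => psi (g (row_mx 0 v)))}.
      apply: (@continuous_comp _ _ _ (fun v => row_mx 0 v) (psi \o g) u (crow u)).
      exact: (@continuous_comp _ _ _ g psi _ (differentiable_continuous dg) (c2 _ u2)).
    move=> N; rewrite /= insE // => /cc.
    have nU : \forall v \near u, U' v by exact: open_nbhs_nbhs.
    by apply: filterS2 nU => v Uv; rewrite /= insE.
- move=> y f [Wy Uy]; have [Uby gby dby] := b1 _ Uy; have [Upy ppy] := h1 _ Wy.
  have nU1 : \forall q \near phi (\val y), U1 q by exact: open_nbhs_nbhs.
  have nU : \forall q \near phi (\val y), U q by exact: open_nbhs_nbhs.
  split=> [[G rG GE]|hf].
  + have hG : holo (G \o psi) (g (row_mx 0 (rsubmx (b (phi (\val y)))))).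
      by rewrite rowE // gby; apply/hr.
    have dgr : \forall u \near rsubmx (b (phi (\val y))),
        differentiable (g \o (fun v => row_mx 0 v)) u.
      have nU' : \forall u \near rsubmx (b (phi (\val y))), U' u.
        by apply: open_nbhs_nbhs; split=> //; exact: phiU.
      apply: filterS nU' => u [u1 _]; have [_ _ dg] := b2 _ u1.
      exact: (differentiable_comp (@differentiable_row0 n k u) dg).
    apply: holo_ext (holo_comp dgr hG).
    have nU' : \forall u \near rsubmx (b (phi (\val y))), U' u.
      by apply: open_nbhs_nbhs; split=> //; exact: phiU.
    have [/= ey] : insubd z0 (psi (g (row_mx 0 (rsubmx (b (phi (\val y))))))) = y.
      by apply: val_inj; rewrite insE; [rewrite rowE // gby|exact: phiU].
    have cpsi : {for rsubmx (b (phi (\val y))), continuous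
        (fun u => insubd z0 (psi (g (row_mx 0 u))) : Z)}.
      apply: continuous_at_val; have [_ [Wu pu [U1u bg]]] := valZ _ (phiU _ (conj Wy Uy)).
      have [u1 u2] := phiU _ (conj Wy Uy); have [_ _ dg] := b2 _ u1.
      have cc : {for rsubmx (b (phi (\val y))), continuous (fun v => psi (g (row_mx 0 v)))}.
        apply: (@continuous_comp _ _ _ (fun v => row_mx 0 v) (psi \o g) _ (crow _)).
        exact: (@continuous_comp _ _ _ g psi _ (differentiable_continuous dg) (c2 _ u2)).
      move=> N; rewrite /= insE => [/cc|]; last exact: phiU.
      by apply: filterS2 nU' => v Uv; rewrite /= insE.
    have GE' : \forall u \near rsubmx (b (phi (\val y))),
        f (insubd z0 (psi (g (row_mx 0 u)))) =
        G (\val (insubd z0 (psi (g (row_mx 0 u))) : Z)).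
      by apply: (cpsi [set z : Z | f z = G (\val z)]); rewrite ey.
    apply: filterS2 nU' GE' => u Uu /= ->; by rewrite insE.
  + exists (f \o (fun u => insubd z0 (psi (g (row_mx 0 u)))) \o rsubmx \o b \o phi).
      apply/hr => //.
      have db : \forall q \near phi (\val y), differentiable (rsubmx \o b) q.
        apply: filterS nU1 => q /b1[_ _ db].
        exact: (differentiable_comp db (differentiable_rsubmx (b q))).
      apply: holo_ext (holo_comp db hf).
      by apply: filterS nU => q /h2[_ /= ->].
    have nW : \forall z \near y, W (\val z) /\ U1 (phi (\val z)) by exact: open_nbhs_nbhs.
    apply: filterS nW => z [Wz Uz] /=; congr f; apply: val_inj.
    rewrite insE; last exact: phiU.
    by rewrite rowE //; have [_ -> _] := b1 _ Uz; have [_ ->] := h1 _ Wz.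
Qed.

(** Phi is the coordinate map on the cone and sigma a holomorphic section of p. A function
    downstairs is compared with its pull-back through sigma in one direction and through Phi in the
    other. *)
Lemma coinduced_chart (V : normedModType C) (A : set V) (T : topologicalType)
    (p : Defs.induced (F := affine_fun V) A -> T) (pc : continuous p) n
    (W : set T) (U : set 'rV[C]_n) (Phi : V -> 'rV[C]_n) (phi : T -> 'rV[C]_n)
    (sigma : 'rV[C]_n -> V) (a0 : A) :
  open W -> open U ->
  (forall y, W y -> exists v, p v = y) ->
  (forall v, W (p v) -> [/\ phi (p v) = Phi (\val v), U (Phi (\val v)),
     \forall w \near \val v, differentiable Phi w &
     p (insubd a0 (sigma (Phi (\val v)))) = p v]) ->
  (forall u, U u -> [/\ A (sigma u), Phi (sigma u) = u, differentiable sigma u &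
     W (p (insubd a0 (sigma u)))]) ->
  (forall y, W y -> {for y, continuous phi}) ->
  @chart (coinduced pc) n W U phi (fun u => p (insubd a0 (sigma u))).
Proof.
move=> oW oU psurj hp hs cphi.
have insE u : U u -> \val (insubd a0 (sigma u)) = sigma u.
  by move=> /hs[Au _ _ _]; rewrite insubdK //; exact: mem_set.
have cins u : U u -> {for u, continuous (fun u => insubd a0 (sigma u) : A)}.
  move=> Uu; apply: continuous_at_val.
  have [_ _ /differentiable_continuous cs _] := hs _ Uu.
  have nU : \forall v \near u, U v by exact: open_nbhs_nbhs.
  move=> N; rewrite /= insE // => /cs.
  by apply: filterS2 nU => v Uv; rewrite /= insE.
have phiK u : U u -> phi (p (insubd a0 (sigma u))) = u.
  move=> Uu; have [Au Pu ds Wu] := hs _ Uu; have [-> _ _ _] := hp _ Wu.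
  by rewrite insE.
split=> //.
- by move=> y Wy; have [v vy] := psurj _ Wy; move: Wy; rewrite -vy => /hp[-> ? _ ->].
- by move=> u Uu; split; [have [] := hs _ Uu|exact: phiK].
- split=> // u Uu.
  apply: (@continuous_comp _ _ _ (fun u => insubd a0 (sigma u) : A) p u (cins u Uu)).
  exact: pc.
- move=> y f Wy; have [Uy py] : U (phi y) /\ p (insubd a0 (sigma (phi y))) = y.
    by have [v vy] := psurj _ Wy; move: Wy; rewrite -vy => /hp[-> ? _ ->].
  have nU : \forall u \near phi y, U u by exact: open_nbhs_nbhs.
  split=> [rf|hf].
  + have [G hG GE] := nbhs_singleton rf _ py.
    have ds : \forall u \near phi y, differentiable sigma u.
      by apply: filterS nU => u /hs[].
    rewrite insE // in hG.
    apply: holo_ext (holo_comp ds hG).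
    have GE' : \forall u \near phi y, f (p (insubd a0 (sigma u))) =
        G (\val (insubd a0 (sigma u) : A)).
      exact: (cins _ Uy [set z : A | f (p z) = G (\val z)]).
    by apply: filterS2 nU GE' => u Uu /= ->; rewrite insE.
  + have nW : \forall z \near y, W z by exact: open_nbhs_nbhs.
    have nh : \forall z \near y, holo (f \o (fun u => p (insubd a0 (sigma u)))) (phi z).
      exact: (cphi _ Wy _ (near_join hf)).
    apply: filterS2 nW nh => z Wz hz v vz; move: Wz hz; rewrite -{z}vz => Wv.
    have [-> Uv dv pv] := hp _ Wv => hv.
    exists (f \o (fun u => p (insubd a0 (sigma u))) \o Phi).
      exact: (holo_comp dv hv).
    have nWv : \forall z \near v, W (p z) by apply: (pc v); exact: open_nbhs_nbhs.
    by apply: filterS nWv => z /hp[_ _ _ /= ->].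
Qed.

End Charts.

(** * Projective spaces *)

Section Topology.

Lemma hausdorff_sep (T : topologicalType) :
  (forall x y : T, x <> y -> exists A B : set T,
     [/\ open A, open B, A x, B y & forall z, A z -> B z -> False]) ->
  hausdorff_space T.
Proof.
move=> h; rewrite open_hausdorff => x y /eqP/h[A [B [oA oB Ax By dAB]]].
exists (A, B); first by split; exact: mem_set.
by split=> //; apply/eqP/seteqP; split=> z // [/dAB h' /h'].
Qed.

Lemma sep_hausdorff (T : topologicalType) : hausdorff_space T ->
  forall x y : T, x <> y -> exists A B : set T,
     [/\ open A, open B, A x, B y & forall z, A z -> B z -> False].
Proof.
rewrite open_hausdorff => h x y /eqP/h[[A B] [/set_mem Ax /set_mem By] [oA oB /eqP AB]].
by exists A, B; split=> // z Az Bz; have : set0 z by rewrite -AB.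
Qed.

Lemma hausdorff_inj (T S : topologicalType) (f : T -> S) :
  continuous f -> injective f -> hausdorff_space S -> hausdorff_space T.
Proof.
move=> cf fi /sep_hausdorff hS; apply: hausdorff_sep => x y xy.
have /hS[A [B [oA oB Ax By dAB]]] : f x <> f y by move=> /fi.
exists (f @^-1` A), (f @^-1` B); split=> //; last by move=> z; exact: dAB.
- exact: open_preimage.
- exact: open_preimage.
Qed.

Lemma hausdorff_prod (T S : topologicalType) :
  hausdorff_space T -> hausdorff_space S -> hausdorff_space (T * S)%type.
Proof.
move=> /sep_hausdorff hT /sep_hausdorff hS; apply: hausdorff_sep => -[x1 x2] [y1 y2] ne.
have [e1|/eqP/hT[A [B [oA oB Ax By dAB]]]] := eqVneq x1 y1.
- have /hS[A [B [oA oB Ax By dAB]]] : x2 <> y2 by move=> e2; apply: ne; rewrite e1 e2.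
  exists (snd @^-1` A), (snd @^-1` B); split=> //; last by move=> z; exact: dAB.
  + by apply: open_preimage => // z; exact: cvg_snd.
  + by apply: open_preimage => // z; exact: cvg_snd.
- exists (fst @^-1` A), (fst @^-1` B); split=> //; last by move=> z; exact: dAB.
  + by apply: open_preimage => // z; exact: cvg_fst.
  + by apply: open_preimage => // z; exact: cvg_fst.
Qed.

Lemma compact_set_type (T : topologicalType) (B K : set T) :
  compact K -> K `<=` B -> compact (\val @^-1` K : set B).
Proof.
move=> cK KB F FF FK; have [x [Kx cl]] := cK (\val @ F) _ FK.
pose x' : B := exist _ x (mem_set (KB _ Kx)).
exists x'; split=> // A N FA [N' [[V oV VE] N'x] sub].
have VN : nbhs x V by apply: open_nbhs_nbhs; split=> //; move: N'x; rewrite -VE.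
have FvA : F (\val @^-1` (\val @` A)) by apply: filterS FA => y Ay; exists y.
have [y [[z Az zy] Vy]] := cl (\val @` A) V FvA VN.
by rewrite -zy in Vy; exists z; split=> //; apply: sub; rewrite -VE.
Qed.
Lemma open_neq0 (R : realType) (V : topologicalType) (f : V -> CC R) :
  (forall v, {for v, continuous f}) -> open [set v | f v != 0].
Proof.
move=> cf; apply: (@open_preimage V (CC R) f [set z | z != 0]) => //.
rewrite openE => z /= z0; apply/(near_nvP z (fun w => w != 0)).
exists (nv z); first by rewrite nv_gt0.
move=> y yz; apply/eqP => y0; move: yz; rewrite y0 sub0r nvN; by rewrite ltxx.
Qed.

End Topology.

Section ProjectiveSpace.
Variable R : realType.
Local Notation C := (CC R).
Variable n : nat.
Local Notation CP := (@CP R n).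
Local Notation line := (@line R n).
Implicit Types (v w : @cone R n) (x : CP).

Lemma line_surj x : exists v, line v = x.
Proof. by exists (repr x); exact: reprK. Qed.

Lemma line_eqP v w : line v = line w <-> exists2 a : C, a != 0 & \val w = a *: \val v.
Proof. by split=> [/eqmodP/asboolP|h]; last by apply/eqmodP/asboolP. Qed.

Lemma open_line (V : set CP) : open (line @^-1` V : set (@cone R n)) -> open V.
Proof. by []. Qed.

(** An arbitrary choice of homogeneous coordinates; it enters only through conditions that are
    invariant under scaling. *)
Definition hrep (x : CP) : 'rV[C]_n.+1 := \val (repr x : @cone R n).

Lemma hrep_line v : exists2 a : C, a != 0 & hrep (line v) = a *: \val v.
Proof. by apply/line_eqP; rewrite /line reprK. Qed.

Lemma hrep_neq0 x : hrep x != 0.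
Proof. exact: set_mem (valP (repr x : @cone R n)). Qed.

Lemma coord_continuous i : continuous (fun v => \val v 0 i : C).
Proof.
move=> v; apply: (@continuous_comp _ _ _ (\val : @cone R n -> _) (fun u : 'rV[C]_n.+1 => u 0 i)).
  exact: initial_continuous.
exact: differentiable_continuous (diff_coord_fun i (differentiable_idfun _)).1.
Qed.

Variable i : 'I_n.+1.

Definition ratios (v : 'rV[C]_n.+1) : 'rV[C]_n := \row_j (v 0 (lift i j) / v 0 i).
Definition slice (u : 'rV[C]_n) : 'rV[C]_n.+1 :=
  \row_k (if unlift i k is Some j then u 0 j else 1).
Definition acoord (x : CP) := ratios (hrep x).
Definition acoord_dom : set CP := [set x | hrep x 0 i != 0].

Lemma acoord_domE v : acoord_dom (line v) = (\val v 0 i != 0) :> Prop.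
Proof. by rewrite /acoord_dom /=; have [a a0 ->] := hrep_line v; rewrite mxE mulf_eq0 (negPf a0). Qed.

Lemma ratiosZ (a : C) (v : 'rV[C]_n.+1) : a != 0 -> ratios (a *: v) = ratios v.
Proof.
by move=> a0; apply/rowP => j; rewrite !mxE invfM mulrACA mulfV // mul1r.
Qed.

Lemma acoordE v : acoord (line v) = ratios (\val v).
Proof. by rewrite /acoord; have [a a0 ->] := hrep_line v; rewrite ratiosZ. Qed.

Lemma slice_i u : slice u 0 i = 1.
Proof. by rewrite mxE unlift_none. Qed.

Lemma slice_lift u j : slice u 0 (lift i j) = u 0 j.
Proof. by rewrite mxE liftK. Qed.

Lemma slice_neq0 u : slice u != 0.
Proof.
apply/eqP => /rowP/(_ i); rewrite slice_i mxE => /eqP; by rewrite oner_eq0.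
Qed.

Lemma ratiosK u : ratios (slice u) = u.
Proof. by apply/rowP => j; rewrite mxE slice_lift slice_i divr1. Qed.

Lemma sliceK (v : 'rV[C]_n.+1) : v 0 i != 0 -> slice (ratios v) = (v 0 i)^-1 *: v.
Proof.
move=> vi; apply/rowP => k; rewrite !mxE; case: unliftP => [j ->|->].
  by rewrite mxE mulrC.
by rewrite mulVf.
Qed.

Lemma differentiable_slice u : differentiable slice u.
Proof.
apply: differentiable_rV => k; case: (unliftP i k) => [j ->|->].
  have -> : (fun y => slice y 0 (lift i j)) = (fun y => y 0 j).
    by apply/funext => y; rewrite slice_lift.
  exact: (diff_coord_fun _ (differentiable_idfun u)).1.
have -> : (fun y => slice y 0 i) = cst 1 by apply/funext => y; rewrite slice_i.
exact: differentiable_cst.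
Qed.

Lemma differentiable_ratios (v : 'rV[C]_n.+1) : v 0 i != 0 -> differentiable ratios v.
Proof.
move=> vi; apply: differentiable_rV => j.
have -> : (fun y => ratios y 0 j) = (fun y => y 0 (lift i j) / y 0 i).
  by apply/funext => y; rewrite mxE.
have dc k := (diff_coord_fun k (differentiable_idfun v)).1.
have di : differentiable (fun w : C => w^-1) (v 0 i).
  have := diffC_inv vi; congr (differentiable _ _).
  by apply/funext => w; rewrite subr0.
exact: (differentiableM (dc (lift i j)) (differentiable_comp (dc i) di)).
Qed.

Lemma open_acoord_dom : open acoord_dom.
Proof.
apply: open_line; have -> : line @^-1` acoord_dom = [set v : @cone R n | \val v 0 i != 0].
  by apply/funext => v /=; exact: acoord_domE.
exact: (open_neq0 (@coord_continuous i)).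
Qed.

Lemma acoord_continuous x : acoord_dom x -> {for x, continuous acoord}.
Proof.
have [v <-] := line_surj x => dv N; rewrite nbhsE => -[N' [oN' N'x] sub].
pose V := [set y | acoord_dom y /\ N' (acoord y)].
suff : nbhs (line v) V by apply: filterS => y [_ /sub].
apply: open_nbhs_nbhs; split=> //; apply: open_line.
have -> : line @^-1` V = [set w : @cone R n | \val w 0 i != 0 /\ N' (ratios (\val w))].
  by apply/funext => w; rewrite /V /= acoordE acoord_domE.
apply: (@open_preimage_on _ _ [set w : @cone R n | \val w 0 i != 0] (ratios \o \val) N' _ _ oN').
  exact: (open_neq0 (@coord_continuous i)).
move=> w wi; apply: continuous_comp; first exact: initial_continuous.
exact: differentiable_continuous (differentiable_ratios wi).
Qed.

Lemma acoord_inj v w : \val v 0 i != 0 -> \val w 0 i != 0 ->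
  acoord (line v) = acoord (line w) -> line v = line w.
Proof.
move=> vi wi; rewrite !acoordE => /(congr1 slice); rewrite !sliceK // => e.
apply/line_eqP; exists (\val w 0 i / \val v 0 i); first by rewrite mulf_neq0 ?invr_neq0.
by rewrite -scalerA e scalerA mulfV // scale1r.
Qed.
End ProjectiveSpace.

Section ProjectiveTopology.
Variable R : realType.
Local Notation C := (CC R).
Variable n : nat.
Local Notation CP := (@CP R n).
Local Notation line := (@line R n).

Lemma nrm_continuous : continuous (@nrm R).
Proof.
move=> z; apply: (@continuous_comp _ _ _ (fun z : C => `|z|) (@re R)); last exact: re_continuous.
exact: norm_continuous.
Qed.

Lemma open_coord_lt (i j : 'I_n.+1) :
  open [set x : CP | nrm (hrep x 0 i) < nrm (hrep x 0 j)].
Proof.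
apply: open_line; set A := _ @^-1` _.
have -> : A = [set v : @cone R n | nrm (\val v 0 i) - nrm (\val v 0 j) < 0].
  apply/funext => v; rewrite /A /=; have [a a0 ->] := hrep_line v.
  by rewrite !mxE !nrmM ltr_pM2l ?nrm_gt0 // subr_lt0.
apply: (@open_preimage _ R (fun v : @cone R n => nrm (\val v 0 i) - nrm (\val v 0 j)) [set y | y < 0]).
  move=> v; apply: continuousB.
    apply: (@continuous_comp _ _ _ (fun v : @cone R n => \val v 0 i) (@nrm R)).
      exact: coord_continuous.
    exact: nrm_continuous.
  apply: (@continuous_comp _ _ _ (fun v : @cone R n => \val v 0 j) (@nrm R)).
    exact: coord_continuous.
  exact: nrm_continuous.
exact: open_lt.
Qed.

Lemma row_neq0P m (v : 'rV[C]_m) : v != 0 -> exists i, v 0 i != 0.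
Proof.
by apply: contra_neqP => /forallNP h; apply/rowP => i; rewrite mxE; apply/eqP; move: (h i) => /negP; rewrite negbK.
Qed.

(** Points of a common affine chart are separated there. Otherwise some i, j satisfy x_i <> 0 = x_j
    and y_j <> 0 = y_i, and the inequalities |z_j| < |z_i| and |z_i| < |z_j| separate them. *)
Lemma CP_hausdorff : hausdorff_space CP.
Proof.
have hrV : hausdorff_space 'rV[C]_n by exact: norm_hausdorff.
apply: hausdorff_sep => x y xy.
have [[i [xi yi]]|no] := pselect (exists i, acoord_dom i x /\ acoord_dom i y).
  have /(sep_hausdorff hrV)[A [B [oA oB Ax By dAB]]] : acoord i x <> acoord i y.
    move: xi yi xy; have [v <-] := line_surj x; have [w <-] := line_surj y.
    by rewrite !acoord_domE => vi wi xy /(acoord_inj vi wi).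
  have co z : acoord_dom i z -> {for z, continuous (@acoord R n i)} by exact: acoord_continuous.
  exists [set z | acoord_dom i z /\ A (acoord i z)], [set z | acoord_dom i z /\ B (acoord i z)].
  split=> //; last by move=> z [_ Az] [_ Bz]; exact: dAB Az Bz.
  + by apply: open_preimage_on => //; exact: open_acoord_dom.
  + by apply: open_preimage_on => //; exact: open_acoord_dom.
have [i xi] := row_neq0P (hrep_neq0 x); have [j yj] := row_neq0P (hrep_neq0 y).
have yi : hrep y 0 i = 0 by apply: contrapT => /eqP yi; apply: no; exists i.
have xj : hrep x 0 j = 0 by apply: contrapT => /eqP xj; apply: no; exists j.
exists [set z | nrm (hrep z 0 j) < nrm (hrep z 0 i)], [set z | nrm (hrep z 0 i) < nrm (hrep z 0 j)].
split=> /=.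
- exact: open_coord_lt.
- exact: open_coord_lt.
- by rewrite xj nrm0 nrm_gt0.
- by rewrite yi nrm0 nrm_gt0.
- by move=> z h1 h2; move: (lt_trans h1 h2); rewrite ltxx.
Qed.

Definition box : set C := [set z | (-1 <= re z <= 1) /\ (-1 <= im z <= 1)].

Lemma compact_box : compact box.
Proof.
have -> : box = (fun p : R * R => mkC p.1 p.2) @` (`[-1, 1]%classic `*` `[-1, 1]%classic).
  apply/seteqP; split=> [z [h1 h2]|_ [[x y] [/= h1 h2] <-]].
    by exists (re z, im z); rewrite /= ?in_itv //= mkCK.
  by move: h1 h2; rewrite !in_itv.
apply: continuous_compact; last by apply: compact_setX; exact: segment_compact.
apply: continuous_subspaceT => p; apply: cvg_mkC; [exact: cvg_fst|exact: cvg_snd].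
Qed.

(* the product expresses that some coordinate equals 1, as a closed condition *)
Definition normalized : set 'rV[C]_n.+1 :=
  [set v | (forall i, box (v 0 i)) /\ \prod_i (v 0 i - 1) = 0].

Lemma normalized_neq0 v : normalized v -> v != 0.
Proof.
move=> [_ /eqP/prodf_eq0[i _ h]]; apply: contraL h => /eqP->.
by rewrite mxE sub0r oppr_eq0 oner_eq0.
Qed.

Lemma compact_normalized : compact normalized.
Proof.
have cB : compact [set v : 'rV[C]_n.+1 | forall i, box (v ord0 i)].
  exact: (@rV_compact C n.+1 (fun=> box) (fun=> compact_box)).
have -> : normalized = [set v : 'rV[C]_n.+1 | forall i, box (v ord0 i)] `&`
    [set v | \prod_i (v 0 i - 1) = 0] by [].
apply: compact_closedI => //.
have cp : continuous (fun v : 'rV[C]_n.+1 => \prod_i (v 0 i - 1)).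
  apply: (@continuous_big C _ *%R) => //; first exact: mul_continuous.
  move=> i _ v; exact: (differentiable_continuous
    (differentiableB (diff_coord_fun i (differentiable_idfun v)).1 (differentiable_cst (1 : C) v))).
have := open_neq0 cp; rewrite -closedC; congr closed.
by apply/seteqP; split=> v /=; [move/negP; rewrite negbK => /eqP|move->; rewrite eqxx].
Qed.

Lemma normalize (v : @cone R n) : exists2 w : @cone R n, normalized (\val w) & line w = line v.
Proof.
have [i0 vi0] := row_neq0P (set_mem (valP v)).
(* Division by a coordinate of largest modulus makes it 1 and brings the others into the unit
   disc. *)
have [i _ imax] := @arg_maxP _ R _ i0 predT (fun i => nrm (\val v 0 i)) erefl.
have vi : \val v 0 i != 0.
  by rewrite -nrm_eq0 gt_eqF // (lt_le_trans _ (imax i0 erefl)) // nrm_gt0.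
pose a := (\val v 0 i)^-1; have a0 : a != 0 by rewrite invr_neq0.
have w0 : a *: \val v != 0 by rewrite scaler_eq0 (negPf a0) /=; exact: set_mem (valP v).
exists (exist _ (a *: \val v) (mem_set w0)); last first.
  by apply/esym/line_eqP; exists a.
split=> [j|]; last by apply/eqP/prodf_eq0; exists i => //; rewrite /= mxE mulVf // subrr.
have le1 : nrm ((a *: \val v) 0 j) <= 1.
  rewrite mxE nrmM; have /= h := imax j erefl.
  have <- : nrm a * nrm (\val v 0 i) = 1 by rewrite -nrmM mulVf // nrm1.
  by rewrite ler_wpM2l ?nrm_ge0.
split; rewrite -ler_norml.
  by apply: le_trans le1; exact: ler_re.
by apply: le_trans le1; exact: ler_im.
Qed.
End ProjectiveTopology.

(** * Reduced divisors and fibres *)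

Section Divisors.
Variable R : realType.
Local Notation C := (CC R).

Lemma chart_restrict (F : funspace R) n W U phi psi (V : set F) :
  @chart R F n W U phi psi -> open V ->
  @chart R F n (W `&` V) [set q | U q /\ V (psi q)] phi psi.
Proof.
move=> [[oW oU] h1 h2 [c1 c2] hr] oV; split.
- by split; [exact: openI|exact: open_preimage_on].
- by move=> x [/h1[Ux px] Vx]; rewrite /= px.
- by move=> q [/h2[Wq pq] Vq].
- by split=> [x [/c1]|q [/c2]].
- by move=> x f [Wx _]; exact: hr.
Qed.

(* The first condition is flatness over the discrete valuation ring O_(C, pi x);
   the second says that the fibre of pi is reduced at x, so that it carries the
   induced structure. *)
Definition reduced_divisor (F : funspace R) (pi : F -> C) (x : F) : Prop :=
  (forall h, reg F x h -> (\forall y \near x, (pi y - pi x) * h y = 0) ->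
     \forall y \near x, h y = 0) /\
  (forall h, reg F x h -> (\forall y \near x, pi y = pi x -> h y = 0) ->
     exists2 g, reg F x g & \forall y \near x, h y = (pi y - pi x) * g y).

Lemma reduced_divisor_chart (F : funspace R) n W U phi psi pi x :
  @chart R F n W U phi psi -> W x ->
  reduced_divisor (F := affine_fun 'rV[C]_n) (pi \o psi) (phi x) ->
  reduced_divisor pi x.
Proof.
move=> ch Wx [g1 g2]; have [[oW oU] h1 h2 [c1 c2] hr] := ch.
have [Ux px] := h1 _ Wx; rewrite /= px in g1 g2.
have nW : \forall y \near x, W y by exact: open_nbhs_nbhs.
have toq (P : set F) : (\forall y \near x, P y) -> \forall q \near phi x, P (psi q).
  by move=> nP; apply: (c2 _ Ux); rewrite px.
have tox (P : set 'rV[C]_n) : (\forall q \near phi x, P q) -> \forall y \near x, P (phi y).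
  by move=> nP; exact: (c1 _ Wx).
split=> h hh.
  move=> /toq h0; have := tox _ (g1 _ ((hr x h Wx).1 hh) h0).
  by apply: filterS2 nW => y /h1[_ /= ->].
move=> /toq h0; have [g hg gE] := g2 _ ((hr x h Wx).1 hh) h0.
exists (g \o phi); first exact: (chart_reg ch).
have := tox _ gE.
by apply: filterS2 nW => y /h1[_ /= ->].
Qed.

Lemma reduced_divisor_ext (F : funspace R) (pi pi' : F -> C) x :
  (\forall y \near x, pi y = pi' y) -> reduced_divisor pi x -> reduced_divisor pi' x.
Proof.
move=> e [g1 g2]; have ex := nbhs_singleton e; split=> h hh h0.
  apply: g1 => //; by apply: filterS2 e h0 => y -> ; rewrite ex.
have [|g hg gE] := g2 h hh.
  by apply: filterS2 e h0 => y -> ; rewrite ex.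
by exists g => //; apply: filterS2 e gE => y <-; rewrite ex.
Qed.

Lemma nv_line (V : normedModType C) (e : V) (d : R) : 0 < d ->
  exists2 s : C, s != 0 & nv (s *: e) < d.
Proof.
move=> d0; have e1 : 0 < nv e + 1 by rewrite ltr_wpDl ?nv_ge0.
exists (mkC (d / (nv e + 1)) 0).
  by rewrite -nrm_gt0 nrm_mkC ?normr_gt0 gt_eqF ?divr_gt0.
rewrite nvZ nrm_mkC gtr0_norm ?divr_gt0 // mulrAC ltr_pdivrMr // ltr_pM2l //.
by rewrite ltrDl.
Qed.

Lemma dense_torsion_free (V : normedModType C) (f : V -> C) (p : V) :
  (\forall y \near p, forall d : R, 0 < d -> exists2 y', nv (y' - y) < d & f y' != f p) ->
  forall h, holo h p -> (\forall y \near p, (f y - f p) * h y = 0) ->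
  \forall y \near p, h y = 0.
Proof.
move=> dense h hh h0.
have [d1 d10 D1] := (near_nvP _ _).1 (filterI h0 hh).
have := dense; have nd : \forall y \near p, nv (y - p) < d1.
  by apply/(near_nvP p (fun y => nv (y - p) < d1)); exists d1.
apply: filterS2 nd => y yd dy; apply/eqP; apply: contraT => hy.
have [_ /differentiable_continuous ch] := D1 _ yd.
have n1 : \forall z \near y, h z != 0.
  have := (@open_neq0 R C id (fun v => @cvg_id _ _)); rewrite openE => /(_ _ hy).
  exact: ch.
have n2 : \forall z \near y, nv (z - p) < d1.
  apply/(near_nvP y (fun z => nv (z - p) < d1)).
  exists (d1 - nv (y - p)); first by rewrite subr_gt0.
  move=> z hz; have -> : z - p = (z - y) + (y - p) by rewrite addrA subrK.
  by apply: le_lt_trans (nvD _ _) _; rewrite -ltrBrDr.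
have [d d0 Dd] := (near_nvP _ _).1 (filterI n1 n2).
have [z /Dd[hz /D1[/eqP + _]] fz] := dy d d0.
by rewrite mulf_eq0 (negPf hz) orbF subr_eq0 (negPf fz).
Qed.

(** If f y = 0, then f takes the value r (a + r) at y + r e, which has a single nonzero root: when r
    fails, r / 2 does not. *)
Lemma dense_quadratic (V : normedModType C) (f : V -> C) (e y : V) (a : C) (d : R) :
  (forall r, f (y + r *: e) = f y + r * a + r ^+ 2) -> 0 < d ->
  exists2 y', nv (y' - y) < d & f y' != 0.
Proof.
move=> fE d0; have [fy|] := eqVneq (f y) 0; last first.
  by exists y; rewrite // subrr nv0.
have [r r0 rd] := nv_line e d0.
have [ar|ar] := eqVneq (a + r) 0.
  exists (y + (r / 2) *: e).
    rewrite addrC addKr mulrC -scalerA nvZ; apply: le_lt_trans rd.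
    rewrite ler_piMl ?nv_ge0 //.
    rewrite -leC -nrmE; have -> : mkC 1 0 = 1 :> C by [].
    by rewrite ger0_norm ?invr_ge0 // invf_le1 // ler1n.
  rewrite fE fy add0r expr2 -mulrDr.
  have -> : a + r / 2 = - (r / 2) by move/eqP: ar; rewrite addr_eq0 => /eqP ->; field.
  by rewrite mulrN oppr_eq0 mulf_neq0 // mulf_neq0 // invr_eq0 pnatr_eq0.
exists (y + r *: e); first by rewrite addrC addKr.
by rewrite fE fy add0r expr2 -mulrDr mulf_neq0.
Qed.

Lemma reduced_divisor_coordinate (V : normedModType C) (lam : V -> C) (p e : V) :
  (forall y t, lam (y + t *: e) = lam y + t) -> holo lam p ->
  reduced_divisor (F := affine_fun V) lam p.
Proof.
move=> lamE hlam; split=> h hh h0.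
  apply: (@dense_torsion_free V lam p) h0 => //; apply: filterE => y d d0.
  have [ly|] := eqVneq (lam y) (lam p); last by exists y; rewrite // subrr nv0.
  have [r r0 rd] := nv_line e d0; exists (y + r *: e); first by rewrite addrC addKr.
  by rewrite lamE ly -subr_eq0 addrAC subrr add0r.
have lE (y : V) (t : C) : lam (y + t *: e) - lam p = lam y - lam p + t.
  by rewrite lamE addrAC.
have hl : holo (fun y => lam y - lam p) p.
  by apply: filterS hlam => y dy; exact: differentiableB dy (differentiable_cst _ _).
have h0' : \forall y \near p, lam y - lam p = 0 -> h y = 0.
  by apply: filterS h0 => y hy /eqP; rewrite subr_eq0 => /eqP.
exact: (divisible_by_coordinate lE (subrr _) hl hh h0').
Qed.

Definition quadric (v : 'rV[C]_4) : C :=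
  hcoord v 0 * hcoord v 3 - hcoord v 1 * hcoord v 2.

Lemma differentiable_hcoord n k (v : 'rV[C]_n.+1) :
  differentiable (fun y : 'rV[C]_n.+1 => hcoord y k) v.
Proof. exact: (diff_coord_fun _ (differentiable_idfun v)).1. Qed.

Lemma hcoordD n (v w : 'rV[C]_n.+1) k : hcoord (v + w) k = hcoord v k + hcoord w k.
Proof. by rewrite /hcoord mxE. Qed.

Lemma hcoordZ n (a : C) (v : 'rV[C]_n.+1) k : hcoord (a *: v) k = a * hcoord v k.
Proof. by rewrite /hcoord mxE. Qed.

Lemma differentiable_quadric v : differentiable quadric v.
Proof.
have d k := @differentiable_hcoord 3 k v.
exact: (differentiableB (differentiableM (d 0%N) (d 3%N)) (differentiableM (d 1%N) (d 2%N))).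
Qed.

(* quadric = ((x0 + x3) / 2)^2 - (((x0 - x3) / 2)^2 + x1 x2) *)
Lemma quadric_divides (h : 'rV[C]_4 -> C) : holo h 0 ->
  (\forall y \near (0 : 'rV[C]_4), quadric y = 0 -> h y = 0) ->
  exists2 g, holo g 0 & \forall y \near (0 : 'rV[C]_4), h y = quadric y * g y.
Proof.
pose lam (v : 'rV[C]_4) := (hcoord v 0 + hcoord v 3) * 2^-1.
pose del (v : 'rV[C]_4) := (hcoord v 0 - hcoord v 3) * 2^-1.
pose s v := del v * del v + hcoord v 1 * hcoord v 2.
pose e (a b c d : C) : 'rV[C]_4 := \row_(i < 4) nth 0 [:: a; b; c; d] i.
have eE a b c d k : (k < 4)%N -> hcoord (e a b c d) k = nth 0 [:: a; b; c; d] k.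
  by move=> k4; rewrite /hcoord mxE inordK.
have d k (v : 'rV[C]_4) := @differentiable_hcoord 3 k v.
have dc (v : 'rV[C]_4) : differentiable (cst (2^-1 : C)) v by exact: differentiable_cst.
have dlam v : differentiable lam v.
  exact: (differentiableM (differentiableD (d 0%N v) (d 3%N v)) (dc v)).
have ddel v : differentiable del v.
  exact: (differentiableM (differentiableB (d 0%N v) (d 3%N v)) (dc v)).
have ds v : differentiable s v.
  exact: (differentiableD (differentiableM (ddel v) (ddel v)) (differentiableM (d 1%N v) (d 2%N v))).
have h00 k : hcoord (0 : 'rV[C]_4) k = 0 by rewrite /hcoord mxE.
have lamE (y : 'rV[C]_4) (t : C) : lam (y + t *: e 1 0 0 1) = lam y + t.
  by rewrite /lam !hcoordD !hcoordZ !eE //=; field.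
have lam0 : lam 0 = 0 by rewrite /lam !h00; ring.
have s0 : s 0 = 0 by rewrite /s /del !h00; ring.
have sE (y : 'rV[C]_4) (t : C) : s (y + t *: e 1 0 0 1) = s y.
  by rewrite /s /del !hcoordD !hcoordZ !eE //=; ring.
have sd : \forall y \near (0 : 'rV[C]_4), forall d : R, 0 < d -> exists2 y', nv (y' - y) < d & s y' != 0.
  (* In this direction s is a quadratic polynomial with leading coefficient 1, since both factors of
     x1 x2 are shifted and x0 - x3 is unchanged. *)
  apply: filterE => y r r0; apply: (@dense_quadratic _ s (e 0 1 1 0) y (hcoord y 1 + hcoord y 2)) => //.
  by move=> t; rewrite /s /del !hcoordD !hcoordZ !eE //=; ring.
move=> hh h0.
have qE v : quadric v = lam v ^+ 2 - s v by rewrite /quadric /lam /s /del; field.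
have h0' : \forall y \near (0 : 'rV[C]_4), lam y ^+ 2 - s y = 0 -> h y = 0.
  by apply: filterS h0 => y; rewrite qE.
have hlam : holo lam 0 by apply: filterE => v; exact: dlam.
have hs : holo s 0 by apply: filterE => v; exact: ds.
have [g hg gE] := divisible_by_quadric lamE lam0 hlam hs s0 sE sd hh h0'.
by exists g => //; apply: filterS gE => y; rewrite qE.
Qed.

Lemma quadric_dense (y : 'rV[C]_4) (r : R) : 0 < r ->
  exists2 y', nv (y' - y) < r & quadric y' != 0.
Proof.
pose e : 'rV[C]_4 := \row_(i < 4) nth 0 [:: 1; 0; 0; 1] i.
have eE k : (k < 4)%N -> hcoord e k = nth 0 [:: 1; 0; 0; 1] k.
  by move=> k4; rewrite /hcoord mxE inordK.
apply: (@dense_quadratic _ quadric e y (hcoord y 0 + hcoord y 3)) => t.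
by rewrite /quadric !hcoordD !hcoordZ !eE //=; ring.
Qed.

Lemma near_neq0 (V : normedModType C) (f : V -> C) p : {for p, continuous f} ->
  f p != 0 -> \forall y \near p, f y != 0.
Proof.
move=> cf fp; have := (@open_neq0 R C id (fun v => @cvg_id _ _)); rewrite openE => /(_ _ fp).
exact: cf.
Qed.

Lemma near_differentiable_inv (V : normedModType C) (f : V -> C) p : differentiable f p ->
  f p != 0 -> differentiable (fun y => (f y)^-1) p.
Proof.
move=> df fp; have di : differentiable (fun w : C => w^-1) (f p).
  by have := diffC_inv fp; congr (differentiable _ _); apply/funext => w; rewrite subr0.
exact: (differentiable_comp df di).
Qed.

(** Used for the time function at a node: there it is a unit times the quadric, so both conditions
    reduce to the density of the complement of the cone and to [quadric_divides]. *)
Lemma reduced_divisor_quadric (tau u : 'rV[C]_4 -> C) : holo u 0 -> u 0 != 0 ->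
  (\forall y \near (0 : 'rV[C]_4), tau y - tau 0 = u y * quadric y) ->
  reduced_divisor (F := affine_fun 'rV[C]_4) tau (0 : 'rV[C]_4).
Proof.
move=> hu u0 tE; have nu := near_neq0 (differentiable_continuous (nbhs_singleton hu)) u0.
split=> h hh h0.
  apply: (@dense_torsion_free _ tau 0) h0 => //.
  have [r r0 Dr] := (near_nvP _ _).1 (filterI tE nu).
  apply/(near_nvP 0 (fun y => forall d : R, 0 < d -> exists2 y', nv (y' - y) < d & tau y' != tau 0)).
  exists (r / 2) => [|y yr d d0]; first by rewrite divr_gt0.
  have md : 0 < Num.min d (r / 2) by rewrite lt_min d0 divr_gt0.
  have [y' ] := quadric_dense y md; rewrite lt_min => /andP[y'd y'r] qy'.
  exists y' => //; rewrite -subr_eq0; have [|-> uy'] := Dr y'.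
    rewrite [r]splitr; have -> : y' - 0 = (y' - y) + (y - 0) by rewrite addrA subrK.
    by apply: le_lt_trans (nvD _ _) _; apply: ltrD.
  by rewrite mulf_neq0.
have [|g hg gE] := quadric_divides hh.
  apply: filterS2 h0 tE => y hy ty qy; apply: hy; apply/eqP; rewrite -subr_eq0 ty qy.
  by rewrite mulr0.
exists (fun y => (u y)^-1 * g y).
  have : \forall y \near (0 : 'rV[C]_4), differentiable (fun y => (u y)^-1) y.
    by apply: filterS2 hu nu => y; exact: near_differentiable_inv.
  by apply: filterS2 hg => y dg du; exact: differentiableM du dg.
near=> y; have -> : h y = quadric y * g y by near: y.
have -> : tau y - tau 0 = u y * quadric y by near: y.
have uy : u y != 0 by near: y.
by field.
Unshelve. all: by end_near.
Qed.
End Divisors.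

Section Fibres.
Variable R : realType.
Local Notation C := (CC R).

Lemma germ_valuation (b : C) (a : @germ R (affine_fun C) b) :
  a = 0 \/ exists k u v, u * v = 1 /\ a = u * germ_of (b : affine_fun C) (fun z => z - b) ^+ k.
Proof.
have [f hf <-] := germ_of_surj a; have [f0|[k [g [hg gb fE]]]] := holo_order hf.
  by left; apply/germ_eq0.
right; exists k, (germ_of (b : affine_fun C) g), (germ_of (b : affine_fun C) (fun z => (g z)^-1)).
have hw : reg (affine_fun C) b (fun z => z - b).
  apply: filterE => z; exact: differentiableB (differentiable_idfun z) (differentiable_cst b z).
have ng := near_neq0 (differentiable_continuous (nbhs_singleton hg)) gb.
have hgi : reg (affine_fun C) b (fun z => (g z)^-1).
  by apply: filterS2 hg ng => z; exact: near_differentiable_inv.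
have powE : reg (affine_fun C) b (fun z => (z - b) ^+ k) /\
    germ_of (b : affine_fun C) (fun z => (z - b) ^+ k) =
    germ_of (b : affine_fun C) (fun z => z - b) ^+ k.
  elim: k {fE} => [|k [IH1 IH2]].
    split; first exact: (reg_cst (b : affine_fun C) (1 : C)).
    exact: (rmorph1 (@germ_cst R (affine_fun C) b)).
  have -> : (fun z => (z - b) ^+ k.+1) = (fun z => z - b) \* (fun z => (z - b) ^+ k).
    by apply/funext => z; rewrite exprS.
  split; first exact: reg_mul hw IH1.
  by rewrite (germ_mul hw IH1) IH2 exprS.
split.
  rewrite -germ_mul // -(rmorph1 (@germ_cst R (affine_fun C) b)); apply/germ_eqP.
  - exact: reg_mul.
  - exact: reg_cst.
  - by apply: filterS ng => z gz /=; rewrite mulfV.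
rewrite -powE.2 -germ_mul //; last exact: powE.1.
apply/germ_eqP => //; first exact: (@reg_mul R (affine_fun C) b _ _ hg powE.1).
by apply: filterS fE => z ->; rewrite /= mulrC.
Qed.

Lemma reduced_divisor_flat (F : funspace R) (pi : F -> C)
    (rpi : forall x, @regular_at R F (affine_fun C) pi x) x :
  reduced_divisor pi x -> flat_hom (pull (@morphism_of R F (affine_fun C) pi rpi) x).
Proof.
move=> [tf _]; have hw : reg (affine_fun C) (pi x) (fun z => z - pi x).
  apply: filterE => z; exact: differentiableB (differentiable_idfun z) (differentiable_cst _ z).
apply: (@torsion_free_flat _ _ _ (germ_of (pi x : affine_fun C) (fun z => z - pi x))).
  exact: germ_valuation.
move=> a; have [h hh <-] := germ_of_surj a.
have hp := (rpi x).2 _ hw.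
rewrite [X in X * _ = 0](germ_pullE (rpi x) hw) -germ_mul // => /germ_eq0 h0.
by apply/germ_eq0 => //; apply: tf => //; apply: h0; exact: reg_mul.
Qed.

(** Applied to x -> (x, 0) with the first projection as retraction, since N_1 lives in CP^4 x CP^1,
    and to the identity for the other fibres. Composition with r extends functions from the fibre;
    [reduced_divisor] shows that those vanishing on it are multiples of pi - b. *)
Lemma fibre_of_induced (E1 E2 : funspace R) (j : E1 -> E2) (r : E2 -> E1)
    (Z1 : set E1) (Z2 : set E2) (pi : E2 -> C) (b : C)
    (rpi : forall x : Defs.induced Z2, @regular_at R (Defs.induced Z2) (affine_fun C) (pi \o \val) x) :
  (forall x, regular_at j x) -> (forall y, regular_at r y) -> cancel j r ->
  (forall x, Z1 x <-> Z2 (j x) /\ pi (j x) = b) -> (forall y, Z2 y -> pi y = b -> exists x, j x = y) ->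
  (forall y, pi (\val y) = b -> @reduced_divisor R (Defs.induced Z2) (pi \o \val) y) ->
  is_fibre (@morphism_of R (Defs.induced Z2) (affine_fun C) _ rpi) b
    (rs_of_funspace (Defs.induced Z1)).
Proof.
move=> rj rr jK hZ hsurj red.
have jZ (x : Z1) : j (\val x) \in Z2 by apply/mem_set; have [] := (hZ _).1 (set_mem (valP x)).
have pij (x : Z1) : pi (j (\val x)) = b by have [] := (hZ _).1 (set_mem (valP x)).
pose i (x : Defs.induced Z1) : Defs.induced Z2 := exist _ (j (\val x)) (jZ x).
have vc (E : funspace R) (Z : set E) (x : Z) : {for x, continuous (\val : Z -> E)}.
  exact: initial_continuous.
have ci x : {for x, continuous i}.
  apply: continuous_at_val.
  exact: (@continuous_comp _ _ _ (\val : Z1 -> E1) j x (vc _ _ x) (rj (\val x)).1).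
have ri x : regular_at i x.
  split; first exact: ci.
  move=> h [g rg gE]; exists (g \o j); first exact: (rj _).2.
  exact: (ci x _ gE).
exists (morphism_of ri); split.
- by move=> x y /(congr1 \val) /= /(congr1 r); rewrite !jK => /val_inj.
- apply/seteqP; split=> [_ [x _ <-]|y yb]; first exact: pij.
  have [x xy] := hsurj _ (set_mem (valP y)) yb.
  have Zx : Z1 x by apply/hZ; rewrite xy; split=> //; exact: set_mem (valP y).
  by exists (exist _ x (mem_set Zx)) => //; apply: val_inj.
- move=> x N [N' [[V oV VE] N'x] sub].
  have Vx : nbhs (\val x) V by apply: open_nbhs_nbhs; split=> //; move: N'x; rewrite -VE.
  exists [set y | V (r (\val y))].
    apply: (near_val (P := fun y => V (r y))).
    by apply: (rr _).1; rewrite /= jK.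
  by move=> y /= Vy; apply: sub; rewrite -VE /=; rewrite jK in Vy.
- move=> x a; have [h [g rg gE] <-] := germ_of_surj a.
  have rgr : reg (Defs.induced Z2) (i x) (g \o r \o \val).
    exists (g \o r); last exact: filterE.
    by apply: (rr _).2; rewrite /= jK.
  exists (germ_of (i x) (g \o r \o \val)); rewrite [LHS](germ_pullE (ri x) rgr).
  apply/germ_eqP; first exact: (ri x).2.
    by exists g.
  by apply: filterS gE => y ->; rewrite /= jK.
- move=> x a; have [h hh <-] := germ_of_surj a.
  have pix : pi (\val (i x)) = b by exact: pij.
  rewrite [X in X = 0](germ_pullE (ri x) hh) germ_eq0; last exact: (ri x).2.
  split=> [h0|].
    have [|g hg gE] := (red _ pix).2 h hh.
      move: h0 => [N' [[V oV VE] N'x] sub].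
      have Vx : nbhs (\val x) V by apply: open_nbhs_nbhs; split=> //; move: N'x; rewrite -VE.
      have nV : \forall y \near i x, V (r (\val y)).
        apply: (near_val (P := fun y => V (r y))).
        by apply: (rr _).1; rewrite /= jK.
      apply: filterS nV => y Vy; rewrite /= pij => yb.
      have [x' x'y] := hsurj _ (set_mem (valP y)) yb.
      have Zx : Z1 x' by apply/hZ; rewrite x'y; split=> //; exact: set_mem (valP y).
      have -> : y = i (exist _ x' (mem_set Zx)) by apply: val_inj.
      apply: sub; rewrite -VE /=; by rewrite -x'y jK in Vy.
    have hw : reg (affine_fun C) (pi (\val (i x))) (fun z => z - b).
      apply: filterE => z; exact: differentiableB (differentiable_idfun z) (differentiable_cst _ z).
    exists 1%N, (fun=> germ_of (i x) g), (fun=> germ_of (i x) ((fun z => z - b) \o (pi \o \val))).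
    split=> [_|].
      exists (fun z => z - b); first by split=> //; rewrite -pix subrr.
      exact: (germ_pullE (rpi (i x)) hw).
    rewrite big_ord1 -germ_mul //; last exact: (rpi (i x)).2.
    apply/germ_eqP => //; first by apply: reg_mul => //; exact: (rpi (i x)).2.
    by apply: filterS gE => y ->; rewrite mulrC /= pij.
  move=> [k [l [g [gS gE]]]].
  suff : germ_pull_rmorphism (ri x) (germ_of (i x) h) = 0.
    rewrite [X in X = 0](germ_pullE (ri x) hh) germ_eq0 //; exact: (ri x).2.
  rewrite gE rmorph_sum big1 // => m _; have [f [hf f0] <-] := gS m.
  rewrite rmorphM; have hp := (rpi (i x)).2 _ hf.
  have -> : germ_pull_rmorphism (ri x)
      (pull (@morphism_of R (Defs.induced Z2) (affine_fun C) _ rpi) (i x)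
        (germ_of (pi (\val (i x)) : affine_fun C) f)) = 0.
    have -> : pull (@morphism_of R (Defs.induced Z2) (affine_fun C) _ rpi) (i x)
        (germ_of (pi (\val (i x)) : affine_fun C) f) = germ_of (i x) (f \o (pi \o \val)).
      exact: (germ_pullE (rpi (i x)) hf).
    rewrite [LHS](germ_pullE (ri x) hp).
    apply/germ_eq0; first exact: (ri x).2.
    apply: filterE => y /=; rewrite pij -pix; exact: f0.
  by rewrite mulr0.
Qed.
End Fibres.

(** * Rules for differentials and the charts of CP^m x CP^n x C *)

Section Derivations.
Variable R : realType.
Local Notation C := (CC R).
Variable V : normedModType C.
Implicit Types (f g L M : V -> C) (p : V).

(** The differential is recorded as a plain function, so that its formula can be normalized by
    [isd_ext] and [ring]. *)
Definition isd f p L := differentiable f p /\ forall v, 'd f p v = L v.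

Lemma isd_cst a p : isd (fun=> a) p (fun=> 0).
Proof. by split=> [|v]; [exact: differentiable_cst|rewrite diff_cst]. Qed.

Lemma isdD f g p L M : isd f p L -> isd g p M ->
  isd (fun y => f y + g y) p (fun v => L v + M v).
Proof.
move=> [df Lf] [dg Mg]; split=> [|v]; first exact: differentiableD df dg.
by have /(congr1 (fun h => h v)) := diffD df dg; rewrite -Lf -Mg.
Qed.

Lemma isdB f g p L M : isd f p L -> isd g p M ->
  isd (fun y => f y - g y) p (fun v => L v - M v).
Proof.
move=> [df Lf] [dg Mg]; split=> [|v]; first exact: differentiableB df dg.
by have /(congr1 (fun h => h v)) := diffB df dg; rewrite -Lf -Mg.
Qed.

Lemma isdM f g p L M : isd f p L -> isd g p M ->
  isd (fun y => f y * g y) p (fun v => f p * M v + g p * L v).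
Proof.
move=> [df Lf] [dg Mg]; split=> [|v]; first exact: differentiableM df dg.
by have /(congr1 (fun h => h v)) := diffM df dg; rewrite -Lf -Mg.
Qed.

Lemma isdX f p L k : isd f p L ->
  isd (fun y => f y ^+ k.+1) p (fun v => k.+1%:R * f p ^+ k * L v).
Proof.
move=> hf; elim: k => [|k IH].
  have -> : (fun v => 1%:R * f p ^+ 0 * L v) = L.
    by apply/funext => v; rewrite expr0 !mul1r.
  exact: hf.
have := isdM hf IH; have -> : (fun y => f y * f y ^+ k.+1) = (fun y => f y ^+ k.+2).
  by apply/funext => y; rewrite [in RHS]exprS.
congr isd; apply/funext => v.
by rewrite -[in RHS]addn1 natrD exprS; ring.
Qed.

Lemma isd_ext f p L M : L =1 M -> isd f p L -> isd f p M.
Proof. by move=> /funext ->. Qed.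
End Derivations.

Section Pairs.
Variable R : realType.
Local Notation C := (CC R).

Lemma differentiable_pair_fun (V V1 V2 : normedModType C) (f : V -> V1) (g : V -> V2) p :
  differentiable f p -> differentiable g p -> differentiable (fun y => (f y, g y)) p.
Proof. exact: differentiable_pair. Qed.

Lemma differentiable_fst_fun (V1 V2 : normedModType C) (p : V1 * V2) : differentiable fst p.
Proof.
have l : linear (fst : (V1 * V2)%type -> V1) by [].
pose f : {linear (V1 * V2)%type -> V1} := HB.pack (fst : (V1 * V2)%type -> V1)
  (GRing.isLinear.Build C _ _ _ _ l).
have c : continuous f by move=> q; exact: cvg_fst.
exact: (linear_differentiable p c).
Qed.

Lemma differentiable_snd_fun (V1 V2 : normedModType C) (p : V1 * V2) : differentiable snd p.
Proof.
have l : linear (snd : (V1 * V2)%type -> V2) by [].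
pose f : {linear (V1 * V2)%type -> V2} := HB.pack (snd : (V1 * V2)%type -> V2)
  (GRing.isLinear.Build C _ _ _ _ l).
have c : continuous f by move=> q; exact: cvg_snd.
exact: (linear_differentiable p c).
Qed.

Lemma differentiable_scalar_mx1 (p : C) : differentiable (fun s : C => s%:M : 'rV[C]_1) p.
Proof.
apply: differentiable_rV => k; have -> : (fun y : C => (y%:M : 'rV[C]_1) 0 k) = id.
  by apply/funext => y; rewrite mxE (ord1 k) eqxx mulr1n.
exact: differentiable_idfun.
Qed.

Lemma continuous_row_mx (T : topologicalType) a b (f : T -> 'rV[C]_a) (g : T -> 'rV[C]_b) x :
  {for x, continuous f} -> {for x, continuous g} ->
  {for x, continuous (fun y => row_mx (f y) (g y))}.
Proof.
move=> cf cg; apply: (@continuous_comp _ _ _ (fun y => (f y, g y))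
  (fun p : 'rV[C]_a * 'rV[C]_b => row_mx p.1 p.2)).
  exact: (cvg_pair cf cg).
exact: differentiable_continuous
  (differentiable_row_mx (differentiable_fst_fun _) (differentiable_snd_fun _)).1.
Qed.
End Pairs.

Section Ambient.
Variable R : realType.
Local Notation C := (CC R).

Definition dslice n (i : 'I_n.+1) (u : 'rV[C]_n) : 'rV[C]_n.+1 :=
  \row_k (if unlift i k is Some j then u 0 j else 0).

Lemma isd_slice (V : normedModType C) n (i : 'I_n.+1) (f L : V -> 'rV[C]_n) p k :
  (forall j, isd (fun y => f y 0 j) p (fun v => L v 0 j)) ->
  isd (fun y => slice i (f y) 0 k) p (fun v => dslice i (L v) 0 k).
Proof.
move=> hf; have -> : (fun y => slice i (f y) 0 k) =
    (fun y => if unlift i k is Some j then f y 0 j else 1).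
  by apply/funext => y; rewrite mxE.
have -> : (fun v => dslice i (L v) 0 k) =
    (fun y => if unlift i k is Some j then L y 0 j else 0).
  by apply/funext => y; rewrite mxE.
by case: unlift => [j|]; [exact: hf|exact: isd_cst].
Qed.

Lemma isd_coord n (p : 'rV[C]_n) i : isd (fun y : 'rV[C]_n => y 0 i) p (fun v => v 0 i).
Proof.
have [d1 d2] := diff_coord_fun i (differentiable_idfun p); split=> // v; rewrite d2.
by rewrite (diff_val (is_diff_def := is_diff_id p)).
Qed.

(** A vector a of C^(n+1) becomes tangent to the slice z_i = 1 after a multiple of z is subtracted;
    differentials of homogeneous equations do not see this multiple at a zero. *)
Lemma dslice_surj n (i : 'I_n.+1) (a z : 'rV[C]_n.+1) : z 0 i = 1 ->
  dslice i (\row_j (a - a 0 i *: z) 0 (lift i j)) = a - a 0 i *: z.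
Proof.
move=> zi; apply/rowP => k; rewrite mxE; case: unliftP => [j ->|->]; first by rewrite mxE.
by rewrite !mxE zi mulr1 subrr.
Qed.

Lemma hrep_slice n (i : 'I_n.+1) (x : @CP R n) : acoord_dom i x ->
  exists2 a : C, a != 0 & hrep x = a *: slice i (acoord i x).
Proof.
move=> xi; exists (hrep x 0 i) => //.
by rewrite /acoord sliceK // scalerA mulfV // scale1r.
Qed.

Lemma acoord_dom_ex n (x : @CP R n) : exists i, acoord_dom i x.
Proof. by have [i xi] := row_neq0P (hrep_neq0 x); exists i. Qed.

Section Projective_chart.
Variables (n : nat) (i : 'I_n.+1).

Definition cone_slice (u : 'rV[C]_n) : cone n := exist _ (slice i u) (mem_set (slice_neq0 i u)).

Lemma CP_chart : @chart R (CP_fun R n) n (acoord_dom i) setT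
  (acoord i) (fun u => line (cone_slice u)).
Proof.
have insE u : insubd (cone_slice 0) (slice i u) = cone_slice u.
  by apply: val_inj; rewrite insubdK //; apply/mem_set; exact: slice_neq0.
have -> : (fun u => line (cone_slice u)) = (fun u => line (insubd (cone_slice 0) (slice i u))).
  by apply/funext => u; rewrite insE.
apply: (@coinduced_chart R 'rV[C]_n.+1 (cone n) (CP R n) (@line R n) (@line_continuous R n) n
  (acoord_dom i) setT (ratios i) (acoord i) (slice i) (cone_slice 0)).
- exact: open_acoord_dom.
- exact: openT.
- by move=> y _; exact: line_surj.
- move=> v; rewrite acoord_domE => vi; split=> //.
  + exact: acoordE.
  + have nv : \forall w \near (\val v : 'rV[C]_n.+1), (w : 'rV[C]_n.+1) 0 i != 0.
      have := near_neq0 (f := fun w : 'rV[C]_n.+1 => w 0 i) _ vi; apply.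
      exact: differentiable_continuous (isd_coord _ _).1.
    by apply: filterS nv => w; exact: differentiable_ratios.
  + rewrite insE; apply/line_eqP; exists (\val v 0 i) => //=.
    by rewrite sliceK // scalerA mulfV // scale1r.
- move=> u _; split=> //.
  + exact: slice_neq0.
  + exact: ratiosK.
  + exact: differentiable_slice.
  + by rewrite insE acoord_domE /= slice_i oner_neq0.
- exact: acoord_continuous.
Qed.
End Projective_chart.

Section Product_with_line.
Variables m n : nat.
Local Notation amb := ('rV[C]_m.+1 * 'rV[C]_n.+1 * C)%type.

Definition tricone : set amb := [set p | bicone m n p.1].

Definition tbi (p : tricone) : @bicone R m n :=
  exist _ (\val p).1 (mem_set (set_mem (valP p) : bicone m n (\val p).1)).

Definition tline (p : tricone) : @CP R m * @CP R n * C := (biline (tbi p), (\val p).2).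

Lemma tbi_continuous : continuous tbi.
Proof.
move=> p; apply: continuous_at_val.
apply: (@continuous_comp _ _ _ (\val : tricone -> amb) fst); last exact: cvg_fst.
exact: initial_continuous.
Qed.

Lemma tline_continuous : continuous tline.
Proof.
have c2 : continuous (@biline R m n \o tbi).
  move=> p; exact: (@continuous_comp _ _ _ tbi (@biline R m n) p (@tbi_continuous p) (@biline_continuous R m n _)).
have c3 : continuous (fun p : tricone => (\val p).2).
  move=> p; apply: (@continuous_comp _ _ _ (\val : tricone -> amb) snd); last exact: cvg_snd.
  exact: initial_continuous.
by move=> p; exact: (cvg_pair (c2 p) (c3 p)).
Qed.

Definition CPxCPxC_fun : funspace R :=
  @coinduced R (Defs.induced (F := affine_fun amb) tricone) _ tline tline_continuous.

Variables (i : 'I_m.+1) (j : 'I_n.+1).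

Definition zcoord (u : 'rV[C]_(m + n + 1)) : 'rV[C]_m.+1 := slice i (lsubmx (lsubmx u)).
Definition wcoord (u : 'rV[C]_(m + n + 1)) : 'rV[C]_n.+1 := slice j (rsubmx (lsubmx u)).
Definition tcoord (u : 'rV[C]_(m + n + 1)) : C := u 0 (rshift (m + n) ord0).

Definition slice_point u : tricone :=
  exist _ (zcoord u, wcoord u, tcoord u)
    (mem_set (conj (slice_neq0 i _) (slice_neq0 j _) : tricone (zcoord u, wcoord u, tcoord u))).

Definition bidom : set (@CP R m * @CP R n * C) :=
  [set y | acoord_dom i y.1.1 /\ acoord_dom j y.1.2].

Definition bicoord (y : @CP R m * @CP R n * C) : 'rV[C]_(m + n + 1) :=
  row_mx (row_mx (acoord i y.1.1) (acoord j y.1.2)) y.2%:M.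

Lemma zcoord_bicoord y : zcoord (bicoord y) = slice i (acoord i y.1.1).
Proof. by rewrite /zcoord /bicoord !row_mxKl. Qed.

Lemma wcoord_bicoord y : wcoord (bicoord y) = slice j (acoord j y.1.2).
Proof. by rewrite /wcoord /bicoord row_mxKl row_mxKr. Qed.

Lemma tcoord_bicoord y : tcoord (bicoord y) = y.2.
Proof. by rewrite /tcoord /bicoord row_mxEr mxE eqxx mulr1n. Qed.

Lemma CPxCPxC_chart : @chart R CPxCPxC_fun (m + n + 1) bidom setT
  bicoord (fun u => tline (slice_point u)).
Proof.
have insE u : insubd (slice_point 0) (zcoord u, wcoord u, tcoord u) = slice_point u.
  by apply: val_inj; rewrite insubdK //; exact: valP (slice_point u).
have -> : (fun u => tline (slice_point u)) =
    (fun u => tline (insubd (slice_point 0) (zcoord u, wcoord u, tcoord u))).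
  by apply/funext => u; rewrite insE.
pose Phi (p : amb) : 'rV[C]_(m + n + 1) := row_mx (row_mx (ratios i p.1.1) (ratios j p.1.2)) p.2%:M.
have dl a b (u : 'rV[C]_(a + b)) := @differentiable_lsubmx C 1 a b u.
have dr a b (u : 'rV[C]_(a + b)) := @differentiable_rsubmx C 1 a b u.
apply: (@coinduced_chart R amb tricone _ tline tline_continuous (m + n + 1)
  bidom setT Phi bicoord (fun u => (zcoord u, wcoord u, tcoord u)) (slice_point 0)).
- apply: (@openI _ [set y : @CP R m * @CP R n * C | acoord_dom i y.1.1]
    [set y : @CP R m * @CP R n * C | acoord_dom j y.1.2]).
    apply: (@open_preimage _ _ (fun y : @CP R m * @CP R n * C => y.1.1)); last exact: open_acoord_dom.
    move=> y; apply: (@continuous_comp _ _ _ fst fst); exact: cvg_fst.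
  apply: (@open_preimage _ _ (fun y : @CP R m * @CP R n * C => y.1.2)); last exact: open_acoord_dom.
  move=> y; apply: (@continuous_comp _ _ _ fst snd); [exact: cvg_fst|exact: cvg_snd].
- exact: openT.
- move=> [[x y] t] _; have [v vx] := line_surj x; have [w wy] := line_surj y.
  have h : tricone (\val v, \val w, t) by split; [exact: set_mem (valP v)|exact: set_mem (valP w)].
  exists (exist _ (\val v, \val w, t) (mem_set h)); rewrite /tline /biline /=; congr (_, _, _).
    by rewrite -vx; congr line; exact: val_inj.
  by rewrite -wy; congr line; exact: val_inj.
- move=> v [vi vj]; rewrite /= !acoord_domE /= in vi vj.
  have e : bicoord (tline v) = Phi (\val v) by rewrite /bicoord /= !acoordE.
  split=> //.
  + have n1 : \forall w \near (\val v : amb), (w : amb).1.1 0 i != 0.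
      apply: (near_neq0 (f := fun w : amb => w.1.1 0 i)) => //.
      apply: (@continuous_comp _ _ _ (fun w : amb => w.1.1) (fun w : 'rV[C]_m.+1 => w 0 i)).
        apply: (@continuous_comp _ _ _ fst fst); exact: cvg_fst.
      exact: differentiable_continuous (isd_coord _ _).1.
    have n2 : \forall w \near (\val v : amb), (w : amb).1.2 0 j != 0.
      apply: (near_neq0 (f := fun w : amb => w.1.2 0 j)) => //.
      apply: (@continuous_comp _ _ _ (fun w : amb => w.1.2) (fun w : 'rV[C]_n.+1 => w 0 j)).
        apply: (@continuous_comp _ _ _ fst snd); [exact: cvg_fst|exact: cvg_snd].
      exact: differentiable_continuous (isd_coord _ _).1.
    apply: filterS2 n1 n2 => w w1 w2.
    have d1 : differentiable (fun w : amb => ratios i w.1.1) w.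
      apply: (differentiable_comp (differentiable_comp (differentiable_fst_fun w)
        (differentiable_fst_fun w.1)) (differentiable_ratios w1)).
    have d2 : differentiable (fun w : amb => ratios j w.1.2) w.
      apply: (differentiable_comp (differentiable_comp (differentiable_fst_fun w)
        (differentiable_snd_fun w.1)) (differentiable_ratios w2)).
    have d3 : differentiable (fun w : amb => w.2%:M : 'rV[C]_1) w.
      exact: (differentiable_comp (differentiable_snd_fun w) (differentiable_scalar_mx1 w.2)).
    exact: (differentiable_row_mx (differentiable_row_mx d1 d2).1 d3).1.
  + rewrite insE -e /tline /biline; congr (_, _, _).
    * apply/line_eqP; exists ((\val v).1.1 0 i) => //=.
      by rewrite zcoord_bicoord acoordE sliceK // scalerA mulfV // scale1r.
    * apply/line_eqP; exists ((\val v).1.2 0 j) => //=.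
      by rewrite wcoord_bicoord acoordE sliceK // scalerA mulfV // scale1r.
    * exact: tcoord_bicoord.
- move=> u _; split.
  + exact: set_mem (valP (slice_point u)).
  + rewrite /Phi /= !ratiosK -[RHS]hsubmxK; congr row_mx; first by rewrite hsubmxK.
    by apply/rowP => k; rewrite !mxE (ord1 k) eqxx mulr1n.
  + apply: differentiable_pair_fun; last exact: (isd_coord _ _).1.
    apply: differentiable_pair_fun.
      exact: (differentiable_comp (differentiable_comp (dl _ _ u) (dl _ _ _)) (differentiable_slice _ _)).
    exact: (differentiable_comp (differentiable_comp (dl _ _ u) (dr _ _ _)) (differentiable_slice _ _)).
  + by rewrite insE /bidom /= !acoord_domE /= !slice_i !oner_neq0.
- move=> y [yi yj].
  apply: continuous_row_mx; first apply: continuous_row_mx.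
  + apply: (@continuous_comp _ _ _ (fun y : @CP R m * @CP R n * C => y.1.1) (acoord i)).
      apply: (@continuous_comp _ _ _ fst fst); exact: cvg_fst.
    exact: acoord_continuous.
  + apply: (@continuous_comp _ _ _ (fun y : @CP R m * @CP R n * C => y.1.2) (acoord j)).
      apply: (@continuous_comp _ _ _ fst snd); [exact: cvg_fst|exact: cvg_snd].
    exact: acoord_continuous.
  + apply: (@continuous_comp _ _ _ snd (fun s : C => s%:M : 'rV[C]_1)); first exact: cvg_snd.
    exact: differentiable_continuous (differentiable_scalar_mx1 _).
Qed.

End Product_with_line.
End Ambient.

(** * The smoothing family *)

Section Family.
Variable R : realType.
Local Notation C := (CC R).
Variable c : R.
Local Notation gam := ((c%:C)%C : C).
Local Notation T := (@CP R 4 * @CP R 1 * C)%type.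

Definition eqP_ (z : 'rV[C]_5) (w : 'rV[C]_2) : C :=
  hcoord z 3 * hcoord w 1 - hcoord z 4 * hcoord w 0.

Definition eqQ (z : 'rV[C]_5) (w : 'rV[C]_2) (t : C) : C :=
  hcoord w 1 * (hcoord z 1 * (hcoord z 0 ^+ 3 - hcoord z 1 ^+ 3 - hcoord z 4 ^+ 3)
                + t * hcoord z 0 ^+ 4)
  - hcoord w 0 * (hcoord z 2 * (gam * hcoord z 0 ^+ 3 - hcoord z 2 ^+ 3 - hcoord z 3 ^+ 3)
                - t * hcoord z 0 ^+ 4).

Lemma eqPZ a b z w : eqP_ (a *: z) (b *: w) = a * b * eqP_ z w.
Proof. by rewrite /eqP_ !hcoordZ; ring. Qed.

Lemma eqQZ a b z w t : eqQ (a *: z) (b *: w) t = a ^+ 4 * b * eqQ z w t.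
Proof. by rewrite /eqQ !hcoordZ; ring. Qed.

Definition on_family (y : T) : Prop :=
  eqP_ (hrep y.1.1) (hrep y.1.2) = 0 /\ eqQ (hrep y.1.1) (hrep y.1.2) y.2 = 0.

Lemma on_familyE (y : T) (z : 'rV[C]_5) (w : 'rV[C]_2) (a b : C) : a != 0 -> b != 0 -> hrep y.1.1 = a *: z -> hrep y.1.2 = b *: w ->
  on_family y <-> eqP_ z w = 0 /\ eqQ z w y.2 = 0.
Proof.
move=> a0 b0 e1 e2; rewrite /on_family e1 e2 eqPZ eqQZ.
have h1 : a * b != 0 by rewrite mulf_neq0.
have h2 : a ^+ 4 * b != 0 by rewrite mulf_neq0 // expf_neq0.
split=> -[E1 E2]; last by rewrite E1 E2 !mulr0.
by split; [apply: (mulfI h1)|apply: (mulfI h2)]; rewrite ?E1 ?E2 mulr0.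
Qed.

Lemma on_family_tline (p : @tricone R 4 1) :
  on_family (tline p) <-> eqP_ (\val p).1.1 (\val p).1.2 = 0 /\ eqQ (\val p).1.1 (\val p).1.2 (\val p).2 = 0.
Proof.
have [a a0 e1] := hrep_line (bifst (tbi p)); have [b b0 e2] := hrep_line (bisnd (tbi p)).
exact: (@on_familyE (tline p) (\val p).1.1 (\val p).1.2 a b a0 b0 e1 e2).
Qed.

Local Notation amb := ('rV[C]_5 * 'rV[C]_2 * C)%type.

Lemma amb_coord_isd k (p : amb) :
  differentiable (fun p : amb => hcoord p.1.1 k) p /\ differentiable (fun p : amb => hcoord p.1.2 k) p.
Proof.
split.
  exact: (differentiable_comp (differentiable_comp (differentiable_fst_fun p)
    (differentiable_fst_fun p.1)) (differentiable_hcoord k p.1.1)).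
exact: (differentiable_comp (differentiable_comp (differentiable_fst_fun p)
    (differentiable_snd_fun p.1)) (differentiable_hcoord k p.1.2)).
Qed.

Definition dQeq (z : 'rV[C]_5) (w : 'rV[C]_2) (t : C) (dz : 'rV[C]_5) (dw : 'rV[C]_2) (dt : C) : C :=
  hcoord dw 1 * (hcoord z 1 * (hcoord z 0 ^+ 3 - hcoord z 1 ^+ 3 - hcoord z 4 ^+ 3) + t * hcoord z 0 ^+ 4)
  + hcoord w 1 * (hcoord dz 1 * (hcoord z 0 ^+ 3 - 4 * hcoord z 1 ^+ 3 - hcoord z 4 ^+ 3)
     + 3 * hcoord z 1 * (hcoord z 0 ^+ 2 * hcoord dz 0 - hcoord z 4 ^+ 2 * hcoord dz 4)
     + dt * hcoord z 0 ^+ 4 + 4 * t * hcoord z 0 ^+ 3 * hcoord dz 0)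
  - hcoord dw 0 * (hcoord z 2 * (gam * hcoord z 0 ^+ 3 - hcoord z 2 ^+ 3 - hcoord z 3 ^+ 3) - t * hcoord z 0 ^+ 4)
  - hcoord w 0 * (hcoord dz 2 * (gam * hcoord z 0 ^+ 3 - 4 * hcoord z 2 ^+ 3 - hcoord z 3 ^+ 3)
     + 3 * hcoord z 2 * (gam * hcoord z 0 ^+ 2 * hcoord dz 0 - hcoord z 3 ^+ 2 * hcoord dz 3)
     - dt * hcoord z 0 ^+ 4 - 4 * t * hcoord z 0 ^+ 3 * hcoord dz 0).

Definition dPeq (z : 'rV[C]_5) (w : 'rV[C]_2) (dz : 'rV[C]_5) (dw : 'rV[C]_2) : C :=
  hcoord dz 3 * hcoord w 1 + hcoord z 3 * hcoord dw 1
  - hcoord dz 4 * hcoord w 0 - hcoord z 4 * hcoord dw 0.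

Section Composite.
Variables (V : normedModType C) (z dz : V -> 'rV[C]_5) (w dw : V -> 'rV[C]_2) (t dt : V -> C) (p : V).
Hypothesis hz : forall k, isd (fun y => hcoord (z y) k) p (fun v => hcoord (dz v) k).
Hypothesis hw : forall k, isd (fun y => hcoord (w y) k) p (fun v => hcoord (dw v) k).
Hypothesis ht : isd t p dt.

Lemma isd_eqP : isd (fun y => eqP_ (z y) (w y)) p (fun v => dPeq (z p) (w p) (dz v) (dw v)).
Proof.
rewrite /eqP_; apply: isd_ext; last first.
  apply: isdB; (apply: isdM; [exact: hz|exact: hw]).
by move=> v /=; rewrite /dPeq; ring.
Qed.

Lemma isd_eqQ : isd (fun y => eqQ (z y) (w y) (t y)) p
  (fun v => dQeq (z p) (w p) (t p) (dz v) (dw v) (dt v)).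
Proof.
rewrite /eqQ; apply: isd_ext; last first.
  apply: isdB; (apply: isdM; first exact: hw).
    apply: isdD; apply: isdM; [exact: hz|apply: isdB; first apply: isdB|exact: ht|];
      by apply: isdX; exact: hz.
  apply: isdB; apply: isdM; [exact: hz|apply: isdB; first apply: isdB|exact: ht|].
  - by apply: isdM; [exact: isd_cst|apply: isdX; exact: hz].
  - by apply: isdX; exact: hz.
  - by apply: isdX; exact: hz.
  - by apply: isdX; exact: hz.
by move=> v /=; rewrite /dQeq; ring.
Qed.
End Composite.

(** The source of properness: the set is the image under [tline] of the solutions with normalized z
    and w, a closed part of a compact set. *)
Lemma compact_family (K : set C) : compact K -> compact [set y : T | on_family y /\ K y.2].
Proof.
move=> cK; pose S : set amb := ((@normalized R 4 `*` @normalized R 1) `*` K) `&`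
  ([set p | eqP_ p.1.1 p.1.2 = 0] `&` [set p | eqQ p.1.1 p.1.2 p.2 = 0]).
have hi k (p : amb) := amb_coord_isd k p.
have isd_of (f : amb -> C) p : differentiable f p -> isd f p ('d f p) by [].
have cS : compact S.
  apply: compact_closedI.
    by apply: compact_setX => //; apply: compact_setX; exact: compact_normalized.
  have cl (f : amb -> C) : (forall p, differentiable f p) -> closed [set p | f p = 0].
    move=> df; have := @open_neq0 R amb f (fun p => differentiable_continuous (df p)).
    rewrite -closedC; congr closed; apply/seteqP; split=> p /=.
      by move/negP; rewrite negbK => /eqP.
    by move->; rewrite eqxx.
  apply: closedI; apply: cl => p.
    exact: (differentiableB (differentiableM (hi 3 p).1 (hi 1%N p).2) (differentiableM (hi 4 p).1 (hi 0%N p).2)).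
  pose dz k v := 'd (fun p : amb => hcoord p.1.1 k) p v.
  have hz k : isd (fun y : amb => hcoord y.1.1 k) p (fun v => hcoord (\row_(l < 5) 'd (fun p : amb => hcoord p.1.1 l) p v) k).
    split=> [|v]; first exact: (hi k p).1.
    rewrite /hcoord mxE; congr ('d _ p v); apply/funext => y; rewrite /hcoord; congr (_ _ _).
    by apply: val_inj; rewrite inord_val.
  have hw k : isd (fun y : amb => hcoord y.1.2 k) p (fun v => hcoord (\row_(l < 2) 'd (fun p : amb => hcoord p.1.2 l) p v) k).
    split=> [|v]; first exact: (hi k p).2.
    rewrite /hcoord mxE; congr ('d _ p v); apply/funext => y; rewrite /hcoord; congr (_ _ _).
    by apply: val_inj; rewrite inord_val.
  exact: (isd_eqQ hz hw (isd_of _ _ (differentiable_snd_fun p))).1.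
have ScT : S `<=` @tricone R 4 1.
  move=> p [[[n1 n2] _] _]; split; [exact: normalized_neq0 n1|exact: normalized_neq0 n2].
have -> : [set y : T | on_family y /\ K y.2] = @tline R 4 1 @` (\val @^-1` S).
  apply/seteqP; split=> [[[x y] t] [fam Kt]|_ [p [[_ Kp] [p1 p2]] <-]]; last first.
    by split=> //; apply/on_family_tline.
  have [v vx] := line_surj x; have [v' nv vv'] := normalize v.
  have [w wy] := line_surj y; have [w' nw ww'] := normalize w.
  have h : @tricone R 4 1 (\val v', \val w', t).
    by split; [exact: set_mem (valP v')|exact: set_mem (valP w')].
  have e : tline (exist _ (\val v', \val w', t) (mem_set h) : @tricone R 4 1) = (x, y, t).
    rewrite /tline /biline /=; congr (_, _, _).
      by rewrite -vx -vv'; congr line; exact: val_inj.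
    by rewrite -wy -ww'; congr line; exact: val_inj.
  exists (exist _ (\val v', \val w', t) (mem_set h)) => //.
  by split=> //; move: fam; rewrite -e => /on_family_tline.
apply: (@continuous_compact _ _ (@tline R 4 1)); last exact: (compact_set_type cS ScT).
by apply: continuous_subspaceT; exact: tline_continuous.
Qed.

End Family.

Section Regular_maps.
Variable R : realType.
Local Notation C := (CC R).

Lemma regular_comp (F G H : funspace R) (f : F -> G) (g : G -> H) x :
  regular_at f x -> regular_at g (f x) -> regular_at (g \o f) x.
Proof.
move=> [cf rf] [cg rg]; split; first exact: continuous_comp.
by move=> h /rg/rf.
Qed.

Lemma regular_val (F : funspace R) (Z : set F) (x : Z) :
  @regular_at R (Defs.induced Z) F \val x.
Proof.
split=> [|h hh]; first exact: initial_continuous.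
by exists h => //; exact: filterE.
Qed.

Variables m n : nat.
Local Notation E := (CPxCPxC_fun R m n).
Local Notation amb := ('rV[C]_m.+1 * 'rV[C]_n.+1 * C)%type.

Lemma regular_time (y : E) : @regular_at R E (affine_fun C) snd y.
Proof.
split=> [|h hh]; first exact: cvg_snd.
have c : {for y, continuous (snd : @CP R m * @CP R n * C -> C)} by exact: cvg_snd.
have cz : \forall z \near y, holo h z.2 := c _ (near_join hh).
apply: (filterS _ cz) => z hz v vz.
rewrite -{z}vz in hz; exists (h \o snd); last exact: filterE.
apply: (holo_comp (h := snd : amb -> C) _ hz).
by apply: filterE => q; exact: differentiable_snd_fun.
Qed.

Lemma regular_fst (y : E) : @regular_at R E (CPxCP_fun R m n) fst y.
Proof.
split=> [|h hh]; first exact: cvg_fst.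
have c : {for y, continuous (fst : @CP R m * @CP R n * C -> @CP R m * @CP R n)} by exact: cvg_fst.
have cz : \forall z \near y, forall v, biline v = z.1 ->
    reg (Defs.induced (F := affine_fun _) (@bicone R m n)) v (h \o @biline R m n) := c _ hh.
apply: (filterS _ cz) => z hz v vz.
have [G rG GE] := hz (tbi v) (congr1 fst vz).
exists (G \o fst).
  apply: (holo_comp (h := fst : amb -> _) _ rG).
  by apply: filterE => q; exact: differentiable_fst_fun.
exact: (@tbi_continuous R m n v _ GE).
Qed.

Lemma regular_inclusion (b : C) (x : CPxCP_fun R m n) :
  @regular_at R (CPxCP_fun R m n) E (fun x => (x, b)) x.
Proof.
have c : {for x, continuous (fun x : @CP R m * @CP R n => (x, b))}.
  have c1 : {for x, continuous (id : @CP R m * @CP R n -> _)} by exact: cvg_id.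
  have c2 : {for x, continuous (fun _ : @CP R m * @CP R n => b)} by exact: cvg_cst.
  exact: (cvg_pair c1 c2).
split=> // h hh.
have cz : \forall z \near x, forall v, tline v = (z, b) ->
    reg (Defs.induced (F := affine_fun _) (@tricone R m n)) v (h \o @tline R m n) := c _ hh.
apply: (filterS _ cz) => z hz v vz.
have tv : @tricone R m n (\val v, b) by exact: set_mem (valP v).
pose v' : @tricone R m n := exist _ (\val v, b) (mem_set tv).
have ev (u : @bicone R m n) (tu : @tricone R m n (\val u, b)) :
    tline (exist _ (\val u, b) (mem_set tu) : @tricone R m n) = (biline u, b).
  by rewrite /tline /biline /=; congr (_, _, _); congr line; exact: val_inj.
have [G rG GE] : reg (Defs.induced (F := affine_fun _) (@tricone R m n)) v' (h \o @tline R m n).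
  by apply: hz; rewrite /v' ev vz.
exists (G \o (fun q => (q, b))).
  apply: (holo_comp (h := fun q : 'rV[C]_m.+1 * 'rV[C]_n.+1 => (q, b)) _ rG).
  apply: filterE => q; apply: differentiable_pair_fun; first exact: differentiable_idfun.
  exact: differentiable_cst.
pose k (u : @bicone R m n) : @tricone R m n :=
  exist _ (\val u, b) (mem_set (set_mem (valP u) : @tricone R m n (\val u, b))).
have ck : continuous k.
  move=> u; apply: continuous_at_val.
  have c1 : {for u, continuous (\val : @bicone R m n -> _)} by exact: initial_continuous.
  have c2 : differentiable (fun q : 'rV[C]_m.+1 * 'rV[C]_n.+1 => (q, b)) (\val u).
    exact: (differentiable_pair_fun (differentiable_idfun _) (differentiable_cst b _)).
  exact: (@continuous_comp _ _ _ (\val : @bicone R m n -> _)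
    (fun q : 'rV[C]_m.+1 * 'rV[C]_n.+1 => (q, b)) u c1 (differentiable_continuous c2)).
have kv : k v = v' by exact: val_inj.
have GE' : \forall u \near v, (h \o @tline R m n) (k u) = G (\val (k u)).
  by apply: (ck v (fun y => (h \o @tline R m n) y = G (\val y))); rewrite kv.
by apply: filterS GE' => u /= <-; rewrite /k ev.
Qed.
End Regular_maps.

Section Smoothing.
Variables (R : realType) (c d : R).
Local Notation C := (CC R).
Local Notation T := (@CP R 4 * @CP R 1 * C)%type.
Local Notation E := (CPxCPxC_fun R 4 1).

Definition Xset : set E := [set y : T | on_family c y /\ nrm y.2 < d].
Definition time (y : E) : C := (y : T).2.

Lemma regular_time_X (x : Defs.induced Xset) :
  @regular_at R (Defs.induced Xset) (affine_fun C) (time \o \val) x.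
Proof. exact: (regular_comp (regular_val x) (@regular_time R 4 1 (\val x))). Qed.

Lemma ambient_hausdorff : hausdorff_space T.
Proof.
apply: hausdorff_prod; last exact: norm_hausdorff.
by apply: hausdorff_prod; exact: CP_hausdorff.
Qed.

Definition D0_coords (v : 'rV[C]_5) : 'rV[C]_2 := \row_(j < 2) hcoord v (j + 3).

(** What remains to be shown about the family is local on it, apart from the identification of the
    blow-up with the central fibre. *)
Lemma smoothable_of_local : 0 < d ->
  (forall x : Defs.induced Xset,
     (exists W U phi psi, @chart R (Defs.induced Xset) 4 W U phi psi /\ W x) /\
     @reduced_divisor R (Defs.induced Xset) (time \o \val) x) ->
  (forall b, nrm b < d -> b != 0 ->
     nonsingular (rs_of_funspace (Defs.induced (F := E) (Xset `&` [set y | time y = b])))) ->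
  blowup_set (N0_set c) D0_coords = [set x | Xset (x, 0)] ->
  smoothable (N1 c).
Proof.
move=> d0 loc fib bl.
exists (rs_of_funspace (Defs.induced Xset)), [set t : C | nrm t < d],
  (@morphism_of R (Defs.induced Xset) (affine_fun C) _ regular_time_X).
have D0 : open [set t : C | nrm t < d].
  apply: (@open_preimage C R (@nrm R) [set y | y < d]); last exact: open_lt.
  by move=> z; exact: nrm_continuous.
split.
  split.
  - split.
      apply: (@hausdorff_inj _ T (\val : Xset -> T)); last exact: ambient_hausdorff.
        exact: initial_continuous.
      exact: val_inj.
    move=> x; have [[W [U [phi [psi [ch Wx]]]]] _] := loc x.
    exists 4%N, 0%N, (fun=> cst 0), (phi x); exact: chart_local_model ch _ _ Wx.
  - exact: D0.
  - by rewrite /= nrm0.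
  - by move=> _ [x _ <-]; have [] := set_mem (valP x).
split.
- move=> K cK KD.
  have := @compact_set_type T Xset _ (compact_family (c := c) cK); case: (pselect True) => // _.
  have h1 : [set y : T | on_family c y /\ K y.2] `<=` Xset by move=> y [? /KD].
  move=> /(_ h1); congr compact; apply/seteqP; split=> y /=; first by case.
  by move=> Ky; split=> //; case: (set_mem (valP y)).
- by move=> x; apply: reduced_divisor_flat; have [] := loc x.
- rewrite /N1 /blowup -/D0_coords bl.
  apply: (@fibre_of_induced R (CPxCP_fun R 4 1) E (fun x => (x, 0)) fst _ Xset time 0).
  + by move=> x; exact: regular_inclusion.
  + by move=> y; exact: regular_fst.
  + by [].
  + by move=> x; split=> // -[].
  + by move=> [x t] /= _ <-; exists x.
  + by move=> y _; have [] := loc y.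
- move=> b Db b0; exists (rs_of_funspace (Defs.induced (F := E) (Xset `&` [set y | time y = b]))).
    apply: (@fibre_of_induced R E E id id _ Xset time b) => //.
    + by move=> x; split=> // x; exact: cvg_id.
    + by move=> x; split=> // x; exact: cvg_id.
    + by move=> y _ _; exists y.
    + by move=> y _; have [] := loc y.
  exact: fib.
Qed.
End Smoothing.

Section Independence.
Variable R : realType.
Local Notation C := (CC R).

Lemma independent_coordinates k n (F : 'rV[C]_(k + n) -> 'rV[C]_k) q
    (dF : 'I_k -> 'rV[C]_(k + n) -> C) :
  (forall u l, differentiable (fun y => F y 0 l) u) ->
  (forall l, isd (fun u => F u 0 l) q (dF l)) ->
  (forall c : 'I_k -> C, (forall v, \sum_l c l * dF l v = 0) -> forall l, c l = 0) ->
  exists (b g : 'rV[C]_(k + n) -> 'rV[C]_(k + n)) U U', [/\ U q, biholo b g U U' & forall u, lsubmx (b u) = F u].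
Proof.
move=> hF hd ind; have dFu u : differentiable F u by apply: differentiable_rV => l; exact: hF.
have dE v : 'd F q v = v *m lin1_mx ('d F q) by rewrite mul_rV_lin1.
have [||K [U [U' [g [Uq bi]]]]] := @complete_coordinates R k n F q (lin1_mx ('d F q)) _ dE.
- by apply: filterE => u; exact: dFu.
- move=> c Dc; apply/colP => l; rewrite [RHS]mxE; apply: (ind (fun l => c l 0)) => v.
  transitivity (('d F q v *m c) 0 0); last by rewrite dE -mulmxA Dc mulmx0 mxE.
  rewrite [RHS]mxE; apply: eq_bigr => m _.
  by rewrite mulrC -(hd m).2 (diff_coord_fun m (dFu q)).2.
by exists (fun u => row_mx (F u) (u *m K)), g, U, U'; split=> // u; rewrite row_mxKl.
Qed.

Definition mkrow n (s : seq C) : 'rV[C]_n.+1 := \row_(i < n.+1) nth 0 s i.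

Lemma mkrowE n s k : (k < n.+1)%N -> hcoord (mkrow n s) k = nth 0 s k.
Proof. by move=> kn; rewrite /hcoord mxE inordK. Qed.

Lemma hcoordB n (v w : 'rV[C]_n.+1) k : hcoord (v - w) k = hcoord v k - hcoord w k.
Proof. by rewrite /hcoord !mxE. Qed.

Lemma hcoord_inj n (v w : 'rV[C]_n.+1) : (forall k, (k < n.+1)%N -> hcoord v k = hcoord w k) -> v = w.
Proof. by move=> h; apply/rowP => i; have := h i (ltn_ord i); rewrite /hcoord inord_val. Qed.

Variable c : R.
Local Notation gam := ((c%:C)%C : C).
Variables (i : 'I_5) (j : 'I_2).

Definition dzcoord (v : 'rV[C]_(4 + 1 + 1)) : 'rV[C]_5 := dslice i (lsubmx (lsubmx v)).
Definition dwcoord (v : 'rV[C]_(4 + 1 + 1)) : 'rV[C]_2 := dslice j (rsubmx (lsubmx v)).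

Lemma isd_zcoord q k : isd (fun u : 'rV[C]_(4 + 1 + 1) => hcoord (zcoord i u) k) q
  (fun v => hcoord (dzcoord v) k).
Proof.
apply: isd_slice => l.
have -> : (fun y : 'rV[C]_(4 + 1 + 1) => lsubmx (lsubmx y) 0 l) =
    (fun y => y 0 (lshift 1 (lshift 1 l))) by apply/funext => y; rewrite !mxE.
exact: isd_coord.
Qed.

Lemma isd_wcoord q k : isd (fun u : 'rV[C]_(4 + 1 + 1) => hcoord (wcoord j u) k) q
  (fun v => hcoord (dwcoord v) k).
Proof.
apply: isd_slice => l.
have -> : (fun y : 'rV[C]_(4 + 1 + 1) => rsubmx (lsubmx y) 0 l) =
    (fun y => y 0 (lshift 1 (rshift 4 l))) by apply/funext => y; rewrite !mxE.
exact: isd_coord.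
Qed.

Lemma isd_tcoord q : isd (@tcoord R 4 1) q (@tcoord R 4 1).
Proof. exact: isd_coord. Qed.

Lemma isd_eqP_chart q : isd (fun u => eqP_ (zcoord i u) (wcoord j u)) q
  (fun v => dPeq (zcoord i q) (wcoord j q) (dzcoord v) (dwcoord v)).
Proof. exact: isd_eqP (isd_zcoord q) (isd_wcoord q). Qed.

Lemma isd_eqQ_chart q : isd (fun u => eqQ c (zcoord i u) (wcoord j u) (tcoord u)) q
  (fun v => dQeq c (zcoord i q) (wcoord j q) (tcoord q) (dzcoord v) (dwcoord v) (tcoord v)).
Proof. exact: isd_eqQ (isd_zcoord q) (isd_wcoord q) (isd_tcoord q). Qed.

(** With the Euler relations below, differentials on the chart may be evaluated on arbitrary vectors
    of C^5 x C^2 x C, so that the critical equations take the same form in every chart. *)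
Lemma tangent_surj q (a : 'rV[C]_5) (b : 'rV[C]_2) (s : C) :
  exists v, [/\ dzcoord v = a - a 0 i *: zcoord i q,
                dwcoord v = b - b 0 j *: wcoord j q & tcoord v = s].
Proof.
exists (row_mx (row_mx (\row_l (a - a 0 i *: zcoord i q) 0 (lift i l))
  (\row_l (b - b 0 j *: wcoord j q) 0 (lift j l))) s%:M); split.
- by rewrite /dzcoord !row_mxKl dslice_surj // /zcoord slice_i.
- by rewrite /dwcoord row_mxKl row_mxKr dslice_surj // /wcoord slice_i.
- by rewrite /tcoord row_mxEr mxE eqxx mulr1n.
Qed.

Lemma euler_dP z w (a : 'rV[C]_5) (b : 'rV[C]_2) (x y : C) : eqP_ z w = 0 ->
  dPeq z w (a - x *: z) (b - y *: w) = dPeq z w a b.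
Proof.
move=> h; apply/eqP; rewrite -subr_eq0; apply/eqP.
transitivity (- (x + y) * eqP_ z w); last by rewrite h mulr0.
by rewrite /dPeq /eqP_ !hcoordB !hcoordZ; ring.
Qed.

Lemma euler_dQ z w t (a : 'rV[C]_5) (b : 'rV[C]_2) (s x y : C) : eqQ c z w t = 0 ->
  dQeq c z w t (a - x *: z) (b - y *: w) s = dQeq c z w t a b s.
Proof.
move=> h; apply/eqP; rewrite -subr_eq0; apply/eqP.
transitivity (- (4 * x + y) * eqQ c z w t); last by rewrite h mulr0.
by rewrite /dQeq /eqQ !hcoordB !hcoordZ; ring.
Qed.
End Independence.

(** * Points where t is part of a coordinate system *)

Section Smooth_points.
Variables (R : realType) (c d : R).
Local Notation C := (CC R).
Local Notation T := (@CP R 4 * @CP R 1 * C)%type.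
Local Notation E := (CPxCPxC_fun R 4 1).
Local Notation rV6 := 'rV[C]_(4 + 1 + 1).

(* By Euler's relations this amounts to the independence of the differentials of
   P, Q and t on CP^4 x CP^1 x C. *)
Definition submersive (z : 'rV[C]_5) (w : 'rV[C]_2) (t : C) : Prop :=
  forall a b e : C,
    (forall dz dw dt, a * dPeq z w dz dw + b * dQeq c z w t dz dw dt + e * dt = 0) ->
    [/\ a = 0, b = 0 & e = 0].

Lemma open_small_time : open [set y : E | nrm (time y) < d].
Proof.
apply: (@open_preimage T R (fun y => nrm y.2) [set y | y < d]); last exact: open_lt.
move=> y; apply: (@continuous_comp _ _ _ snd (@nrm R)); first exact: cvg_snd.
exact: nrm_continuous.
Qed.

Variables (i : 'I_5) (j : 'I_2).

Definition small_chart := chart_restrict (@CPxCPxC_chart R 4 1 i j) open_small_time.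

Lemma on_family_chart (y : E) : bidom i j y -> on_family c y <->
  eqP_ (zcoord i (bicoord i j y)) (wcoord j (bicoord i j y)) = 0 /\
  eqQ c (zcoord i (bicoord i j y)) (wcoord j (bicoord i j y)) (tcoord (bicoord i j y)) = 0.
Proof.
move=> [y1 y2]; have [a a0 e1] := hrep_slice y1; have [b b0 e2] := hrep_slice y2.
rewrite tcoord_bicoord zcoord_bicoord wcoord_bicoord.
exact: (@on_familyE R c y _ _ a b a0 b0 e1 e2).
Qed.

Lemma smooth_coordinates (x : E) : bidom i j x -> on_family c x ->
  submersive (zcoord i (bicoord i j x)) (wcoord j (bicoord i j x)) (time x) ->
  exists (b g : rV6 -> rV6) (U U' : set rV6), [/\ U (bicoord i j x), biholo b g U U' &
    forall u : rV6, [/\ b u 0 (inord 0) = eqP_ (zcoord i u) (wcoord j u),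
      b u 0 (inord 1) = eqQ c (zcoord i u) (wcoord j u) (tcoord u) &
      b u 0 (inord 2) = tcoord u - time x]].
Proof.
move=> dx fx sub; set q := bicoord i j x in sub *.
have [P0 Q0] : eqP_ (zcoord i q) (wcoord j q) = 0 /\ eqQ c (zcoord i q) (wcoord j q) (time x) = 0.
  by have := (on_family_chart dx).1 fx; rewrite tcoord_bicoord.
have tq : tcoord q = time x by rewrite tcoord_bicoord.
pose f (k : nat) (u : rV6) : C := nth 0 [:: eqP_ (zcoord i u) (wcoord j u);
  eqQ c (zcoord i u) (wcoord j u) (tcoord u); tcoord u - time x] k.
pose df (p : rV6) (k : nat) (v : rV6) : C :=
  nth 0 [:: dPeq (zcoord i p) (wcoord j p) (dzcoord i v) (dwcoord j v);
  dQeq c (zcoord i p) (wcoord j p) (tcoord p) (dzcoord i v) (dwcoord j v) (tcoord v); tcoord v] k.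
have fd p (k : 'I_3) : isd (f k) p (df p k).
  case: k => -[|[|[|//]]] _ /=; rewrite /f /df /=.
  - exact: isd_eqP_chart.
  - exact: isd_eqQ_chart.
  - apply: isd_ext; last by apply: isdB; [exact: isd_tcoord|exact: isd_cst].
    by move=> v /=; rewrite subr0.
pose F (u : 'rV[C]_(3 + 3)) : 'rV[C]_3 := \row_k f k u.
have FE l : (fun u => F u 0 l) = f l by apply/funext => u; rewrite mxE.
have [|||b [g [U [U' [Uq bi bF]]]]] := @independent_coordinates R 3 3 F q (fun l => df q l).
- by move=> u l; rewrite FE; exact: (fd u l).1.
- by move=> l; rewrite FE; exact: fd.
- move=> k hk; have [|k0 k1 k2] := sub (k (inord 0)) (k (inord 1)) (k (inord 2)).
    move=> dz dw dt; have [v [e1 e2 e3]] := tangent_surj i j q dz dw dt.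
    have := hk v; rewrite !big_ord_recl big_ord0 addr0 addrA => <-.
    rewrite /df /= e1 e2 e3 tq euler_dP // euler_dQ //.
    by congr (_ * _ + _ * _ + _ * _); congr k; apply: val_inj; rewrite /= inordK.
  move=> l; have -> : l = inord l by rewrite inord_val.
  by case: l => -[|[|[|//]]] ?.
exists b, g, U, U'; split=> // u.
have bE (l : 'I_3) : b u 0 (inord l) = f l u.
  rewrite -[RHS](congr1 (fun h => h u) (FE l)) -bF mxE; congr (b u 0 _); apply: val_inj => /=.
  by rewrite inordK // (ltn_trans (ltn_ord l)).
split.
- by have := bE (Ordinal (isT : (0 < 3)%N)).
- by have := bE (Ordinal (isT : (1 < 3)%N)).
- by have := bE (Ordinal (isT : (2 < 3)%N)).
Qed.

(** P, Q and t - b0 are three of six ambient coordinates, and the fibre is where they vanish. *)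
Lemma smooth_fibre (x : E) (b0 : C) : Xset c d x -> time x = b0 -> bidom i j x ->
  submersive (zcoord i (bicoord i j x)) (wcoord j (bicoord i j x)) (time x) ->
  forall x' : Defs.induced (F := E) (Xset c d `&` [set y | time y = b0]), \val x' = x ->
  @nonsingular_at R (rs_of_funspace (Defs.induced (F := E) (Xset c d `&` [set y | time y = b0]))) x'.
Proof.
move=> [fx tx] xb dx sub x' x'x.
have [b [g [U [U' [Ux bi bE]]]]] := smooth_coordinates dx fx sub.
have := @induced_chart R E 3 3 _ _ _ _ b g U U' (Xset c d `&` [set y | time y = b0]) x' small_chart bi.
case/(_ _)/chart_nonsingular/(_ x').
- move=> y [dy ty] Uy; have [e0 e1 e2] := bE (bicoord i j y).
  have e : lsubmx (b (bicoord i j y) : 'rV[C]_(3 + 3)) = 0 <->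
      [/\ b (bicoord i j y) 0 (inord 0) = 0, b (bicoord i j y) 0 (inord 1) = 0 &
        b (bicoord i j y) 0 (inord 2) = 0].
    have lE (l : 'I_3) : (lsubmx (b (bicoord i j y) : 'rV[C]_(3 + 3))) 0 l =
        b (bicoord i j y) 0 (inord l).
      rewrite mxE; congr (b _ 0 _); apply: val_inj => /=.
      by rewrite inordK // (ltn_trans (ltn_ord l)).
    split=> [h|[h0 h1 h2]].
      split.
      - by have := lE (Ordinal (isT : (0 < 3)%N)); rewrite h mxE.
      - by have := lE (Ordinal (isT : (1 < 3)%N)); rewrite h mxE.
      - by have := lE (Ordinal (isT : (2 < 3)%N)); rewrite h mxE.
    by apply/rowP => -[[|[|[|//]]] ?]; rewrite lE mxE.
  rewrite e e0 e1 e2 tcoord_bicoord; split=> [[[fy _] yb]|[h0 h1 h2]].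
    have [h0 h1] := (on_family_chart dy).1 fy; rewrite tcoord_bicoord in h1.
    by split=> //; rewrite xb -yb /time subrr.
  split; last by move/eqP: h2; rewrite subr_eq0 xb => /eqP.
  by split=> //; apply/on_family_chart => //; rewrite tcoord_bicoord.
- by rewrite /= x'x; split.
- by move=> n [f [p h]]; exists n, f, p.
Qed.
End Smooth_points.

(** * The total space of the family at the nodes *)

Section Nodes.
Variables (R : realType) (c d : R).
Local Notation C := (CC R).
Local Notation gam := ((c%:C)%C : C).
Local Notation T := (@CP R 4 * @CP R 1 * C)%type.
Local Notation E := (CPxCPxC_fun R 4 1).
Local Notation rV6 := 'rV[C]_(4 + 1 + 1).
Local Notation X := (Defs.induced (F := E) (Xset c d)).

Section Family_chart.
Variables (i : 'I_5) (j : 'I_2) (b g : rV6 -> rV6) (U U' : set rV6) (x : X).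
Hypothesis bi : biholo b g U U'.
Hypothesis bE : forall u : rV6, b u 0 (inord 0) = eqP_ (zcoord i u) (wcoord j u) /\
  b u 0 (inord 1) = eqQ c (zcoord i u) (wcoord j u) (tcoord u).
Hypothesis dx : bidom i j (\val x).
Hypothesis Ux : U (bicoord i j (\val x)).

Definition family_phi (y : X) : 'rV[C]_4 := rsubmx (b (bicoord i j (\val y)) : 'rV[C]_(2 + 4)).
Definition family_psi (u : 'rV[C]_4) : X :=
  insubd x (tline (slice_point i j (g (row_mx (0 : 'rV[C]_2) u)))).

Lemma family_equations (y : X) : bidom i j (\val y) -> U (bicoord i j (\val y)) ->
  row_mx (0 : 'rV[C]_2) (family_phi y) = b (bicoord i j (\val y)).
Proof.
move=> dy Uy; rewrite -[RHS](@hsubmxK _ 1 2 4); congr row_mx.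
have [fy _] := set_mem (valP y); have [h0 h1] := (on_family_chart c dy).1 fy.
have [e0 e1] := bE (bicoord i j (\val y)).
apply/rowP => l; rewrite [RHS]mxE.
have -> : lshift 4 l = inord l :> 'I_6.
  by apply: val_inj; rewrite /= inordK // (ltn_trans (ltn_ord l)).
by case: l => -[|[|//]] ? /=; rewrite mxE ?[RHS]e0 ?[RHS]e1.
Qed.

Lemma family_zero (y : E) : (bidom i j `&` [set y : E | nrm (time y) < d]) y ->
  U (bicoord i j y) -> Xset c d y <-> lsubmx (b (bicoord i j y) : 'rV[C]_(2 + 4)) = 0.
Proof.
move=> [dy ty] Uy; have [e0 e1] := bE (bicoord i j y).
have lE (l : 'I_2) : (lsubmx (b (bicoord i j y) : 'rV[C]_(2 + 4))) 0 l =
    b (bicoord i j y) 0 (inord l).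
  rewrite mxE; congr (b _ 0 _); apply: val_inj => /=.
  by rewrite inordK // (ltn_trans (ltn_ord l)).
split=> [[fy _]|h].
  have [h0 h1] := (on_family_chart c dy).1 fy.
  apply/rowP => l; rewrite lE mxE; case: l => -[|[|//]] ? /=.
    by rewrite e0.
  by rewrite e1.
split=> //; apply/(on_family_chart c dy).
have := lE (Ordinal (isT : (0 < 2)%N)); have := lE (Ordinal (isT : (1 < 2)%N)).
by rewrite h !mxE /= e0 e1.
Qed.

(** P and Q are the first two ambient coordinates, so the other four are coordinates on the family.
    The last clause gives back the ambient point, on which the time function can be computed. *)
Lemma family_chart : exists (W : set X) V,
  [/\ @chart R X 4 W V family_phi family_psi, W x & forall u, V u ->
   exists2 p : rV6, [/\ U p, U' (row_mx (0 : 'rV[C]_2) u : rV6) & g (row_mx (0 : 'rV[C]_2) u) = p] &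
    b p = row_mx (0 : 'rV[C]_2) u /\ time (\val (family_psi u)) = tcoord p].
Proof.
do 2!eexists; split.
- apply: (@induced_chart R E 2 4 _ _ _ _ b g U U' (Xset c d) x (small_chart d i j) bi).
  exact: family_zero.
- by split=> //; split=> //; have [] := set_mem (valP x).
- have := @induced_chart R E 2 4 _ _ _ _ b g U U' (Xset c d) x (small_chart d i j) bi.
  move=> /(_ _)[|_ _ h2 _ _ u Vu]; first exact: family_zero.
  have [[[dy _] Uy] phiu] := h2 _ Vu.
  have e := family_equations dy Uy; rewrite [X in row_mx _ X]phiu in e.
  have [_ _ b1 _] := bi; have [Ub gb _] := b1 _ Uy.
  exists (bicoord i j (\val (family_psi u))); first by rewrite -e in Ub gb; split.
  by split=> //; rewrite tcoord_bicoord.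
Qed.
End Family_chart.

Lemma submersive_local (i : 'I_5) (j : 'I_2) (x : X) : bidom i j (\val x) ->
  submersive c (zcoord i (bicoord i j (\val x))) (wcoord j (bicoord i j (\val x))) (time (\val x)) ->
  (exists W U phi psi, @chart R X 4 W U phi psi /\ W x) /\
  @reduced_divisor R X (@time R \o \val) x.
Proof.
move=> dx sub; have [fx tx] := set_mem (valP x).
have [b [g [U [U' [Ux bi bE]]]]] := smooth_coordinates dx fx sub.
have bE' (u : rV6) : b u 0 (inord 0) = eqP_ (zcoord i u) (wcoord j u) /\
    b u 0 (inord 1) = eqQ c (zcoord i u) (wcoord j u) (tcoord u).
  by have [? ? _] := bE u.
have [W [V [ch Wx psiE]]] := family_chart bi bE' dx Ux.
split; first by exists W, V, (family_phi i j b), (family_psi i j g x).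
apply: (reduced_divisor_chart ch Wx).
(* The third ambient coordinate is t - t(x); on the family it is the first one that remains. *)
pose lam (u : 'rV[C]_4) : C := hcoord u 0 + time (\val x).
apply: (@reduced_divisor_ext R (affine_fun 'rV[C]_4) lam).
  have [[_ oV] h1 _ _ _] := ch.
  have nV : \forall u \near family_phi i j b x, V u.
    by apply: open_nbhs_nbhs; split=> //; case: (h1 _ Wx).
  apply: (filterS _ nV) => u /psiE[p _ [bp tp]] /=; rewrite tp /lam.
  have [_ _ e2] := bE p; move/eqP: e2; rewrite eq_sym subr_eq => /eqP ->; congr (_ + _).
  rewrite bp -[in LHS](@row_mxKr _ 1 2 4 0 u) /hcoord mxE; congr (row_mx _ _ _ _).
  by apply: val_inj; rewrite /= !inordK.
apply: (@reduced_divisor_coordinate R 'rV[C]_4 lam _ (mkrow 3 [:: 1; 0; 0; 0])).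
  by move=> y t; rewrite /lam hcoordD hcoordZ mkrowE //= mulr1 addrAC.
apply: filterE => y; exact: (differentiableD (differentiable_hcoord 0 y) (differentiable_cst _ y)).
Qed.

Section Node_coordinates.
Variables (al be : bool).

(** [al] tells which of z1, z4 vanishes at the node and [be] which of z2, z3. The vanishing factor
    is a coordinate by itself, and its partner is multiplied by the cubic factor, so that x0 x3 - x1
    x2 is always the quintic. *)
Definition node_coord (k : nat) (z : 'rV[C]_5) : C :=
  nth 0 [:: hcoord z (if al then 1 else 4)%N;
    hcoord z (if be then 2 else 3)%N;
    hcoord z (if be then 3 else 2)%N * (gam * hcoord z 0 ^+ 3 - hcoord z 2 ^+ 3 - hcoord z 3 ^+ 3);
    hcoord z (if al then 4 else 1)%N * (hcoord z 0 ^+ 3 - hcoord z 1 ^+ 3 - hcoord z 4 ^+ 3)] k.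

Definition dnode_coord (k : nat) (z dz : 'rV[C]_5) : C :=
  nth 0 [:: hcoord dz (if al then 1 else 4)%N;
    hcoord dz (if be then 2 else 3)%N;
    hcoord dz (if be then 3 else 2)%N * (gam * hcoord z 0 ^+ 3 - hcoord z 2 ^+ 3 - hcoord z 3 ^+ 3)
    + hcoord z (if be then 3 else 2)%N * (3 * (gam * hcoord z 0 ^+ 2 * hcoord dz 0
        - hcoord z 2 ^+ 2 * hcoord dz 2 - hcoord z 3 ^+ 2 * hcoord dz 3));
    hcoord dz (if al then 4 else 1)%N * (hcoord z 0 ^+ 3 - hcoord z 1 ^+ 3 - hcoord z 4 ^+ 3)
    + hcoord z (if al then 4 else 1)%N * (3 * (hcoord z 0 ^+ 2 * hcoord dz 0
        - hcoord z 1 ^+ 2 * hcoord dz 1 - hcoord z 4 ^+ 2 * hcoord dz 4))] k.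

Lemma isd_node_coord (V : normedModType C) (z dz : V -> 'rV[C]_5) (p : V) :
  (forall k, isd (fun y => hcoord (z y) k) p (fun v => hcoord (dz v) k)) ->
  forall k, (k < 4)%N -> isd (fun y => node_coord k (z y)) p (fun v => dnode_coord k (z p) (dz v)).
Proof.
move=> hz [|[|[|[|//]]]] _; rewrite /node_coord /dnode_coord /=; try exact: hz.
- apply: isd_ext; last first.
    apply: isdM; first exact: hz.
    apply: isdB; first apply: isdB; last by apply: isdX; exact: hz.
      by apply: isdM; [exact: isd_cst|apply: isdX; exact: hz].
    by apply: isdX; exact: hz.
  by move=> v /=; ring.
- apply: isd_ext; last first.
    apply: isdM; first exact: hz.
    apply: isdB; first apply: isdB; by apply: isdX; exact: hz.
  by move=> v /=; ring.
Qed.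

Definition node (z : 'rV[C]_5) : Prop :=
  [/\ hcoord z 1 * hcoord z 4 = 0 /\ hcoord z 2 * hcoord z 3 = 0,
    hcoord z 1 ^+ 4 = hcoord z 1 * hcoord z 0 ^+ 3,
    hcoord z 4 ^+ 4 = hcoord z 4 * hcoord z 0 ^+ 3,
    hcoord z 2 ^+ 4 = gam * hcoord z 2 * hcoord z 0 ^+ 3 &
    hcoord z 3 ^+ 4 = gam * hcoord z 3 * hcoord z 0 ^+ 3].

Hypothesis gam0 : gam != 0.
Variable z : 'rV[C]_5.
Hypotheses (z0 : hcoord z 0 = 1) (nz : node z).
Hypotheses (zal : hcoord z (if al then 1 else 4)%N = 0) (zbe : hcoord z (if be then 2 else 3)%N = 0).

(** Either x = 0 or x^3 = g, so the value is g or - 3 g. *)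
Lemma node_factor (x g : C) : g != 0 -> x ^+ 4 = g * x -> g - 4 * x ^+ 3 != 0.
Proof.
move=> g0 e; have [->|x0] := eqVneq x 0; first by rewrite expr0n mulr0 subr0.
have -> : x ^+ 3 = g by apply: (mulfI x0); rewrite -exprS e mulrC.
have -> : g - 4 * g = - (3 * g) by ring.
by rewrite oppr_eq0 mulf_neq0 // pnatr_eq0.
Qed.

(** In the chart z0 = 1 the coordinates split into two pairs, one in z1, z4 and one in z2, z3. At
    the node the derivatives of each pair are 1 and g - 4 x^3 with g = 1 or c, nonzero by
    [node_factor]. *)
Lemma node_coords_independent (k0 k1 k2 k3 : C) :
  (forall a, hcoord a 0 = 0 -> k0 * dnode_coord 0 z a + k1 * dnode_coord 1 z a
     + k2 * dnode_coord 2 z a + k3 * dnode_coord 3 z a = 0) ->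
  [/\ k0 = 0, k1 = 0, k2 = 0 & k3 = 0].
Proof.
move: nz zal zbe => [_]; rewrite z0 expr1n !mulr1 => e1 e4 e2 e3 hal hbe h.
have f1 : 1 - 4 * hcoord z 1 ^+ 3 != 0 by apply: node_factor; rewrite ?oner_neq0 // mul1r.
have f4 : 1 - 4 * hcoord z 4 ^+ 3 != 0 by apply: node_factor; rewrite ?oner_neq0 // mul1r.
have f2 : gam - 4 * hcoord z 2 ^+ 3 != 0 by exact: node_factor.
have f3 : gam - 4 * hcoord z 3 ^+ 3 != 0 by exact: node_factor.
have h1 := h (mkrow 4 [:: 0; 1; 0; 0; 0]); have h2 := h (mkrow 4 [:: 0; 0; 1; 0; 0]).
have h3 := h (mkrow 4 [:: 0; 0; 0; 1; 0]); have h4 := h (mkrow 4 [:: 0; 0; 0; 0; 1]).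
rewrite !mkrowE //= in h1 h2 h3 h4.
move: (h1 erefl) (h2 erefl) (h3 erefl) (h4 erefl) => {h1 h2 h3 h4 h} h1 h2 h3 h4.
rewrite /dnode_coord /= z0 in h1 h2 h3 h4.
have k0E : k0 = 0 /\ k3 = 0.
  move: hal h1 h4 f1 f4; clear; case: al => /= e; case: be => /=; rewrite !mkrowE //= e => h1 h4 f1 f4.
  1,2: split; [by rewrite -[RHS]h1; ring|by apply: (mulIf f4); rewrite mul0r -[RHS]h4; ring].
  1,2: split; [by rewrite -[RHS]h4; ring|by apply: (mulIf f1); rewrite mul0r -[RHS]h1; ring].
have k1E : k1 = 0 /\ k2 = 0.
  move: hbe h2 h3 f2 f3; clear; case: be => /= e; case: al => /=; rewrite !mkrowE //= e => h2 h3 f2 f3.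
  1,2: split; [by rewrite -[RHS]h2; ring|by apply: (mulIf f3); rewrite mul0r -[RHS]h3; ring].
  1,2: split; [by rewrite -[RHS]h3; ring|by apply: (mulIf f2); rewrite mul0r -[RHS]h2; ring].
by case: k0E => -> ->; case: k1E => -> ->.
Qed.

Lemma node_coord0 k : (k < 4)%N -> node_coord k z = 0.
Proof.
move: nz zal zbe => [[e14 e23]]; rewrite z0 expr1n !mulr1 => e1 e4 e2 e3 hal hbe.
move: k => [|[|[|[|//]]]] _ //; rewrite /node_coord /= z0.
- by move: hbe; case: be => /= e; rewrite e; ring: e2 e3.
- by move: hal; case: al => /= e; rewrite e; ring: e1 e4.
Qed.
End Node_coordinates.

(** z3 = - z4 <> 0 would give c = z3^3 = - z4^3 = - 1. *)
Lemma node_sum_neq0 (z : 'rV[C]_5) : gam != 0 -> 1 + gam != 0 -> hcoord z 0 = 1 -> node z ->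
  hcoord z 3 != 0 \/ hcoord z 4 != 0 -> hcoord z 3 + hcoord z 4 != 0.
Proof.
move=> g0 g1 z0 [_ _ e4 _ e3] h; rewrite z0 expr1n !mulr1 in e3 e4.
apply/negP; rewrite addr_eq0 => /eqP z34.
have z3 : hcoord z 3 != 0 by case: h => //; rewrite z34 oppr_eq0.
have z4 : hcoord z 4 != 0 by rewrite -oppr_eq0 -z34.
have c3 : hcoord z 3 ^+ 3 = gam by apply: (mulfI z3); rewrite -exprS e3 mulrC.
have c4 : hcoord z 4 ^+ 3 = 1 by apply: (mulfI z4); rewrite -exprS e4 mulr1.
by move/eqP: g1; apply; rewrite -c3 -c4 z34; ring.
Qed.

(** Elimination of w: by P = 0 it is proportional to (z3, z4), and Q becomes the quintic with its
    perturbation. Cancelling a nonzero component of w, instead of dividing by z3 or z4, keeps D_0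
    included. *)
Lemma family_relation (z : 'rV[C]_5) (w : 'rV[C]_2) (t : C) : w != 0 ->
  eqP_ z w = 0 -> eqQ c z w t = 0 ->
  hcoord z 1 * hcoord z 4 * (hcoord z 0 ^+ 3 - hcoord z 1 ^+ 3 - hcoord z 4 ^+ 3)
  - hcoord z 2 * hcoord z 3 * (gam * hcoord z 0 ^+ 3 - hcoord z 2 ^+ 3 - hcoord z 3 ^+ 3)
  = - (t * hcoord z 0 ^+ 4 * (hcoord z 3 + hcoord z 4)).
Proof.
rewrite /eqP_ /eqQ => w0 /eqP; rewrite subr_eq0 => /eqP hP hQ; apply/eqP; rewrite -subr_eq0 opprK; apply/eqP.
have [w00|w00] := eqVneq (hcoord w 0) 0.
  have w10 : hcoord w 1 != 0.
    apply: contraNneq w0 => w10; apply/eqP/hcoord_inj => -[|[|//]] _;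
    by rewrite ?w00 ?w10 /hcoord mxE.
  apply: (mulfI w10); rewrite mulr0 -[RHS](mulr0 (hcoord z 4)) -{}[in RHS]hQ.
  by rewrite w00 in hP *; ring: hP.
apply: (mulfI w00); rewrite mulr0 -[RHS](mulr0 (hcoord z 3)) -{}[in RHS]hQ.
by ring: hP.
Qed.

Lemma node_coord_quadric al be (z : 'rV[C]_5) :
  node_coord al be 0 z * node_coord al be 3 z - node_coord al be 1 z * node_coord al be 2 z =
  hcoord z 1 * hcoord z 4 * (hcoord z 0 ^+ 3 - hcoord z 1 ^+ 3 - hcoord z 4 ^+ 3)
  - hcoord z 2 * hcoord z 3 * (gam * hcoord z 0 ^+ 3 - hcoord z 2 ^+ 3 - hcoord z 3 ^+ 3).
Proof. by rewrite /node_coord; case: al; case: be => /=; ring. Qed.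

Lemma node_branches (z : 'rV[C]_5) : node z -> exists al be : bool,
  hcoord z (if al then 1 else 4)%N = 0 /\ hcoord z (if be then 2 else 3)%N = 0.
Proof.
move=> [[/eqP h14 /eqP h23] _ _ _ _].
have /orP h1 : (hcoord z 1 == 0) || (hcoord z 4 == 0) by rewrite -mulf_eq0.
have /orP h2 : (hcoord z 2 == 0) || (hcoord z 3 == 0) by rewrite -mulf_eq0.
have [al hal] : exists al : bool, hcoord z (if al then 1 else 4)%N = 0.
  by case: h1 => /eqP h; [exists true|exists false].
have [be hbe] : exists be : bool, hcoord z (if be then 2 else 3)%N = 0.
  by case: h2 => /eqP h; [exists true|exists false].
by exists al, be.
Qed.

Section Node_local.
Variables (j : 'I_2) (x : X).
Local Notation q := (bicoord ord0 j (\val x)).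
Local Notation z := (zcoord ord0 q).
Local Notation w := (wcoord j q).
Hypotheses (gam0 : gam != 0) (gam1 : 1 + gam != 0).
Hypotheses (dx : bidom ord0 j (\val x)) (tx : time (\val x) = 0).
Hypotheses (nz : node z) (z34 : hcoord z 3 != 0 \/ hcoord z 4 != 0).

Lemma zcoord0_0 (u : rV6) : hcoord (zcoord (ord0 : 'I_5) u) 0 = 1.
Proof.
rewrite /hcoord; have -> : inord 0 = ord0 :> 'I_5 by apply: val_inj; rewrite /= inordK.
exact: slice_i.
Qed.

Lemma wcoord_j (u : rV6) : hcoord (wcoord j u) j = 1.
Proof. rewrite /hcoord inord_val; exact: slice_i. Qed.

(** P, Q and the four node coordinates are six functions of six variables. Varying t alone isolates
    the coefficient of Q, as w0 + w1 <> 0; varying w alone then isolates that of P, as (z3, z4) <>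
    0; the rest is [node_coords_independent]. *)
Lemma node_coordinates (al be : bool) :
  hcoord z (if al then 1 else 4)%N = 0 -> hcoord z (if be then 2 else 3)%N = 0 ->
  exists (b g : rV6 -> rV6) (U U' : set rV6), [/\ U q, biholo b g U U' &
    forall u : rV6, [/\ b u 0 (inord 0) = eqP_ (zcoord ord0 u) (wcoord j u),
      b u 0 (inord 1) = eqQ c (zcoord ord0 u) (wcoord j u) (tcoord u) &
      forall k, (k < 4)%N -> b u 0 (inord k.+2) = node_coord al be k (zcoord ord0 u)]].
Proof.
move=> hal hbe.
pose f (k : nat) (u : rV6) : C := if k is k'.+2 then node_coord al be k' (zcoord ord0 u) else
  nth 0 [:: eqP_ (zcoord ord0 u) (wcoord j u); eqQ c (zcoord ord0 u) (wcoord j u) (tcoord u)] k.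
pose df (p : rV6) (k : nat) (v : rV6) : C :=
  if k is k'.+2 then dnode_coord al be k' (zcoord ord0 p) (dzcoord ord0 v) else
  nth 0 [:: dPeq (zcoord ord0 p) (wcoord j p) (dzcoord ord0 v) (dwcoord j v);
    dQeq c (zcoord ord0 p) (wcoord j p) (tcoord p) (dzcoord ord0 v) (dwcoord j v) (tcoord v)] k.
have fd p (k : 'I_6) : isd (f k) p (df p k).
  case: k => -[|[|k]] hk; rewrite /f /df /=.
  - exact: isd_eqP_chart.
  - exact: isd_eqQ_chart.
  - by apply: isd_node_coord => // l; exact: isd_zcoord.
pose F (u : 'rV[C]_(6 + 0)) : 'rV[C]_6 := \row_k f k u.
have FE l : (fun u => F u 0 l) = f l by apply/funext => u; rewrite mxE.
have [|||b [g [U [U' [Uq bi bF]]]]] := @independent_coordinates R 6 0 F q (fun l => df q l).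
- by move=> u l; rewrite FE; exact: (fd u l).1.
- by move=> l; rewrite FE; exact: fd.
- move=> k hk.
  have rel (a : 'rV[C]_5) (b : 'rV[C]_2) (s : C) : hcoord a 0 = 0 -> hcoord b j = 0 ->
      k (inord 0) * dPeq z w a b + k (inord 1) * dQeq c z w 0 a b s +
      (k (inord 2) * dnode_coord al be 0 z a + k (inord 3) * dnode_coord al be 1 z a
       + k (inord 4) * dnode_coord al be 2 z a + k (inord 5) * dnode_coord al be 3 z a) = 0.
    move=> a0 bj; have [v [e1 e2 e3]] := tangent_surj ord0 j q a b s.
    have ai : a 0 ord0 = 0.
      by rewrite -[RHS]a0 /hcoord; congr (a _ _); apply: val_inj; rewrite /= inordK.
    have bj' : b 0 j = 0 by rewrite -[RHS]bj /hcoord inord_val.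
    rewrite ai scale0r subr0 in e1; rewrite bj' scale0r subr0 in e2.
    have hk' : \sum_(l < 6) k (inord l) * df q l v = 0.
      by rewrite -[RHS](hk v); apply: eq_bigr => l _; rewrite inord_val.
    move: hk'; rewrite !big_ord_recl big_ord0 addr0 /df /= e1 e2 e3 tcoord_bicoord.
    by rewrite -[X in dQeq c _ _ X]/(time (\val x)) tx !addrA.
  have w0 : wcoord j q != 0 by exact: slice_neq0.
  have hP : eqP_ z w = 0 by have := (on_family_chart c dx).1 (set_mem (valP x)).1; case.
  have hs := node_sum_neq0 gam0 gam1 (zcoord0_0 q) nz z34.
  have zero5 : hcoord (0 : 'rV[C]_5) 0 = 0 by rewrite /hcoord mxE.
  have d0 l : dnode_coord al be l z 0 = 0.
    have h0 m : hcoord (0 : 'rV[C]_5) m = 0 by rewrite /hcoord mxE.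
    case: l => [|[|[|[|l]]]]; rewrite /dnode_coord /= ?h0 //; last by rewrite nth_nil.
      by ring.
    by ring.
  have k1 : k (inord 1) = 0.
    have hb : hcoord (0 : 'rV[C]_2) j = 0 by rewrite /hcoord mxE.
    have := rel 0 0 1 zero5 hb; rewrite !d0 !mulr0 !addr0 /dPeq /dQeq zcoord0_0 => e.
    have h0 n m : hcoord (0 : 'rV[C]_n.+1) m = 0 by rewrite /hcoord mxE.
    rewrite !h0 in e; have sw : hcoord w 0 + hcoord w 1 != 0.
      apply: contraNneq w0 => sw; have w1E : hcoord w 1 = - hcoord w 0.
        by apply/eqP; rewrite -addr_eq0 addrC sw.
      have w00 : hcoord w 0 = 0.
        apply: (mulIf hs); rewrite mul0r -[RHS]oppr0 -[in RHS]hP /eqP_ w1E; ring.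
      apply/eqP/hcoord_inj => -[|[|//]] _; by rewrite ?w1E w00 ?oppr0 /hcoord mxE.
    by apply: (mulIf sw); rewrite mul0r -[RHS]e; ring.
  have k0 : k (inord 0) = 0.
    have wj := wcoord_j q; move: hP; rewrite /eqP_.
    have [j0|j1] : nat_of_ord j = 0%N \/ nat_of_ord j = 1%N.
      by case: (j) => -[|[|//]] ?; [left|right].
    - rewrite j0 in wj; rewrite wj mulr1 => /eqP; rewrite subr_eq0 => /eqP e.
      have z3 : hcoord z 3 != 0.
        by case: z34 => // h4; apply: contraNneq h4 => h3; rewrite -e h3 mul0r.
      have := rel 0 (mkrow 1 [:: 0; 1]) 0 zero5; rewrite j0 mkrowE //= => /(_ erefl).
      rewrite !d0 k1 !mulr0 !addr0 mul0r addr0 /dPeq !mkrowE //= wj => e'.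
      have h0 m : hcoord (0 : 'rV[C]_5) m = 0 by rewrite /hcoord mxE.
      by apply: (mulIf z3); rewrite mul0r -[RHS]e' !h0; ring.
    - rewrite j1 in wj; rewrite wj mulr1 => /eqP; rewrite subr_eq0 => /eqP e.
      have z4 : hcoord z 4 != 0.
        by case: z34 => // h3; apply: contraNneq h3 => h4; rewrite e h4 mul0r.
      have := rel 0 (mkrow 1 [:: 1; 0]) 0 zero5; rewrite j1 mkrowE //= => /(_ erefl).
      rewrite !d0 k1 !mulr0 !addr0 mul0r addr0 /dPeq !mkrowE //= wj => e'.
      have h0 m : hcoord (0 : 'rV[C]_5) m = 0 by rewrite /hcoord mxE.
      by apply: (mulIf z4); rewrite mul0r -[RHS]oppr0 -[in RHS]e' !h0; ring.
  have [|k2 k3 k4 k5] := @node_coords_independent al be gam0 z (zcoord0_0 q) nz hal hbe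
    (k (inord 2)) (k (inord 3)) (k (inord 4)) (k (inord 5)).
    move=> a a0; have hb : hcoord (0 : 'rV[C]_2) j = 0 by rewrite /hcoord mxE.
    by have := rel a 0 0 a0 hb; rewrite k0 k1 !mul0r !add0r.
  move=> l; rewrite -[l]inord_val.
  by case: l => -[|[|[|[|[|[|//]]]]]] ? /=.
exists b, g, U, U'; split=> // u.
have bE (l : 'I_6) : b u 0 (inord l) = f l u.
  rewrite -[RHS](congr1 (fun h => h u) (FE l)) -bF mxE; congr (b u 0 _); apply: val_inj => /=.
  by rewrite inordK.
split.
- by have := bE (Ordinal (isT : (0 < 6)%N)).
- by have := bE (Ordinal (isT : (1 < 6)%N)).
- by move=> k k4; have := bE (Ordinal (k4 : (k.+2 < 6)%N)).
Qed.

(** In the coordinates u of the family, [family_relation] reads quadric u = - t (z3 + z4). The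
    factor [den] is a unit by [node_sum_neq0], so t is a unit times the quadric. *)
Lemma node_local :
  (exists W U phi psi, @chart R X 4 W U phi psi /\ W x) /\
  @reduced_divisor R X (@time R \o \val) x.
Proof.
have [al [be [hal hbe]]] := node_branches nz.
have [b [g [U [U' [Ux bi bE]]]]] := node_coordinates hal hbe.
have bE' (u : rV6) : b u 0 (inord 0) = eqP_ (zcoord ord0 u) (wcoord j u) /\
    b u 0 (inord 1) = eqQ c (zcoord ord0 u) (wcoord j u) (tcoord u).
  by have [? ? _] := bE u.
have [W [V [ch Wx psiE]]] := family_chart bi bE' dx Ux.
split; first by exists W, V, (family_phi ord0 j b), (family_psi ord0 j g x).
apply: (reduced_divisor_chart ch Wx).
have rE (p : rV6) k : (k < 4)%N -> hcoord (rsubmx (b p : 'rV[C]_(2 + 4))) k =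
    node_coord al be k (zcoord ord0 p).
  move=> k4; have [_ _ <-] := bE p; last by [].
  by rewrite /hcoord mxE; congr (b _ _ _); apply: val_inj; rewrite /= !inordK.
have phi0 : family_phi ord0 j b x = 0.
  apply: hcoord_inj => k k4; rewrite rE // node_coord0 //; first by rewrite /hcoord mxE.
  exact: zcoord0_0.
have [[_ oV] h1 _ _ _] := ch; have [V0 psi0] := h1 _ Wx; rewrite phi0 in V0 psi0 *.
pose G (u : 'rV[C]_4) : rV6 := g (row_mx (0 : 'rV[C]_2) u).
pose den (u : 'rV[C]_4) : C := - (hcoord (zcoord ord0 (G u)) 3 + hcoord (zcoord ord0 (G u)) 4).
have oVn : \forall u \near (0 : 'rV[C]_4), V u by exact: open_nbhs_nbhs.
have dden : \forall u \near (0 : 'rV[C]_4), differentiable den u.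
  apply: (filterS _ oVn) => u /psiE[p [Up U'u gp] _].
  have [_ _ _ b2] := bi; have [_ _ dg] := b2 _ U'u.
  have dG : differentiable G u := differentiable_comp (@differentiable_row0 R 4 2 u) dg.
  have d3 := differentiable_comp dG (isd_zcoord ord0 (G u) 3).1.
  have d4 := differentiable_comp dG (isd_zcoord ord0 (G u) 4).1.
  exact: (differentiableN (differentiableD d3 d4)).
have G0 : G 0 = q.
  have [p [Up U'0 gp] [bp _]] := psiE _ V0; rewrite /G gp.
  have [_ _ b1 _] := bi; have [_ gb _] := b1 _ Up; rewrite -gb bp.
  have := family_equations bE' dx Ux; rewrite phi0 => ->.
  by have [_ -> _] := b1 _ Ux.
have den0 : den 0 != 0.
  by rewrite /den G0 oppr_eq0; exact: (node_sum_neq0 gam0 gam1 (zcoord0_0 q) nz z34).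
have nden := near_neq0 (differentiable_continuous (nbhs_singleton dden)) den0.
apply: (@reduced_divisor_quadric R _ (fun u => (den u)^-1)).
- by apply: filterS2 dden nden => u; exact: near_differentiable_inv.
- by rewrite invr_eq0.
- rewrite /= psi0 tx; apply: filterS2 oVn nden => u Vu nu; rewrite subr0.
  have [p [Up U'u gp] [bp ->]] := psiE _ Vu.
  have pE : p = G u by [].
  have hP : eqP_ (zcoord ord0 p) (wcoord j p) = 0.
    have [<- _] := bE' p; rewrite bp.
    have -> : inord 0 = lshift 4 (ord0 : 'I_2) :> 'I_(2 + 4) by apply: val_inj; rewrite /= inordK.
    by rewrite [LHS](@row_mxEl _ 1 2 4 0 u 0 ord0) mxE.
  have hQ : eqQ c (zcoord ord0 p) (wcoord j p) (tcoord p) = 0.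
    have [_ <-] := bE' p; rewrite bp.
    have -> : inord 1 = lshift 4 (inord 1 : 'I_2) :> 'I_(2 + 4) by apply: val_inj; rewrite /= !inordK.
    by rewrite [LHS](@row_mxEl _ 1 2 4 0 u 0 (inord 1)) mxE.
  have := family_relation (slice_neq0 j _) hP hQ; rewrite -(node_coord_quadric al be).
  have uE k : (k < 4)%N -> node_coord al be k (zcoord ord0 p) = hcoord u k.
    by move=> k4; rewrite -rE // bp row_mxKr.
  rewrite !uE // zcoord0_0 expr1n mulr1 -/(quadric u) => e.
  apply: (mulfI nu); rewrite mulrA mulfV // mul1r e /den -pE; ring.
Qed.
End Node_local.

End Nodes.

(** * The blow-up as the central fibre *)

Section Blowup.
Variables (R : realType) (c d : R).
Local Notation C := (CC R).
Local Notation gam := ((c%:C)%C : C).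
Local Notation T := (@CP R 4 * @CP R 1 * C)%type.
Local Notation E := (CPxCPxC_fun R 4 1).
Local Notation rV6 := 'rV[C]_(4 + 1 + 1).

Definition graph : set (@CP R 4 * @CP R 1) :=
  [set x | exists (v : cone 4) (w : cone 1),
     [/\ N0_set c (line v), \val w = D0_coords (\val v) & x = (line v, line w)]].

Lemma quinticZ a (v : 'rV[C]_5) : quintic c (a *: v) = a ^+ 5 * quintic c v.
Proof. by rewrite /quintic !hcoordZ; ring. Qed.

Lemma N0_line (v : @cone R 4) : N0_set c (line v) <-> quintic c (\val v) = 0.
Proof.
split=> [[v' hv' /line_eqP[a a0 e]]|h]; last by exists v.
by rewrite e quinticZ hv' mulr0.
Qed.

Lemma D0_coordsE (v : 'rV[C]_5) k : (k < 2)%N -> hcoord (D0_coords v) k = hcoord v (k + 3).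
Proof. by move=> k2; rewrite /hcoord !mxE inordK. Qed.

Lemma graph_tline (p : @tricone R 4 1) : eqP_ (\val p).1.1 (\val p).1.2 = 0 ->
  eqQ c (\val p).1.1 (\val p).1.2 0 = 0 ->
  hcoord (\val p).1.1 3 != 0 \/ hcoord (\val p).1.1 4 != 0 -> graph (tline p).1.
Proof.
have [z0 w0] := set_mem (valP p); pose z := (\val p).1.1; pose w := (\val p).1.2.
rewrite -/z -/w in z0 w0 * => hP hQ h34.
have ze : \val (bifst (tbi p)) = z by [].
have we' : \val (bisnd (tbi p)) = w by [].
have D0 : D0_coords z != 0.
  case: h34; apply: contraNneq => e.
    by rewrite -(D0_coordsE z (isT : (0 < 2)%N)) e /hcoord mxE.
  by rewrite -(D0_coordsE z (isT : (1 < 2)%N)) e /hcoord mxE.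
exists (bifst (tbi p)), (exist _ (D0_coords z) (mem_set D0)); split.
- apply/N0_line; rewrite ze.
  have := family_relation w0 hP hQ; rewrite !mul0r oppr0 => <-.
  by rewrite /quintic.
- by rewrite ze.
- rewrite /tline /biline; congr (_, _); apply/line_eqP.
  move: hP; rewrite /eqP_ => /eqP; rewrite subr_eq0 => /eqP hP.
  have [w00|w00] := eqVneq (hcoord w 0) 0.
    have w10 : hcoord w 1 != 0.
      apply: contraNneq w0 => w10; apply/eqP/hcoord_inj => -[|[|//]] _;
      by rewrite ?w00 ?w10 /hcoord mxE.
    have z3 : hcoord z 3 = 0 by apply: (mulIf w10); rewrite hP w00 mulr0 mul0r.
    have z4 : hcoord z 4 != 0 by case: h34 => //; rewrite z3 eqxx.
    exists (hcoord z 4 / hcoord w 1); first by rewrite mulf_neq0 ?invr_eq0.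
    rewrite we' /=; apply: hcoord_inj => -[|[|//]] _; rewrite D0_coordsE // hcoordZ /=.
      by rewrite w00 z3 mulr0.
    by rewrite divfK.
  have z3 : hcoord z 3 != 0.
    case: h34 => // z4; apply: contraNneq z4 => z3; apply/eqP/(mulIf w00).
    by rewrite -hP z3 !mul0r.
  exists (hcoord z 3 / hcoord w 0); first by rewrite mulf_neq0 ?invr_eq0.
  rewrite we' /=; apply: hcoord_inj => -[|[|//]] _; rewrite D0_coordsE // hcoordZ /=.
    by rewrite divfK.
  by apply: (mulIf w00); rewrite -hP mulrAC divfK.
Qed.

Lemma graph_on_family x : graph x -> on_family c (x, 0).
Proof.
move=> [v [w [/N0_line hv we ->]]].
have h : @tricone R 4 1 (\val v, \val w, 0).
  by split; [exact: set_mem (valP v)|exact: set_mem (valP w)].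
pose p : @tricone R 4 1 := exist _ (\val v, \val w, 0) (mem_set h).
have -> : (line v, line w, 0) = tline p.
  by rewrite /tline /biline; congr (_, _, _); congr line; exact: val_inj.
apply/on_family_tline; rewrite /= we /eqP_ /eqQ !D0_coordsE //=; split; first by ring.
by rewrite -[RHS]hv /quintic /= -[hcoord (sval v)]/(hcoord (\val v)); ring.
Qed.

Lemma closed_special_fibre : closed [set x : @CP R 4 * @CP R 1 | on_family c (x, 0)].
Proof.
have c0 : compact [set (0 : C)] by exact: compact_set1.
have cF := compact_family (c := c) c0.
have clF := compact_closed (@ambient_hausdorff R) cF.
pose f (x : @CP R 4 * @CP R 1) : T := (x, 0).
have cf : continuous f.
  move=> x; have c1 : {for x, continuous (id : @CP R 4 * @CP R 1 -> _)} by exact: cvg_id.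
  have c2 : {for x, continuous (fun _ : @CP R 4 * @CP R 1 => 0 : C)} by exact: cvg_cst.
  exact: (cvg_pair c1 c2).
have := @open_preimage _ _ f _ (fun x => cf x) (closed_openC clF).
rewrite -closedC; congr closed; apply/seteqP; split=> x /=.
  by move=> h; apply: contrapT => h'; apply: h => -[].
by move=> h []; split.
Qed.

(** Over D_0 the complete intersection might have had a component outside the closure of the graph.
    Where w_j = 1, the ideal of D_0 is generated by z_(3+j); since P, Q, t and z_(3+j) have
    independent differentials, one can leave D_0 by varying the last one with the first three kept
    at 0. *)
Lemma approach_D0 (x : @CP R 4 * @CP R 1) (i : 'I_5) (j : 'I_2) : gam != 0 ->
  on_family c (x, 0) -> bidom i j (x, 0) ->
  hcoord (zcoord i (bicoord i j (x, 0))) 3 = 0 -> hcoord (zcoord i (bicoord i j (x, 0))) 4 = 0 ->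
  closure graph x.
Proof.
move=> g0 fx dx; set q := bicoord i j (x, 0) => z3 z4.
have [hP hQ] : eqP_ (zcoord i q) (wcoord j q) = 0 /\ eqQ c (zcoord i q) (wcoord j q) 0 = 0.
  by have := (on_family_chart (y := ((x, 0) : E)) c dx).1 fx; rewrite tcoord_bicoord.
have tq : tcoord q = 0 by rewrite tcoord_bicoord.
pose f (k : nat) (u : rV6) : C := nth 0 [:: eqP_ (zcoord i u) (wcoord j u);
  eqQ c (zcoord i u) (wcoord j u) (tcoord u); tcoord u; hcoord (zcoord i u) (3 + j)] k.
pose df (p : rV6) (k : nat) (v : rV6) : C :=
  nth 0 [:: dPeq (zcoord i p) (wcoord j p) (dzcoord i v) (dwcoord j v);
  dQeq c (zcoord i p) (wcoord j p) (tcoord p) (dzcoord i v) (dwcoord j v) (tcoord v); tcoord v;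
  hcoord (dzcoord i v) (3 + j)] k.
have fd p (k : 'I_4) : isd (f k) p (df p k).
  case: k => -[|[|[|[|//]]]] _ /=; rewrite /f /df /=.
  - exact: isd_eqP_chart.
  - exact: isd_eqQ_chart.
  - exact: isd_tcoord.
  - exact: isd_zcoord.
have j01 : (j = 0%N :> nat) \/ (j = 1%N :> nat) by case: (j) => -[|[|//]] ?; [left|right].
have z34 : hcoord (zcoord i q) (3 + j) = 0 by case: j01 => ->.
pose F (u : 'rV[C]_(4 + 2)) : 'rV[C]_4 := \row_k f k u.
have FE l : (fun u => F u 0 l) = f l by apply/funext => u; rewrite mxE.
have [|||b [g [U [U' [Uq bi bF]]]]] := @independent_coordinates R 4 2 F q (fun l => df q l).
- by move=> u l; rewrite FE; exact: (fd u l).1.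
- by move=> l; rewrite FE; exact: fd.
- move=> k hk; set z := zcoord i q in hP hQ z3 z4 z34; set w := wcoord j q in hP hQ.
  have wj : hcoord w j = 1 by rewrite /hcoord inord_val; exact: slice_i.
  have zz : z != 0 by exact: slice_neq0.
  have rel (a : 'rV[C]_5) (e : 'rV[C]_2) (s : C) :
      k (inord 0) * dPeq z w a e + k (inord 1) * dQeq c z w 0 a e s + k (inord 2) * s
      + k (inord 3) * hcoord a (3 + j) = 0.
    have [v [e1 e2 e3]] := tangent_surj i j q a e s.
    have hk' : \sum_(l < 4) k (inord l) * df q l v = 0.
      by rewrite -[RHS](hk v); apply: eq_bigr => l _; rewrite inord_val.
    move: hk'; rewrite !big_ord_recl big_ord0 addr0 /df /= e1 e2 e3 tq.
    by rewrite euler_dP // euler_dQ // hcoordB hcoordZ z34 mulr0 subr0 !addrA.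
  have k0 : k (inord 0) = 0.
    case: j01 => j0; rewrite j0 in wj rel.
      have := rel (mkrow 4 [:: 0; 0; 0; 0; 1]) 0 0; rewrite /dPeq /dQeq !mkrowE //= z4 wj.
      have h0 m : hcoord (0 : 'rV[C]_2) m = 0 by rewrite /hcoord mxE.
      by rewrite !h0 => h; rewrite -[RHS]oppr0 -[in RHS]h; ring.
    have := rel (mkrow 4 [:: 0; 0; 0; 1; 0]) 0 0; rewrite /dPeq /dQeq !mkrowE //= z3 wj.
    have h0 m : hcoord (0 : 'rV[C]_2) m = 0 by rewrite /hcoord mxE.
    by rewrite !h0 => h; rewrite -[RHS]h; ring.
  have rel' (a0 a1 a2 a3 a4 e0 e1 s : C) : k (inord 1) * dQeq c z w 0
      (mkrow 4 [:: a0; a1; a2; a3; a4]) (mkrow 1 [:: e0; e1]) s + k (inord 2) * s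
      + k (inord 3) * nth 0 [:: a3; a4] j = 0.
    have := rel (mkrow 4 [:: a0; a1; a2; a3; a4]) (mkrow 1 [:: e0; e1]) s.
    by rewrite k0 mul0r add0r; case: j01 => ->; rewrite mkrowE.
  have E j' : nth 0 [:: 0; 0] j' = 0 :> C by case: j' => [|[|[|?]]].
  (* Otherwise the derivatives of Q along z1, z2, w0 and w1 all vanish, and together with Q = 0 and
     z3 = z4 = 0 they force z = 0. *)
  have k1 : k (inord 1) = 0.
    apply: contrapT => /eqP k1; have bz (y : C) : k (inord 1) * y = 0 -> y = 0.
      by move/eqP; rewrite mulf_eq0 (negPf k1) => /eqP.
    have zero (z0' : hcoord z 0 = 0) (z1' : hcoord z 1 = 0) (z2' : hcoord z 2 = 0) : False.
      move/eqP: zz; apply; apply: hcoord_inj => -[|[|[|[|[|//]]]]] _;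
      by rewrite ?z0' ?z1' ?z2' ?z3 ?z4 /hcoord mxE.
    have r1 := rel' 0 1 0 0 0 0 0 0; have r2 := rel' 0 0 1 0 0 0 0 0.
    have r3 := rel' 0 0 0 0 0 1 0 0; have r4 := rel' 0 0 0 0 0 0 1 0.
    rewrite /dQeq !mkrowE //= !E !mulr0 !addr0 z3 z4 in r1 r2 r3 r4.
    move: {r1 r2 r3 r4} (bz _ r1) (bz _ r2) (bz _ r3) (bz _ r4).
    rewrite !(mul0r, mulr0, subr0, add0r, addr0, expr0n, mul1r, mulr1, sub0r) /= ?subr0.
    move=> r1 r2 r3 r4.
    have pw (y : C) m : y ^+ m.+1 = 0 -> y = 0 by move/eqP; rewrite expf_eq0 => /eqP.
    have n3 : (3 : C) != 0 by rewrite pnatr_eq0.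
    have hQ' := hQ; rewrite /eqQ z3 z4 !(mul0r, subr0, addr0, expr0n) /= ?subr0 in hQ'.
    case: j01 => jj; rewrite jj in wj; rewrite wj in r1 r2.
      have z2' : hcoord z 2 = 0.
        apply: (pw _ 3%N); apply: (mulfI n3); rewrite mulr0.
        transitivity (hcoord z 2 * (- (1 * (gam * hcoord z 0 ^+ 3 - 4 * hcoord z 2 ^+ 3)))
          - (- (hcoord z 2 * (gam * hcoord z 0 ^+ 3 - hcoord z 2 ^+ 3)))); first by ring.
        by rewrite r2 r3; ring.
      have z0' : hcoord z 0 = 0.
        apply: (pw _ 2%N); apply: (mulfI g0); rewrite mulr0 -[RHS]oppr0 -[in RHS]r2 z2'; ring.
      apply: zero => //; apply: (pw _ 3%N); rewrite -[RHS]oppr0 -[in RHS]r4 z0'; ring.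
    have z1' : hcoord z 1 = 0.
      apply: (pw _ 3%N); apply: (mulfI n3); rewrite mulr0.
      transitivity (hcoord z 1 * (hcoord z 0 ^+ 3 - hcoord z 1 ^+ 3)
        - hcoord z 1 * (1 * (hcoord z 0 ^+ 3 - 4 * hcoord z 1 ^+ 3))); first by ring.
      by rewrite r1 r4; ring.
    have z0' : hcoord z 0 = 0.
      apply: (pw _ 2%N); rewrite -[RHS]r1 z1'; ring.
    apply: zero => //; apply: (pw _ 3%N); rewrite -[RHS]r3 z0'; ring.
  have h0 n m : hcoord (0 : 'rV[C]_n.+1) m = 0 by rewrite /hcoord mxE.
  have k2 : k (inord 2) = 0.
    by have := rel 0 0 1; rewrite k0 k1 h0 !mul0r !add0r mulr0 addr0 mulr1.
  have k3 : k (inord 3) = 0.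
    have := rel (mkrow 4 [:: 0; 0; 0; 1; 1]) 0 0; rewrite k0 k1 k2 !mul0r !add0r.
    by case: j01 => ->; rewrite mkrowE //= mulr1.
  by move=> l; rewrite -[l]inord_val; case: l => -[|[|[|[|//]]]] ? /=.
pose r : 'rV[C]_2 := rsubmx (b q : 'rV[C]_(4 + 2)).
pose e3 : 'rV[C]_4 := mkrow 3 [:: 0; 0; 0; 1].
pose us (s : C) : 'rV[C]_(4 + 2) := row_mx (s *: e3) r.
have us0 : us 0 = b q.
  rewrite /us scale0r -[RHS](@hsubmxK _ 1 4 2); congr row_mx; rewrite bF; apply/rowP => l.
  rewrite !mxE; case: l => -[|[|[|[|//]]]] ?; rewrite /f /= ?hP ?tq ?hQ //; exact/esym.
have [oU oU' b1 b2] := bi; have [Ub gb db] := b1 _ Uq.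
have [[_ _] ch1 _ [_ cpsi] _] := @CPxCPxC_chart R 4 1 i j.
have [_ psiq] := ch1 (x, 0) dx.
have dus (s : C) : differentiable us s.
  apply: (differentiable_row_mx _ (differentiable_cst r s)).1.
  apply: (@differentiableZl C C 'rV[C]_4 id); exact: differentiable_idfun.
pose y (s : C) : T := tline (slice_point i j (g (us s))).
have cy : {for 0, continuous y}.
  rewrite -us0 in Ub; have [_ _ dg] := b2 _ Ub.
  apply: (@continuous_comp _ _ _ us (fun u => tline (slice_point i j (g u)) : T) 0).
    exact: differentiable_continuous (dus 0).
  exact: (@continuous_comp _ _ _ g (fun u => tline (slice_point i j u) : T) (us 0)
    (differentiable_continuous dg) (cpsi _ I)).
have y0 : y 0 = (x, 0) by rewrite /y us0 gb.
move=> B nB.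
have n1 : \forall s \near (0 : C), B (y s).1.
  apply: (cy (fst @^-1` B)); rewrite y0.
  have cf : {for ((x, 0) : T), continuous (fst : T -> @CP R 4 * @CP R 1)} by exact: cvg_fst.
  exact: (cf B nB).
have n2 : \forall s \near (0 : C), U' (us s).
  apply: (differentiable_continuous (dus 0)).
  by apply: open_nbhs_nbhs; split=> //; rewrite us0.
have [del del0 Hd] := (near_nvP _ _).1 (filterI n1 n2).
(* At parameter s one has z_(3+j) = s, so a small nonzero s gives a point of the graph close to
   x. *)
have [s s0 sd] := nv_line (1 : C) del0.
have [|Bs U's] := Hd s.
  by rewrite subr0; move: sd; rewrite /GRing.scale /= mulr1.
exists (y s).1; split=> //; have [Up bg _] := b2 _ U's.
have FE' (l : 'I_4) : f l (g (us s)) = (s *: e3) 0 l.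
  rewrite -[LHS](congr1 (fun h => h (g (us s))) (FE l)) -bF bg.
  by rewrite (@row_mxKl _ 1 4 2).
have f0 := FE' (Ordinal (isT : (0 < 4)%N)); have f1 := FE' (Ordinal (isT : (1 < 4)%N)).
have f2 := FE' (Ordinal (isT : (2 < 4)%N)); have f3 := FE' (Ordinal (isT : (3 < 4)%N)).
rewrite !mxE /= ?mulr0 ?mulr1 in f0 f1 f2 f3.
apply: graph_tline => /=.
- exact: f0.
- by rewrite -[X in eqQ c _ _ X]f2; exact: f1.
- have {}f3 : hcoord (zcoord i (g (us s) : rV6)) (3 + j) = s := f3.
  by case: j01 f3 => -> f3; [left|right]; rewrite f3.
Qed.

Lemma blowup_setE : gam != 0 -> 0 < d ->
  blowup_set (N0_set c) (@D0_coords R) = [set x | Xset c d (x, 0)].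
Proof.
move=> g0 d0; apply/seteqP; split=> x.
  move=> clx; split; last by rewrite /= nrm0.
  apply: (closed_special_fibre) => B nB; have [y [gy By]] := clx B nB.
  by exists y; split=> //; exact: graph_on_family.
move=> [fx _]; have [i xi] := acoord_dom_ex x.1; have [j xj] := acoord_dom_ex x.2.
have dx : bidom i j (x, 0) by [].
have [z3|z3] := eqVneq (hcoord (zcoord i (bicoord i j (x, 0))) 3) 0; last first.
  apply: subset_closure; have [hP hQ] := (on_family_chart (y := ((x, 0) : E)) c dx).1 fx.
  have [[_ _] ch1 _ _ _] := @CPxCPxC_chart R 4 1 i j; have [_ psiq] := ch1 (x, 0) dx.
  rewrite -[x]/((x, 0 : C).1) -psiq; apply: graph_tline => //=; last by left.
  by rewrite tcoord_bicoord in hQ.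
have [z4|z4] := eqVneq (hcoord (zcoord i (bicoord i j (x, 0))) 4) 0; last first.
  apply: subset_closure; have [hP hQ] := (on_family_chart (y := ((x, 0) : E)) c dx).1 fx.
  have [[_ _] ch1 _ _ _] := @CPxCPxC_chart R 4 1 i j; have [_ psiq] := ch1 (x, 0) dx.
  rewrite -[x]/((x, 0 : C).1) -psiq; apply: graph_tline => //=; last by right.
  by rewrite tcoord_bicoord in hQ.
exact: (approach_D0 g0 fx dx z3 z4).
Qed.
End Blowup.

(** * Critical points of the family *)

Section Critical_points.
Variable R : realType.
Local Notation C := (CC R).

(** The threshold below which A, 1 - 5 A, B or 5 B - c counts as negligible: [small c] times (c +
    1)^4 is 10^-4, while (c + 1)^4 bounds |c - 4 B|^4 when B is negligible. *)
Definition small (c : R) : R := (10 ^+ 4 * (c + 1) ^+ 4)^-1.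

Lemma small_gt0 c : 10 < c -> 0 < small c.
Proof. by move=> c10; rewrite invr_gt0 mulr_gt0 ?exprn_gt0 //; lra. Qed.

Lemma small_mul c : 10 < c -> small c * (c + 1) ^+ 4 = (10 ^+ 4)^-1.
Proof.
move=> c10; rewrite /small invfM -mulrA mulVf ?mulr1 //.
by rewrite expf_neq0 // gt_eqF //; lra.
Qed.

Lemma small_le c : 10 < c -> small c <= 1 / 1000.
Proof.
move=> c10; have h : 1 <= (c + 1) ^+ 4 by apply: exprn_ege1; lra.
have e0 := small_gt0 c10; have := small_mul c10.
have : small c * 1 <= small c * (c + 1) ^+ 4 by rewrite ler_pM2l.
move: (small c * (c + 1) ^+ 4) => x; rewrite mulr1 => h1 h2; rewrite h2 in h1.
by apply: le_trans h1 _; lra.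
Qed.

Lemma pow_between (x l u : R) n : 0 <= l -> l <= x -> x <= u -> l ^+ n <= x ^+ n /\ x ^+ n <= u ^+ n.
Proof.
by move=> l0 lx xu; split; apply: lerXn2r; rewrite ?nnegrE //; lra.
Qed.

(** The variables are moduli: p, p4, p5 of A, 1 - 4 A, 1 - 5 A and q, q4, q5 of B, c - 4 B, 5 B - c.
    The linear hypotheses are triangle inequalities, the last two equations the relations between A
    and B. *)
Lemma critical_bounds (c p p4 p5 q q4 q5 : R) : 10 < c ->
  [/\ 0 <= p, 0 <= p4, 0 <= p5, 0 <= q & 0 <= q4] -> 0 <= q5 ->
  [/\ p4 <= 1 + 4 * p, 1 - 5 * p <= p5, 5 * p4 <= 1 + 4 * p5 & 1 - 4 * p5 <= 5 * p4] ->
  5 * p <= 1 + p5 -> 1 - p5 <= 5 * p ->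
  [/\ c - 4 * q <= q4, q4 <= c + 4 * q, q5 <= c + 5 * q & c - 4 * q5 <= 5 * q4] ->
  c - q5 <= 5 * q ->
  p <= small c \/ p5 <= small c -> q <= small c \/ q5 <= small c ->
  p * p4 ^+ 4 = q * q4 ^+ 4 -> p4 ^+ 4 * q5 ^+ 3 = q4 ^+ 4 * p5 ^+ 3 -> False.
Proof.
move=> c10 [p0 p40 p50 q0 q40] q50 [h1 h2 h3 h4] h5 h6 [h7 h8 h9 h10] h11 hp hq e1 e2.
have e0 := small_gt0 c10; have e3 := small_le c10; have e4 := small_mul c10.
move: (small c) hp hq e0 e3 e4 => e hp hq e0 e3 e4.
(* When 5 B is close to c, |B| |c - 4 B|^4 is at least 1, while |A| |1 - 4 A|^4 is at most 1/2. *)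
have big : q5 <= e -> False.
  move=> q5e.
  have b1 : 1 <= q4 ^+ 4 by apply: exprn_ege1; lra.
  have b2 : 1 <= q * q4 ^+ 4.
    have b3 : 1 <= q by lra.
    by apply: le_trans b1 _; rewrite ler_peMl // exprn_ge0.
  have p4l : p4 <= 11 / 10 by case: hp; lra.
  have pl : p <= 1 / 4 by case: hp; lra.
  have [_ b4] := @pow_between p4 0 (11 / 10) 4 (lexx _) p40 p4l.
  have b5 : p * p4 ^+ 4 <= 1 / 4 * (11 / 10) ^+ 4.
    by apply: ler_pM => //; rewrite exprn_ge0.
  have b6 : (11 / 10 : R) ^+ 4 <= 2 by rewrite expr_div_n ler_pdivrMr ?exprn_gt0 //; lra.
  move: e1 b5 b6 b2; move: (p * p4 ^+ 4) (q * q4 ^+ 4) ((11 / 10 : R) ^+ 4) => a b f; lra.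
case: hq => // hq; case: hp => hp.
  (* A and B both negligible: [e2] equates a number of size at most 2 c^3 with one of size at least
     47/100 c^4. *)
  have [_ b1] := @pow_between p4 0 (11 / 10) 4 (lexx _) p40 ltac:(lra).
  have [_ b2] := @pow_between q5 0 (11 / 10 * c) 3 (lexx _) q50 ltac:(lra).
  have [b3 _] := @pow_between q4 (c * (9 / 10)) q4 4 ltac:(lra) ltac:(lra) (lexx _).
  have [b4 _] := @pow_between p5 (9 / 10) p5 3 ltac:(lra) ltac:(lra) (lexx _).
  have c3 : 0 < c ^+ 3 by rewrite exprn_gt0 //; lra.
  have l1 : p4 ^+ 4 * q5 ^+ 3 <= (11 / 10) ^+ 4 * (11 / 10 * c) ^+ 3.
    by apply: ler_pM => //; rewrite exprn_ge0.
  have l2 : (c * (9 / 10)) ^+ 4 * (9 / 10) ^+ 3 <= q4 ^+ 4 * p5 ^+ 3.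
    by apply: ler_pM => //; rewrite exprn_ge0 //; lra.
  rewrite e2 in l1; have := le_trans l2 l1; rewrite leNgt => /negP; apply.
  have -> : (11 / 10) ^+ 4 * (11 / 10 * c) ^+ 3 = (11 / 10) ^+ 7 * c ^+ 3 by field.
  have -> : (c * (9 / 10)) ^+ 4 * (9 / 10) ^+ 3 = (c * (9 / 10) ^+ 7) * c ^+ 3 by field.
  rewrite ltr_pM2r //.
  have a1 : (11 / 10 : R) ^+ 7 <= 2 by rewrite expr_div_n ler_pdivrMr ?exprn_gt0 //; lra.
  have a2 : 47 / 100 <= (9 / 10 : R) ^+ 7 by rewrite expr_div_n ler_pdivlMr ?exprn_gt0 //; lra.
  apply: le_lt_trans a1 _; apply: (@lt_le_trans _ _ (c * (47 / 100))); first by lra.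
  by rewrite ler_pM2l //; lra.
(* 5 A close to 1 and B negligible: in [e1] the left side is at least (19/100)^5 > 10^-4 and the
   right side at most e (c + 1)^4 = 10^-4. *)
have b1 : 1 / 10 <= p by lra.
have [b2 _] := @pow_between p4 (19 / 100) p4 4 ltac:(lra) ltac:(lra) (lexx _).
have [_ b3] := @pow_between q4 0 (c + 1) 4 (lexx _) q40 ltac:(lra).
have b4 : 19 / 100 * (19 / 100) ^+ 4 <= p * p4 ^+ 4.
  by apply: ler_pM => //; try lra; rewrite exprn_ge0 //; lra.
have b5 : q * q4 ^+ 4 <= e * (c + 1) ^+ 4 by apply: ler_pM => //; rewrite exprn_ge0.
rewrite e4 -e1 in b5.
have := le_trans b4 b5; rewrite leNgt => /negP; apply.
by rewrite expr_div_n; lra.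
Qed.

Section Bounds.
Variable c : R.
Local Notation gam := ((c%:C)%C : C).
Hypothesis c10 : 10 < c.

Lemma nrmN (z : C) : nrm (- z) = nrm z.
Proof. by rewrite /nrm normrN. Qed.

Lemma nrm_nat n : nrm (n%:R : C) = n%:R.
Proof.
have -> : (n%:R : C) = ((n%:R : R)%:C)%C by rewrite rmorph_nat.
by rewrite -[(_)%:C%C]/(mkC n%:R 0) nrm_mkC normr_nat.
Qed.

Lemma nrm_gam : nrm gam = c.
Proof. by rewrite -[gam]/(mkC c 0) nrm_mkC gtr0_norm //; move: c10; lra. Qed.

Lemma gam_neq0 : gam != 0.
Proof. by rewrite -nrm_eq0 nrm_gam gt_eqF //; move: c10; lra. Qed.

Lemma gam_neqN1 : 1 + gam != 0.
Proof.
rewrite addrC addr_eq0; apply/eqP => h; have := nrm_gam.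
by rewrite h nrmN nrm1 => e; move: c10; rewrite -e; lra.
Qed.

(* A = z1^3, B = z2^3 and tau = t^3 / 27 at a critical point of the family with
   z0 = 1 and z3 z4 <> 0; the last relation is the cube of z1 z4^4 = z2 z3^4.
   The first two force A or 1 - 5 A, and B or c - 5 B, to be small, and the last
   one is violated in each of the four cases. *)
Lemma no_critical_value (A B tau : C) : tau != 0 -> nrm tau < small c ^+ 4 ->
  A * (1 - 5 * A) ^+ 3 = tau -> B * (5 * B - gam) ^+ 3 = tau ->
  A * (1 - 4 * A) ^+ 4 = B * (gam - 4 * B) ^+ 4 -> False.
Proof.
move=> t0 ts eA eB eAB; have e0 := small_gt0 c10.
have dich (x y : C) : x * y ^+ 3 = tau -> nrm x <= small c \/ nrm y <= small c.
  move=> xy; apply: contrapT => /not_orP[/negP + /negP]; rewrite -!ltNge => hx hy.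
  move: ts; rewrite -xy nrmM nrmX ltNge => /negP; apply; rewrite [leLHS]exprS.
  apply: ler_pM; [exact: ltW|exact: exprn_ge0 (ltW e0)|exact: ltW|].
  by apply: lerXn2r; rewrite ?nnegrE ?nrm_ge0 // ltW.
have n4 : nrm (4 : C) = 4 := nrm_nat 4; have n5 : nrm (5 : C) = 5 := nrm_nat 5.
have tri (x y z : C) : x = y + z -> nrm x <= nrm y + nrm z by move=> ->; exact: nrmD.
have triB (x y z : C) : x = y - z -> nrm x <= nrm y + nrm z.
  by move=> ->; apply: le_trans (nrmD _ _) _; rewrite nrmN.
apply: (@critical_bounds c (nrm A) (nrm (1 - 4 * A)) (nrm (1 - 5 * A))
  (nrm B) (nrm (gam - 4 * B)) (nrm (5 * B - gam)) c10).
- by split; exact: nrm_ge0.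
- exact: nrm_ge0.
- split.
  + by have := triB (1 - 4 * A) 1 (4 * A) erefl; rewrite nrmM n4 nrm1.
  + have := tri 1 (1 - 5 * A) (5 * A); rewrite subrK nrmM n5 nrm1 => /(_ erefl).
    by move: (nrm _) (nrm _) => x y; lra.
  + have := tri (5 * (1 - 4 * A)) 1 (4 * (1 - 5 * A)); rewrite !nrmM n4 n5 nrm1; apply; ring.
  + have := triB 1 (5 * (1 - 4 * A)) (4 * (1 - 5 * A)); rewrite !nrmM n4 n5 nrm1.
    move=> h; have := h ltac:(ring); by move: (nrm _) (nrm _) => x y; lra.
- have := triB (5 * A) 1 (1 - 5 * A); rewrite nrmM n5 nrm1; apply; ring.
- have := tri 1 (5 * A) (1 - 5 * A); rewrite nrmM n5 nrm1 => h.
  have := h ltac:(ring); by move: (nrm _) (nrm _) => x y; lra.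
- split.
  + have := tri gam (gam - 4 * B) (4 * B); rewrite subrK nrmM n4 nrm_gam => /(_ erefl).
    by move: (nrm _) (nrm _) => x y; lra.
  + by have := triB (gam - 4 * B) gam (4 * B) erefl; rewrite nrmM n4 nrm_gam.
  + have := triB (5 * B - gam) (5 * B) gam erefl; rewrite nrmM n5 nrm_gam.
    by move: (nrm _) (nrm _) => x y; lra.
  + have := tri gam (5 * (gam - 4 * B)) (4 * (5 * B - gam)); rewrite !nrmM n4 n5 nrm_gam => h.
    have := h ltac:(ring); by move: (nrm _) (nrm _) => x y; lra.
- have := triB gam (5 * B) (5 * B - gam); rewrite nrmM n5 nrm_gam => h.
  have := h ltac:(ring); by move: (nrm _) (nrm _) => x y; lra.
- exact: dich eA.
- exact: dich eB.
- by rewrite -!nrmX -!nrmM eAB.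
- rewrite -!nrmX -!nrmM; congr nrm; apply: (mulfI t0).
  rewrite -{1}eA mulrACA eAB -eB; ring.
Qed.

(** This fixes the radius of the disc: |t|^3 <= |t|^2 < [small c ^+ 4], as [no_critical_value]
    requires for tau. *)
Lemma nrm_exp_lt (t : C) : nrm t < small c ^+ 2 -> nrm (t ^+ 3 / 27) < small c ^+ 4.
Proof.
move=> ht; have e0 := small_gt0 c10; have e1 := small_le c10.
rewrite nrmM nrmX nrmV nrm_nat.
have h1 : nrm t <= 1.
  apply: le_trans (ltW ht) _; apply: exprn_ile1; rewrite ?ltW //.
  by lra.
have h2 : nrm t ^+ 3 <= nrm t ^+ 2.
  by rewrite exprSr ler_piMr // exprn_ge0 // nrm_ge0.
have h3 : nrm t ^+ 2 < small c ^+ 4.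
  rewrite [ltRHS](_ : _ = (small c ^+ 2) ^+ 2); last by rewrite -exprM.
  by rewrite ltrXn2r ?nnegrE ?nrm_ge0 // exprn_ge0 // ltW.
apply: le_lt_trans h3; apply: le_trans h2.
by rewrite ler_piMr ?exprn_ge0 ?nrm_ge0 // invf_le1 // ler1n.
Qed.

Lemma expf0 (y : C) m : y ^+ m.+1 = 0 -> y = 0.
Proof. by move/eqP; rewrite expf_eq0 => /eqP. Qed.

Lemma mulf0 (x y : C) : x != 0 -> x * y = 0 -> y = 0.
Proof. by move=> x0 /eqP; rewrite mulf_eq0 (negPf x0) => /eqP. Qed.

Lemma nat_neq0 n : (n.+1%:R : C) != 0.
Proof. by rewrite pnatr_eq0. Qed.

(** A linear system for x^3 and y^3 with determinant 15. *)
Lemma critical_cubes (x y g : C) : x != 0 -> y != 0 ->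
  y * (g - 4 * x ^+ 3 - y ^+ 3) = 0 -> x * (g - x ^+ 3 - 4 * y ^+ 3) = 0 ->
  x ^+ 3 = g / 5 /\ y ^+ 3 = g / 5.
Proof.
move=> x0 y0 /(mulf0 y0) h1 /(mulf0 x0) h2; have n15 := nat_neq0 14.
have n5 := nat_neq0 4.
have yE : y ^+ 3 = g - 4 * x ^+ 3.
  by rewrite -[LHS]addr0 -h1; ring.
rewrite yE in h2; have xE : x ^+ 3 = g / 5.
  by apply: (mulfI n15); rewrite -[LHS]subr0 -[X in _ - X]h2; field.
by split=> //; rewrite yE xE; field.
Qed.

(* the vanishing of the differential where z0 = 1 and (w0 : w1) = (z3 : z4) *)
Lemma critical_normalized (x1 x2 x3 x4 t : C) : nrm t < small c ^+ 2 ->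
  x3 != 0 \/ x4 != 0 ->
  x4 * (1 - 4 * x1 ^+ 3 - x4 ^+ 3) = 0 -> x3 * (gam - 4 * x2 ^+ 3 - x3 ^+ 3) = 0 ->
  x1 * x4 ^+ 4 = x2 * x3 ^+ 4 ->
  x1 * (1 - x1 ^+ 3 - 4 * x4 ^+ 3) + t = 0 -> x2 * (gam - x2 ^+ 3 - 4 * x3 ^+ 3) - t = 0 ->
  x4 * (3 * x1 + 4 * t) = x3 * (3 * gam * x2 - 4 * t) ->
  [/\ t = 0, x1 * x4 = 0 /\ x2 * x3 = 0, x1 ^+ 4 = x1 /\ x4 ^+ 4 = x4 &
    x2 ^+ 4 = gam * x2 /\ x3 ^+ 4 = gam * x3].
Proof.
move=> ht x34 e1 e2 e3 e4 e5 e6; have g0 := gam_neq0.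
have n3 := nat_neq0 2; have n5 := nat_neq0 4.
have [t0|t0] := eqVneq t 0; last exfalso.
  rewrite t0 ?(addr0, subr0, mulr0) in e4 e5 e6.
  have e6' : x1 * x4 = gam * (x2 * x3).
    by apply: (mulfI n3); transitivity (x4 * (3 * x1)); [ring|rewrite e6; ring].
  (* Otherwise none of the four vanishes, the cubes are 1/5 for x1, x4 and c/5 for x2, x3, and the
     cube of [e6'] gives c^5 = 1. *)
  have a1 : x1 * x4 = 0.
    apply: contrapT => /eqP n14; have := n14; rewrite mulf_eq0 negb_or => /andP[n1 n4].
    have n23 : x2 * x3 != 0.
      by apply: contraNneq n14 => h; rewrite e6' h mulr0.
    have := n23; rewrite mulf_eq0 negb_or => /andP[n2 n3'].
    have [c1 c4] := critical_cubes n1 n4 e1 e4; have [c2 c3] := critical_cubes n2 n3' e2 e5.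
    have : (x1 * x4) ^+ 3 = (gam * (x2 * x3)) ^+ 3 by rewrite e6'.
    rewrite !exprMn c1 c2 c3 c4 => h.
    have g5 : gam ^+ 5 = 1.
      have n25 : (5 : C) ^+ 2 != 0 by rewrite expf_neq0.
      apply: (mulIf (invr_neq0 n25)); transitivity (gam ^+ 3 * (gam / 5 * (gam / 5))); first by field.
      by rewrite -h; field.
    have := congr1 (@nrm R) g5; rewrite nrmX nrm_gam nrm1 => c5.
    have : 1 < c ^+ 5 by rewrite exprn_egt1 //; move: c10; lra.
    by rewrite c5 ltxx.
  have a2 : x2 * x3 = 0 by apply: (mulfI g0); rewrite -e6' a1 mulr0.
  split=> //; split.
  - rewrite -[LHS]addr0 -[X in _ + X]e4; transitivity (x1 - 4 * (x1 * x4) * x4 ^+ 2); first by ring.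
    by rewrite a1; ring.
  - rewrite -[LHS]addr0 -[X in _ + X]e1; transitivity (x4 - 4 * (x1 * x4) * x1 ^+ 2); first by ring.
    by rewrite a1; ring.
  - rewrite -[LHS]addr0 -[X in _ + X]e5; transitivity (gam * x2 - 4 * (x2 * x3) * x3 ^+ 2); first by ring.
    by rewrite a2; ring.
  - rewrite -[LHS]addr0 -[X in _ + X]e2; transitivity (gam * x3 - 4 * (x2 * x3) * x2 ^+ 2); first by ring.
    by rewrite a2; ring.
(* If x4 = 0, then [e3] gives x2 = 0 and [e5] gives t = 0; symmetrically for x3 with x1 and [e4]. *)
have n4 : x4 != 0.
  apply: contraNneq t0 => x40; have n3' : x3 != 0 by case: x34 => //; rewrite x40 eqxx.
  rewrite x40 expr0n mulr0 in e3; have x20 : x2 = 0.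
    by apply: (mulIf (expf_neq0 4 n3')); rewrite -e3 mul0r.
  by rewrite x20 mul0r sub0r in e5; rewrite -oppr_eq0 e5.
have n3' : x3 != 0.
  apply: contraNneq t0 => x30; rewrite x30 expr0n mulr0 in e3.
  have x10 : x1 = 0 by apply: (mulIf (expf_neq0 4 n4)); rewrite e3 mul0r.
  by rewrite x10 mul0r add0r in e4; rewrite e4.
have cD : x4 ^+ 3 = 1 - 4 * x1 ^+ 3 by rewrite -[LHS]addr0 -(mulf0 n4 e1); ring.
have cC : x3 ^+ 3 = gam - 4 * x2 ^+ 3 by rewrite -[LHS]addr0 -(mulf0 n3' e2); ring.
rewrite cD in e4; rewrite cC in e5.
have f1 : x1 * (1 - 5 * x1 ^+ 3) = t / 3.
  apply: (mulfI n3); rewrite -[LHS]addr0 -[X in _ + X]e4; by field.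
have f2 : x2 * (5 * x2 ^+ 3 - gam) = t / 3.
  apply: (mulfI n3); rewrite -[LHS]subr0 -[X in _ - X]e5; by field.
apply: (@no_critical_value (x1 ^+ 3) (x2 ^+ 3) (t ^+ 3 / 27)).
- by rewrite mulf_neq0 ?expf_neq0 // invr_neq0 // nat_neq0.
- exact: nrm_exp_lt.
- rewrite -exprMn f1; by field.
- rewrite -exprMn f2; by field.
- rewrite -cD -cC -!exprM; transitivity ((x1 * x4 ^+ 4) ^+ 3); first by rewrite exprMn -exprM.
  by rewrite e3 exprMn -exprM.
Qed.

(* the vanishing of the differential along z3 = z4 = 0 *)
Lemma critical_on_D0 (z0 z1 z2 w0 w1 t : C) : nrm t < small c ^+ 2 ->
  [\/ z0 != 0, z1 != 0 | z2 != 0] -> w0 != 0 \/ w1 != 0 ->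
  w1 * (z0 ^+ 3 - 4 * z1 ^+ 3) = 0 -> w0 * (gam * z0 ^+ 3 - 4 * z2 ^+ 3) = 0 ->
  z1 * (z0 ^+ 3 - z1 ^+ 3) + t * z0 ^+ 4 = 0 -> z2 * (gam * z0 ^+ 3 - z2 ^+ 3) - t * z0 ^+ 4 = 0 ->
  False.
Proof.
move=> ht zn0 wn0 e1 e2 e3 e4; have g0 := gam_neq0; have n3 := nat_neq0 2; have n4 := nat_neq0 3.
have zz : z0 != 0.
  apply/negP => /eqP z00; rewrite z00 !expr0n /= ?(mulr0, addr0, subr0, sub0r) in e3 e4.
  have z1' : z1 = 0 by apply: (@expf0 _ 3); rewrite exprS -[RHS]oppr0 -[in RHS]e3 mulrN opprK.
  have z2' : z2 = 0 by apply: (@expf0 _ 3); rewrite exprS -[RHS]oppr0 -[in RHS]e4 mulrN opprK.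
  by case: zn0; rewrite ?z00 ?z1' ?z2' eqxx.
(* The critical values found below satisfy 256 t^3 = 27 c^4 or 256 t^3 = - 27; both are too large
   for the disc. *)
have tb : nrm (256 * t ^+ 3) < 27.
  have := nrm_exp_lt ht; rewrite (nrmM (t ^+ 3)) (nrmM 256) nrmV nrmX !nrm_nat.
  have : small c ^+ 4 <= 1 / 1000.
    have e := small_le c10; have e' := small_gt0 c10.
    have e3' : small c ^+ 3 <= 1 by apply: exprn_ile1; [exact: ltW|lra].
    by rewrite exprS; apply: le_trans e; rewrite -[leRHS]mulr1 ler_pM2l.
  by move: (nrm t ^+ 3) (small c ^+ 4) => x y; lra.
case: wn0 => [/mulf0/(_ e2)|/mulf0/(_ e1)] h.
- pose x := z2 / z0; have zx : z2 = x * z0 by rewrite divfK.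
  have h1 : x ^+ 3 = gam / 4.
    apply: (mulIf (expf_neq0 3 zz)); rewrite -exprMn -zx; apply: (mulfI n4).
    by rewrite -[LHS]addr0 -h; field.
  have h2 : x * (gam - x ^+ 3) = t.
    apply: (mulIf (expf_neq0 4 zz)); apply/eqP; rewrite -subr_eq0; apply/eqP; rewrite -[RHS]e4 zx; ring.
  have h3 : 256 * t ^+ 3 = 27 * gam ^+ 4.
    rewrite -h2 exprMn h1; by field.
  move: tb; rewrite h3 nrmM nrmX nrm_nat nrm_gam.
  have : 1 <= c ^+ 4 by rewrite exprn_ege1 //; move: c10; lra.
  by move: (c ^+ 4) => y; lra.
- pose x := z1 / z0; have zx : z1 = x * z0 by rewrite divfK.
  have h1 : x ^+ 3 = 1 / 4.
    apply: (mulIf (expf_neq0 3 zz)); rewrite -exprMn -zx; apply: (mulfI n4).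
    by rewrite -[LHS]addr0 -h; field.
  have h2 : x * (1 - x ^+ 3) = - t.
    apply: (mulIf (expf_neq0 4 zz)); apply/eqP; rewrite -subr_eq0; apply/eqP; rewrite -[RHS]e3 zx; ring.
  have h3 : 256 * t ^+ 3 = - 27.
    have -> : t = - (x * (1 - x ^+ 3)) by rewrite h2 opprK.
    transitivity (- 256 * x ^+ 3 * (1 - x ^+ 3) ^+ 3); first by ring.
    rewrite h1; by field.
  by move: tb; rewrite h3 nrmN nrm_nat ltxx.
Qed.

(** At z0 = 0 the equations decouple into the pairs z1, z4 and z2, z3 and force z3 = z4 = 0.
    Otherwise division by z0 leads to [critical_normalized]. *)
Lemma critical_off_D0 (z0 z1 z2 z3 z4 t : C) : nrm t < small c ^+ 2 ->
  z3 != 0 \/ z4 != 0 ->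
  z4 * (z0 ^+ 3 - 4 * z1 ^+ 3 - z4 ^+ 3) = 0 -> z3 * (gam * z0 ^+ 3 - 4 * z2 ^+ 3 - z3 ^+ 3) = 0 ->
  z1 * z4 ^+ 4 = z2 * z3 ^+ 4 ->
  z1 * (z0 ^+ 3 - z1 ^+ 3 - 4 * z4 ^+ 3) + t * z0 ^+ 4 = 0 ->
  z2 * (gam * z0 ^+ 3 - z2 ^+ 3 - 4 * z3 ^+ 3) - t * z0 ^+ 4 = 0 ->
  z4 * (3 * z1 * z0 ^+ 2 + 4 * t * z0 ^+ 3) = z3 * (3 * gam * z2 * z0 ^+ 2 - 4 * t * z0 ^+ 3) ->
  [/\ t = 0, z0 != 0, z1 * z4 = 0 /\ z2 * z3 = 0,
    z1 ^+ 4 = z1 * z0 ^+ 3 /\ z4 ^+ 4 = z4 * z0 ^+ 3 &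
    z2 ^+ 4 = gam * z2 * z0 ^+ 3 /\ z3 ^+ 4 = gam * z3 * z0 ^+ 3].
Proof.
move=> ht z34 e1 e2 e3 e4 e5 e6.
have n15 := nat_neq0 14.
have zz : z0 != 0.
  apply/negP => /eqP z00; rewrite z00 !expr0n /= ?(mulr0, addr0, subr0, sub0r) in e1 e2 e4 e5.
  have half (x y : C) : y * (- (4 * x ^+ 3) - y ^+ 3) = 0 -> x * (- x ^+ 3 - 4 * y ^+ 3) = 0 -> y = 0.
    move=> h1 h2; have [//|y0] := eqVneq y 0; have h3 := mulf0 y0 h1.
    have yE : y ^+ 3 = - (4 * x ^+ 3) by rewrite -[LHS]addr0 -h3; ring.
    rewrite yE in h2; have x0 : x = 0.
      apply: (@expf0 _ 3); apply: (mulfI n15); rewrite mulr0 -[RHS]h2; ring.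
    by apply: (@expf0 _ 2); rewrite yE x0 expr0n mulr0 oppr0.
  by case: z34; rewrite ?(half z2 z3 e2 e5) ?(half z1 z4 e1 e4) eqxx.
have z04 : z0 ^+ 4 != 0 by rewrite expf_neq0.
have [] := @critical_normalized (z1 / z0) (z2 / z0) (z3 / z0) (z4 / z0) t ht.
- by case: z34 => h; [left|right]; rewrite mulf_neq0 ?invr_eq0.
- by apply: (mulIf z04); rewrite mul0r -[RHS]e1; field.
- by apply: (mulIf z04); rewrite mul0r -[RHS]e2; field.
- apply: (mulIf (expf_neq0 5 zz)); transitivity (z1 * z4 ^+ 4); first by field.
  by rewrite e3; field.
- by apply: (mulIf z04); rewrite mul0r -[RHS]e4; field.
- by apply: (mulIf z04); rewrite mul0r -[RHS]e5; field.
- apply: (mulIf z04); transitivity (z4 * (3 * z1 * z0 ^+ 2 + 4 * t * z0 ^+ 3)); first by field.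
  by rewrite e6; field.
- move=> t0 [h14 h23] [h1 h4] [h2 h3]; split=> //; split.
  + by transitivity (z1 / z0 * (z4 / z0) * z0 ^+ 2); [field|rewrite h14 mul0r].
  + by transitivity (z2 / z0 * (z3 / z0) * z0 ^+ 2); [field|rewrite h23 mul0r].
  + by transitivity ((z1 / z0) ^+ 4 * z0 ^+ 4); [field|rewrite h1; field].
  + by transitivity ((z4 / z0) ^+ 4 * z0 ^+ 4); [field|rewrite h4; field].
  + by transitivity ((z2 / z0) ^+ 4 * z0 ^+ 4); [field|rewrite h2; field].
  + by transitivity ((z3 / z0) ^+ 4 * z0 ^+ 4); [field|rewrite h3; field].
Qed.

Lemma row5_neq0 (z : 'rV[C]_5) : z != 0 -> hcoord z 3 = 0 -> hcoord z 4 = 0 ->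
  [\/ hcoord z 0 != 0, hcoord z 1 != 0 | hcoord z 2 != 0].
Proof.
move=> z0 h3 h4; apply: contrapT => h; case/negP: z0; apply/eqP/hcoord_inj => k k5.
rewrite [RHS]/hcoord mxE; apply: contrapT => /eqP hk; apply: h.
move: k k5 hk => [|[|[|[|[|//]]]]] _ hk; first by constructor 1.
- by constructor 2.
- by constructor 3.
- by rewrite h3 eqxx in hk.
- by rewrite h4 eqxx in hk.
Qed.

Lemma row2_neq0 (w : 'rV[C]_2) : w != 0 -> hcoord w 0 != 0 \/ hcoord w 1 != 0.
Proof.
move=> w0; apply: contrapT => /not_orP[/negP + /negP]; rewrite !negbK => /eqP h0 /eqP h1.
by case/negP: w0; apply/eqP/hcoord_inj => -[|[|//]] _; rewrite ?h0 ?h1 /hcoord mxE.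
Qed.

(** A dependence between the differentials gives Lagrange multipliers a, b, e. If b = 0, then w <> 0
    makes all of them vanish; so one divides by b, and evaluation on basis vectors yields the
    critical equations. Off D_0, w is a multiple mu of (z3, z4), and eliminating al = a / b leaves
    the hypotheses of [critical_off_D0]. *)
Lemma submersive_or_node (z : 'rV[C]_5) (w : 'rV[C]_2) (t : C) : z != 0 -> w != 0 ->
  eqP_ z w = 0 -> eqQ c z w t = 0 -> nrm t < small c ^+ 2 ->
  submersive c z w t \/
  [/\ t = 0, node c z, hcoord z 0 != 0 & hcoord z 3 != 0 \/ hcoord z 4 != 0].
Proof.
move=> z0 w0 hP hQ ht.
have [|ns] := pselect (submersive c z w t); first by left.
right; have [a [b [e [rel nz]]]] : exists a b e : C,
    (forall dz dw dt, a * dPeq z w dz dw + b * dQeq c z w t dz dw dt + e * dt = 0) /\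
    ~ [/\ a = 0, b = 0 & e = 0].
  apply: contrapT => no; apply: ns => a b e rel; apply: contrapT => nz.
  by apply: no; exists a, b, e.
have rw := row2_neq0 w0.
have rel' (a0 a1 a2 a3 a4 e0 e1 s : C) : a * dPeq z w (mkrow 4 [:: a0; a1; a2; a3; a4]) (mkrow 1 [:: e0; e1])
    + b * dQeq c z w t (mkrow 4 [:: a0; a1; a2; a3; a4]) (mkrow 1 [:: e0; e1]) s + e * s = 0 by exact: rel.
have b0 : b != 0.
  apply/negP => /eqP b0; apply: nz.
  have r3 := rel' 0 0 0 1 0 0 0 0; have r4 := rel' 0 0 0 0 1 0 0 0; have rs := rel' 0 0 0 0 0 0 0 1.
  rewrite /dPeq /dQeq !mkrowE //= b0 in r3 r4 rs.
  split=> //; last by rewrite -[RHS]rs; ring.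
  case: rw => h; apply: (mulIf h); rewrite mul0r; first by rewrite -[RHS]oppr0 -[in RHS]r4; ring.
  by rewrite -[RHS]r3; ring.
pose al := a / b; have aE : a = al * b by rewrite divfK.
have r0 := rel' 1 0 0 0 0 0 0 0; have r1 := rel' 0 1 0 0 0 0 0 0; have r2 := rel' 0 0 1 0 0 0 0 0.
have r3 := rel' 0 0 0 1 0 0 0 0; have r4 := rel' 0 0 0 0 1 0 0 0.
have s0 := rel' 0 0 0 0 0 1 0 0; have s1 := rel' 0 0 0 0 0 0 1 0.
rewrite /dPeq /dQeq !mkrowE //= aE in r0 r1 r2 r3 r4 s0 s1.
move: hP hQ r0 r1 r2 r3 r4 s0 s1 rw (row5_neq0 z0); rewrite /node /eqP_ /eqQ {rel rel' nz ns z0 w0}.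
move: (hcoord z 0) (hcoord z 1) (hcoord z 2) (hcoord z 3) (hcoord z 4) (hcoord w 0) (hcoord w 1).
move=> z0 z1 z2 z3 z4 w0 w1 /eqP; rewrite subr_eq0 => /eqP hP hQ r0 r1 r2 r3 r4 s0 s1 rw rz.
have g0 : w1 * (3 * z1 * z0 ^+ 2 + 4 * t * z0 ^+ 3) - w0 * (3 * gam * z2 * z0 ^+ 2 - 4 * t * z0 ^+ 3) = 0.
  by apply: (mulfI b0); rewrite mulr0 -[RHS]r0; ring.
have g1 : w1 * (z0 ^+ 3 - 4 * z1 ^+ 3 - z4 ^+ 3) = 0 by apply: (mulfI b0); rewrite mulr0 -[RHS]r1; ring.
have g2 : w0 * (gam * z0 ^+ 3 - 4 * z2 ^+ 3 - z3 ^+ 3) = 0.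
  by apply: (mulfI b0); rewrite mulr0 -[RHS]oppr0 -[in RHS]r2; ring.
have g3 : al * w1 + 3 * w0 * z2 * z3 ^+ 2 = 0 by apply: (mulfI b0); rewrite mulr0 -[RHS]r3; ring.
have g4 : al * w0 + 3 * w1 * z1 * z4 ^+ 2 = 0.
  by apply: (mulfI b0); rewrite mulr0 -[RHS]oppr0 -[in RHS]r4; ring.
have h0 : al * z4 + z2 * (gam * z0 ^+ 3 - z2 ^+ 3 - z3 ^+ 3) - t * z0 ^+ 4 = 0.
  by apply: (mulfI b0); rewrite mulr0 -[RHS]oppr0 -[in RHS]s0; ring.
have h1 : al * z3 + z1 * (z0 ^+ 3 - z1 ^+ 3 - z4 ^+ 3) + t * z0 ^+ 4 = 0.
  by apply: (mulfI b0); rewrite mulr0 -[RHS]s1; ring.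
have [[z30 z40]|z34] := pselect (z3 = 0 /\ z4 = 0).
  exfalso; rewrite z30 z40 in g1 g2 h0 h1.
  apply: (@critical_on_D0 z0 z1 z2 w0 w1 t ht (rz z30 z40) rw).
  - by rewrite -[RHS]g1; ring.
  - by rewrite -[RHS]g2; ring.
  - by rewrite -[RHS]h1; ring.
  - by rewrite -[RHS]h0; ring.
have {rz}z34 : z3 != 0 \/ z4 != 0.
  apply: contrapT => /not_orP[/negP + /negP]; rewrite !negbK => /eqP h3 /eqP h4; exact: z34.
have [mu [mu0 [w0E w1E]]] : exists mu : C, mu != 0 /\ w0 = mu * z3 /\ w1 = mu * z4.
  have [w00|w00] := eqVneq w0 0.
    have w10 : w1 != 0 by case: rw => //; rewrite w00 eqxx.
    have z30 : z3 = 0 by apply: (mulIf w10); rewrite hP w00 mulr0 mul0r.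
    have z40 : z4 != 0 by case: z34 => //; rewrite z30 eqxx.
    by exists (w1 / z4); rewrite mulf_neq0 ?invr_eq0 // z30 mulr0 divfK.
  have z30 : z3 != 0.
    case: z34 => // z40; apply: contraNneq z40 => z30; apply/eqP/(mulIf w00).
    by rewrite -hP z30 !mul0r.
  exists (w0 / z3); rewrite mulf_neq0 ?invr_eq0 // divfK //; split=> //; split=> //.
  by apply: (mulfI z30); rewrite hP; field.
rewrite w0E w1E in g0 g1 g2 g3 g4.
have k3 : al * z4 + 3 * z2 * z3 ^+ 3 = 0 by apply: (mulfI mu0); rewrite mulr0 -[RHS]g3; ring.
have k4 : al * z3 + 3 * z1 * z4 ^+ 3 = 0 by apply: (mulfI mu0); rewrite mulr0 -[RHS]g4; ring.
have n3 := nat_neq0 2.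
have [] := @critical_off_D0 z0 z1 z2 z3 z4 t ht z34.
- by apply: (mulfI mu0); rewrite mulr0 -[RHS]g1; ring.
- by apply: (mulfI mu0); rewrite mulr0 -[RHS]g2; ring.
- apply: (mulfI n3); apply/eqP; rewrite -subr_eq0; apply/eqP.
  transitivity (z4 * (al * z3 + 3 * z1 * z4 ^+ 3) - z3 * (al * z4 + 3 * z2 * z3 ^+ 3)); first by ring.
  by rewrite k3 k4; ring.
- transitivity (al * z3 + z1 * (z0 ^+ 3 - z1 ^+ 3 - z4 ^+ 3) + t * z0 ^+ 4 - (al * z3 + 3 * z1 * z4 ^+ 3)).
    by ring.
  by rewrite h1 k4 subr0.
- transitivity (al * z4 + z2 * (gam * z0 ^+ 3 - z2 ^+ 3 - z3 ^+ 3) - t * z0 ^+ 4 - (al * z4 + 3 * z2 * z3 ^+ 3)).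
    by ring.
  by rewrite h0 k3 subr0.
- apply: (mulfI mu0); apply/eqP; rewrite -subr_eq0; apply/eqP; rewrite -[RHS]g0; ring.
- by move=> t0 zz [? ?] [? ?] [? ?].
Qed.
End Bounds.
End Critical_points.

Section Smoothability.
Variables (R : realType) (c : R).
Local Notation C := (CC R).
Local Notation E := (CPxCPxC_fun R 4 1).
Local Notation d := (small c ^+ 2).
Hypothesis c10 : 10 < c.

Lemma family_dichotomy (x : E) (i : 'I_5) (j : 'I_2) : Xset c d x -> bidom i j x ->
  submersive c (zcoord i (bicoord i j x)) (wcoord j (bicoord i j x)) (time x) \/
  [/\ time x = 0, node c (zcoord i (bicoord i j x)), acoord_dom (ord0 : 'I_5) (x : _ * _).1.1 &
    hcoord (zcoord i (bicoord i j x)) 3 != 0 \/ hcoord (zcoord i (bicoord i j x)) 4 != 0].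
Proof.
move=> [fx tx] dx; have [hP hQ] := (on_family_chart c dx).1 fx; rewrite tcoord_bicoord in hQ.
have [|[t0 nz z0 z34]] := submersive_or_node c10 (slice_neq0 i _) (slice_neq0 j _) hP hQ tx.
  by left.
right; split=> //; rewrite /acoord_dom /=.
have [a a0 ->] := hrep_slice dx.1; rewrite -(zcoord_bicoord i j) mxE mulf_neq0 //.
move: z0; rewrite /hcoord; congr (_ != _); congr (_ _ _).
by apply: val_inj; rewrite /= inordK.
Qed.

Lemma smoothable_N1 : smoothable (N1 c).
Proof.
have d0 : 0 < d by rewrite exprn_gt0 // small_gt0.
have g0 := gam_neq0 c10.
apply: (smoothable_of_local d0).
- move=> x; have Xx := set_mem (valP x).
  have [j xj] := acoord_dom_ex ((\val x : _ * _).1.2).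
  (* The node coordinates belong to the chart z0 = 1, which is therefore tried first; outside it
     there are no nodes. *)
  have [x0|x0] := pselect (acoord_dom (ord0 : 'I_5) (\val x : _ * _).1.1).
    have dx : bidom (ord0 : 'I_5) j (\val x) := conj x0 xj.
    have [sub|[t0 nz _ z34]] := family_dichotomy Xx dx; first exact: submersive_local dx sub.
    exact: (node_local g0 (gam_neqN1 c10) dx t0 nz z34).
  have [i xi] := acoord_dom_ex ((\val x : _ * _).1.1).
  have dx : bidom i j (\val x) := conj xi xj.
  have [sub|[_ _ h _]] := family_dichotomy Xx dx; first exact: submersive_local dx sub.
  by case: (x0 h).
- move=> b bd b0 x; have [Xx xb] := set_mem (valP x).
  have [j xj] := acoord_dom_ex ((\val x : _ * _).1.2).
  have [i xi] := acoord_dom_ex ((\val x : _ * _).1.1).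
  have dx : bidom i j (\val x) := conj xi xj.
  have [sub|[t0 _ _ _]] := family_dichotomy Xx dx; first exact: (smooth_fibre Xx xb dx sub).
  by case/negP: b0; rewrite -xb t0.
- exact: (blowup_setE g0 d0).
Qed.
End Smoothability.

(** * The nodal quintic *)

Section Quintic.
Variables (R : realType) (c : R).
Local Notation C := (CC R).
Local Notation gam := ((c%:C)%C : C).
Hypothesis c10 : 10 < c.
Local Notation N0fun := (Defs.induced (F := CP_fun R 4) (N0_set c)).

Definition dquintic (z dz : 'rV[C]_5) : C :=
  hcoord dz 1 * (hcoord z 4 * (hcoord z 0 ^+ 3 - 4 * hcoord z 1 ^+ 3 - hcoord z 4 ^+ 3))
  + hcoord dz 4 * (hcoord z 1 * (hcoord z 0 ^+ 3 - hcoord z 1 ^+ 3 - 4 * hcoord z 4 ^+ 3))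
  - hcoord dz 2 * (hcoord z 3 * (gam * hcoord z 0 ^+ 3 - 4 * hcoord z 2 ^+ 3 - hcoord z 3 ^+ 3))
  - hcoord dz 3 * (hcoord z 2 * (gam * hcoord z 0 ^+ 3 - hcoord z 2 ^+ 3 - 4 * hcoord z 3 ^+ 3))
  + hcoord dz 0 * (3 * hcoord z 0 ^+ 2 * (hcoord z 1 * hcoord z 4 - gam * (hcoord z 2 * hcoord z 3))).

Lemma isd_quintic (V : normedModType C) (z dz : V -> 'rV[C]_5) (p : V) :
  (forall k, isd (fun y => hcoord (z y) k) p (fun v => hcoord (dz v) k)) ->
  isd (fun y => quintic c (z y)) p (fun v => dquintic (z p) (dz v)).
Proof.
move=> hz; rewrite /quintic /=; apply: isd_ext; last first.
  apply: isdB; (apply: isdM; first by apply: isdM; exact: hz).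
    by apply: isdB; first apply: isdB; apply: isdX; exact: hz.
  apply: isdB; first apply: isdB.
  - by apply: isdM; [exact: isd_cst|apply: isdX; exact: hz].
  - by apply: isdX; exact: hz.
  - by apply: isdX; exact: hz.
by move=> v /=; rewrite /dquintic; ring.
Qed.

Lemma euler_quintic (z a : 'rV[C]_5) (x : C) : quintic c z = 0 ->
  dquintic z (a - x *: z) = dquintic z a.
Proof.
move=> h; apply/eqP; rewrite -subr_eq0; apply/eqP.
transitivity (- (5 * x) * quintic c z); last by rewrite h mulr0.
by rewrite /dquintic /quintic !hcoordB !hcoordZ; ring.
Qed.

(** On D_0 the equations are read off directly; elsewhere they are those of [critical_off_D0] for t
    = 0, the quintic itself supplying the relation between z1 z4^4 and z2 z3^4. *)
Lemma quintic_dichotomy (z : 'rV[C]_5) : z != 0 -> quintic c z = 0 ->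
  (forall a, dquintic z a = 0) -> node c z /\ hcoord z 0 != 0.
Proof.
move=> zn0 hq h; have g0 := gam_neq0 c10.
have rel (a0 a1 a2 a3 a4 : C) := h (mkrow 4 [:: a0; a1; a2; a3; a4]).
have r0 := rel 1 0 0 0 0; have r1 := rel 0 1 0 0 0; have r2 := rel 0 0 1 0 0.
have r3 := rel 0 0 0 1 0; have r4 := rel 0 0 0 0 1.
rewrite /dquintic !mkrowE //= in r0 r1 r2 r3 r4.
move: hq r0 r1 r2 r3 r4 (row5_neq0 zn0); rewrite /node /quintic /= {h rel zn0}.
move: (hcoord z 0) (hcoord z 1) (hcoord z 2) (hcoord z 3) (hcoord z 4).
move=> z0 z1 z2 z3 z4 hq r0 r1 r2 r3 r4 rz.
have e1 : z4 * (z0 ^+ 3 - 4 * z1 ^+ 3 - z4 ^+ 3) = 0 by rewrite -[RHS]r1; ring.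
have e4 : z1 * (z0 ^+ 3 - z1 ^+ 3 - 4 * z4 ^+ 3) = 0 by rewrite -[RHS]r4; ring.
have e2 : z3 * (gam * z0 ^+ 3 - 4 * z2 ^+ 3 - z3 ^+ 3) = 0 by rewrite -[RHS]oppr0 -[in RHS]r2; ring.
have e3 : z2 * (gam * z0 ^+ 3 - z2 ^+ 3 - 4 * z3 ^+ 3) = 0 by rewrite -[RHS]oppr0 -[in RHS]r3; ring.
have e0 : 3 * z0 ^+ 2 * (z1 * z4 - gam * (z2 * z3)) = 0 by rewrite -[RHS]r0; ring.
have [[z30 z40]|z34] := pselect (z3 = 0 /\ z4 = 0).
  have f1 : z1 ^+ 4 = z1 * z0 ^+ 3 by rewrite -[LHS]addr0 -[X in _ + X]e4 z40; ring.
  have f2 : z2 ^+ 4 = gam * z2 * z0 ^+ 3 by rewrite -[LHS]addr0 -[X in _ + X]e3 z30; ring.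
  rewrite z30 z40 !mulr0 !mul0r !expr0n /=; split=> //.
  apply/negP => /eqP z00; rewrite z00 expr0n !mulr0 in f1 f2.
  by case: (rz z30 z40); rewrite ?z00 ?(expf0 f1) ?(expf0 f2) eqxx.
have {rz}z34 : z3 != 0 \/ z4 != 0.
  apply: contrapT => /not_orP[/negP + /negP]; rewrite !negbK => /eqP h3 /eqP h4; exact: z34.
have n3 : (3 : C) != 0 := nat_neq0 R 2.
have [] := @critical_off_D0 R c c10 z0 z1 z2 z3 z4 0 _ z34 e1 e2.
- by rewrite nrm0 exprn_gt0 // small_gt0.
(* The quintic, minus z4 times [e4] and plus z3 times [e3], is 3 (z1 z4^4 - z2 z3^4). *)
- apply: (mulfI n3); apply/eqP; rewrite -subr_eq0; apply/eqP.
  transitivity (z1 * z4 * (z0 ^+ 3 - z1 ^+ 3 - z4 ^+ 3) - z2 * z3 * (gam * z0 ^+ 3 - z2 ^+ 3 - z3 ^+ 3)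
     - z4 * (z1 * (z0 ^+ 3 - z1 ^+ 3 - 4 * z4 ^+ 3)) + z3 * (z2 * (gam * z0 ^+ 3 - z2 ^+ 3 - 4 * z3 ^+ 3))).
    by ring.
  by rewrite hq e4 e3; ring.
- by rewrite -[RHS]e4; ring.
- by rewrite -[RHS]e3; ring.
- apply/eqP; rewrite -subr_eq0; apply/eqP; rewrite -[RHS]e0; ring.
by move=> _ ? [? ?] [? ?] [? ?].
Qed.

Lemma quintic_slice i (x : @CP R 4) : acoord_dom i x ->
  N0_set c x <-> quintic c (slice i (acoord i x)) = 0.
Proof.
move=> xi; have [a a0 e] := hrep_slice xi; have [v vx] := line_surj x.
have [b b0 eb] := hrep_line v; rewrite -{1}vx N0_line.
have : hrep x = b *: \val v by rewrite -vx.
rewrite e => /(congr1 (quintic c)); rewrite !quinticZ => h.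
split=> h0; [apply: (mulfI (expf_neq0 5 a0))|apply: (mulfI (expf_neq0 5 b0))].
  by rewrite h h0 !mulr0.
by rewrite -h h0 !mulr0.
Qed.

Lemma isd_slice_coord (i : 'I_5) (q : 'rV[C]_4) k :
  isd (fun u => hcoord (slice i u) k) q (fun v => hcoord (dslice i v) k).
Proof. by apply: isd_slice => l; exact: isd_coord. Qed.

Lemma quintic_smooth (x : N0fun) (i : 'I_5) : acoord_dom i (\val x) ->
  (exists a, dquintic (slice i (acoord i (\val x))) a != 0) ->
  exists (W : set N0fun) V phi psi, @chart R N0fun 3 W V phi psi /\ W x.
Proof.
move=> xi [a0 ha]; set q := acoord i (\val x) in ha.
have hq : quintic c (slice i q) = 0 by apply/quintic_slice => //; exact: set_mem (valP x).
pose F (u : 'rV[C]_(1 + 3)) : 'rV[C]_1 := \row_k quintic c (slice i u).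
have FE l : (fun u => F u 0 l) = (fun u => quintic c (slice i u)) by apply/funext => u; rewrite mxE.
have hd u : isd (fun u => quintic c (slice i u)) u (fun v => dquintic (slice i u) (dslice i v)).
  by apply: isd_quintic => k; exact: isd_slice_coord.
have [|||b [g [U [U' [Uq bi bF]]]]] := @independent_coordinates R 1 3 F q
  (fun l v => dquintic (slice i q) (dslice i v)).
- by move=> u l; rewrite FE; exact: (hd u).1.
- by move=> l; rewrite FE; exact: hd.
- move=> k hk l; apply: (mulIf ha); rewrite mul0r -[RHS](hk (\row_j (a0 - a0 0 i *: slice i q) 0 (lift i j))).
  rewrite big_ord1 dslice_surj ?slice_i // euler_quintic //; congr (k _ * _).
  by rewrite (ord1 l).
have hZ (y : CP_fun R 4) : acoord_dom i y -> U (acoord i y) ->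
    N0_set c y <-> lsubmx (b (acoord i y) : 'rV[C]_(1 + 3)) = 0.
  move=> yi _; rewrite (quintic_slice yi) bF; split=> [h|/rowP/(_ 0)]; last by rewrite !mxE.
  by apply/rowP => l; rewrite !mxE.
have := @induced_chart R (CP_fun R 4) 1 3 _ _ _ _ b g U U' (N0_set c) x (@CP_chart R 4 i) bi hZ.
by move=> ch; do 4!eexists; split; [exact: ch|split].
Qed.
End Quintic.

(** * The ideal of the quadric cone and the local model of the nodes *)

Section Quadric_cone.
Variable R : realType.
Local Notation C := (CC R).

Lemma hcoord_mkrow_delta (k l : nat) (t : C) (y : 'rV[C]_4) : (k < 4)%N -> (l < 4)%N ->
  hcoord (y + t *: mkrow 3 (ncons k 0 [:: 1])) l = hcoord y l + (if l == k then t else 0).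
Proof.
move=> k4 l4; rewrite hcoordD hcoordZ mkrowE // nth_ncons; case: ltngtP => [lk|kl|->].
- by rewrite mulr0.
- by rewrite -(subnSK kl) /= nth_nil mulr0.
- by rewrite subnn /= mulr1.
Qed.

(** Where x_k <> 0, the quadric is a unit times the coordinate x_l - x_m x_n / x_k. The sign e
    covers the choice of the product that contains x_k. *)
Lemma quadric_divides_off_vertex (k l m n : nat) (e : C) (q : 'rV[C]_4) (h : 'rV[C]_4 -> C) :
  [/\ (k < 4)%N, (l < 4)%N, (m < 4)%N & (n < 4)%N] -> [&& k != l, m != l & n != l] -> e * e = 1 ->
  (forall v, quadric v = e * (hcoord v k * hcoord v l - hcoord v m * hcoord v n)) ->
  hcoord q k != 0 -> quadric q = 0 -> holo h q ->
  (\forall y \near q, quadric y = 0 -> h y = 0) ->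
  exists2 g, holo g q & \forall y \near q, h y = quadric y * g y.
Proof.
move=> [k4 l4 m4 n4] /and3P[kl ml nl] ee qE qk q0 hh h0.
pose lam (v : 'rV[C]_4) := hcoord v l - hcoord v m * hcoord v n / hcoord v k.
have dk := fun y : 'rV[C]_4 => differentiable_hcoord k y.
have nk := near_neq0 (differentiable_continuous (dk q)) qk.
have quadE y : hcoord y k != 0 -> quadric y = e * (hcoord y k * lam y).
  by move=> yk; rewrite qE /lam; congr (_ * _); field.
have lamE (y : 'rV[C]_4) (t : C) : lam (y + t *: mkrow 3 (ncons l 0 [:: 1])) = lam y + t.
  rewrite /lam !hcoord_mkrow_delta // eqxx (negPf kl) (negPf ml) (negPf nl) !addr0.
  by rewrite addrAC.
have e0 : e != 0 by apply/negP => /eqP e0; move/eqP: ee; rewrite e0 mul0r eq_sym oner_eq0.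
have lamq : lam q = 0.
  apply: (mulfI qk); apply: (mulfI e0); by rewrite !mulr0 -quadE.
have hlam : holo lam q.
  apply: filterS nk => y yk.
  exact: (differentiableB (differentiable_hcoord l y) (differentiableM (differentiableM
    (differentiable_hcoord m y) (differentiable_hcoord n y)) (near_differentiable_inv (dk y) yk))).
have h0' : \forall y \near q, lam y = 0 -> h y = 0.
  by apply: filterS2 nk h0 => y yk hy ly; apply: hy; rewrite quadE // ly !mulr0.
have [g hg gE] := divisible_by_coordinate lamE lamq hlam hh h0'.
exists (fun y => e * ((hcoord y k)^-1 * g y)).
  apply: filterS2 nk hg => y yk dg.
  exact: (differentiableM (differentiable_cst e y) (differentiableM (near_differentiable_inv (dk y) yk) dg)).
apply: filterS2 nk gE => y yk ->; rewrite quadE //.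
transitivity ((e * e) * lam y * g y); first by rewrite ee mul1r.
by field.
Qed.

(** [local_model] prescribes the kernel at every point of the cone in the chart, not only at the
    vertex. *)
Lemma quadric_divides_on_cone (q : 'rV[C]_4) (h : 'rV[C]_4 -> C) : quadric q = 0 -> holo h q ->
  (\forall y \near q, quadric y = 0 -> h y = 0) ->
  exists2 g, holo g q & \forall y \near q, h y = quadric y * g y.
Proof.
move=> q0 hh h0.
have [z0|n0] := eqVneq (hcoord q 0) 0; last first.
  apply: (@quadric_divides_off_vertex 0 3 1 2 1 q h) => //; rewrite ?mulr1 // => v.
  by rewrite mul1r.
have [z1|n1] := eqVneq (hcoord q 1) 0; last first.
  apply: (@quadric_divides_off_vertex 1 2 0 3 (-1) q h) => //; first by rewrite mulrNN mulr1.
  by move=> v; rewrite /quadric; ring.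
have [z2|n2] := eqVneq (hcoord q 2) 0; last first.
  apply: (@quadric_divides_off_vertex 2 1 0 3 (-1) q h) => //; first by rewrite mulrNN mulr1.
  by move=> v; rewrite /quadric; ring.
have [z3|n3] := eqVneq (hcoord q 3) 0; last first.
  apply: (@quadric_divides_off_vertex 3 0 1 2 1 q h) => //; rewrite ?mulr1 // => v.
  by rewrite /quadric; ring.
have e : q = 0 by apply: hcoord_inj => -[|[|[|[|//]]]] _; rewrite ?z0 ?z1 ?z2 ?z3 /hcoord mxE.
by rewrite e in hh h0 *; exact: quadric_divides.
Qed.
End Quadric_cone.

Section Quintic_node.
Variables (R : realType) (c : R).
Local Notation C := (CC R).
Local Notation gam := ((c%:C)%C : C).
Hypothesis c10 : 10 < c.
Local Notation N0fun := (Defs.induced (F := CP_fun R 4) (N0_set c)).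
Local Notation i0 := (ord0 : 'I_5).

Lemma slice0_0 (u : 'rV[C]_4) : hcoord (slice i0 u) 0 = 1.
Proof.
rewrite /hcoord; have -> : inord 0 = i0 by apply: val_inj; rewrite /= inordK.
exact: slice_i.
Qed.

Lemma node_coord_quintic al be (u : 'rV[C]_4) :
  quintic c (slice i0 u) = node_coord c al be 0 (slice i0 u) * node_coord c al be 3 (slice i0 u)
    - node_coord c al be 1 (slice i0 u) * node_coord c al be 2 (slice i0 u).
Proof. by rewrite node_coord_quadric. Qed.

Variable x : N0fun.
Hypotheses (dx : acoord_dom i0 (\val x)) (nz : node c (slice i0 (acoord i0 (\val x)))).

Lemma quintic_node_coordinates : exists (b g : 'rV[C]_4 -> 'rV[C]_4) (U U' : set 'rV[C]_4),
  [/\ U (acoord i0 (\val x)), biholo b g U U', b (acoord i0 (\val x)) = 0 &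
    forall u, quadric (b u) = quintic c (slice i0 u)].
Proof.
have g0 := gam_neq0 c10.
have [al [be [hal hbe]]] := node_branches nz.
pose q := acoord i0 (\val x); have nq : node c (slice i0 q) := nz.
rewrite -/q in hal hbe *.
pose F (u : 'rV[C]_(4 + 0)) : 'rV[C]_4 := \row_k node_coord c al be k (slice i0 u).
have FE l : (fun u => F u 0 l) = (fun u => node_coord c al be l (slice i0 u)).
  by apply/funext => u; rewrite mxE.
have hd u (l : 'I_4) : isd (fun u => node_coord c al be l (slice i0 u)) u
    (fun v => dnode_coord c al be l (slice i0 u) (dslice i0 v)).
  by apply: isd_node_coord => // k; exact: isd_slice_coord.
have [|||b [g [U [U' [Uq bi bF]]]]] := @independent_coordinates R 4 0 F q
  (fun l v => dnode_coord c al be l (slice i0 q) (dslice i0 v)).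
- by move=> u l; rewrite FE; exact: (hd u l).1.
- by move=> l; rewrite FE; exact: hd.
- move=> k hk.
  have [|k0 k1 k2 k3] := @node_coords_independent R c al be g0 (slice i0 q) (slice0_0 q) nq hal hbe
    (k (inord 0)) (k (inord 1)) (k (inord 2)) (k (inord 3)).
    move=> a a0; have ai : a 0 i0 = 0.
      by rewrite -[RHS]a0 /hcoord; congr (a _ _); apply: val_inj; rewrite /= inordK.
    have hk' : \sum_(l < 4) k (inord l) * dnode_coord c al be l (slice i0 q)
        (dslice i0 (\row_j (a - a 0 i0 *: slice i0 q) 0 (lift i0 j))) = 0.
      by rewrite -[RHS](hk (\row_j (a - a 0 i0 *: slice i0 q) 0 (lift i0 j))); apply: eq_bigr => l _; rewrite inord_val.
    rewrite dslice_surj ?slice_i // ai scale0r subr0 in hk'.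
    by move: hk'; rewrite !big_ord_recl big_ord0 addr0 /= !addrA.
  by move=> l; rewrite -[l]inord_val; case: l => -[|[|[|[|//]]]] ? /=.
have bE u k : (k < 4)%N -> hcoord (b u) k = node_coord c al be k (slice i0 u).
  move=> k4; have := congr1 (fun h => h u) (FE (Ordinal k4)) => /= <-; rewrite -bF mxE /hcoord.
  by congr (b u _ _); apply: val_inj; rewrite /= inordK.
exists b, g, U, U'; split=> //.
  apply: hcoord_inj => k k4; rewrite bE // [RHS]/hcoord mxE.
  exact: (node_coord0 (slice0_0 q) nq hal hbe k4).
by move=> u; rewrite (node_coord_quintic al be) /quadric !bE.
Qed.

(** The maps are kept explicit because they serve twice: for [node_at], and in [cone_singular] for
    the proof that the point is singular. *)
Lemma quintic_node_model : exists (W : set N0fun) (U : set 'rV[C]_4) (phi : N0fun -> 'rV[C]_4) psi,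
  [/\ open W, W x, open U & phi x = 0] /\
  [/\ forall y, W y -> [/\ U (phi y), quadric (phi y) = 0 & psi (phi y) = y],
    forall q, U q -> quadric q = 0 -> W (psi q) /\ phi (psi q) = q,
    forall y, W y -> @regular_at R N0fun (affine_fun 'rV[C]_4) phi y,
    forall y N, W y -> nbhs y N -> \forall q \near phi y, quadric q = 0 -> N (psi q) &
    forall y h, W y -> reg N0fun y h -> exists2 g, holo g (phi y) & \forall z \near y, h z = g (phi z)].
Proof.
have [b [g [U [U' [Uq bi bq bE]]]]] := quintic_node_coordinates.
have [oU oU' b1 b2] := bi; have ch := @CP_chart R 4 i0; have [[oD _] ch1 ch2 [cc1 cc2] hr] := ch.
have vc (y : N0fun) : {for y, continuous (\val : N0fun -> CP_fun R 4)} by exact: initial_continuous.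
pose W : set N0fun := [set y | acoord_dom i0 (\val y) /\ U (acoord i0 (\val y))].
pose phi (y : N0fun) := b (acoord i0 (\val y)).
pose psi (q : 'rV[C]_4) : N0fun := insubd x (line (cone_slice i0 (g q))).
have oW : open W.
  have oV : open [set y : @CP R 4 | acoord_dom i0 y /\ U (acoord i0 y)] by exact: open_preimage_on.
  exact: (open_preimage vc oV).
have psiE q : U' q -> quadric q = 0 -> \val (psi q) = line (cone_slice i0 (g q)).
  move=> Uq' q0; have [Ug bg _] := b2 _ Uq'.
  rewrite /psi insubdK //; apply: mem_set; have [dl al] := ch2 (g q) I.
  by apply/(quintic_slice c dl); rewrite al -bE bg.
have phiU y : W y -> U' (phi y) /\ quadric (phi y) = 0.
  move=> [dy Uy]; have [Ub gb _] := b1 _ Uy; split=> //.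
  by rewrite bE; apply/(quintic_slice c dy); exact: set_mem (valP y).
have psiK y : W y -> psi (phi y) = y.
  move=> Wy; have [Up qp] := phiU _ Wy; apply: val_inj; rewrite psiE //.
  have [dy Uy] := Wy; have [_ gb _] := b1 _ Uy; rewrite /phi gb.
  by have [_] := ch1 _ dy.
exists W, U', phi, psi; split; first by split=> //; exact: bq.
split.
- by move=> y Wy; have [? ?] := phiU _ Wy; split=> //; exact: psiK.
- move=> q Uq' q0; have [Ug bg _] := b2 _ Uq'; have [dl al] := ch2 (g q) I.
  by rewrite /W /phi /= psiE // al.
- move=> y [dy Uy]; have [_ _ db] := b1 _ Uy; split.
    apply: (@continuous_comp _ _ _ (acoord i0 \o \val : N0fun -> _) b y).
      exact: (@continuous_comp _ _ _ (\val : N0fun -> _) (acoord i0) y (vc y) (cc1 _ dy)).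
    exact: differentiable_continuous db.
  move=> h hh; exists ((h \o b) \o acoord i0); last exact: filterE.
  apply: (chart_reg ch dy).
  have nU : \forall u \near acoord i0 (\val y), differentiable b u.
    have nU : \forall u \near acoord i0 (\val y), U u by exact: open_nbhs_nbhs.
    by apply: filterS nU => u /b1[].
  exact: (holo_comp nU hh).
- move=> y N Wy [N' [[V oV VE] N'y] sub]; have [Up qp] := phiU _ Wy.
  have [_ _ dg] := b2 _ Up; have [dy Uy] := Wy.
  have Vy : nbhs (line (cone_slice i0 (g (phi y)))) V.
    rewrite -psiE // psiK //; apply: open_nbhs_nbhs; split=> //; move: N'y; by rewrite -VE.
  have cg : {for phi y, continuous (fun q => line (cone_slice i0 (g q)))}.
    exact: (@continuous_comp _ _ _ g (fun u => line (cone_slice i0 u)) (phi y)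
      (differentiable_continuous dg) (cc2 _ I)).
  have nU : \forall q \near phi y, U' q by exact: open_nbhs_nbhs.
  apply: filterS2 nU (cg _ Vy) => q Uq' Vq q0; apply: sub; rewrite -VE.
  rewrite -[(_ @^-1` _) _]/(V (\val (psi q))) psiE //; exact: Vq.
- move=> y h Wy [G rG GE]; have [Up qp] := phiU _ Wy; have [dy Uy] := Wy.
  have hG : holo (G \o (fun u => line (cone_slice i0 u))) (acoord i0 (\val y)) by apply/hr.
  have [_ gb _] := b1 _ Uy.
  have dg : \forall q \near phi y, differentiable g q.
    have nU : \forall q \near phi y, U' q by exact: open_nbhs_nbhs.
    by apply: filterS nU => q /b2[].
  exists ((G \o (fun u => line (cone_slice i0 u))) \o g).
    by apply: (holo_comp dg); rewrite /phi gb.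
  have nW : \forall z \near y, W z by exact: open_nbhs_nbhs.
  apply: filterS2 nW GE => z Wz ->; have [dz Uz] := Wz; have [_ gbz _] := b1 _ Uz.
  by rewrite /= /phi gbz; have [_ ->] := ch1 _ dz.
Qed.

Lemma quintic_node_at : @node_at R (N0 c) x.
Proof.
have [W [U [phi [psi [[oW Wx oU p0] [h1 h2 h3 h4 h5]]]]]] := quintic_node_model.
have := @local_model_intro R N0fun 4 1 (fun _ v => quadric v) W U phi psi oW oU.
case/(_ _ _ _ _ _ _ _ x Wx).
- by move=> _ q _; exact: differentiable_quadric.
- by move=> y /h1[].
- by move=> q Uq /(_ ord0); exact: h2.
- exact: h3.
- by move=> y N Wy /(h4 _ _ Wy); apply: filterS => q hq /(_ ord0).
- by move=> y h Wy /(h5 _ _ Wy)[g ? ?]; exists g.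
- move=> y h Wy hh h0; have [Uy qy py] := h1 _ Wy.
  have nq : \forall q \near phi y, quadric q = 0 -> h q = 0.
    have nU : \forall q \near phi y, U q by exact: open_nbhs_nbhs.
    apply: filterS2 nU (h4 _ _ Wy h0) => q Uq hq q0; have := hq q0.
    by rewrite /= (h2 _ Uq q0).2.
  have [g hg gE] := quadric_divides_on_cone qy hh nq.
  exists (fun _ => g); split=> // ; by apply: filterS gE => q ->; rewrite big_ord1 mulrC.
move=> W' [U' [psi' hm]]; rewrite /node_at /local_model; exists W', U', psi'.
by move: hm; rewrite p0.
Qed.
End Quintic_node.

(** * The vertex of the quadric cone is singular *)

Section Local_morphisms.
Variable R : realType.
Local Notation C := (CC R).

Lemma isd_near (V : normedModType C) (f g L : V -> C) (p : V) :
  (\forall y \near p, f y = g y) -> isd f p L -> isd g p L.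
Proof.
move=> fg [df Lf]; split; first exact: near_eq_differentiable fg df.
have /diff_locallyP[cd ef] := df.
have eg : g \o shift p = cst (g p) + 'd f p +o_0 id.
  apply/eqaddoP => e e0.
  move/eqaddoP : ef => /(_ e e0).
  have : \forall y \near 0, f (y + p) = g (y + p).
    have -> : (\forall y \near 0, f (y + p) = g (y + p)) = (\forall y \near p, f y = g y).
      rewrite (near_shift 0 p) /=; congr (nbhs _ _).
      by apply/funext => z /=; rewrite subr0.
    by [].
  apply: filterS2 => y e1.
  by rewrite /= /GRing.add /GRing.opp /= e1 (nbhs_singleton fg).
by move=> v; rewrite (diff_unique cd eg) Lf.
Qed.

Variables (F : funspace R) (W : set F) (V : normedModType C).
Variable Y : morphism (@open_subspace R (rs_of_funspace F) W) (affine V).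

(* an element of the local ring is determined up to a unit by its value, so
   morphisms of C-algebras preserve values *)
Lemma pull_value (w : W) (h : V -> C) (k : F -> C) : holo h (Y w) -> reg F (\val w) k ->
  pull Y w (germ_of (Y w : affine_fun V) h) = germ_of (\val w) k -> k (\val w) = h (Y w).
Proof.
move=> hh rk e; apply: contrapT => ne; pose l := k (\val w).
have hl : holo (fun v => h v - l) (Y w).
  by apply: filterS hh => v dv; exact: differentiableB dv (differentiable_cst l v).
have hl0 : h (Y w) - l != 0 by rewrite subr_eq0; apply/eqP => h0; exact: ne.
have nl := near_neq0 (differentiable_continuous (nbhs_singleton hl)) hl0.
have hi : holo (fun v => (h v - l)^-1) (Y w).
  by apply: filterS2 hl nl => v; exact: near_differentiable_inv.
have e1 : pull Y w (germ_of (Y w : affine_fun V) (fun v => h v - l)) = germ_of (\val w) (k \- cst l).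
  have -> : germ_of (Y w : affine_fun V) (fun v => h v - l) =
      germ_of (Y w : affine_fun V) h - germ_of (Y w : affine_fun V) (cst l).
    by rewrite -germ_sub //; exact: reg_cst.
  rewrite rmorphB e (germ_sub rk (reg_cst _ l)); congr (_ - _).
  exact: (pull_scal Y w l).
have [m rm me] := germ_of_surj (pull Y w (germ_of (Y w : affine_fun V) (fun v => (h v - l)^-1)) : @germ R F (\val w)).
have one : germ_of (\val w) ((k \- cst l) \* m) = 1.
  rewrite (germ_mul (reg_sub rk (reg_cst _ l)) rm) -e1 me -rmorphM -germ_mul //.
  rewrite -[RHS](rmorph1 (pull Y w)) -(rmorph1 (@germ_cst R (affine_fun V) (Y w))).
  congr (pull Y w _); apply/germ_eqP; [exact: (@reg_mul R (affine_fun V) (Y w) _ _ hl hi)|exact: reg_cst|].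
  by apply: filterS nl => v vl /=; rewrite mulfV.
have := rmorph1 (@germ_cst R F (\val w)); rewrite -one => /esym.
move/(germ_eqP (reg_mul (reg_sub rk (reg_cst _ l)) rm) (reg_cst _ 1))/nbhs_singleton => /=.
by rewrite subrr mul0r => /esym/eqP; rewrite oner_eq0.
Qed.

(** The maps of stalks in a morphism are arbitrary homomorphisms compatible with sections; by
    [pull_value] at all nearby points they act as composition with Y. *)
Lemma pull_function (w : W) (h : V -> C) : holo h (Y w) ->
  exists k, [/\ reg F (\val w) k, pull Y w (germ_of (Y w : affine_fun V) h) = germ_of (\val w) k &
    \forall w' \near w, k (\val w') = h (Y w')].
Proof.
move=> hh; have hs : @sec R (affine V) (Y w) (fun v => germ_of (v : affine_fun V) h).
  by exists h => //; exact: filterE.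
have [t [k rk kE] tE] := @pull_sec R _ _ Y w _ hs.
have nk : \forall w' \near w, t (\val w') = germ_of (\val w') k := near_val kE.
have nr : \forall w' \near w, reg F (\val w') k := near_val (reg_near rk).
have nh : \forall w' \near w, holo h (Y w').
  exact: (@mor_cont _ _ _ Y w _ (near_join hh)).
exists k; split=> //; first by rewrite (nbhs_singleton tE) (nbhs_singleton kE).
have ff : Filter (nbhs (w : @open_subspace R (rs_of_funspace F) W)) := nbhs_filter w.
suff : @nbhs _ (@open_subspace R (rs_of_funspace F) W) w (fun w' => k (\val w') = h (Y w')) by [].
apply: (filterS _ (filterI (filterI nk tE) (filterI nr nh))) => w' [[e1 e2] [r1 r2]].
by apply: (pull_value r2 r1); rewrite [LHS]e2.
Qed.
End Local_morphisms.

Section Local_coordinates.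
Variable R : realType.
Local Notation C := (CC R).

Lemma near_and (T : topologicalType) (x : T) (P Q : set T) :
  nbhs x P -> nbhs x Q -> nbhs x (fun y => P y /\ Q y).
Proof. exact: filterI. Qed.

Lemma near_set_type (T : topologicalType) (W : set T) (w : W) (P : set W) :
  (\forall y \near w, P y) -> \forall z \near \val w, forall y : W, \val y = z -> P y.
Proof.
move=> [N [[V oV VE] Nw] sub].
have Vw : nbhs (\val w) V by apply: open_nbhs_nbhs; split=> //; move: Nw; rewrite -VE.
apply: filterS Vw => z Vz y yz; apply: sub; rewrite -VE; change (V (\val y)); rewrite yz.
exact: Vz.
Qed.

Lemma not_near_zero : ~ \forall s \near (0 : C), s = 0.
Proof.
move=> n0; have [|s [-> /eqP]] := @filter_ex _ ((0 : C)^') _ (fun s => s = 0 /\ s != 0).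
by apply: filterI; [exact: nbhs_dnbhs n0|exact: (@nbhs_dnbhs_neq _ (0 : C))].
by case.
Qed.

Lemma isd_line (V : normedModType C) (f : V -> C) (p v : V) : differentiable f p ->
  isd (fun s : C => f (p + s *: v)) 0 (fun s => s * 'd f p v).
Proof.
move=> df; have [dl el] := is_diff_line p v 0.
have df' : differentiable f (p + (0 : C) *: v) by rewrite scale0r addr0.
split; first exact: (differentiable_comp dl df').
move=> s; rewrite (diff_comp dl df') /= el /= scale0r addr0.
by rewrite linearZ.
Qed.

Lemma isd_id (p : C) : isd (fun s : C => s) p (fun s => s).
Proof. by have [dl el] := is_diff_id p; split=> // v; rewrite el. Qed.

(* Tangent vectors to the cone span C^4, so functions A_k that restrict to the
   coordinates along the cone through a smooth ambient space would have
   independent differentials; but then the quadric in the A_k, which vanishes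
   identically, would be nonzero to second order. *)
Lemma quadric_not_parametrized n (A : nat -> 'rV[C]_n -> C) (G : 'rV[C]_4 -> 'rV[C]_n) (p : 'rV[C]_n) :
  G 0 = p -> differentiable G 0 -> (forall k, holo (A k) p) ->
  (forall k, \forall q \near (0 : 'rV[C]_4), quadric q = 0 -> A k (G q) = hcoord q k) ->
  ~ \forall u \near p, A 0%N u * A 3%N u - A 1%N u * A 2%N u = 0.
Proof.
move=> G0 dG hA AG nA.
have dA k : differentiable (A k) p := nbhs_singleton (hA k).
have hA0 k : A k p = hcoord (0 : 'rV[C]_4) k.
  by rewrite -G0; apply: (nbhs_singleton (AG k)); rewrite /quadric /hcoord !mxE !mulr0 subrr.
have cl (V : normedModType C) (a v : V) (P : set V) : (\forall y \near a, P y) -> \forall s \near (0 : C), P (a + s *: v).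
  move=> h; have [dl _] := is_diff_line a v 0; have := differentiable_continuous dl.
  by move=> cs; apply: cs; rewrite /= scale0r addr0.
have tg e k : (forall s, quadric (s *: e) = 0) -> 'd (A k) p ('d G 0 e) = hcoord e k.
  move=> qe; have dA' : differentiable (A k) (G 0) by rewrite G0.
  have dAG : differentiable (A k \o G) 0 by exact: differentiable_comp dG dA'.
  have := isd_line e dAG; rewrite (diff_comp dG dA') G0 => h.
  have E : \forall s \near (0 : C), (A k \o G) (0 + s *: e) = s * hcoord e k.
    by apply: filterS (cl _ 0 e _ (AG k)) => s; rewrite add0r hcoordZ => /(_ (qe s)).
  have [_ h1] := isd_near E h; have [_ h2] : isd (fun s : C => s * hcoord e k) 0 (fun s => s * hcoord e k).
    have hid := isd_id (0 : C).
    by apply: isd_ext (isdM hid (isd_cst _ _)) => s; rewrite /= mul0r add0r mulrC.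
  by have := h1 1; rewrite h2 !mul1r.
pose e i : 'rV[C]_4 := mkrow 3 (ncons i 0 [:: 1]).
have he i k : (i < 4)%N -> (k < 4)%N -> hcoord (e i) k = (if k == i then 1 else 0).
  move=> i4 k4; have := hcoord_mkrow_delta 1 (0 : 'rV[C]_4) i4 k4.
  by rewrite hcoordD hcoordZ mul1r (_ : hcoord 0 k = 0) ?[hcoord 0 k]mxE // !add0r.
(* e 0 and e 3 lie on the cone, where the A k are known, but the quadric is 1 on their sum. So along
   om the quadric in the A k is s^2 D s with D 0 = 1. *)
pose om := 'd G 0 (e 0%N) + 'd G 0 (e 3%N).
have dom k : (k < 4)%N -> 'd (A k) p om = (if k == 0 then 1 else 0) + (if k == 3 then 1 else 0).
  move=> k4; rewrite [LHS](linearD ('d (A k) p)) !tg ?he //.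
    by move=> s; rewrite /quadric !hcoordZ !he //=; ring.
  by move=> s; rewrite /quadric !hcoordZ !he //=; ring.
have gk k : exists2 g, holo g (0 : C) & \forall s \near (0 : C), A k (p + s *: om) = s * g s.
  have hb : holo (fun s : C => A k (p + s *: om)) 0.
    have nl : \forall s \near (0 : C), differentiable (fun s : C => p + s *: om) s.
      by apply: filterE => s; case: (is_diff_line p om s).
    have hA' : holo (A k) (p + (0 : C) *: om) by rewrite scale0r addr0.
    exact: (holo_comp nl hA').
  have [|g hg gE] := holo_div hb.
    by rewrite scale0r addr0 hA0 /hcoord mxE.
  by exists g => //; apply: filterS gE => s ->; rewrite subr0.
have /choice[g gP] : forall k, exists g : C -> C, holo g (0 : C) /\ \forall s \near (0 : C), A k (p + s *: om) = s * g s.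
  by move=> k; have [g ? ?] := gk k; exists g.
have g0 k : g k 0 = 'd (A k) p om.
  have [hg gE] := gP k; have [_ h1] := isd_near gE (isd_line om (dA k)).
  have hid := isd_id (0 : C).
  have hgk : isd (g k) (0 : C) ('d (g k) 0) := conj (nbhs_singleton hg) (fun=> erefl).
  have [_ h2] := isdM hid hgk.
  by have := h1 1; rewrite h2 /= mul0r add0r mulr1 mul1r.
pose D s := g 0%N s * g 3%N s - g 1%N s * g 2%N s.
have dg k : differentiable (g k) 0 := nbhs_singleton (gP k).1.
have dD : differentiable D 0.
  exact: (differentiableB (differentiableM (dg 0%N) (dg 3%N)) (differentiableM (dg 1%N) (dg 2%N))).
have D0 : D 0 != 0.
  have v0 : g 0%N 0 = 1 by rewrite g0 dom // addr0.
  have v1 : g 1%N 0 = 0 by rewrite g0 dom // addr0.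
  have v3 : g 3%N 0 = 1 by rewrite g0 dom // add0r.
  by rewrite /D v0 v1 v3 mul0r subr0 mulr1 oner_eq0.
apply: not_near_zero.
have n1 := near_and (near_neq0 (differentiable_continuous dD) D0) (cl _ p om _ nA).
have n2 := near_and (near_and (gP 0%N).2 (gP 1%N).2) (near_and (gP 2%N).2 (gP 3%N).2).
apply: filterS (near_and n1 n2) => s [[Ds As] [[E0 E1] [E2 E3]]].
have : s * s * D s = 0 by rewrite -[RHS]As /= E0 E1 E2 E3 /D; ring.
by move/eqP; rewrite !mulf_eq0 (negPf Ds) orbF orbb => /eqP.
Qed.
End Local_coordinates.

Section Node_singular.
Variables (R : realType) (F : funspace R) (x : F) (W : set F) (U : set 'rV[CC R]_4).
Variables (phi : F -> 'rV[CC R]_4) (psi : 'rV[CC R]_4 -> F).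
Local Notation C := (CC R).
Hypotheses (oW : open W) (Wx : W x) (oU : open U) (phix : phi x = 0).
Hypothesis phi_cone : forall y, W y -> [/\ U (phi y), quadric (phi y) = 0 & psi (phi y) = y].
Hypothesis psi_cone : forall q, U q -> quadric q = 0 -> W (psi q) /\ phi (psi q) = q.
Hypothesis phi_reg : forall y, W y -> @regular_at R F (affine_fun 'rV[C]_4) phi y.
Hypothesis psi_cont : forall y N, W y -> nbhs y N -> \forall q \near phi y, quadric q = 0 -> N (psi q).
Hypothesis phi_ext : forall y h, W y -> reg F y h ->
  exists2 g, holo g (phi y) & \forall z \near y, h z = g (phi z).

(** A smooth chart Y, of any dimension n, lifts the coordinates of the cone to functions A k on C^n
    by surjectivity on stalks, and the components of Y extend by [phi_ext] to a map G on C^4.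
    [quadric_not_parametrized] excludes such a pair. *)
Lemma cone_singular : ~ @nonsingular_at R (rs_of_funspace F) x.
Proof.
move=> [n [f [p [W0 [U0 [Y [[oW0 W0x oU0 U0p] [_ hY [_ rY eY sY _]]]]]]]]].
pose w0 : @open_subspace R (rs_of_funspace F) W0 := exist _ x (mem_set W0x).
have Yw0 : Y w0 = p by exact: hY.
have lift k : exists A, holo A p /\ \forall w \near w0, hcoord (phi (\val w)) k = A (Y w).
  have rk : reg F x (fun y => hcoord (phi y) k).
    apply: (phi_reg Wx).2 (fun v => hcoord v k) _.
    by apply: filterE => v; exact: differentiable_hcoord.
  have [a ae] := sY w0 (germ_of x (fun y => hcoord (phi y) k)).
  have [A hA AE] := germ_of_surj a; rewrite -AE in ae.
  have [k' [rk' pk' nk']] := pull_function hA.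
  exists A; split; first by rewrite -Yw0.
  have nk : \forall y \near x, k' y = hcoord (phi y) k by apply/(germ_eqP rk' rk); rewrite -pk' -ae.
  have nk2 : \forall w \near w0, k' (\val w) = hcoord (phi (\val w)) k := @near_val (rs_of_funspace F) W0 w0 _ nk.
  by apply: (filterS _ (filterI nk2 nk')) => w [<-].
have /choice[A AP] := lift.
have coord l : exists g, holo g (0 : 'rV[C]_4) /\ \forall w \near w0, Y w 0 l = g (phi (\val w)).
  have hl : holo (fun v : 'rV[C]_n => v 0 l) (Y w0).
    by apply: filterE => v; exact: (isd_coord v l).1.
  have [k [rk _ nk]] := pull_function hl.
  have [g hg gE] := phi_ext Wx rk; exists g; split; first by rewrite -phix.
  have nk2 : \forall w \near w0, k (\val w) = g (phi (\val w)) := @near_val (rs_of_funspace F) W0 w0 _ gE.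
  by apply: (filterS _ (filterI nk2 nk)) => w [<- <-].
have /choice[g gP] := coord.
pose G q : 'rV[C]_n := \row_l g l q.
have GY : \forall w \near w0, Y w = G (phi (\val w)).
  have : \forall w \near w0, forall l, Y w 0 l = g l (phi (\val w)).
    suff : @nbhs _ (@open_subspace R (rs_of_funspace F) W0) w0 (fun w => forall l, Y w 0 l = g l (phi (\val w))) by [].
    apply: (@filter_forall _ _ (fun (l : 'I_n) (w : @open_subspace R (rs_of_funspace F) W0) => Y w 0 l = g l (phi (\val w))) _ (nbhs_filter w0)) => l; exact: (gP l).2.
  by apply: filterS => w h; apply/rowP => l; rewrite mxE h.
have nW0 : \forall y \near x, W0 y by exact: open_nbhs_nbhs.
apply: (@quadric_not_parametrized R n A G p).
- by rewrite -Yw0 (nbhs_singleton GY) /= phix.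
- apply: differentiable_rV => l.
  rewrite (_ : (fun y => _) = g l); first exact: nbhs_singleton (gP l).1.
  by apply/funext => y; rewrite mxE.
- by move=> k; exact: (AP k).1.
- move=> k; have n1 := near_set_type (near_and GY (AP k).2).
  have := psi_cont Wx (near_and nW0 n1); rewrite phix => n2.
  have nU : \forall q \near (0 : 'rV[C]_4), U q.
    by apply: open_nbhs_nbhs; split=> //; rewrite -phix; case: (phi_cone Wx).
  apply: filterS2 nU n2 => q Uq h q0; have [W0q hq] := h q0.
  have [e1 e2] := hq (exist _ (psi q) (mem_set W0q)) erefl.
  by move: e1 e2; rewrite /= (psi_cone Uq q0).2 => <- <-.
- have nW : \forall w \near w0, W (\val w) by apply: (@near_val (rs_of_funspace F) W0 w0); exact: open_nbhs_nbhs.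
  have n1 := near_and nW (near_and (near_and (AP 0).2 (AP 1).2) (near_and (AP 2).2 (AP 3).2)).
  have [M nM sub] := eY _ _ n1; rewrite Yw0 in nM.
  have nU : \forall u \near p, U0 u by exact: open_nbhs_nbhs.
  apply: filterS2 nU nM => u Uu Mu.
  have : range Y u by rewrite rY; split=> // -[].
  move=> [w _ wu]; have [] := sub w; first by rewrite /preimage /= wu.
  move=> Ww [[e0 e1] [e2 e3]]; rewrite -wu -e0 -e1 -e2 -e3.
  by have [_] := phi_cone Ww.
Qed.
End Node_singular.

(** * Counting the nodes *)

Section Cube_roots.
Variable C : numClosedFieldType.

(** A primitive cube root of unity. *)
Definition root3 : C := (sqrtC (- 3) - 1) / 2.

Lemma root3_eq : root3 ^+ 2 + root3 + 1 = 0.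
Proof.
have h := sqrtCK (- 3 : C); rewrite /root3; move: (sqrtC _) h => s h.
transitivity ((s ^+ 2 + 3) / 4); last by rewrite h addNr mul0r.
by field.
Qed.

Definition axis_roots : seq (C * C) :=
  [:: (0, 0); (1, 0); (root3, 0); (root3 ^+ 2, 0); (0, 1); (0, root3); (0, root3 ^+ 2)].

Lemma axis_roots_uniq : uniq axis_roots.
Proof.
have h := root3_eq; pose w := root3.
have w0 : w != 0 by apply/eqP => e; move/eqP: h; rewrite -/w e expr0n /= !add0r oner_eq0.
have w1 : w != 1.
  apply/eqP => e; move/eqP: h; rewrite -/w e expr1n.
  by rewrite (_ : 1 + 1 + 1 = 3%:R :> C) ?pnatr_eq0 //; ring.
have ww1 : w ^+ 2 != 1.
  apply/eqP => e; have : w = - 2 by rewrite -[LHS]subr0 -h -/w e; ring.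
  move=> e2; move/eqP: e; rewrite e2 -subr_eq0.
  by rewrite (_ : (- 2) ^+ 2 - 1 = 3%:R :> C) ?pnatr_eq0 //; ring.
have www : w ^+ 2 != w by rewrite expr2 -subr_eq0 -{3}[w]mulr1 -mulrBr mulf_neq0 // subr_eq0.
have ww0 : w ^+ 2 != 0 by rewrite expf_neq0.
have n1 : (0 : C) != 1 by rewrite eq_sym oner_neq0.
rewrite /axis_roots [uniq _]/= !inE -/w !xpair_eqE !eqxx ?andbT ?andTb (eq_sym 0 w) (eq_sym 0 (w ^+ 2)) (eq_sym 1 w) (eq_sym 1 (w ^+ 2)) (eq_sym w (w ^+ 2)) ?(eq_sym 1 0).
by rewrite (negPf w0) (negPf w1) (negPf ww1) (negPf www) (negPf ww0) (negPf n1).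
Qed.

Lemma fourth_power_eq (x : C) : x ^+ 4 = x <-> x \in [:: 0; 1; root3; root3 ^+ 2].
Proof.
have h := root3_eq; pose w := root3; rewrite -/w in h *.
have w3 : w ^+ 3 = 1.
  by apply/eqP; rewrite -subr_eq0; apply/eqP; transitivity ((w - 1) * (w ^+ 2 + w + 1)); [ring|rewrite h mulr0].
have E : x ^+ 4 - x = x * (x - 1) * (x - w) * (x - w ^+ 2).
  transitivity (x * (x - 1) * (x ^+ 2 - (w ^+ 2 + w + 1) * x + x + w ^+ 3)); last by ring.
  by rewrite h w3; ring.
rewrite !inE; split=> [/eqP|hx]; last apply/eqP.
  by rewrite -subr_eq0 E !mulf_eq0 !subr_eq0 -!orbA.
by rewrite -subr_eq0 E !mulf_eq0 !subr_eq0 -!orbA.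
Qed.

Lemma mem_axis_roots (x y : C) :
  (x, y) \in axis_roots <-> [/\ x * y = 0, x ^+ 4 = x & y ^+ 4 = y].
Proof.
split=> [|[/eqP]].
  have f (z : C) : z \in [:: 0; 1; root3; root3 ^+ 2] -> z ^+ 4 = z by move/fourth_power_eq.
  by rewrite !inE !xpair_eqE => /or4P[|||/or4P[|||]] /andP[/eqP -> /eqP ->];
    rewrite ?mulr0 ?mul0r; split=> //; apply: f; rewrite !inE eqxx ?orbT.
rewrite mulf_eq0 => /orP[/eqP -> _|/eqP ->].
  by move/fourth_power_eq; rewrite !inE !xpair_eqE eqxx /= => /or4P[] ->; rewrite ?orbT.
by move=> /fourth_power_eq + _; rewrite !inE !xpair_eqE eqxx !andbT => /or4P[] ->; rewrite ?orbT.
Qed.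
End Cube_roots.

Section Nodal_quintic.
Variables (R : realType) (c : R).
Local Notation C := (CC R).
Local Notation gam := ((c%:C)%C : C).
Hypothesis c10 : 10 < c.
Local Notation N0fun := (Defs.induced (F := CP_fun R 4) (N0_set c)).
Local Notation i0 := (ord0 : 'I_5).

Definition node_point (x : @CP R 4) := acoord_dom i0 x /\ node c (slice i0 (acoord i0 x)).

Lemma quintic_local (x : N0fun) : ~ node_point (\val x) ->
  exists (W : set N0fun) V phi psi, @chart R N0fun 3 W V phi psi /\ W x.
Proof.
(* The chart z0 <> 0 is preferred, since [node_point] is expressed in it. *)
move=> np; have [i [xi hi]] : exists i, acoord_dom i (\val x) /\ (acoord_dom i0 (\val x) -> i = i0).
  have [x0|x0] := pselect (acoord_dom i0 (\val x)); first by exists i0.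
  by have [i xi] := acoord_dom_ex (\val x); exists i.
have [|h] := pselect (exists a, dquintic c (slice i (acoord i (\val x))) a != 0).
  exact: quintic_smooth xi.
have q0 : quintic c (slice i (acoord i (\val x))) = 0 by apply/quintic_slice => //; exact: set_mem (valP x).
have [|nz z0] := quintic_dichotomy c10 (slice_neq0 i (acoord i (\val x))) q0.
  by move=> a; apply: contrapT => /eqP ha; apply: h; exists a.
have x0 : acoord_dom i0 (\val x).
  rewrite /acoord_dom /=; have [a a0 ->] := hrep_slice xi; rewrite mxE mulf_neq0 //.
  by move: z0; rewrite /hcoord; congr (_ != _); congr (_ _ _); apply: val_inj; rewrite /= inordK.
by case: np; split=> //; move: nz; rewrite (hi x0).
Qed.

Lemma quintic_smooth_or_node (x : N0fun) : @nonsingular_at R (N0 c) x \/ @node_at R (N0 c) x.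
Proof.
have [[x0 nx]|np] := pselect (node_point (\val x)); first by right; exact: quintic_node_at.
by left; have [W [V [phi [psi [ch Wx]]]]] := quintic_local np; exact: chart_nonsingular ch _ Wx.
Qed.

Lemma nodal_N0 : nodal (N0 c).
Proof.
split; last by move=> x sx; case: (quintic_smooth_or_node x).
split.
  apply: (@hausdorff_inj _ _ (\val : N0fun -> @CP R 4)); [exact: initial_continuous|exact: val_inj|exact: CP_hausdorff].
move=> x; case: (quintic_smooth_or_node x) => [[n [f [p h]]]|h]; first by exists n, 0%N, f, p.
by exists 4, 1, (fun _ v => hcoord v 0 * hcoord v 3 - hcoord v 1 * hcoord v 2), 0.
Qed.

Lemma singular_pointsE (x : N0fun) : singular_points (N0 c) x <-> node_point (\val x).
Proof.
split=> [sx|[x0 nx]].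
  apply: contrapT => /quintic_local[W [V [phi [psi [ch Wx]]]]]; apply: sx.
  exact: chart_nonsingular ch _ Wx.
have [W [U [phi [psi [[oW Wx oU p0] [h1 h2 h3 h4 h5]]]]]] := quintic_node_model c10 x0 nx.
exact: (cone_singular oW Wx oU p0 h1 h2 h3 h4 h5).
Qed.

(** The quotient and the remainder of k by 7 select two of the seven pairs, one for (z1, z4) and one
    for (z2, z3); a cube root of c rescales the second equation to the first. *)
Definition node_row (k : nat) : 'rV[C]_4 :=
  let p := nth (0, 0) (axis_roots C) (k %/ 7) in let q := nth (0, 0) (axis_roots C) (k %% 7) in
  mkrow 3 [:: p.1; 3.-root gam * q.1; 3.-root gam * q.2; p.2].

Lemma hcoord_slice (u : 'rV[C]_4) k : (k < 4)%N -> hcoord (slice i0 u) k.+1 = hcoord u k.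
Proof.
move=> k4; rewrite /hcoord -[RHS](slice_lift i0); congr (slice i0 u _ _).
by apply: val_inj; rewrite /= !inordK // ?ltnS // bump0.
Qed.

Lemma node_rowP (u : 'rV[C]_4) : node c (slice i0 u) <-> exists2 k, (k < 49)%N & u = node_row k.
Proof.
pose r : C := 3.-root gam; have r3 : r ^+ 3 = gam by exact: rootCK.
have g0 := gam_neq0 c10; have r0 : r != 0 by apply/eqP => e; move/eqP: g0; rewrite -r3 e expr0n.
have scaled (y : C) : (r * y) ^+ 4 = gam * (r * y) <-> y ^+ 4 = y.
  rewrite -r3; split=> [h|h]; last by rewrite exprMn h; ring.
  by apply: (mulfI (expf_neq0 4 r0)); rewrite -exprMn h; ring.
have nodeE p q s t : node c (slice i0 (mkrow 3 [:: p; r * q; r * s; t])) <->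
    (p, t) \in axis_roots C /\ (q, s) \in axis_roots C.
  rewrite /node slice0_0 !hcoord_slice // !mkrowE // /=.
  have e1 (y : C) : y * 1 ^+ 3 = y by rewrite expr1n mulr1.
  rewrite !e1; split=> [[[pt qs] hp ht hq hs]|[/mem_axis_roots[pt hp ht] /mem_axis_roots[qs hq hs]]].
    split; apply/mem_axis_roots; split=> //; try exact/scaled.
    by apply: (mulfI (mulf_neq0 r0 r0)); rewrite mulr0 -[RHS]qs; ring.
  split; [|exact: hp|exact: ht|exact: (scaled q).2|exact: (scaled s).2].
  by split=> //; transitivity (r * r * (q * s)); [ring|rewrite qs mulr0].
split=> [h|[k k49 ->]]; last first.
  by apply/nodeE; rewrite -!surjective_pairing !mem_nth // ?ltn_mod // ltn_divLR.
have uE : u = mkrow 3 [:: hcoord u 0; r * (r^-1 * hcoord u 1); r * (r^-1 * hcoord u 2); hcoord u 3].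
  by apply: hcoord_inj => -[|[|[|[|//]]]] _; rewrite mkrowE //= mulrA mulfV // mul1r.
rewrite uE in h; have [hp hq] := (nodeE _ _ _ _).1 h.
pose a := index (hcoord u 0, hcoord u 3) (axis_roots C).
pose b := index (r^-1 * hcoord u 1, r^-1 * hcoord u 2) (axis_roots C).
have a7 : (a < 7)%N by rewrite index_mem.
have b7 : (b < 7)%N by rewrite index_mem.
exists (a * 7 + b)%N.
  by apply: (@leq_trans (a.+1 * 7)); [rewrite mulSn addnC ltn_add2r|rewrite (leq_mul2r 7 _ 7)].
rewrite /node_row divnMDl // (divn_small b7) addn0 modnMDl modn_small // !nth_index //=; exact: uE.
Qed.

Lemma node_row_inj : {in `I_49 &, injective node_row}.
Proof.
move=> k l; rewrite !inE => k49 l49 e.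
have r0 : 3.-root gam != 0 :> C.
  apply/eqP => e0; move/eqP: (gam_neq0 c10); apply.
  by rewrite -[gam](@rootCK C 3) // e0 expr0n.
have h m : (m < 4)%N -> hcoord (node_row k) m = hcoord (node_row l) m by rewrite e.
have h0 := h 0%N isT; have h1 := h 1%N isT; have h2 := h 2%N isT; have h3 := h 3%N isT.
rewrite !mkrowE //= in h0 h1 h2 h3; have {}h1 := mulfI r0 h1; have {}h2 := mulfI r0 h2.
have pair (p q : C * C) : p.1 = q.1 -> p.2 = q.2 -> p = q by case: p q => [? ?] [? ?] /= -> ->.
have nu a b : (a < 7)%N -> (b < 7)%N -> nth (0, 0) (axis_roots C) a = nth (0, 0) (axis_roots C) b -> a = b.
  by move=> a7 b7 /eqP; rewrite nth_uniq // ?axis_roots_uniq // => /eqP.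
have d7 m : (m < 49)%N -> (m %/ 7 < 7)%N by move=> m49; rewrite ltn_divLR.
have e1 := nu _ _ (d7 _ k49) (d7 _ l49) (pair _ _ h0 h3).
have e2 := nu _ _ (ltn_pmod k (isT : 0 < 7)%N) (ltn_pmod l (isT : 0 < 7)%N) (pair _ _ h1 h2).
by rewrite (divn_eq k 7) (divn_eq l 7) e1 e2.
Qed.

Lemma node_points : [set x | node_point x] = [set line (cone_slice i0 (node_row k)) | k in `I_49].
Proof.
have [_ ch1 ch2 _ _] := @CP_chart R 4 i0; apply/seteqP; split=> [x [x0 nx]|_ [k k49 <-]].
  have [k k49 e] := (node_rowP _).1 nx; exists k => //; rewrite -e; exact: (ch1 _ x0).2.
have [d a] := ch2 (node_row k) I; split=> //; rewrite a; apply/node_rowP; by exists k.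
Qed.

Lemma node_point_on x : node_point x -> N0_set c x.
Proof.
move=> [x0 nx]; apply/(quintic_slice c x0); case: nx => [[e1 e2] _ _ _ _].
by rewrite /quintic /= e1 e2 !mul0r subrr.
Qed.

Lemma card_singular_points : (singular_points (N0 c) #= `I_49)%card.
Proof.
have [_ ch1 ch2 _ _] := @CP_chart R 4 i0.
have e : [set \val x | x in (singular_points (N0 c) : set N0fun)] = [set x | node_point x].
  apply/seteqP; split=> [_ [x /singular_pointsE ? <-]//|x nx].
  have Nx := node_point_on nx.
  exists (exist _ x (mem_set Nx)) => //; exact/singular_pointsE.
apply: card_eq_trans (_ : ([set \val x | x in (singular_points (N0 c) : set N0fun)] #= _)%card).
  by rewrite card_eq_sym; apply: inj_card_eq => x y _ _; exact: val_inj.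
rewrite e node_points; apply: inj_card_eq => k l k49 l49 h; apply: (node_row_inj k49 l49).
by have := congr1 (acoord i0) h; rewrite (ch2 _ I).2 (ch2 _ I).2.
Qed.
End Nodal_quintic.

Theorem mainTheorem13 (R : realType) :
  exists c0 : R, 0 < c0 /\ forall c : R, c0 < c ->
    (nodal (N0 c) /\ singular_points (N0 c) #= `I_49) /\ smoothable (N1 c).
Proof.
(* Above 10 the comparisons between powers of c in [critical_bounds] hold. *)
exists 10; split=> [|c c10]; first by rewrite ltr0n.
split; last exact: smoothable_N1.
by split; [exact: nodal_N0|exact: card_singular_points].
Qed.
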